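(* Let $M$ be a compact convex Riemannian manifold of constant non-positive sectional curvature. Then the set of fair-cut centers of $M$ is convex; that is, if $x_1,x_2\in M$ are fair-cut centers, then every point of the geodesic arc $[x_1,x_2]$ is a fair-cut center.
   Context: Riemannian manifolds are allowed to have boundary. A Riemannian manifold $M$ is \emph{convex} if any two points $p,q\in M$ are joined by a unique geodesic arc $[p,q]$, whose interior is disjoint from the boundary of $M$. $T^1_xM$ denotes the set of unit vectors in $T_xM$. For $x\in M$ and $v\in T^1_xM$, the \emph{half-space} is $H(x,v)=\{q\in M : \langle v_q,v\rangle\leq 0\}$, where $v_q$ is the tangent vector at $x$ of the geodesic $[q,x]$ oriented from $q$ to $x$ (the point $q=x$ is counted as belonging to $H(x,v)$). Set $\varphi_M(x)=\min_{v\in T^1_xM}\frac{\operatorname{vol} H(x,v)}{\operatorname{vol} M}$ and $\Phi(M)=\max_{x\in M}\varphi_M(x)$. A \emph{fair-cut center} of $M$ is a point $x_0\in M$ with $\varphi_M(x_0)=\Phi(M)$. *)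

(* Defs.v *)
(* Smooth Riemannian manifolds with boundary, of dimension n = d.+1 >= 1, given
   by a smooth atlas of charts in the closed half-space {y | 0 <= y_0} of R^n
   and by the components of the metric in these charts. *)
From HB Require Import structures.
From mathcomp Require Import all_boot all_order all_algebra.
From mathcomp Require Import all_classical all_reals all_analysis.
Set Implicit Arguments.
Unset Strict Implicit.
Unset Printing Implicit Defensive.
Import Order.TTheory GRing.Theory Num.Theory.
Import numFieldNormedType.Exports.
Local Open Scope classical_set_scope.
Local Open Scope ring_scope.

Section calculus_within.
Context {R : realType}.

(* Library directional derivatives, with the increments restricted to those
   staying in D: one-sided at boundary points of D, two-sided elsewhere. *)
Definition diff_quot {V W : normedModType R} (f : V -> W) (x v : V) : R -> W :=
  fun h => h^-1 *: (f (h *: v + x) - f x).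

Definition incr {V : normedModType R} (D : set V) (x v : V) : set_system R :=
  within [set h : R | D (h *: v + x)] 0^'.

Definition derivable_within {V W : normedModType R} (D : set V) (f : V -> W)
    (x v : V) : Prop :=
  cvg (diff_quot f x v @ incr D x v).

Definition derive_within {V W : normedModType R} (D : set V) (f : V -> W)
    (v x : V) : W :=
  lim (diff_quot f x v @ incr D x v).

Definition partial {n : nat} (D : set 'rV[R]_n.+1) (f : 'rV[R]_n.+1 -> R)
    (a : 'I_n.+1) : 'rV[R]_n.+1 -> R :=
  derive_within D f (delta_mx 0 a).

Fixpoint Ck_on {n : nat} (k : nat) (D : set 'rV[R]_n.+1)
    (f : 'rV[R]_n.+1 -> R) : Prop :=
  {within D, continuous f} /\
  match k with
  | 0%N => True
  | k'.+1 => forall a : 'I_n.+1,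
      (forall x, D x -> derivable_within D f x (delta_mx 0 a)) /\
      Ck_on k' D (partial D f a)
  end.

(* For D relatively open in a closed half-space this is smoothness up to the
   boundary: by Seeley's theorem f extends smoothly near each point of D. *)
Definition smooth_on {n : nat} (D : set 'rV[R]_n.+1) (f : 'rV[R]_n.+1 -> R) :=
  forall k, Ck_on k D f.

Definition half_space {n : nat} : set 'rV[R]_n.+1 := [set y | 0 <= y 0 ord0].

(* Integral of a nonnegative Borel function over R^n with respect to the
   n-dimensional Lebesgue measure, as an iterated integral (Tonelli). *)
Fixpoint lebesgue_int (n : nat) : ('rV[R]_n -> \bar R) -> \bar R :=
  match n return ('rV[R]_n -> \bar R) -> \bar R with
  | 0%N => fun f => f 0
  | m.+1 => fun f => (\int[@lebesgue_measure R]_x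
      lebesgue_int (fun y : 'rV[R]_m => f (row_mx (x%:M : 'rV[R]_1) y)))%E
  end.

End calculus_within.

(* A tangent vector at p is represented by its (row of) components in the
   preferred chart [chart_at p] around p. The atlas need not be maximal. [inv i]
   is relevant only on the image of the chart i, and [metric i] likewise. *)
Record riemannian_manifold (R : realType) (d : nat) := RiemannianManifold {
  carrier :> topologicalType ;
  hausdorffM : hausdorff_space carrier ;
  second_countableM : @second_countable carrier ;

  chart_idx : Type ;
  dom : chart_idx -> set carrier ;
  coord : chart_idx -> carrier -> 'rV[R]_d.+1 ;
  inv : chart_idx -> 'rV[R]_d.+1 -> carrier ;
  chart_at : carrier -> chart_idx ;
  dom_chart_at : forall p, dom (chart_at p) p ;
  dom_open : forall i, open (dom i) ;
  image_open : forall i, exists2 O : set 'rV[R]_d.+1,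
    open O & coord i @` dom i = O `&` half_space ;
  coordK : forall i p, dom i p -> inv i (coord i p) = p ;
  coord_continuous : forall i, {within dom i, continuous (coord i)} ;
  inv_continuous : forall i, {within coord i @` dom i, continuous (inv i)} ;
  transition_smooth : forall i j (b : 'I_d.+1),
    smooth_on (coord i @` (dom i `&` dom j))
      (fun y => coord j (inv i y) 0 b) ;

  metric : chart_idx -> 'rV[R]_d.+1 -> 'M[R]_d.+1 ;
  metric_smooth : forall i (a b : 'I_d.+1),
    smooth_on (coord i @` dom i) (fun y => metric i y a b) ;
  metric_sym : forall i y, (coord i @` dom i) y ->
    (metric i y)^T = metric i y ;
  metric_pos : forall i y (u : 'rV[R]_d.+1), (coord i @` dom i) y -> u != 0 ->
    0 < (u *m metric i y *m u^T) 0 0 ;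
  metric_compat : forall i j y, (coord i @` (dom i `&` dom j)) y ->
    let J := \matrix_(a, b) partial (coord i @` (dom i `&` dom j))
               (fun z => coord j (inv i z) 0 b) a y in
    metric i y = J *m metric j (coord j (inv i y)) *m J^T
}.

Section riemannian_geometry.
Context {R : realType} {d : nat} (M : riemannian_manifold R d).
Local Notation vec := 'rV[R]_d.+1.

Definition chart_image (i : chart_idx M) : set vec := coord i @` dom i.

Definition boundary : set M :=
  [set p | exists2 i : chart_idx M, dom i p & coord i p 0 ord0 = 0].

Definition gdot (i : chart_idx M) (y u v : vec) : R :=
  (u *m metric i y *m v^T) 0 0.

Definition dmetric (i : chart_idx M) (a b c : 'I_d.+1) (y : vec) : R :=
  partial (chart_image i) (fun z => metric i z b c) a y.

(* Gamma^l_(ab) *)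
Definition christoffel (i : chart_idx M) (l a b : 'I_d.+1) (y : vec) : R :=
  2^-1 * \sum_(m < d.+1) invmx (metric i y) l m *
    (dmetric i a b m y + dmetric i b a m y - dmetric i m a b y).

(* l-th component of R(e_a, e_b) e_c, with the sign convention
   R(X, Y) = [nabla_X, nabla_Y] - nabla_[X, Y] *)
Definition riemann (i : chart_idx M) (l a b c : 'I_d.+1) (y : vec) : R :=
  partial (chart_image i) (christoffel i l b c) a y
  - partial (chart_image i) (christoffel i l a c) b y
  + \sum_(m < d.+1) (christoffel i m b c y * christoffel i l a m y
                     - christoffel i m a c y * christoffel i l b m y).

Definition curvature_op (i : chart_idx M) (y u v w : vec) : vec :=
  \row_l \sum_(a < d.+1) \sum_(b < d.+1) \sum_(c < d.+1)
    u 0 a * v 0 b * w 0 c * riemann i l a b c y.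

Definition sectional (i : chart_idx M) (y u v : vec) : R :=
  gdot i y (curvature_op i y u v v) u
  / (gdot i y u u * gdot i y v v - gdot i y u v ^+ 2).

(* No condition in dimension 1, where there are no tangent planes. *)
Definition constant_curvature (kappa : R) : Prop :=
  forall (i : chart_idx M) (y u v : vec), chart_image i y ->
    row_free (col_mx u v) -> sectional i y u v = kappa.

Definition time_dom (g : R -> M) (i : chart_idx M) : set R :=
  [set t | 0 <= t <= 1 /\ dom i (g t)].

Definition velocity (g : R -> M) (i : chart_idx M) (t : R) : vec :=
  derive_within (time_dom g i) (coord i \o g) 1 t.

Definition acceleration (g : R -> M) (i : chart_idx M) (t : R) : vec :=
  derive_within (time_dom g i) (velocity g i) 1 t.

(* Solutions on [0, 1] of nabla_(g') g' = 0 (in particular g has constant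
   speed); the values of g outside [0, 1] are irrelevant. *)
Definition geodesic (g : R -> M) : Prop :=
  {within `[0, 1], continuous g} /\
  forall (i : chart_idx M) (t : R), time_dom g i t ->
    [/\ derivable_within (time_dom g i) (coord i \o g) t 1,
        derivable_within (time_dom g i) (velocity g i) t 1 &
        forall l : 'I_d.+1, acceleration g i t 0 l
          + \sum_(a < d.+1) \sum_(b < d.+1)
              christoffel i l a b (coord i (g t))
              * velocity g i t 0 a * velocity g i t 0 b = 0].

Definition geodesic_arc (p q : M) (g : R -> M) : Prop :=
  [/\ geodesic g, {in `[0, 1] &, injective g}, g 0 = p & g 1 = q].

(* Geodesic arcs being parametrized proportionally to arc length on [0, 1],
   uniqueness of the arc is uniqueness of its parametrization. The arc [p, p]
   is {p}. *)
Definition convexM : Prop :=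
  forall p q : M, p <> q ->
    exists2 g, geodesic_arc p q g /\
               (forall t, 0 < t < 1 -> ~ boundary (g t))
             & forall g', geodesic_arc p q g' -> {in `[0, 1], g' =1 g}.

Definition segment (p q : M) : set M :=
  [set z | (p = q /\ z = p) \/
           exists g t, [/\ geodesic_arc p q g, 0 <= t <= 1 & z = g t]].

Definition tdot (x : M) (u v : vec) : R :=
  gdot (chart_at x) (coord (chart_at x) x) u v.

Definition unit_tangent (x : M) : set vec := [set v | tdot x v v = 1].

(* The half-space H(x, v). The vector v_q is the terminal velocity of the arc
   from q to x; its length does not matter. *)
Definition halfM (x : M) (v : vec) : set M :=
  [set q | q = x \/ exists2 g, geodesic_arc q x g
                  & tdot x (velocity g (chart_at x) 1) v <= 0].

(* Riemannian volume of the part of the chart i with coordinates in E. *)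
Definition chart_vol (i : chart_idx M) (E : set vec) : \bar R :=
  lebesgue_int (fun y => (\1_E y * Num.sqrt (\det (metric i y)))%:E).

(* The Riemannian volume measure, extended to arbitrary subsets of M as an outer
   measure: infimum of the total volumes of the countable covers of A by Borel
   sets contained in charts. *)
Definition vol (A : set M) : \bar R :=
  ereal_inf [set s | exists (i : nat -> chart_idx M) (E : nat -> set vec),
    [/\ forall k, <<s @open vec >> (E k),
        forall k, E k `<=` chart_image (i k),
        A `<=` \bigcup_k [set p | dom (i k) p /\ E k (coord (i k) p)] &
        s = (\sum_(0 <= k <oo) chart_vol (i k) (E k))%E]].

(* Infimum and supremum in place of the (attained) minimum and maximum. *)
Definition fair_cut (x : M) : \bar R :=
  ereal_inf [set (vol (halfM x v) / vol [set: M])%E | v in unit_tangent x].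

Definition fair_cut_max : \bar R := ereal_sup [set fair_cut x | x in [set: M]].

Definition fair_cut_center (x : M) : Prop := fair_cut x = fair_cut_max.

End riemannian_geometry.

(* Main.v *)
(* A function f with Hess f = - kappa f g, together with its differential, is a
   parallel section of a connection on R + T^*M, which is flat because g has
   curvature kappa. So the local solutions form a space of dimension 1 + dim M,
   and the values of a basis of solutions are a local isometry F of M to the
   model {Y | Y^T H Y = 1}: a sheet of a hyperboloid, or an affine hyperplane if
   kappa = 0. Along a geodesic, F'' = c F with c = - kappa |g'|^2 >= 0, hence F is
   a combination of the functions cosh and sinh of sqrt(c) t (or 1 and t).

   Solutions extend to M. Given an interior point z, the arcs from z to points
   near q0 are obtained by lifting to M the geodesics of the model which end near
   F(q0); they are the only arcs since M is convex, so following F along the arcs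
   from z is a local isometry near q0. It extends to the boundary since the
   interior is locally connected there.

   Let z be an interior point of the arc [x1, x2], v a unit vector at z and f the
   solution with f(z) = 0 and df(z) = <v, .>. Along the arc from z to q, f is a
   multiple of sinh, so that H(z, v) = {f >= 0}. On [x1, x2] also f is a multiple
   of a sinh vanishing at z, so f(x) >= 0 at one of the end points x. There the
   half-space H(x, v') = {df(v_q) <= 0} is contained in {f >= 0}, because f(q) is
   f(x) times a cosh minus df(v_q) times a nonnegative sinh. Hence
   vol H(z, v) >= vol H(x, v') >= Phi(M) vol M. *)
Require Import Defs.
From HB Require Import structures.
From mathcomp Require Import all_boot all_order all_algebra.
From mathcomp Require Import all_classical all_reals all_analysis.
From mathcomp Require Import ring lra.
Set Implicit Arguments.
Unset Strict Implicit.
Unset Printing Implicit Defensive.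
Import Order.TTheory GRing.Theory Num.Theory.
Import numFieldNormedType.Exports.
Local Open Scope classical_set_scope.
Local Open Scope ring_scope.
Import Defs.

(** The metric lives in charts that may touch the boundary, where partial derivatives are one-sided.
    So smoothness is used through uniform first order expansions with quadratic error on boxes of
    the half-space: they determine their derivatives, survive products, inverses and composition,
    and force constancy on convex sets when the derivative is 0. Convexity of M only speaks of
    injective geodesic arcs. Before uniqueness applies to a lifted chord, two facts are needed: a
    path whose development solves F'' = c F is a geodesic, and it does not meet itself. The arc
    between two interior points avoids the boundary, so that nearby chords can be lifted in all
    directions. This is why the developing map is built on the interior first and only then
    extended. Chords are affine segments of the linear space, projected centrally to the model. The
    cone over a chart at an interior point fills a neighbourhood of e0, so that an inverse function
    argument in a vector space replaces one on the quadric, and kappa = 0 needs no separate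
    treatment. Frames are only germs: F may change along a path, and what is propagated is the
    existence of a continuation. *)

Section entry_norm.
Context {R : realType}.

(** The entrywise l1 norm is submultiplicative with constant 1 for all sizes, additive on stacked
    blocks, and [|h|] on [h] times a unit row. The price is the factor [m * k] in
    [nrm_le_entries]. *)
Definition nrm {m k : nat} (A : 'M[R]_(m, k)) : R := \sum_i \sum_j `|A i j|.

Lemma nrm_ge0 m k (A : 'M[R]_(m, k)) : 0 <= nrm A.
Proof. by apply: sumr_ge0 => i _; apply: sumr_ge0. Qed.
Hint Resolve nrm_ge0 : core.

Lemma nrm0 m k : nrm (0 : 'M[R]_(m, k)) = 0.
Proof. by apply: big1 => i _; apply: big1 => j _; rewrite mxE normr0. Qed.

Lemma nrmN m k (A : 'M[R]_(m, k)) : nrm (- A) = nrm A.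
Proof. by apply: eq_bigr => i _; apply: eq_bigr => j _; rewrite mxE normrN. Qed.

Lemma nrmD m k (A B : 'M[R]_(m, k)) : nrm (A + B) <= nrm A + nrm B.
Proof.
rewrite -big_split /=; apply: ler_sum => i _; rewrite -big_split /=.
by apply: ler_sum => j _; rewrite mxE ler_normD.
Qed.

Lemma nrmB m k (A B : 'M[R]_(m, k)) : nrm (A - B) <= nrm A + nrm B.
Proof. by rewrite -(nrmN B) nrmD. Qed.

Lemma nrm_distC m k (A B : 'M[R]_(m, k)) : nrm (A - B) = nrm (B - A).
Proof. by rewrite -nrmN opprB. Qed.

Lemma nrmZ m k c (A : 'M[R]_(m, k)) : nrm (c *: A) = `|c| * nrm A.
Proof.
rewrite /nrm mulr_sumr; apply: eq_bigr => i _; rewrite mulr_sumr.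
by apply: eq_bigr => j _; rewrite mxE normrM.
Qed.

Lemma nrm_sum m k I (r : seq I) (P : pred I) (F : I -> 'M[R]_(m, k)) :
  nrm (\sum_(i <- r | P i) F i) <= \sum_(i <- r | P i) nrm (F i).
Proof.
apply: (big_ind2 (fun x y => nrm x <= y)); first by rewrite nrm0.
  by move=> ? ? ? ? h1 h2; apply: le_trans (nrmD _ _) _; apply: lerD.
by [].
Qed.

Lemma entry_le m k (A : 'M[R]_(m, k)) i j : `|A i j| <= nrm A.
Proof.
rewrite /nrm (bigD1 i) //= (bigD1 j) //= -addrA lerDl addr_ge0 ?sumr_ge0 //.
by move=> a _; apply: sumr_ge0.
Qed.

Lemma nrm_le_entries m k (A : 'M[R]_(m, k)) c :
  (forall i j, `|A i j| <= c) -> nrm A <= (m * k)%:R * c.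
Proof.
move=> h; apply: (@le_trans _ _ (\sum_(i < m) \sum_(j < k) c)).
  by apply: ler_sum => i _; apply: ler_sum => j _.
by rewrite !sumr_const !card_ord -mulrnA mulr_natl mulnC.
Qed.

Lemma nrmM m k p (A : 'M[R]_(m, k)) (B : 'M[R]_(k, p)) :
  nrm (A *m B) <= nrm A * nrm B.
Proof.
rewrite {2}/nrm mulr_suml; apply: ler_sum => i _.
apply: (@le_trans _ _ (\sum_j \sum_l `|A i l| * `|B l j|)).
  apply: ler_sum => j _; rewrite mxE; apply: le_trans (ler_norm_sum _ _ _) _.
  by apply: ler_sum => l _; rewrite normrM.
rewrite exchange_big /= mulr_suml; apply: ler_sum => l _.
rewrite -mulr_sumr; apply: ler_wpM2l => //.
by rewrite /nrm (bigD1 l) //= lerDl sumr_ge0 // => a _; apply: sumr_ge0.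
Qed.

Lemma nrm_eq0 m k (A : 'M[R]_(m, k)) : nrm A <= 0 -> A = 0.
Proof.
move=> h; apply/matrixP => i j; rewrite mxE; apply/eqP; rewrite -normr_le0.
exact: le_trans (entry_le A i j) h.
Qed.

Lemma nrm_tr m k (A : 'M[R]_(m, k)) : nrm A^T = nrm A.
Proof.
rewrite /nrm exchange_big /=.
by apply: eq_bigr => i _; apply: eq_bigr => j _; rewrite mxE.
Qed.

Lemma mxnorm_le_nrm m k (A : 'M[R]_(m.+1, k.+1)) : `|A| <= nrm A.
Proof.
rewrite [leLHS]mx_normrE; apply/bigmax_leP; split => // -[i j] _ /=.
exact: entry_le.
Qed.

Lemma entry_le_mxnorm m k (A : 'M[R]_(m.+1, k.+1)) i j : `|A i j| <= `|A|.
Proof.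
rewrite [leRHS]mx_normrE.
exact: (le_bigmax _ (fun ij : 'I_m.+1 * 'I_k.+1 => `|A ij.1 ij.2|) (i, j)).
Qed.

Lemma nrm_col m1 m2 k (A : 'M[R]_(m1, k)) (B : 'M[R]_(m2, k)) :
  nrm (col_mx A B) = nrm A + nrm B.
Proof.
rewrite /nrm big_split_ord /=; congr (_ + _); apply: eq_bigr => i _;
by apply: eq_bigr => j _; rewrite (col_mxEu, col_mxEd).
Qed.

End entry_norm.
#[global] Hint Extern 0 (is_true (@Order.le _ _ _ (nrm _))) => exact: nrm_ge0 : core.

(** * Induction along an interval, and the use of quadratic error bounds *)

Section real_induction.
Context {R : realType}.

(** The step at the supremum of the good initial segments carries [P] across it. Steps only go
    forward and only between points near a common [t], so [P] may assert the existence of something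
    to be continued, such as a lift. *)
Lemma real_step (P : R -> Prop) (a b : R) :
  a <= b -> P a ->
  (forall t, a <= t <= b -> exists2 e, 0 < e &
     forall s s', a <= s -> s <= s' -> s' <= b -> `|s - t| < e ->
       `|s' - t| < e -> P s -> P s') ->
  forall t, a <= t <= b -> P t.
Proof.
move=> ab Pa step.
pose A := [set t | a <= t <= b /\ forall s, a <= s <= t -> P s].
have Aa : A a.
  split; first by rewrite lexx.
  by move=> s; rewrite -eq_le => /eqP <-.
have supA : has_sup A by split; [exists a | exists b => t [/andP[]]].
set c := sup A.
have ac : a <= c by apply: ub_le_sup => //; case: supA.
have cb : c <= b by apply: ge_sup; [exists a | move=> t [/andP[]]].
have [e e0 he] := step c (introT andP (conj ac cb)).
have [t0 At0 t0c] : exists2 t0, A t0 & c - e < t0 by apply: sup_adherent.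
have t0le : t0 <= c by apply: ub_le_sup => //; case: supA.
have near_c s' : t0 <= s' -> s' <= b -> `|s' - c| < e -> P s'.
  case: At0 => /andP[at0 _] Pt0 t0s s'b s'c.
  apply: (he t0 s') => //; last by apply: Pt0; rewrite at0 lexx.
  by rewrite ltr_norml; apply/andP; split; lra.
have A_ext s' : t0 <= s' -> s' <= b -> s' < c + e -> A s'.
  move=> t0s s'b s'c; case: (At0) => /andP[at0 _] Pt0; split.
    by rewrite (le_trans at0 t0s).
  move=> s /andP[as_ ss']; have [st|ts] := lerP s t0; first by apply: Pt0; rewrite as_.
  by apply: near_c; [exact: ltW|lra|rewrite ltr_norml; apply/andP; split; lra].
have cb' : c = b.
  apply/eqP; rewrite eq_le cb /= leNgt; apply/negP => c_lt_b.
  have : A (Num.min b (c + e / 2)).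
    apply: A_ext; rewrite ?ge_min ?lexx //.
      by rewrite le_min; apply/andP; split; lra.
    by rewrite gt_min; apply/orP; right; lra.
  move=> /(ub_le_sup (proj2 supA)); rewrite -/c ge_min => /orP[|]; lra.
move=> t /andP[at_ tb]; have [tt0|t0t] := lerP t t0.
  by case: At0 => _; apply; rewrite at_.
by apply: near_c; [exact: ltW|by []|rewrite ltr_norml; apply/andP; split; lra].
Qed.

Lemma le_of_quad (x y C : R) :
  (forall m : nat, x <= y + C / m.+1%:R) -> x <= y.
Proof.
move=> h; rewrite leNgt; apply/negP => yx.
have [|C0] := lerP C 0.
  by move=> C0; have := h 0%N; rewrite divr1; lra.
have e0 : 0 < x - y by lra.
have := archi_boundP (ltW (divr_gt0 C0 e0)).
set m := Num.bound _ => hm.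
have := h m; have m1 : 0 < m.+1%:R :> R by rewrite ltr0n.
rewrite -lerBlDl; apply/negP; rewrite -ltNge.
rewrite ltr_pdivrMr // mulrC -ltr_pdivrMr //; apply: lt_trans hm _.
by rewrite ltr_nat.
Qed.

(** Cut [[a, b]] into m + 1 equal pieces: the errors add up to [C * (b - a) ^+ 2] divided by m + 1,
    which [le_of_quad] removes. This does the work of the mean value theorem for functions known up
    to a quadratic error. *)
Lemma mono_quad (f : R -> R) (a b C : R) : a <= b ->
  (forall s t, a <= s -> s <= t -> t <= b -> f s - C * (t - s) ^+ 2 <= f t) ->
  f a <= f b.
Proof.
move=> ab h; apply: (@le_of_quad _ _ (C * (b - a) ^+ 2)) => m.
set N : R := m.+1%:R; have N0 : 0 < N by rewrite ltr0n.
pose u (j : nat) := a + (b - a) * (j%:R / N).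
have uS j : u j.+1 - u j = (b - a) / N.
  by rewrite /u -natr1; field; rewrite gt_eqF.
have st j : u j <= u j.+1 by rewrite -subr_ge0 uS divr_ge0 ?subr_ge0 // ltW.
have ua j : a <= u j.
  by rewrite lerDl mulr_ge0 ?subr_ge0 // divr_ge0 // ltW.
have ub j : (j <= m.+1)%N -> u j <= b.
  move=> jm; rewrite -lerBrDl -[leRHS]mulr1 ler_wpM2l ?subr_ge0 //.
  by rewrite ler_pdivrMr // mul1r ler_nat.
have H j : (j <= m.+1)%N -> f a - j%:R * (C * ((b - a) / N) ^+ 2) <= f (u j).
  elim: j => [|j ih] jm; first by rewrite /u !mul0r mulr0 addr0 subr0.
  apply: le_trans (h (u j) (u j.+1) (ua _) (st _) (ub _ jm)).
  by rewrite uS; have := ih (ltnW jm); rewrite -[j.+1%:R]natr1 [(_ + 1) * _]mulrDl mul1r opprD addrA lerD2r.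
have := H m.+1 (leqnn _).
have -> : u m.+1 = b by rewrite /u divff ?gt_eqF // mulr1 addrC subrK.
have -> : m.+1%:R * (C * ((b - a) / N) ^+ 2) = C * (b - a) ^+ 2 / N.
  by rewrite -/N; field; rewrite gt_eqF.
by rewrite lerBlDr.
Qed.

End real_induction.

(** * Quadratic differentiability *)

Section quadratic_differentiability.
Context {R : realType}.

(* F is differentiable on Q with derivative D, up to a uniform quadratic error.
   [ds] is the displacement from one point to another: the difference of two
   vectors, or the 1x1 matrix of the difference of two times. *)
Definition QD {T : Type} {n : nat} (ds : T -> T -> 'rV[R]_n) (Q : set T)
    (F : T -> R) (D : 'I_n -> T -> R) : Prop :=
  exists C : R, forall y, Q y -> [/\ `|F y| <= C, forall a, `|D a y| <= C &
    forall y', Q y' ->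
      `|F y' - F y - \sum_a D a y * ds y y' 0 a| <= C * nrm (ds y y') ^+ 2].

(** For displacements at most 1 a quadratic error is also a linear one. This gives Lipschitz bounds,
    and with them products, inverses and composites. *)
Definition small {T : Type} {n : nat} (ds : T -> T -> 'rV[R]_n) (Q : set T) :=
  forall y y', Q y -> Q y' -> nrm (ds y y') <= 1.

Definition QDm {T : Type} {n m k : nat} (ds : T -> T -> 'rV[R]_n) (Q : set T)
    (F : T -> 'M[R]_(m, k)) (D : 'I_n -> T -> 'M[R]_(m, k)) : Prop :=
  forall i j, QD ds Q (fun y => F y i j) (fun a y => D a y i j).

Definition vdisp {n : nat} (y y' : 'rV[R]_n) : 'rV[R]_n := y' - y.
Definition tdisp (t t' : R) : 'rV[R]_1 := (t' - t)%:M.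

Section algebra.
Context {T : Type} {n : nat} (ds : T -> T -> 'rV[R]_n) (Q : set T).

Lemma qd_const (F : T -> R) D : QD ds Q F D -> exists2 C : R, 0 <= C &
  forall y, Q y -> [/\ `|F y| <= C, forall a, `|D a y| <= C &
    forall y', Q y' ->
      `|F y' - F y - \sum_a D a y * ds y y' 0 a| <= C * nrm (ds y y') ^+ 2].
Proof.
move=> [C hC]; exists (Num.max C 0); first by rewrite le_max lexx orbT.
have CC : C <= Num.max C 0 by rewrite le_max lexx.
move=> y Qy; have [h1 h2 h3] := hC y Qy; split.
- exact: le_trans CC.
- by move=> a; apply: le_trans CC.
- move=> y' Qy'; apply: le_trans (h3 _ Qy') _.
  by apply: ler_wpM2r => //; exact: sqr_ge0.
Qed.

Lemma sum_disp_le (C : R) (D : 'I_n -> R) (k : 'rV[R]_n) :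
  (forall a, `|D a| <= C) -> `|\sum_a D a * k 0 a| <= C * nrm k.
Proof.
move=> h; rewrite /nrm big_ord1 mulr_sumr.
apply: le_trans (ler_norm_sum _ _ _) _; apply: ler_sum => a _.
by rewrite normrM ler_wpM2r.
Qed.

Lemma qd_lip (F : T -> R) D : small ds Q -> QD ds Q F D ->
  exists2 C : R, 0 <= C & forall y y', Q y -> Q y' ->
    `|F y' - F y| <= C * nrm (ds y y').
Proof.
move=> sm /qd_const [C C0 hC]; exists (C + C); first by rewrite addr_ge0.
move=> y y' Qy Qy'; have [_ h2 h3] := hC y Qy.
rewrite -[_ - _](subrK (\sum_a D a y * ds y y' 0 a)).
apply: le_trans (ler_normD _ _) _; rewrite mulrDl; apply: lerD.
  apply: le_trans (h3 _ Qy') _; rewrite expr2 mulrA ler_piMr ?sm //.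
  by rewrite mulr_ge0.
exact: sum_disp_le.
Qed.

Lemma qd_ext (F G : T -> R) D E :
  (forall y, Q y -> F y = G y) -> (forall a y, Q y -> D a y = E a y) ->
  QD ds Q F D -> QD ds Q G E.
Proof.
move=> FG DE [C h]; exists C => y Qy; have [h1 h2 h3] := h y Qy.
split; [by rewrite -FG|by move=> a; rewrite -DE|move=> y' Qy'].
rewrite -!FG //; have := h3 _ Qy'.
by under eq_bigr => a _ do rewrite DE //.
Qed.

Lemma qd_cst (c : R) : QD ds Q (fun=> c) (fun _ _ => 0).
Proof.
exists `|c| => y Qy; split => // [a|y' _]; first by rewrite normr0.
rewrite big1 => [|a _]; last by rewrite mul0r.
by rewrite !subrr normr0 mulr_ge0 // sqr_ge0.
Qed.

Lemma qd_add F G D E : QD ds Q F D -> QD ds Q G E ->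
  QD ds Q (fun y => F y + G y) (fun a y => D a y + E a y).
Proof.
move=> [C hF] [C' hG]; exists (C + C') => y Qy.
have [f1 f2 f3] := hF y Qy; have [g1 g2 g3] := hG y Qy; split.
- by apply: le_trans (ler_normD _ _) _; apply: lerD.
- by move=> a; apply: le_trans (ler_normD _ _) _; apply: lerD.
- move=> y' Qy'; under eq_bigr => a _ do rewrite mulrDl.
  rewrite big_split /= mulrDl.
  rewrite (_ : _ - _ = (F y' - F y - \sum_a D a y * ds y y' 0 a) +
    (G y' - G y - \sum_a E a y * ds y y' 0 a)); last by ring.
  by apply: le_trans (ler_normD _ _) _; apply: lerD; [exact: f3|exact: g3].
Qed.

Lemma qd_scale c F D : QD ds Q F D ->
  QD ds Q (fun y => c * F y) (fun a y => c * D a y).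
Proof.
move=> [C hF]; exists (`|c| * C) => y Qy.
have [f1 f2 f3] := hF y Qy; split.
- by rewrite normrM ler_wpM2l.
- by move=> a; rewrite normrM ler_wpM2l.
- move=> y' Qy'; under eq_bigr => a _ do rewrite -mulrA.
  rewrite -mulr_sumr -!mulrBr normrM -mulrA ler_wpM2l //; exact: f3.
Qed.

Lemma qd_opp F D : QD ds Q F D -> QD ds Q (fun y => - F y) (fun a y => - D a y).
Proof.
move=> h; apply: qd_ext (qd_scale (-1) h) => [y|a y] _; by rewrite mulN1r.
Qed.

Lemma qd_sub F G D E : QD ds Q F D -> QD ds Q G E ->
  QD ds Q (fun y => F y - G y) (fun a y => D a y - E a y).
Proof. by move=> hF hG; apply: qd_add => //; exact: qd_opp. Qed.

Lemma qd_mul F G D E : small ds Q -> QD ds Q F D -> QD ds Q G E ->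
  QD ds Q (fun y => F y * G y) (fun a y => D a y * G y + F y * E a y).
Proof.
move=> sm hF hG.
have [L L0 lF] := qd_lip sm hF; have [L' L'0 lG] := qd_lip sm hG.
have [C C0 {}hF] := qd_const hF; have [C' C'0 {}hG] := qd_const hG.
have LL : 0 <= L * L' by rewrite mulr_ge0.
have CC : 0 <= C * C' by rewrite mulr_ge0.
exists (C * C' + C * C' + L * L') => y Qy.
have [f1 f2 f3] := hF y Qy; have [g1 g2 g3] := hG y Qy; split.
- by rewrite normrM (le_trans (ler_pM _ _ f1 g1)) // -addrA lerDl addr_ge0.
- move=> a; apply: le_trans (ler_normD _ _) _; rewrite !normrM.
  apply: (@le_trans _ _ (C * C' + C * C')); last by rewrite lerDl.
  by apply: lerD; apply: ler_pM.
- move=> y' Qy'; set k := ds y y'.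
  have -> : \sum_a (D a y * G y + F y * E a y) * k 0 a =
      (\sum_a D a y * k 0 a) * G y + F y * (\sum_a E a y * k 0 a).
    rewrite mulr_suml mulr_sumr -big_split; apply: eq_bigr => a _ /=; ring.
  rewrite (_ : _ - _ = (F y' - F y - \sum_a D a y * k 0 a) * G y +
    F y * (G y' - G y - \sum_a E a y * k 0 a) + (F y' - F y) * (G y' - G y));
    last by ring.
  apply: le_trans (ler_normD _ _) _; rewrite [leRHS]mulrDl; apply: lerD.
    apply: le_trans (ler_normD _ _) _; rewrite [leRHS]mulrDl !normrM; apply: lerD.
      rewrite mulrAC; apply: ler_pM => //; exact: f3.
    rewrite -mulrA; apply: ler_pM => //; exact: g3.
  rewrite normrM expr2 mulrACA; apply: ler_pM => //; [exact: lF|exact: lG].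
Qed.

Lemma qd_sum I (r : seq I) (F : I -> T -> R) D :
  (forall i, QD ds Q (F i) (D i)) ->
  QD ds Q (fun y => \sum_(i <- r) F i y) (fun a y => \sum_(i <- r) D i a y).
Proof.
move=> h; elim: r => [|i r ih].
  by apply: qd_ext (qd_cst 0) => [y|a y] _; rewrite big_nil.
by apply: qd_ext (qd_add (h i) ih) => [y|a y] _; rewrite big_cons.
Qed.

Lemma qd_subset (Q' : set T) F D : Q' `<=` Q -> QD ds Q F D -> QD ds Q' F D.
Proof.
move=> s [C h]; exists C => y Qy; have [h1 h2 h3] := h y (s _ Qy).
by split => // y' Qy'; apply: h3; apply: s.
Qed.

Lemma small_subset (Q' : set T) : Q' `<=` Q -> small ds Q -> small ds Q'.
Proof. by move=> s h y y' /s Qy /s Qy'; apply: h. Qed.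

Section matrices.
Context {m k : nat}.
Implicit Types (F G : T -> 'M[R]_(m, k)) (D E : 'I_n -> T -> 'M[R]_(m, k)).

Lemma qdm_est F D : QDm ds Q F D -> exists2 C : R, 0 <= C &
  forall y, Q y -> [/\ nrm (F y) <= C, forall a, nrm (D a y) <= C &
    forall y', Q y' ->
    nrm (F y' - F y - \sum_a ds y y' 0 a *: D a y) <= C * nrm (ds y y') ^+ 2].
Proof.
move=> h.
have /choice[c hc] : forall ij : 'I_m * 'I_k, exists C : R, 0 <= C /\
  forall y, Q y -> [/\ `|F y ij.1 ij.2| <= C, forall a, `|D a y ij.1 ij.2| <= C &
    forall y', Q y' -> `|F y' ij.1 ij.2 - F y ij.1 ij.2 -
      \sum_a D a y ij.1 ij.2 * ds y y' 0 a| <= C * nrm (ds y y') ^+ 2].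
  by move=> [i j]; have [C C0 hC] := qd_const (h i j); exists C.
exists (\sum_i \sum_j c (i, j)).
  by apply: sumr_ge0 => i _; apply: sumr_ge0 => j _; have [] := hc (i, j).
move=> y Qy; split.
- apply: ler_sum => i _; apply: ler_sum => j _.
  by have [_ /(_ y Qy)[]] := hc (i, j).
- move=> a; apply: ler_sum => i _; apply: ler_sum => j _.
  by have [_ /(_ y Qy)[]] := hc (i, j).
- move=> y' Qy'; rewrite mulr_suml; apply: ler_sum => i _.
  rewrite mulr_suml; apply: ler_sum => j _; rewrite !mxE summxE.
  under eq_bigr => a _ do rewrite mxE mulrC.
  by have [_ /(_ y Qy)[_ _]] := hc (i, j); apply.
Qed.

Lemma qdm_of_est F D C : (forall y, Q y ->
   [/\ nrm (F y) <= C, forall a, nrm (D a y) <= C &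
    forall y', Q y' ->
    nrm (F y' - F y - \sum_a ds y y' 0 a *: D a y) <= C * nrm (ds y y') ^+ 2]) ->
  QDm ds Q F D.
Proof.
move=> h i j; exists C => y Qy; have [h1 h2 h3] := h y Qy; split.
- exact: le_trans (entry_le _ _ _) h1.
- by move=> a; exact: le_trans (entry_le _ _ _) (h2 a).
- move=> y' Qy'; apply: le_trans (h3 _ Qy').
  apply: le_trans (entry_le _ i j); rewrite !mxE summxE.
  by under [X in _ <= `|_ - X|]eq_bigr => a _ do rewrite mxE mulrC.
Qed.

Lemma qdm_ext F G D E :
  (forall y, Q y -> F y = G y) -> (forall a y, Q y -> D a y = E a y) ->
  QDm ds Q F D -> QDm ds Q G E.
Proof.
move=> FG DE h i j; apply: qd_ext (h i j) => [y|a y] Qy; by rewrite (FG, DE).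
Qed.

Lemma qdm_cst A : QDm ds Q (fun=> A : 'M[R]_(m, k)) (fun _ _ => 0).
Proof. by move=> i j; apply: qd_ext (qd_cst (A i j)) => // a y _; rewrite mxE. Qed.

Lemma qdm_scale c F D : QDm ds Q F D ->
  QDm ds Q (fun y => c *: F y) (fun a y => c *: D a y).
Proof.
move=> hF i j; apply: qd_ext (qd_scale c (hF i j)) => [y|a y] _; by rewrite mxE.
Qed.

Lemma qdm_lip F D : small ds Q -> QDm ds Q F D ->
  exists2 C : R, 0 <= C & forall y y', Q y -> Q y' ->
    nrm (F y' - F y) <= C * nrm (ds y y').
Proof.
move=> sm h.
have /choice[c hc] : forall ij : 'I_m * 'I_k, exists C : R, 0 <= C /\
  forall y y', Q y -> Q y' ->
    `|F y' ij.1 ij.2 - F y ij.1 ij.2| <= C * nrm (ds y y').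
  by move=> [i j]; have [C C0 hC] := qd_lip sm (h i j); exists C.
exists (\sum_i \sum_j c (i, j)).
  by apply: sumr_ge0 => i _; apply: sumr_ge0 => j _; have [] := hc (i, j).
move=> y y' Qy Qy'; rewrite mulr_suml; apply: ler_sum => i _.
rewrite mulr_suml; apply: ler_sum => j _; rewrite !mxE.
by have [_] := hc (i, j); apply.
Qed.

End matrices.

Lemma qdm_mul m k p (F : T -> 'M[R]_(m, k)) (G : T -> 'M[R]_(k, p)) D E :
  small ds Q -> QDm ds Q F D -> QDm ds Q G E ->
  QDm ds Q (fun y => F y *m G y) (fun a y => D a y *m G y + F y *m E a y).
Proof.
move=> sm hF hG i j.
apply: qd_ext (qd_sum _ (fun l => qd_mul sm (hF i l) (hG l j))) => [y|a y] _.
  by rewrite mxE.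
by rewrite !mxE -big_split.
Qed.

Lemma qdm_tr m k (F : T -> 'M[R]_(m, k)) D : QDm ds Q F D ->
  QDm ds Q (fun y => (F y)^T) (fun a y => (D a y)^T).
Proof. by move=> h i j; apply: qd_ext (h j i) => [y|a y] _; rewrite mxE. Qed.

Lemma qdm_subset (Q' : set T) m k (F : T -> 'M[R]_(m, k)) D :
  Q' `<=` Q -> QDm ds Q F D -> QDm ds Q' F D.
Proof. by move=> s h i j; exact: qd_subset (h i j). Qed.

Lemma qdm_block m1 m2 k1 k2 (A : T -> 'M[R]_(m1, k1)) (B : T -> 'M[R]_(m1, k2))
    (C : T -> 'M[R]_(m2, k1)) (D : T -> 'M[R]_(m2, k2)) A' B' C' D' :
  QDm ds Q A A' -> QDm ds Q B B' -> QDm ds Q C C' -> QDm ds Q D D' ->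
  QDm ds Q (fun y => block_mx (A y) (B y) (C y) (D y))
    (fun a y => block_mx (A' a y) (B' a y) (C' a y) (D' a y)).
Proof.
move=> hA hB hC hD i j.
case: (splitP i) => i' ei; case: (splitP j) => j' ej.
- have -> : i = lshift m2 i' by apply: val_inj.
  have -> : j = lshift k2 j' by apply: val_inj.
  by apply: qd_ext (hA i' j') => [y|a y] _; rewrite block_mxEul.
- have -> : i = lshift m2 i' by apply: val_inj.
  have -> : j = rshift k1 j' by apply: val_inj.
  by apply: qd_ext (hB i' j') => [y|a y] _; rewrite block_mxEur.
- have -> : i = rshift m1 i' by apply: val_inj.
  have -> : j = lshift k2 j' by apply: val_inj.
  by apply: qd_ext (hC i' j') => [y|a y] _; rewrite block_mxEdl.
- have -> : i = rshift m1 i' by apply: val_inj.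
  have -> : j = rshift k1 j' by apply: val_inj.
  by apply: qd_ext (hD i' j') => [y|a y] _; rewrite block_mxEdr.
Qed.

Lemma qdm_dsub m1 m2 k (F : T -> 'M[R]_(m1 + m2, k)) D : QDm ds Q F D ->
  QDm ds Q (fun y => dsubmx (F y)) (fun a y => dsubmx (D a y)).
Proof.
by move=> h i j; apply: qd_ext (h (rshift m1 i) j) => [y|a y] _; rewrite mxE.
Qed.

(** The resolvent identity X' - X = - X' (G' - G) X turns the bound on [X] into a Lipschitz bound.
    Used once more, it leaves two quadratic errors: that of [G], and a product of the increments of
    [X] and [G]. *)
Lemma qdm_inv m (G X : T -> 'M[R]_m) E C : small ds Q -> QDm ds Q G E ->
  (forall y, Q y -> X y *m G y = 1%:M) -> (forall y, Q y -> nrm (X y) <= C) ->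
  QDm ds Q X (fun a y => - (X y *m E a y *m X y)).
Proof.
move=> sm hG XG1 Xb.
have GX1 y : Q y -> G y *m X y = 1%:M by move=> Qy; apply: mulmx1C; exact: XG1.
have [L L0 lG] := qdm_lip sm hG; have [K K0 {}hG] := qdm_est hG.
have [Q0|Q0] := pselect (exists y, Q y); last first.
  by move=> i j; exists 0 => y Qy; exfalso; apply: Q0; exists y.
have C0 : 0 <= C by case: Q0 => y Qy; exact: le_trans (nrm_ge0 _) (Xb y Qy).
have dX y y' : Q y -> Q y' -> X y' - X y = - (X y' *m (G y' - G y) *m X y).
  move=> Qy Qy'; rewrite mulmxBr mulmxBl XG1 // mul1mx -mulmxA GX1 // mulmx1.
  by rewrite opprB.
have lX y y' : Q y -> Q y' -> nrm (X y' - X y) <= C * L * C * nrm (ds y y').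
  move=> Qy Qy'; rewrite dX // nrmN.
  apply: le_trans (nrmM _ _) _; rewrite mulrAC; apply: ler_pM => //; last exact: Xb.
  apply: le_trans (nrmM _ _) _; rewrite -mulrA; apply: ler_pM => //; first exact: Xb.
  exact: lG.
have CLC : 0 <= C * L * C by rewrite !mulr_ge0.
have CKC : 0 <= C * K * C by rewrite !mulr_ge0.
have X3 : 0 <= C * L * C * L * C by rewrite !mulr_ge0.
apply: (@qdm_of_est _ _ _ _ (C + C * K * C + C * L * C * L * C)) => y Qy.
have [g1 g2 g3] := hG y Qy; split.
- by apply: le_trans (Xb y Qy) _; rewrite -addrA lerDl addr_ge0.
- move=> a; rewrite nrmN; apply: (@le_trans _ _ (C * K * C)).
    apply: le_trans (nrmM _ _) _; apply: ler_pM => //; last exact: Xb.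
    by apply: le_trans (nrmM _ _) _; apply: ler_pM => //; exact: Xb.
  by rewrite addrAC lerDr addr_ge0.
- move=> y' Qy'.
  set S := \sum_a ds y y' 0 a *: E a y.
  have -> : \sum_a ds y y' 0 a *: - (X y *m E a y *m X y) = - (X y *m S *m X y).
    rewrite /S mulmx_sumr mulmx_suml -sumrN; apply: eq_bigr => a _.
    by rewrite scalerN -scalemxAr -scalemxAl.
  have -> : X y' - X y - - (X y *m S *m X y) =
     - (X y *m (G y' - G y - S) *m X y) - (X y' - X y) *m (G y' - G y) *m X y.
    rewrite {1}dX // !(mulmxBr, mulmxBl).
    move: (_ *m G y' *m _) (_ *m G y *m _) (_ *m S *m _) => u v w.
    move: (X y *m G y' *m _) (X y *m G y *m _) => u' v'.
    by apply/matrixP => i j; rewrite !mxE; ring.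
  apply: le_trans (nrmB _ _) _; rewrite nrmN 2!mulrDl.
  apply: (@le_trans _ _ (C * K * C * nrm (ds y y') ^+ 2 +
     C * L * C * L * C * nrm (ds y y') ^+ 2)); last first.
    by rewrite lerD2r lerDr mulr_ge0 // sqr_ge0.
  apply: lerD.
    apply: le_trans (nrmM _ _) _; rewrite mulrAC; apply: ler_pM => //; last exact: Xb.
    apply: le_trans (nrmM _ _) _; rewrite -mulrA; apply: ler_pM => //; first exact: Xb.
    exact: g3.
  apply: le_trans (nrmM _ _) _; rewrite mulrAC; apply: ler_pM => //; last exact: Xb.
  apply: le_trans (nrmM _ _) _; rewrite expr2 mulrACA; apply: ler_pM => //.
    exact: lX.
  exact: lG.
Qed.

End algebra.

Lemma qd_comp {T : Type} {n1 n2 : nat} (ds : T -> T -> 'rV[R]_n1) (Q1 : set T)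
    (Q2 : set 'rV[R]_n2) (phi : T -> 'rV[R]_n2) (J : 'I_n1 -> T -> 'rV[R]_n2)
    (F : 'rV[R]_n2 -> R) D :
  small ds Q1 ->
  (forall x, Q1 x -> Q2 (phi x)) -> QDm ds Q1 phi J -> QD vdisp Q2 F D ->
  QD ds Q1 (F \o phi) (fun a x => \sum_b D b (phi x) * J a x 0 b).
Proof.
move=> sm Q12 hphi /qd_const[C C0 hF].
have [L L0 lphi] := qdm_lip sm hphi; have [K K0 {}hphi] := qdm_est hphi.
have CK : 0 <= C * K by rewrite mulr_ge0.
have CL : 0 <= C * L ^+ 2 by rewrite mulr_ge0 // sqr_ge0.
exists (C + C * K + C * L ^+ 2) => x Qx.
have [p1 p2 p3] := hphi x Qx; have [f1 f2 f3] := hF _ (Q12 _ Qx); split.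
- by apply: le_trans f1 _; rewrite -addrA lerDl addr_ge0.
- move=> a; apply: (@le_trans _ _ (C * K)); last by rewrite addrAC lerDr addr_ge0.
  apply: le_trans (sum_disp_le _ f2) _; exact: ler_wpM2l.
- move=> x' Qx' /=.
  set P := \sum_a ds x x' 0 a *: J a x.
  have -> : \sum_a (\sum_b D b (phi x) * J a x 0 b) * ds x x' 0 a =
      \sum_b D b (phi x) * P 0 b.
    under eq_bigr do rewrite mulr_suml.
    rewrite exchange_big /=; apply: eq_bigr => b _.
    rewrite /P summxE mulr_sumr; apply: eq_bigr => a _; rewrite mxE; ring.
  set S1 := \sum_b _.
  rewrite (_ : _ - S1 = (F (phi x') - F (phi x) -
      \sum_b D b (phi x) * vdisp (phi x) (phi x') 0 b) +
      \sum_b D b (phi x) * (phi x' - phi x - P) 0 b); last first.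
    have -> : \sum_b D b (phi x) * (phi x' - phi x - P) 0 b =
        \sum_b D b (phi x) * vdisp (phi x) (phi x') 0 b - S1.
      rewrite /S1 -sumrB; apply: eq_bigr => b _.
      by rewrite -mulrBr [(_ - P) 0 b]mxE [(- P) 0 b]mxE.
    by ring.
  apply: le_trans (ler_normD _ _) _; rewrite 2![in leRHS]mulrDl [leRHS]addrAC.
  apply: (@le_trans _ _ (C * L ^+ 2 * nrm (ds x x') ^+ 2 +
     C * K * nrm (ds x x') ^+ 2)); last first.
    by rewrite lerD2r lerDr mulr_ge0 // sqr_ge0.
  apply: lerD.
    apply: le_trans (f3 _ (Q12 _ Qx')) _; rewrite -mulrA; apply: ler_wpM2l => //.
    by rewrite -exprMn ler_pXn2r ?nnegrE ?mulr_ge0 //; exact: lphi.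
  apply: le_trans (sum_disp_le _ f2) _; rewrite -mulrA; apply: ler_wpM2l => //.
  exact: p3.
Qed.

Lemma qdm_comp {T : Type} {n1 n2 m k : nat} (ds : T -> T -> 'rV[R]_n1)
    (Q1 : set T) (Q2 : set 'rV[R]_n2) (phi : T -> 'rV[R]_n2)
    (J : 'I_n1 -> T -> 'rV[R]_n2) (F : 'rV[R]_n2 -> 'M[R]_(m, k)) D :
  small ds Q1 ->
  (forall x, Q1 x -> Q2 (phi x)) -> QDm ds Q1 phi J -> QDm vdisp Q2 F D ->
  QDm ds Q1 (F \o phi) (fun a x => \sum_b J a x 0 b *: D b (phi x)).
Proof.
move=> sm Q12 hphi hF i j.
apply: qd_ext (qd_comp sm Q12 hphi (hF i j)) => // a y _.
by rewrite summxE; apply: eq_bigr => b _; rewrite mxE mulrC.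
Qed.

Definition seg_convex {n : nat} (Q : set 'rV[R]_n) : Prop :=
  forall y y' (t : R), Q y -> Q y' -> 0 <= t <= 1 -> Q (y + t *: (y' - y)).

(** Along the segment from [y] to [y'] the increments of [F] are quadratically small, so [mono_quad]
    applies to [F] and to its opposite. *)
Lemma qd0_const {n : nat} (Q : set 'rV[R]_n) F : seg_convex Q ->
  QD vdisp Q F (fun _ _ => 0) -> forall y y', Q y -> Q y' -> F y = F y'.
Proof.
move=> cQ /qd_const[C C0 h] y y' Qy Qy'.
have Qt (t : R) : 0 <= t <= 1 -> Q (y + t *: (y' - y)) by apply: cQ.
have est s t : 0 <= s -> s <= t -> t <= 1 ->
    `|F (y + t *: (y' - y)) - F (y + s *: (y' - y))| <=
    C * nrm (y' - y) ^+ 2 * (t - s) ^+ 2.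
  move=> s0 st t1.
  have Qs : Q (y + s *: (y' - y)) by apply: Qt; rewrite s0 (le_trans st).
  have Qt' : Q (y + t *: (y' - y)) by apply: Qt; rewrite t1 (le_trans s0).
  have [_ _ /(_ _ Qt')] := h _ Qs.
  rewrite big1 ?subr0 => [|a _]; last by rewrite mul0r.
  rewrite /vdisp (_ : _ - (_ + _) = (t - s) *: (y' - y)); last first.
    by apply/matrixP => i j; rewrite !mxE; ring.
  by rewrite nrmZ exprMn [`|_| ^+ 2]real_normK ?num_real // mulrCA mulrC mulrA.
apply/eqP; rewrite eq_le; apply/andP; split.
  have := @mono_quad _ (fun t => F (y + t *: (y' - y))) 0 1 _ ler01.
  move=> /(_ (C * nrm (y' - y) ^+ 2)).
  rewrite scale0r addr0 scale1r [y + _]addrC subrK; apply => s t s0 st t1.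
  by have := est s t s0 st t1; rewrite ler_norml => /andP[]; lra.
have := @mono_quad _ (fun t => - F (y + t *: (y' - y))) 0 1 _ ler01.
move=> /(_ (C * nrm (y' - y) ^+ 2)).
rewrite scale0r addr0 scale1r [y + _]addrC subrK lerN2; apply => s t s0 st t1.
by have := est s t s0 st t1; rewrite ler_norml => /andP[]; lra.
Qed.

Lemma qdm0_const {n m k : nat} (Q : set 'rV[R]_n) (F : 'rV[R]_n -> 'M[R]_(m, k)) :
  seg_convex Q ->
  QDm vdisp Q F (fun _ _ => 0) -> forall y y', Q y -> Q y' -> F y = F y'.
Proof.
move=> cQ h y y' Qy Qy'; apply/matrixP => i j.
apply: (@qd0_const _ Q (fun y => F y i j)) => //.
by apply: qd_ext (h i j) => // a x _; rewrite mxE.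
Qed.

End quadratic_differentiability.

(** * Boxes of the half-space and one-sided partial derivatives *)

Section boxes.
Context {R : realType} {n : nat}.
Local Notation V := 'rV[R]_n.+1.

(** A cube cut by the half-space, so that boundary points and interior points have convex
    neighbourhoods of the same form. *)
Definition box (y0 : V) (r : R) : set V :=
  [set y | (forall a, `|y 0 a - y0 0 a| < r) /\ 0 <= y 0 ord0].

Lemma box_half (y0 : V) r : box y0 r `<=` half_space.
Proof. by move=> y []. Qed.

Lemma box_center (y0 : V) r : 0 < r -> half_space y0 -> box y0 r y0.
Proof. by move=> r0 h; split => // a; rewrite subrr normr0. Qed.

Lemma box_le (y0 : V) r r' : r <= r' -> box y0 r `<=` box y0 r'.
Proof. by move=> rr y [h1 h2]; split => // a; exact: lt_le_trans rr. Qed.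

Lemma box_convex (y0 : V) r : seg_convex (box y0 r).
Proof.
move=> y y' t [h1 h2] [h1' h2'] /andP[t0 t1]; split.
  move=> a; rewrite !mxE.
  have := h1 a; have := h1' a; rewrite !ltr_norml => /andP[a1 a2] /andP[b1 b2].
  have [->|t0'] := eqVneq t 0; first by rewrite mul0r addr0 b1 b2.
  have tp : 0 < t by rewrite lt_neqAle eq_sym t0'.
  have t1' : 0 <= 1 - t by lra.
  have p1 : 0 < t * (y' 0 a - y0 0 a + r) by apply: mulr_gt0 => //; lra.
  have p2 : 0 < t * (r - (y' 0 a - y0 0 a)) by apply: mulr_gt0 => //; lra.
  have p3 : 0 <= (1 - t) * (y 0 a - y0 0 a + r) by apply: mulr_ge0 => //; lra.
  have p4 : 0 <= (1 - t) * (r - (y 0 a - y0 0 a)) by apply: mulr_ge0 => //; lra.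
  by apply/andP; split; nra.
rewrite !mxE.
have p1 : 0 <= t * y' 0 ord0 by apply: mulr_ge0.
have p2 : 0 <= (1 - t) * y 0 ord0 by apply: mulr_ge0 => //; lra.
by nra.
Qed.

(** Two points of the box differ by less than [2 * r] in each of the [n.+1] coordinates. *)
Lemma box_small (y0 : V) r : r <= (n.+1).*2%:R^-1 -> small vdisp (box y0 r).
Proof.
move=> hr y y' [h1 _] [h1' _].
have n0 : 0 < n.+1%:R :> R by rewrite ltr0n.
apply: le_trans (@nrm_le_entries _ _ _ _ (2 * r) _) _.
  move=> i a; rewrite (ord1 i) !mxE.
  have := h1 a; have := h1' a; rewrite !ltr_norml ler_norml.
  by move=> /andP[? ?] /andP[? ?]; apply/andP; split; lra.
rewrite mul1n.
apply: (@le_trans _ _ (n.+1%:R * (2 * (n.+1).*2%:R^-1))).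
  by rewrite ler_pM2l // ler_pM2l.
rewrite -mul2n natrM invfM; rewrite le_eqVlt; apply/orP; left; apply/eqP; field.
by rewrite gt_eqF.
Qed.

Lemma box_mem_sub (y0 y y' x : V) r : box y0 r y -> box y0 r y' ->
  (forall a, Num.min (y 0 a) (y' 0 a) <= x 0 a <= Num.max (y 0 a) (y' 0 a)) ->
  box y0 r x.
Proof.
move=> [h1 h2] [h1' h2'] h; split.
  move=> a; have := h1 a; have := h1' a; rewrite !ltr_norml.
  move=> /andP[a1 a2] /andP[b1 b2]; have := h a.
  by rewrite ge_min le_max => /andP[/orP[|] ? /orP[|] ?]; apply/andP; split; lra.
have /andP[+ _] := h ord0; rewrite ge_min => /orP[|]; exact: le_trans.
Qed.

(** Increasing the coordinates never leaves the half-space. So every point, also on the boundary,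
    has admissible increments in each coordinate direction, and the limits that define [partial] are
    along proper filters. *)
Lemma box_forward (y0 y : V) r : box y0 r y -> exists2 e : R, 0 < e &
  forall k : V, (forall a, 0 <= k 0 a < e) -> box y0 r (y + k).
Proof.
move=> [h1 h2].
pose m := \big[Order.max/0]_a `|y 0 a - y0 0 a|.
have [r0|r0] := lerP r 0.
  by have := h1 ord0; rewrite ltNge (le_trans r0).
have mr : m < r by apply/bigmax_ltP; split.
exists (r - m); first by rewrite subr_gt0.
move=> k hk; split => [a|]; last first.
  by rewrite mxE addr_ge0 //; case/andP: (hk ord0).
rewrite mxE addrAC; apply: le_lt_trans (ler_normD _ _) _.
have /andP[k0 k1] := hk a; rewrite (ger0_norm k0).
have : `|y 0 a - y0 0 a| <= m by exact: le_bigmax.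
by lra.
Qed.

Local Notation e_ a := (delta_mx 0 a : V).

Lemma incr_box (D : set V) (y0 y : V) r a : box y0 r y -> box y0 r `<=` D ->
  ProperFilter (incr D y (e_ a)).
Proof.
move=> Qy QD_; have [e e0 he] := box_forward Qy.
apply: Build_ProperFilter_ex => A; rewrite /incr /within /= => -[d /= d0 hd].
have p0 : 0 < Num.min e d / 2 by rewrite divr_gt0 // lt_min e0 d0.
have pe : Num.min e d / 2 < e.
  by apply: (@lt_le_trans _ _ (Num.min e d)); [lra|rewrite ge_min lexx].
have pd : Num.min e d / 2 < d.
  by apply: (@lt_le_trans _ _ (Num.min e d)); [lra|rewrite ge_min lexx orbT].
exists (Num.min e d / 2); apply: hd => /=.
- by rewrite sub0r normrN gtr0_norm.
- by rewrite gt_eqF.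
- apply: QD_; rewrite addrC; apply: he => b; rewrite !mxE /=.
  by case: eqP => _; rewrite ?mulr1 ?mulr0 ?lexx ?e0 ?(ltW p0) ?pe.
Qed.

Lemma qd_partial_cvg (D : set V) (y0 y : V) r F Dd a :
  QD vdisp (box y0 r) F Dd -> box y0 r y -> D `<=` half_space ->
  diff_quot (F : V -> R^o) y (e_ a) @ incr D y (e_ a) --> (Dd a y : R^o).
Proof.
move=> /qd_const[C C0 hF] Qy Dh; have [f1 f2 f3] := hF y Qy.
apply/cvgrPdist_lt => eps eps0; rewrite /incr /within /=.
case: (Qy) => q1 q2.
pose m := \big[Order.max/0]_b `|y 0 b - y0 0 b|.
have r0 : 0 < r by apply: le_lt_trans (q1 ord0).
have mr : m < r by apply/bigmax_ltP; split.
have d0 : 0 < Num.min (r - m) (eps / (C + 1)).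
  by rewrite lt_min subr_gt0 mr divr_gt0 //; lra.
exists (Num.min (r - m) (eps / (C + 1))) => //= h.
rewrite /ball_ /= sub0r normrN lt_min => /andP[h1 h2] hN0 Dx.
have Qx : box y0 r (h *: e_ a + y).
  split; last exact: Dh Dx.
  move=> b; rewrite !mxE /= -addrA; apply: le_lt_trans (ler_normD _ _) _.
  have : `|y 0 b - y0 0 b| <= m by exact: le_bigmax.
  by case: eqP => _; rewrite ?mulr1 ?mulr0 ?normr0; lra.
have := f3 _ Qx; rewrite /vdisp addrK.
have -> : \sum_b Dd b y * (h *: e_ a) 0 b = h * Dd a y.
  rewrite (bigD1 a) //= big1 => [|b ba]; rewrite !mxE /=.
    by rewrite eqxx mulr1 addr0 mulrC.
  by rewrite (negPf ba) mulr0 mulr0.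
have -> : nrm (h *: e_ a) = `|h|.
  rewrite nrmZ /nrm big_ord1 (bigD1 a) //= big1 => [|b ba]; rewrite !mxE /=.
    by rewrite eqxx normr1 addr0 mulr1.
  by rewrite (negPf ba) normr0.
move=> H; rewrite /diff_quot distrC.
have -> : h^-1 *: (F (h *: e_ a + y) - F y : R^o) - Dd a y =
   h^-1 * (F (h *: e_ a + y) - F y - h * Dd a y).
  by rewrite [_ *: _]/(_ * _) mulrBr mulrA mulVf // mul1r.
rewrite normrM normfV.
apply: (@le_lt_trans _ _ (C * `|h|)).
  by rewrite ler_pdivrMl ?normr_gt0 // mulrCA -expr2.
apply: (@le_lt_trans _ _ ((C + 1) * `|h|)); first by rewrite ler_wpM2r // lerDl.
by rewrite mulrC -ltr_pdivlMr //; lra.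
Qed.

(** Identifies the derivatives of an expansion with [partial] on any set between the box and the
    half-space; so they are unique. *)
Lemma qd_partial (D : set V) (y0 y : V) r F Dd a :
  QD vdisp (box y0 r) F Dd -> box y0 r y -> box y0 r `<=` D ->
  D `<=` half_space -> partial D F a y = Dd a y.
Proof.
move=> hF Qy QsD Dh; have PF := incr_box a Qy QsD.
by apply: cvg_lim; [exact: norm_hausdorff|exact: qd_partial_cvg hF Qy Dh].
Qed.

Lemma qd_unique (y0 y : V) r F Dd Dd' a :
  QD vdisp (box y0 r) F Dd -> QD vdisp (box y0 r) F Dd' -> box y0 r y ->
  Dd a y = Dd' a y.
Proof.
move=> h1 h2 Qy; have s : box y0 r `<=` box y0 r by [].
by rewrite -(qd_partial a h1 Qy s (@box_half _ _)) (qd_partial a h2 Qy s (@box_half _ _)).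
Qed.

End boxes.

(** * From smoothness to quadratic errors; symmetry of second derivatives *)

Section smooth_functions.
Context {R : realType} {n : nat}.
Local Notation V := 'rV[R]_n.+1.
Local Notation e_ a := (delta_mx 0 a : V).

(** Strictly inside an admissible interval small increments of both signs are allowed, so the
    restricted limit is a two-sided derivative. *)
Lemma partial_is_derive (D : set V) (F : V -> R) (y : V) a (s l u : R) :
  l < s < u -> (forall t, l <= t <= u -> D (y + t *: e_ a)) ->
  derivable_within D (F : V -> R^o) (y + s *: e_ a) (e_ a) ->
  is_derive s (1 : R^o) (fun t : R^o => F (y + t *: e_ a) : R^o)
    (partial D F a (y + s *: e_ a)).
Proof.
move=> /andP[ls su] hD der.
have fE : incr D (y + s *: e_ a) (e_ a) = 0^'.
  rewrite /incr eqEsubset; split => A; rewrite /within /=; last first.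
    by move=> [e e0 he]; exists e => // h h1 h2 _; exact: he.
  move=> [e /= e0 he].
  have d0 : 0 < Num.min e (Num.min (s - l) (u - s)).
    by rewrite !lt_min e0 !subr_gt0 ls su.
  exists (Num.min e (Num.min (s - l) (u - s))) => //= h.
  rewrite /ball_ /= sub0r normrN !lt_min => /and3P[h1 h2 h3] hN0; apply: he => //=.
    by rewrite sub0r normrN.
  rewrite addrC -addrA -scalerDl; apply: hD.
  by move: h2 h3; rewrite !ltr_norml => /andP[? ?] /andP[? ?]; apply/andP; split; lra.
have qE : (fun h : R => h^-1 *: (((fun t : R^o => F (y + t *: e_ a) : R^o) \o shift s)
      (h *: (1 : R^o)) - F (y + s *: e_ a)) : R^o) =
    diff_quot (F : V -> R^o) (y + s *: e_ a) (e_ a).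
  apply: funext => h; rewrite /diff_quot /=; congr (_ *: (F _ - _)).
  by rewrite [h *: 1]mulr1 scalerDl addrCA.
split.
  by rewrite /derivable qE -fE; exact: der.
by rewrite /derive qE -fE.
Qed.

Lemma coordinate_mvt (D : set V) (F : V -> R) (y : V) a (t : R) :
  {within D, continuous F} ->
  (forall x, D x -> derivable_within D (F : V -> R^o) x (e_ a)) ->
  0 <= t -> (forall s : R, 0 <= s <= t -> D (y + s *: e_ a)) ->
  exists2 s : R, 0 <= s <= t &
    F (y + t *: e_ a) - F y = partial D F a (y + s *: e_ a) * t.
Proof.
move=> cF dF t0 hD.
pose f (s : R^o) : R^o := F (y + s *: e_ a).
have cf : {within `[0, t], continuous f}.
  apply/subspace_continuousP => s /=; rewrite in_itv /= => st.
  move/subspace_continuousP : cF => /(_ _ (hD _ st)) cF.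
  apply: cvg_comp cF => A; rewrite /within /= => hA.
  have lin : {for s, continuous (fun s : R^o => y + s *: e_ a)}.
    by apply: continuousD; [exact: cst_continuous|exact: scalel_continuous].
  change (nbhs s [set x : R | [set` `[0, t]] x -> A (y + x *: e_ a)]).
  have hA' : nbhs s ((fun s : R^o => y + s *: e_ a) @^-1` [set x | D x -> A x]) := lin _ hA.
  apply: (filterS _ hA') => x /= hx.
  by rewrite in_itv /= => xt; apply: hx; apply: hD.
have df (s : R) : s \in `]0, t[%R ->
    is_derive s (1 : R^o) f (partial D F a (y + s *: e_ a)).
  rewrite in_itv /= => sI; apply: (@partial_is_derive _ _ _ _ _ 0 t) => //.
  by apply: dF; apply: hD; case/andP: sI => *; rewrite !ltW.
have [s sI] := @MVT_segment R f (fun s => partial D F a (y + s *: e_ a)) 0 t t0 df cf.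
move: (sI); rewrite in_itv /= => st.
by rewrite /f scale0r addr0 subr0 => E; exists s.
Qed.

Lemma coordinate_mvt_box (D : set V) (F : V -> R) (y0 y : V) r a (t : R) :
  {within D, continuous F} ->
  (forall x, D x -> derivable_within D (F : V -> R^o) x (e_ a)) ->
  box y0 r `<=` D -> box y0 r y -> box y0 r (y + t *: e_ a) ->
  exists2 x, box y0 r x /\ (forall b, `|(x - y) 0 b| <= `|t * (b == a)%:R|) &
    F (y + t *: e_ a) - F y = partial D F a x * t.
Proof.
move=> cF dF QsD Qy Qy'.
have Qs (u : R) : 0 <= u <= 1 -> box y0 r (y + (u * t) *: e_ a).
  by move=> /(box_convex Qy Qy'); rewrite addrAC subrr add0r scalerA.
have [t0|t0] := lerP 0 t.
  have Qs' (s : R) : 0 <= s <= t -> box y0 r (y + s *: e_ a).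
    move=> /andP[s0 st]; have [tE|tN] := eqVneq t 0.
      have -> : s = 0 by apply/eqP; rewrite eq_le s0 -tE st.
      by rewrite scale0r addr0.
    have := Qs (s / t); rewrite divfK //; apply.
    by rewrite divr_ge0 // ler_pdivrMr ?mul1r // lt_neqAle eq_sym tN.
  have [s st E] := coordinate_mvt cF dF t0 (fun s h => QsD _ (Qs' s h)).
  exists (y + s *: e_ a) => //; split; first exact: Qs'.
  move=> b; rewrite addrAC subrr add0r !mxE /=; case/andP: st => s0 st.
  by case: (b == a); rewrite ?mulr1 ?mulr0 // !ger0_norm.
(* For negative [t] the mean value theorem is applied upwards from the other end. *)
have t0' : 0 <= - t by lra.
have Qs' (s : R) : 0 <= s <= - t -> box y0 r (y + t *: e_ a + s *: e_ a).
  move=> /andP[s0 st]; rewrite -addrA -scalerDl.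
  have := Qs ((t + s) / t); rewrite divfK ?lt_eqF //; apply.
  by rewrite -mulrNN -invrN divr_ge0 ?ler_pdivrMr; lra.
have [s st E] := coordinate_mvt cF dF t0' (fun s h => QsD _ (Qs' s h)).
exists (y + t *: e_ a + s *: e_ a); first split; first exact: Qs'.
  have -> : y + t *: e_ a + s *: e_ a - y = (t + s) *: e_ a.
    by apply/rowP => c; rewrite !mxE; ring.
  move=> b; rewrite !mxE /=.
  case/andP: st => s0 st; case: (b == a); rewrite ?mulr1 ?mulr0 //.
  by rewrite (ltr0_norm t0) ler_norml; apply/andP; split; lra.
by move: E; rewrite -addrA -scalerDl subrr scale0r addr0 mulrN => E; lra.
Qed.

(** Moves from [y] to [y'] one coordinate at a time: [mix j] has the first [j] coordinates of [y'].
    These corners and the edges between them stay in the box, also at the boundary. *)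
Lemma telescope_mvt (D : set V) (F : V -> R) (y0 y y' : V) r :
  {within D, continuous F} ->
  (forall a x, D x -> derivable_within D (F : V -> R^o) x (e_ a)) ->
  box y0 r `<=` D -> box y0 r y -> box y0 r y' ->
  exists xi : 'I_n.+1 -> V,
    (forall a, box y0 r (xi a) /\ nrm (xi a - y) <= nrm (y' - y)) /\
    F y' - F y = \sum_a partial D F a (xi a) * (y' - y) 0 a.
Proof.
move=> cF dF QsD Qy Qy'.
pose mix (j : nat) : V := \row_b (if (b < j)%N then y' 0 b else y 0 b).
have mixQ j : box y0 r (mix j).
  apply: (box_mem_sub Qy Qy') => a; rewrite mxE ge_min le_max.
  by case: ifP; rewrite lexx ?orbT.
have mixS (a : 'I_n.+1) : mix a.+1 = mix a + (y' - y) 0 a *: e_ a.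
  apply/rowP => b; rewrite !mxE /= ltnS.
  have [->|ba] := eqVneq b a; first by rewrite leqnn ltnn mulr1 addrC subrK.
  by rewrite mulr0 addr0 leq_eqVlt (inj_eq val_inj) (negPf ba).
have /choice[xi hxi] : forall a : 'I_n.+1, exists x,
    (box y0 r x /\ (forall b, `|(x - mix a) 0 b| <= `|(y' - y) 0 a * (b == a)%:R|)) /\
    F (mix a.+1) - F (mix a) = partial D F a x * (y' - y) 0 a.
  move=> a; have := mixQ a.+1; rewrite mixS => h.
  have [x h1 h2] := coordinate_mvt_box cF (dF a) QsD (mixQ a) h.
  by exists x.
exists xi; split.
  move=> a; have [[h1 h2] _] := hxi a; split => //.
  apply: ler_sum => i _; rewrite (ord1 i); apply: ler_sum => b _.
  have := h2 b; rewrite !mxE.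
  have [->|ba] := eqVneq b a; first by rewrite ltnn mulr1.
  rewrite mulr0 normr0 normr_le0 subr_eq0 => /eqP ->.
  by case: ifP => // _; rewrite subrr normr0.
have -> : y' = mix n.+1 by apply/rowP => b; rewrite mxE ltn_ord.
have -> : F y = F (mix 0%N) by congr F; apply/rowP => b; rewrite mxE.
rewrite -(telescope_sumr (fun j => F (mix j))) // big_mkord.
apply: eq_bigr => a _; have [_ ->] := hxi a; congr (_ * _).
by rewrite !mxE ltn_ord.
Qed.

Lemma within_continuous_bounded (D : set V) (F : V -> R) (y0 : V) :
  {within D, continuous F} -> D y0 ->
  exists2 e : R, 0 < e & forall y, D y -> (forall a, `|y 0 a - y0 0 a| < e) ->
    `|F y| <= `|F y0| + 1.
Proof.
move=> /subspace_continuousP cF Dy0.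
have /cvgrPdist_lt /(_ 1 ltr01) := cF _ Dy0.
rewrite /within /= => /nbhs_ballP[e /= e0 he].
exists e => // y Dy hy.
have /he /(_ Dy) : ball y0 e y.
  split=> // i a; rewrite (ord1 i) /ball /= /ball_ /= distrC; exact: hy.
move=> h; rewrite -[F y](subrK (F y0)) addrC; apply: le_trans (ler_normD _ _) _.
by rewrite lerD2l distrC ltW.
Qed.

Lemma ler_term (I : finType) (f : I -> R) i :
  (forall j, 0 <= f j) -> f i <= \sum_j f j.
Proof. by move=> h; rewrite (bigD1 i) //= lerDl sumr_ge0. Qed.

(** On a small box the second partial derivatives are bounded, so the first ones are Lipschitz. In
    [telescope_mvt] they are taken at points no farther from [y] than [y'], hence differ from those
    at [y] by at most [M2 * nrm (y' - y)]. *)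
Lemma ck2_qd (D : set V) (F : V -> R) (y0 : V) r0 :
  Ck_on 2 D F -> box y0 r0 `<=` D -> 0 < r0 -> half_space y0 ->
  exists2 r : R, 0 < r & QD vdisp (box y0 r) F (partial D F).
Proof.
move=> [cF dF] QsD r00 hy0; have Dy0 : D y0 by apply: QsD; exact: box_center.
have dF1 a x : D x -> derivable_within D (F : V -> R^o) x (e_ a).
  by have [+ _] := dF a; apply.
have cF1 a : {within D, continuous (partial D F a)} by have [_ []] := dF a.
have dF2 a b x : D x -> derivable_within D (partial D F a : V -> R^o) x (e_ b).
  by have [_ [_ /(_ b) [+ _]]] := dF a; apply.
have cF2 a b : {within D, continuous (partial D (partial D F a) b)}.
  by have [_ [_ /(_ b) [_ []]]] := dF a.
have [e0 e00 b0] := within_continuous_bounded cF Dy0.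
have /choice[e1 b1] a : exists e : R, 0 < e /\ forall y, D y ->
   (forall a, `|y 0 a - y0 0 a| < e) -> `|partial D F a y| <= `|partial D F a y0| + 1.
  by have [e] := within_continuous_bounded (cF1 a) Dy0; exists e.
have /choice[e2 b2] : forall ab : 'I_n.+1 * 'I_n.+1, exists e : R, 0 < e /\ forall y, D y ->
   (forall c, `|y 0 c - y0 0 c| < e) -> `|partial D (partial D F ab.1) ab.2 y| <=
      `|partial D (partial D F ab.1) ab.2 y0| + 1.
  by move=> [a b]; have [e] := within_continuous_bounded (cF2 a b) Dy0; exists e.
pose r := Num.min (Num.min r0 e0)
  (Num.min (\big[Num.min/1]_a e1 a) (\big[Num.min/1]_ab e2 ab)).
have r_gt0 : 0 < r.
  rewrite !lt_min r00 e00 /=; apply/andP; split; apply/bigmin_gtP; split => //.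
    by move=> a _; case: (b1 a).
  by move=> ab _; case: (b2 ab).
have rr0 : r <= r0 by rewrite !ge_min lexx.
have re0 : r <= e0 by rewrite !ge_min lexx orbT.
have re1 a : r <= e1 a.
  by rewrite !ge_min; apply/orP; right; apply/orP; left; exact: bigmin_le.
have re2 ab : r <= e2 ab.
  by rewrite !ge_min; apply/orP; right; apply/orP; right; exact: bigmin_le.
have QsD' : box y0 r `<=` D by apply: subset_trans QsD; exact: box_le.
pose M2 := \sum_a \sum_b (`|partial D (partial D F a) b y0| + 1).
pose M1 := \sum_a (`|partial D F a y0| + 1).
have M20 : 0 <= M2 by do 2 (apply: sumr_ge0 => ? _); rewrite addr_ge0.
have M10 : 0 <= M1 by apply: sumr_ge0 => ? _; rewrite addr_ge0.
have B2 a b y : box y0 r y -> `|partial D (partial D F a) b y| <= M2.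
  move=> Qy; apply: le_trans (_ : _ <= `|partial D (partial D F a) b y0| + 1) _.
    have [_ h] := b2 (a, b); apply: h; first exact: QsD'.
    by case: Qy => h _ c; apply: lt_le_trans (h c) (re2 _).
  apply: le_trans (ler_term (f := fun b => `|partial D (partial D F a) b y0| + 1) b _) _.
    by move=> ?; rewrite addr_ge0.
  apply: (ler_term (f := fun a => \sum_b (`|partial D (partial D F a) b y0| + 1))).
  by move=> ?; apply: sumr_ge0 => ? _; rewrite addr_ge0.
have B1 a y : box y0 r y -> `|partial D F a y| <= M1.
  move=> Qy; apply: le_trans (_ : _ <= `|partial D F a y0| + 1) _.
    have [_ h] := b1 a; apply: h; first exact: QsD'.
    by case: Qy => h _ c; apply: lt_le_trans (h c) (re1 _).
  apply: (ler_term (f := fun a => `|partial D F a y0| + 1)) => ?.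
  by rewrite addr_ge0.
have L1 a y y' : box y0 r y -> box y0 r y' ->
    `|partial D F a y' - partial D F a y| <= M2 * nrm (y' - y).
  move=> Qy Qy'.
  have [xi [hxi ->]] := telescope_mvt (cF1 a) (dF2 a) QsD' Qy Qy'.
  by apply: sum_disp_le => b; apply: B2; case: (hxi b).
exists r => //; exists ((`|F y0| + 1) + M1 + M2) => y Qy; split.
- apply: le_trans (_ : _ <= `|F y0| + 1) _; last by rewrite -addrA lerDl addr_ge0.
  apply: b0; first exact: QsD'.
  by case: Qy => h _ c; apply: lt_le_trans (h c) re0.
- move=> a; apply: le_trans (B1 a _ Qy) _.
  by rewrite addrAC lerDr addr_ge0 // addr_ge0.
- move=> y' Qy'; have [xi [hxi ->]] := telescope_mvt cF dF1 QsD' Qy Qy'.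
  rewrite /vdisp -sumrB; under eq_bigr => a _ do rewrite -mulrBl.
  apply: le_trans (sum_disp_le (C := M2 * nrm (y' - y)) _ _) _.
    move=> a; have [Qx hx] := hxi a; apply: le_trans (L1 a _ _ Qy Qx) _.
    exact: ler_wpM2l.
  rewrite -mulrA -expr2; apply: ler_wpM2r; first exact: sqr_ge0.
  by rewrite lerDr addr_ge0 // addr_ge0.
Qed.

Lemma smooth_qd (D : set V) (F : V -> R) (y0 : V) r0 :
  smooth_on D F -> box y0 r0 `<=` D -> 0 < r0 -> half_space y0 ->
  exists2 r : R, 0 < r & QD vdisp (box y0 r) F (partial D F).
Proof. by move=> h; apply: ck2_qd; exact: (h 2). Qed.

Lemma smooth_partial (D : set V) (F : V -> R) a :
  smooth_on D F -> smooth_on D (partial D F a).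
Proof. by move=> h k; have [_ /(_ a)[]] := h k.+1. Qed.

Lemma mean_value_quad (f g : R -> R) (a b B C : R) : a <= b ->
  (forall s t, a <= s -> s <= t -> t <= b ->
     `|f t - f s - g s * (t - s)| <= C * (t - s) ^+ 2) ->
  (forall s, a <= s <= b -> `|g s| <= B) -> `|f b - f a| <= B * (b - a).
Proof.
move=> ab hf hg; rewrite ler_norml; apply/andP; split.
  have := @mono_quad _ (fun t => f t + B * t) a b C ab.
  rewrite /= => H; have : f a + B * a <= f b + B * b; last by lra.
  apply: H => s t as_ st tb; have := hf s t as_ st tb.
  have : `|g s| <= B by apply: hg; rewrite as_ (le_trans st).
  rewrite !ler_norml => /andP[g1 g2] /andP[h1 h2].
  have : 0 <= (B + g s) * (t - s) by apply: mulr_ge0; lra.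
  by lra.
have := @mono_quad _ (fun t => B * t - f t) a b C ab.
rewrite /= => H; have : B * a - f a <= B * b - f b; last by lra.
apply: H => s t as_ st tb; have := hf s t as_ st tb.
have : `|g s| <= B by apply: hg; rewrite as_ (le_trans st).
rewrite !ler_norml => /andP[g1 g2] /andP[h1 h2].
have : 0 <= (B - g s) * (t - s) by apply: mulr_ge0; lra.
by lra.
Qed.

Lemma eq_of_small (x y K e : R) : 0 < e ->
  (forall h, 0 < h < e -> `|x - y| <= K * h) -> x = y.
Proof.
move=> e0 H; apply/eqP; rewrite -subr_eq0 -normr_le0.
apply: (@le_of_quad _ _ _ (`|K| * (e / 2))) => m; rewrite add0r.
have m0 : 0 < m.+1%:R :> R by rewrite ltr0n.
apply: le_trans (H (e / 2 / m.+1%:R) _) _.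
  rewrite divr_gt0 ?divr_gt0 //= ltr_pdivrMr //.
  have : (1 : R) <= m.+1%:R by rewrite ler1n.
  move=> m1; have : e * 1 <= e * m.+1%:R by rewrite ler_pM2l.
  by lra.
by rewrite mulrA ler_pM2r ?invr_gt0 // ler_pM2r ?divr_gt0 // ler_norm.
Qed.

Lemma delta_disp (D : 'I_n.+1 -> R) (h : R) a :
  \sum_b D b * (h *: e_ a) 0 b = D a * h.
Proof.
rewrite (bigD1 a) //= big1 => [|b ba]; rewrite !mxE /=.
  by rewrite eqxx mulr1 addr0.
by rewrite (negPf ba) mulr0 mulr0.
Qed.

Lemma nrm_delta (h : R) a : nrm (h *: e_ a) = `|h|.
Proof.
rewrite nrmZ /nrm big_ord1 (bigD1 a) //= big1 => [|b ba]; rewrite !mxE /=.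
  by rewrite eqxx normr1 addr0 mulr1.
by rewrite (negPf ba) normr0.
Qed.

(** The left-hand side is the increment on [[0, h]] of [f], whose derivative [g] is at most
    [C * 5 * h ^+ 2]: [D1 a] is expanded at [y] towards two points at distances at most [2 * h] and
    [h], with errors 4 and 1 times [C * h ^+ 2]. Exchanging [a] and [b] then yields the symmetry of
    second derivatives. *)
Lemma mixed_difference (y0 y : V) r F D1 D2 a b C h : 0 < h ->
  (forall s t : R, 0 <= s <= h -> 0 <= t <= h ->
     box y0 r (y + s *: e_ a + t *: e_ b)) ->
  QD vdisp (box y0 r) F D1 -> 0 <= C ->
  (forall y, box y0 r y -> forall y', box y0 r y' ->
     `|D1 a y' - D1 a y - \sum_c D2 c y * (y' - y) 0 c| <= C * nrm (y' - y) ^+ 2) ->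
  `|F (y + h *: e_ a + h *: e_ b) - F (y + h *: e_ a) - F (y + h *: e_ b) + F y
    - h ^+ 2 * D2 b y| <= C * 5 * h ^+ 2 * h.
Proof.
move=> h0 Qst /qd_const[K K0 hF] C0 hD1.
have Qy : box y0 r y.
  by have := Qst 0 0; rewrite !scale0r !addr0; apply; rewrite lexx ltW.
have Qa (s : R) : 0 <= s <= h -> box y0 r (y + s *: e_ a).
  by move=> sh; have := Qst s 0 sh; rewrite scale0r addr0; apply; rewrite lexx ltW.
have hh : 0 <= h <= h by rewrite lexx ltW.
pose f t := F (y + t *: e_ a + h *: e_ b) - F (y + t *: e_ a) - t * (h * D2 b y).
pose g t := D1 a (y + t *: e_ a + h *: e_ b) - D1 a (y + t *: e_ a) - h * D2 b y.
have := @mean_value_quad f g 0 h (C * 5 * h ^+ 2) (K + K) (ltW h0).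
rewrite /f scale0r !addr0 subr0 mul0r subr0 => H.
have -> : F (y + h *: e_ a + h *: e_ b) - F (y + h *: e_ a) - F (y + h *: e_ b) +
   F y - h ^+ 2 * D2 b y = F (y + h *: e_ a + h *: e_ b) - F (y + h *: e_ a) -
   h * (h * D2 b y) - (F (y + h *: e_ b) - F y) by rewrite expr2; ring.
apply: H => [s t s0 st th|s sh].
  have sh : 0 <= s <= h by rewrite s0 (le_trans st).
  have th' : 0 <= t <= h by rewrite th (le_trans s0).
  have [_ _ /(_ _ (Qst t h th' hh)) H1] := hF _ (Qst s h sh hh).
  have [_ _ /(_ _ (Qa t th')) H2] := hF _ (Qa s sh).
  move: H1 H2; rewrite /vdisp.
  have -> : y + t *: e_ a + h *: e_ b - (y + s *: e_ a + h *: e_ b) = (t - s) *: e_ a.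
    by apply/rowP => c; rewrite !mxE; ring.
  have -> : y + t *: e_ a - (y + s *: e_ a) = (t - s) *: e_ a.
    by apply/rowP => c; rewrite !mxE; ring.
  rewrite !delta_disp nrm_delta real_normK ?num_real // => H1 H2.
  rewrite /g mulrDl; set X := F _ in H1 H2 *; set Y := F _ in H1 H2 *.
  move: H1 H2; rewrite !ler_norml => /andP[? ?] /andP[? ?].
  by apply/andP; split; lra.
have H1 := hD1 _ Qy _ (Qst s h sh hh); have H2 := hD1 _ Qy _ (Qa s sh).
have : nrm (y + s *: e_ a + h *: e_ b - y) <= 2 * h.
  rewrite -(addrA y) [y + _]addrC addrK; apply: le_trans (nrmD _ _) _.
  by rewrite !nrm_delta !ger0_norm; case/andP: sh; lra.
have : nrm (y + s *: e_ a - y) <= h.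
  by rewrite addrAC subrr add0r nrm_delta; case/andP: sh => *; rewrite ger0_norm.
move: H1 H2.
have -> : y + s *: e_ a + h *: e_ b - y = s *: e_ a + h *: e_ b.
  by rewrite -(addrA y) [y + _]addrC addrK.
rewrite [y + _ - y]addrAC subrr add0r.
under eq_bigr => c _ do rewrite mxE mulrDr.
rewrite big_split /= !delta_disp => H1 H2 n1 n2.
have N1 : C * nrm (s *: e_ a : V) ^+ 2 <= C * h ^+ 2.
  by rewrite ler_wpM2l // ler_pXn2r ?nnegrE // ltW.
have N2 : C * nrm (s *: e_ a + h *: e_ b : V) ^+ 2 <= C * (4 * h ^+ 2).
  rewrite ler_wpM2l // (_ : 4 * h ^+ 2 = (2 * h) ^+ 2); last by ring.
  by rewrite ler_pXn2r ?nnegrE // mulr_ge0 // ltW.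
rewrite /g; move: (D1 a (y + _ + _)) (D1 a (y + _)) (D1 a y) H1 H2 => X Y Z H1 H2.
move: (le_trans H1 N2) (le_trans H2 N1); rewrite !ler_norml.
by move=> /andP[? ?] /andP[? ?]; apply/andP; split; lra.
Qed.

Lemma schwarz (y0 y : V) r F D1 D2 a b : box y0 r y ->
  QD vdisp (box y0 r) F D1 -> (forall c, QD vdisp (box y0 r) (D1 c) (D2 c)) ->
  D2 a b y = D2 b a y.
Proof.
move=> Qy hF hD; have [e e0 he] := box_forward Qy.
have [Ca Ca0 ha] := qd_const (hD a); have [Cb Cb0 hb] := qd_const (hD b).
have Qst c d (s t h : R) : h < e / 2 -> 0 <= s <= h -> 0 <= t <= h ->
    box y0 r (y + s *: e_ c + t *: e_ d).
  move=> hh /andP[s0 s1] /andP[t0 t1]; rewrite -addrA; apply: he => i.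
  rewrite !mxE /=; case: (i == c); case: (i == d);
  by rewrite ?mulr1 ?mulr0 ?addr0 ?add0r; apply/andP; split; lra.
apply: (@eq_of_small _ _ (Ca * 5 + Cb * 5) (e / 2)); first by rewrite divr_gt0.
move=> h /andP[h0 hh].
have H1 := @mixed_difference y0 y r F D1 (D2 a) a b Ca h h0
  (fun s t => Qst a b s t h hh) hF Ca0
  (fun y Qy y' Qy' => let: And3 _ _ H := ha y Qy in H y' Qy').
have H2 := @mixed_difference y0 y r F D1 (D2 b) b a Cb h h0
  (fun s t => Qst b a s t h hh) hF Cb0
  (fun y Qy y' Qy' => let: And3 _ _ H := hb y Qy in H y' Qy').
move: H1 H2; rewrite [y + h *: e_ b + _]addrAC => H1 H2.
have h2 : 0 < h ^+ 2 by rewrite exprn_gt0.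
rewrite -(ler_pM2l h2) -[h ^+ 2 in leLHS]gtr0_norm // -normrM.
move: H1 H2; rewrite !ler_norml => /andP[? ?] /andP[? ?].
by apply/andP; split; lra.
Qed.

End smooth_functions.

(** * Curvature *)

Section local_geometry.
Context {R : realType} {d : nat} (M : riemannian_manifold R d).
Local Notation vec := 'rV[R]_d.+1.
Implicit Types (i : chart_idx M) (y : vec).

Lemma chart_image_half i : chart_image i `<=` half_space.
Proof.
by rewrite /chart_image; have [U _ ->] := image_open i => y [].
Qed.

Lemma open_box (O : set vec) y0 : open O -> O y0 ->
  exists2 r : R, 0 < r & forall y, (forall a, `|y 0 a - y0 0 a| < r) -> O y.
Proof.
move=> oO Oy; have /nbhs_ballP[e /= e0 he] : nbhs y0 O by exact: open_nbhs_nbhs.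
exists e => // y hy; apply: he; split=> // j a.
by rewrite (ord1 j) /ball /= /ball_ /= distrC; exact: hy.
Qed.

Lemma chart_box i y0 : chart_image i y0 ->
  exists2 r : R, 0 < r & box y0 r `<=` chart_image i.
Proof.
rewrite /chart_image; have [U oU ->] := image_open i => -[Uy hy].
have [r r0 hr] := open_box oU Uy; exists r => // y [h1 h2]; split => //.
exact: hr.
Qed.

Lemma metric_unit i y : chart_image i y -> metric i y \in unitmx.
Proof.
move=> iy; rewrite -row_free_unit -kermx_eq0; apply/eqP/row_matrixP => k.
rewrite row0; apply/eqP; apply: contraT => hk.
have := metric_pos iy hk; rewrite (_ : _ *m metric i y = 0) ?mul0mx ?mxE ?ltxx //.
by apply/eqP; rewrite -sub_kermx row_sub.
Qed.

Definition ddmetric i (e a b c : 'I_d.+1) : vec -> R :=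
  partial (chart_image i) (dmetric i a b c) e.
Definition dchristoffel i (e l a b : 'I_d.+1) : vec -> R :=
  partial (chart_image i) (christoffel i l a b) e.

Record local_box i (y0 : vec) (r : R) : Prop := LocalBox {
  lb_gt0 : 0 < r;
  lb_center : chart_image i y0;
  lb_sub : box y0 r `<=` chart_image i;
  lb_small : small vdisp (box y0 r);
  lb_metric : forall b c,
    QD vdisp (box y0 r) (fun y => metric i y b c) (fun a => dmetric i a b c);
  lb_dmetric : forall a b c,
    QD vdisp (box y0 r) (dmetric i a b c) (fun e => ddmetric i e a b c);
  lb_christoffel : forall l a b,
    QD vdisp (box y0 r) (christoffel i l a b) (fun e => dchristoffel i e l a b);
  lb_inv : exists C, forall y, box y0 r y -> nrm (invmx (metric i y)) <= C
}.

Lemma local_box_le i y0 r r' :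
  0 < r' -> r' <= r -> local_box i y0 r -> local_box i y0 r'.
Proof.
move=> r0 rr [h1 h2 h3 h4 h5 h6 h7 [C h8]].
have s : box y0 r' `<=` box y0 r by exact: box_le.
split => //.
- exact: subset_trans h3.
- exact: small_subset h4.
- by move=> b c; exact: qd_subset (h5 b c).
- by move=> a b c; exact: qd_subset (h6 a b c).
- by move=> l a b; exact: qd_subset (h7 l a b).
- by exists C => y /s; exact: h8.
Qed.

Lemma local_box_mem i y0 r : local_box i y0 r -> box y0 r y0.
Proof. by move=> h; apply: box_center (lb_gt0 h) _; exact: chart_image_half (lb_center h). Qed.

Lemma common_radius (I : finType) (P : I -> R -> Prop) (r0 : R) : 0 < r0 ->
  (forall j r r', 0 < r' -> r' <= r -> P j r -> P j r') ->
  (forall j, exists2 r, 0 < r & P j r) ->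
  exists2 r, 0 < r <= r0 & forall j, P j r.
Proof.
move=> r00 mono h.
have /choice[f hf] j : exists r, 0 < r /\ P j r by have [r] := h j; exists r.
have m0 : 0 < \big[Num.min/r0]_j f j.
  by apply/bigmin_gtP; split => // j _; case: (hf j).
exists (\big[Num.min/r0]_j f j); first by rewrite m0; exact: bigmin_le_id.
move=> j; apply: mono (proj2 (hf j)) => //; exact: bigmin_le.
Qed.

Lemma local_box_exists i y0 : chart_image i y0 -> exists r, local_box i y0 r.
Proof.
move=> iy; have hy : half_space y0 by exact: chart_image_half iy.
have [r1 r10 s1] := chart_box iy.
have n0 : 0 < (d.+1).*2%:R^-1 :> R by rewrite invr_gt0 ltr0n double_gt0.
have r20 : 0 < Num.min r1 (d.+1).*2%:R^-1 by rewrite lt_min r10.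
have [r2 /andP[r2_gt0 r2_le] hr2] := @common_radius _
  (fun bc : 'I_d.+1 * 'I_d.+1 => fun r => QD vdisp (box y0 r)
     (fun y => metric i y bc.1 bc.2) (fun a => dmetric i a bc.1 bc.2)) _ r20
  (fun _ _ _ _ rr => qd_subset (box_le rr))
  (fun bc => smooth_qd (@metric_smooth _ _ M i bc.1 bc.2) s1 r10 hy).
have [r3 /andP[r3_gt0 r3_le] hr3] := @common_radius _
  (fun abc : 'I_d.+1 * 'I_d.+1 * 'I_d.+1 => fun r => QD vdisp (box y0 r)
     (dmetric i abc.1.1 abc.1.2 abc.2)
     (fun e => ddmetric i e abc.1.1 abc.1.2 abc.2)) _ r2_gt0
  (fun _ _ _ _ rr => qd_subset (box_le rr))
  (fun abc => smooth_qd (smooth_partial abc.1.1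
     (@metric_smooth _ _ M i abc.1.2 abc.2)) s1 r10 hy).
move: r2_le; rewrite le_min => /andP[r2r1 r2n].
have s3 : box y0 r3 `<=` chart_image i.
  by apply: subset_trans s1; apply: box_le; exact: le_trans r2r1.
have sm3 : small vdisp (box y0 r3) by apply: box_small; exact: le_trans r2n.
have hg b c : QD vdisp (box y0 r3) (fun y => metric i y b c) (fun a => dmetric i a b c).
  by apply: qd_subset (hr2 (b, c)); exact: box_le.
have hgm : QDm vdisp (box y0 r3) (metric i) (fun a y => \matrix_(b, c) dmetric i a b c y).
  by move=> b c; apply: qd_ext (hg b c) => // a y _; rewrite mxE.
have [L L0 lipg] := qdm_lip sm3 hgm.
have Qy0 : box y0 r3 y0 by exact: box_center.
set X0 := invmx (metric i y0).
(* For displacements below [den^-1] in each coordinate, the change of the metric times [nrm X0] is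
   at most 1/2; then X = X0 - X (g - g0) X0 gives [nrm X <= 2 * nrm X0]. The terms [+ 1] keep [den]
   positive. *)
pose den := 2 * (L + 1) * d.+1%:R * (nrm X0 + 1).
have den0 : 0 < den.
  by rewrite !mulr_gt0 ?ltr0n // ltr_pwDr.
pose r := Num.min r3 den^-1.
have r0 : 0 < r by rewrite lt_min r3_gt0 invr_gt0.
have s : box y0 r `<=` box y0 r3 by apply: box_le; rewrite ge_min lexx.
have sm : small vdisp (box y0 r) by exact: small_subset sm3.
have Xb y : box y0 r y -> nrm (invmx (metric i y)) <= 2 * nrm X0.
  move=> Qy; set X := invmx _.
  have uy : metric i y \in unitmx by apply: metric_unit; apply: s3; exact: s.
  have u0 : metric i y0 \in unitmx by exact: metric_unit.
  have XE : X = X0 - X *m (metric i y - metric i y0) *m X0.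
    rewrite mulmxBr mulmxBl (mulVmx uy) mul1mx -mulmxA (mulmxV u0) mulmx1.
    by rewrite opprB addrC subrK.
  have hd : nrm (metric i y - metric i y0) * nrm X0 <= 2^-1.
    have := lipg y0 y Qy0 (s _ Qy); rewrite /vdisp => H1.
    have H2 : nrm (y - y0) <= d.+1%:R * den^-1.
      have := @nrm_le_entries _ _ _ (y - y0) den^-1; rewrite mul1n; apply => j a.
      rewrite (ord1 j) !mxE.
      case: Qy => /(_ a) /ltW h _; apply: le_trans h _.
      by rewrite ge_min lexx orbT.
    apply: le_trans (_ : _ <= (L + 1) * (d.+1%:R * den^-1) * (nrm X0 + 1)) _.
      apply: ler_pM => //; last by rewrite lerDl.
      apply: le_trans H1 _; apply: ler_pM => //; by rewrite lerDl.
    rewrite le_eqVlt; apply/orP; left; apply/eqP; rewrite /den; field.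
    by rewrite !gt_eqF ?ltr0n // ltr_pwDr.
  have : nrm X <= nrm X0 + nrm X * 2^-1.
    rewrite {1}XE; apply: le_trans (nrmB _ _) _; rewrite lerD2l.
    apply: le_trans (nrmM _ _) _.
    apply: le_trans (_ : _ <= nrm X * nrm (metric i y - metric i y0) * nrm X0) _.
      by apply: ler_wpM2r => //; exact: nrmM.
    by rewrite -mulrA; apply: ler_wpM2l.
  by lra.
have hinv := qdm_inv sm (qdm_subset s hgm)
  (fun y Qy => mulVmx (metric_unit (s3 _ (s _ Qy)))) Xb.
have hdg a b c := qd_subset s (hr3 (a, b, c)).
have hch l a b : QD vdisp (box y0 r) (christoffel i l a b)
    (fun e => dchristoffel i e l a b).
  have H := qd_scale 2^-1 (qd_sum (index_enum 'I_d.+1)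
    (fun m => qd_mul sm (hinv l m)
     (qd_sub (qd_add (hdg a b m) (hdg b a m)) (hdg m a b)))).
  apply: qd_ext (H) => // e y Qy; rewrite /dchristoffel; apply/esym.
  exact: (qd_partial e H Qy (subset_trans s s3) (@chart_image_half i)).
exists r; split => //.
- exact: subset_trans s3.
- by move=> b c; exact: qd_subset (hg b c).
- by exists (2 * nrm X0).
Qed.

End local_geometry.

Section curvature_algebra.
Context {R : realType}.

(* Polarization: a tensor with the symmetries of a curvature tensor is determined
   by its sectional values. *)
Lemma curvature_form_eq0 (V : zmodType) (T : V -> V -> V -> V -> R) :
  (forall a b c e f, T (a + b) c e f = T a c e f + T b c e f) ->
  (forall a b c e f, T a (b + c) e f = T a b e f + T a c e f) ->
  (forall a b c e f, T a b (c + e) f = T a b c f + T a b e f) ->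
  (forall a b c e f, T a b c (e + f) = T a b c e + T a b c f) ->
  (forall a b c e, T a b c e = - T b a c e) ->
  (forall a b c e, T a b c e = - T a b e c) ->
  (forall a b c e, T a b c e + T b c a e + T c a b e = 0) ->
  (forall u v, T u v v u = 0) -> forall a b c e, T a b c e = 0.
Proof.
move=> l1 l2 l3 l4 a12 a34 bia quad.
(* The pair symmetry, from four instances of the Bianchi identity. *)
have pair a b c e : T a b c e = T c e a b.
  have := bia a b c e; have := bia b c e a; have := bia c e a b.
  have := bia e a b c.
  have := a34 b c e a; have := a34 c e b a; have := a12 e b c a.
  have := a12 e a c b; have := a34 a e c b; have := a12 a c e b.
  have := a34 c a e b; have := a12 e a b c; have := a34 a b e c.
  have := a34 b e a c.
  by lra.
(* Polarization, here in the middle arguments and then in the outer ones, makes [T] antisymmetric in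
   the first and the last. *)
have t1 u v w : T u v w u = 0.
  have := quad u (v + w); rewrite l2 !l3 !quad.
  have := pair u v w u; rewrite (a12 w u) (a34 u w u v).
  by lra.
have a14 a b c e : T a b c e = - T e b c a.
  by have := t1 (a + e) b c; rewrite l1 !l4 !t1; lra.
move=> a b c e.
(* With this [T] is antisymmetric under every transposition, so the three cyclic terms of the
   Bianchi identity are equal. *)
have a23 a' b' c' e' : T a' b' c' e' = - T a' c' b' e'.
  have := a12 a' b' c' e'; have := a14 b' a' c' e'; have := a34 e' a' c' b'.
  have := a14 e' a' b' c'; have := a12 c' a' b' e'.
  by lra.
have := bia a b c e; have := a12 a b c e; have := a23 b a c e.
have := a12 c a b e; have := a23 a c b e.
by lra.
Qed.

End curvature_algebra.

(* [ring] compares atoms up to conversion, which would unfold limits. *)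
Ltac abstract_atoms := repeat match goal with
  | |- context [@bigop ?T ?I ?z ?r ?F] => generalize (@bigop T I z r F); intro
  | |- context [ddmetric ?i ?e ?a ?b ?c ?y] => generalize (ddmetric i e a b c y); intro
  | |- context [dchristoffel ?i ?e ?l ?a ?b ?y] =>
      generalize (dchristoffel i e l a b y); intro
  | |- context [christoffel ?i ?l ?a ?b ?y] => generalize (christoffel i l a b y); intro
  | |- context [dmetric ?i ?a ?b ?c ?y] => generalize (dmetric i a b c y); intro
  | |- context [riemann ?i ?l ?a ?b ?c ?y] => generalize (riemann i l a b c y); intro
  | |- context [fun_of_matrix ?A ?k ?l] => generalize (fun_of_matrix A k l); intro
  end.

Lemma exchange_big3 (R : pzSemiRingType) (I J K : finType) (F : I -> J -> K -> R) :
  \sum_l \sum_k \sum_a F l k a = \sum_a \sum_l \sum_k F l k a.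
Proof.
transitivity (\sum_l \sum_a \sum_k F l k a); last exact: exchange_big.
by apply: eq_bigr => l _; exact: exchange_big.
Qed.

(** * Symmetries of the curvature tensor in a chart *)

Section flatness.
Context {R : realType} {d : nat} (M : riemannian_manifold R d).
Local Notation vec := 'rV[R]_d.+1.
Context (i : chart_idx M) (y0 : vec) (r : R) (lb : local_box i y0 r).
Local Notation Q := (box y0 r).

Lemma riemannE l a b c y : riemann i l a b c y =
  dchristoffel i a l b c y - dchristoffel i b l a c y +
  \sum_(m < d.+1) (christoffel i m b c y * christoffel i l a m y
                     - christoffel i m a c y * christoffel i l b m y).
Proof. by []. Qed.

Lemma metric_symE y b c : chart_image i y -> metric i y b c = metric i y c b.
Proof. by move=> iy; rewrite -{1}(metric_sym iy) mxE. Qed.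

Lemma dmetric_sym a b c y : Q y -> dmetric i a b c y = dmetric i a c b y.
Proof.
move=> Qy.
have h : QD vdisp Q (fun y => metric i y b c) (fun a => dmetric i a c b).
  apply: qd_ext (lb_metric lb c b) => // x Qx.
  by apply: metric_symE; exact: (lb_sub lb).
exact: (qd_unique a (lb_metric lb b c) h Qy).
Qed.

Lemma ddmetric_sym e a b c y : Q y -> ddmetric i e a b c y = ddmetric i e a c b y.
Proof.
move=> Qy.
have h : QD vdisp Q (dmetric i a b c) (fun e => ddmetric i e a c b).
  by apply: qd_ext (lb_dmetric lb a c b) => // x Qx; exact: dmetric_sym.
exact: (qd_unique e (lb_dmetric lb a b c) h Qy).
Qed.

Lemma ddmetric_swap e a b c y : Q y -> ddmetric i e a b c y = ddmetric i a e b c y.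
Proof.
move=> Qy; apply/esym.
exact: (@schwarz R d y0 y r (fun y => metric i y b c) (fun a => dmetric i a b c)
  (fun a e => ddmetric i e a b c) e a Qy (lb_metric lb b c)
  (fun a => lb_dmetric lb a b c)).
Qed.

(* Christoffel symbols of the first kind, [ab, m], and their derivatives. *)
Definition chr1 a b m y : R :=
  2^-1 * (dmetric i a b m y + dmetric i b a m y - dmetric i m a b y).
Definition dchr1 e a b m y : R :=
  2^-1 * (ddmetric i e a b m y + ddmetric i e b a m y - ddmetric i e m a b y).

Lemma chr1_qd a b m : QD vdisp Q (chr1 a b m) (fun e => dchr1 e a b m).
Proof.
have h := qd_scale 2^-1 (qd_sub (qd_add (lb_dmetric lb a b m) (lb_dmetric lb b a m))
  (lb_dmetric lb m a b)).
exact: h.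
Qed.

(** Compatibility of the Levi-Civita connection with the metric, with the index lowered. *)
Lemma chr1_add a b m y : Q y -> chr1 a b m y + chr1 a m b y = dmetric i a b m y.
Proof.
move=> Qy; rewrite /chr1 (dmetric_sym a m b Qy) (dmetric_sym b a m Qy).
by rewrite (dmetric_sym m a b Qy); field.
Qed.

Lemma christoffelE l a b y :
  christoffel i l a b y = \sum_m invmx (metric i y) l m * chr1 a b m y.
Proof.
by rewrite /christoffel mulr_sumr; apply: eq_bigr => m _; rewrite /chr1; ring.
Qed.

Lemma christoffel_sym l a b y : Q y -> christoffel i l a b y = christoffel i l b a y.
Proof.
move=> Qy; rewrite !christoffelE; apply: eq_bigr => m _; congr (_ * _).
by rewrite /chr1 (dmetric_sym m a b Qy); ring.
Qed.

Lemma metric_christoffel a b k y : Q y ->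
  \sum_l metric i y k l * christoffel i l a b y = chr1 a b k y.
Proof.
move=> Qy; have u : metric i y \in unitmx by apply: metric_unit; exact: (lb_sub lb).
under eq_bigr => l _ do rewrite christoffelE mulr_sumr.
rewrite exchange_big /=.
transitivity (\sum_m (metric i y *m invmx (metric i y)) k m * chr1 a b m y).
  apply: eq_bigr => m _; rewrite mxE mulr_suml; apply: eq_bigr => l _.
  by rewrite mulrA.
rewrite (mulmxV u) (bigD1 k) //= big1 => [|m mk]; rewrite mxE.
  by rewrite eqxx mul1r addr0.
by rewrite eq_sym (negPf mk) mul0r.
Qed.

(** This is [metric_christoffel] differentiated: lowering the index first avoids derivatives of the
    inverse metric. *)
Lemma metric_dchristoffel e a b k y : Q y ->
  \sum_l metric i y k l * dchristoffel i e l a b y =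
  dchr1 e a b k y - \sum_l dmetric i e k l y * christoffel i l a b y.
Proof.
move=> Qy.
have h1 := qd_sum (index_enum 'I_d.+1) (fun l =>
  qd_mul (lb_small lb) (lb_metric lb k l) (lb_christoffel lb l a b)).
have h2 : QD vdisp Q (fun y => \sum_l metric i y k l * christoffel i l a b y)
    (fun e => dchr1 e a b k).
  by apply: qd_ext (chr1_qd a b k) => // x Qx; rewrite metric_christoffel.
have := qd_unique e h1 h2 Qy; rewrite /= => <-.
by rewrite big_split /= addrAC subrr add0r.
Qed.

Definition riemann_low a b c k y : R := \sum_l metric i y k l * riemann i l a b c y.

(** By [chr1_add] the derivatives of the metric coming from [metric_dchristoffel] split in two; one
    half cancels the quadratic terms of the curvature, the other half gives the two sums that
    remain. *)
Lemma riemann_lowE a b c k y : Q y ->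
  riemann_low a b c k y = dchr1 a b c k y - dchr1 b a c k y
   - \sum_m christoffel i m b c y * chr1 a k m y
   + \sum_m christoffel i m a c y * chr1 b k m y.
Proof.
move=> Qy; rewrite /riemann_low.
transitivity (\sum_l metric i y k l * dchristoffel i a l b c y
  - \sum_l metric i y k l * dchristoffel i b l a c y
  + \sum_m (christoffel i m b c y * chr1 a m k y
           - christoffel i m a c y * chr1 b m k y)).
  have -> : \sum_m (christoffel i m b c y * chr1 a m k y
           - christoffel i m a c y * chr1 b m k y) =
    \sum_l metric i y k l * \sum_m (christoffel i m b c y * christoffel i l a m y
                     - christoffel i m a c y * christoffel i l b m y).
    under [RHS]eq_bigr => l _ do rewrite mulr_sumr.
    rewrite exchange_big /=; apply: eq_bigr => m _.
    rewrite -!metric_christoffel // !mulr_sumr -sumrB; apply: eq_bigr => l _.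
    by ring.
  rewrite -sumrB -big_split /=; apply: eq_bigr => l _.
  by rewrite riemannE mulrDr mulrBr.
rewrite [X in X - _ + _](metric_dchristoffel a b c k Qy).
rewrite [X in _ - X + _](metric_dchristoffel b a c k Qy) [X in _ + X]sumrB.
have e1 e x w : \sum_l dmetric i e k l y * christoffel i l x w y =
    \sum_m christoffel i m x w y * chr1 e k m y +
    \sum_m christoffel i m x w y * chr1 e m k y.
  rewrite -big_split; apply: eq_bigr => m _ /=.
  by rewrite -(chr1_add e k m Qy); ring.
have cancel (p q X Y Z W U S : R) : X = U + Z -> Y = S + W ->
    p - X - (q - Y) + (Z - W) = p - q - U + S by lra.
by apply: cancel; exact: e1.
Qed.

Lemma christoffel_chr1_sym a b e k y : Q y ->
  \sum_m christoffel i m a b y * chr1 e k m y =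
  \sum_m christoffel i m e k y * chr1 a b m y.
Proof.
move=> Qy; under eq_bigr => m _ do rewrite -metric_christoffel // mulr_sumr.
rewrite exchange_big /=; apply: eq_bigr => l _.
rewrite -metric_christoffel // mulr_sumr; apply: eq_bigr => m _.
by rewrite (metric_symE l m (lb_sub lb Qy)); ring.
Qed.

Lemma riemann_low_asym12 a b c k y : riemann_low a b c k y = - riemann_low b a c k y.
Proof.
rewrite /riemann_low -sumrN; apply: eq_bigr => l _; rewrite !riemannE -mulrN.
congr (_ * _); rewrite opprD opprB -sumrN; congr (_ + _).
by apply: eq_bigr => m _; rewrite opprB.
Qed.

Lemma riemann_low_asym34 a b c k y : Q y ->
  riemann_low a b c k y = - riemann_low a b k c y.
Proof.
move=> Qy; rewrite !riemann_lowE // (christoffel_chr1_sym b c a k Qy).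
rewrite (christoffel_chr1_sym a c b k Qy) /dchr1.
rewrite (ddmetric_swap b a c k Qy) (ddmetric_swap b a k c Qy).
rewrite (ddmetric_sym a b k c Qy).
rewrite (ddmetric_sym a k b c Qy) (ddmetric_sym a c b k Qy).
rewrite (ddmetric_sym b k a c Qy) (ddmetric_sym b c a k Qy).
by abstract_atoms; field.
Qed.

Lemma dchristoffel_sym e l a b y : Q y ->
  dchristoffel i e l a b y = dchristoffel i e l b a y.
Proof.
move=> Qy.
have h : QD vdisp Q (christoffel i l a b) (fun e => dchristoffel i e l b a).
  by apply: qd_ext (lb_christoffel lb l b a) => // x Qx; exact: christoffel_sym.
exact: (qd_unique e (lb_christoffel lb l a b) h Qy).
Qed.

Lemma riemann_bianchi l a b c y : Q y ->
  riemann i l a b c y + riemann i l b c a y + riemann i l c a b y = 0.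
Proof.
move=> Qy; rewrite !riemannE.
rewrite (dchristoffel_sym a l c b Qy) (dchristoffel_sym b l c a Qy).
rewrite (dchristoffel_sym c l b a Qy).
have cancel (p q s S1 S2 S3 : R) : S1 + S2 + S3 = 0 ->
    p - q + S1 + (q - s + S2) + (s - p + S3) = 0 by lra.
apply: cancel; rewrite -!big_split; apply: big1 => m _ /=.
rewrite (christoffel_sym m c b Qy) (christoffel_sym m c a Qy) (christoffel_sym m b a Qy).
by abstract_atoms; ring.
Qed.

Definition riem_form y (u v w x : vec) : R :=
  \sum_a \sum_b \sum_c \sum_k u 0 a * v 0 b * w 0 c * x 0 k * riemann_low a b c k y.

Lemma gdotE y u v : gdot i y u v = \sum_a \sum_b u 0 a * v 0 b * metric i y a b.
Proof.
rewrite /gdot mxE exchange_big; apply: eq_bigr => b _; rewrite !mxE mulr_suml.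
by apply: eq_bigr => a _; ring.
Qed.

Lemma gdot_sym y u v : chart_image i y -> gdot i y u v = gdot i y v u.
Proof.
move=> iy; rewrite !gdotE exchange_big; apply: eq_bigr => a _; apply: eq_bigr => b _.
by rewrite (metric_symE _ _ iy); ring.
Qed.

Lemma gdotDl y u v w : gdot i y (u + v) w = gdot i y u w + gdot i y v w.
Proof. by rewrite /gdot !mulmxDl mxE. Qed.

Lemma gdotDr y u v w : gdot i y u (v + w) = gdot i y u v + gdot i y u w.
Proof. by rewrite /gdot linearD mulmxDr mxE. Qed.

Lemma gdotZl y c u w : gdot i y (c *: u) w = c * gdot i y u w.
Proof. by rewrite /gdot -!scalemxAl mxE. Qed.

Lemma gdotZr y c u w : gdot i y u (c *: w) = c * gdot i y u w.
Proof. by rewrite /gdot linearZ -scalemxAr mxE. Qed.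

Lemma gdot_gt0 y u : chart_image i y -> u != 0 -> 0 < gdot i y u u.
Proof. by move=> iy u0; exact: metric_pos. Qed.

Lemma curvature_op_riem y u v w x : chart_image i y ->
  gdot i y (curvature_op i y u v w) x = riem_form y u v w x.
Proof.
move=> iy; rewrite gdotE /riem_form /riemann_low /curvature_op.
under eq_bigr => l _ do under eq_bigr => k _ do rewrite mxE.
transitivity (\sum_l \sum_k \sum_a \sum_b \sum_c
     u 0 a * v 0 b * w 0 c * x 0 k * (metric i y k l * riemann i l a b c y)).
  apply: eq_bigr => l _; apply: eq_bigr => k _; rewrite -mulrA mulr_suml.
  apply: eq_bigr => a _; rewrite mulr_suml; apply: eq_bigr => b _.
  rewrite mulr_suml; apply: eq_bigr => c _.
  by rewrite (metric_symE l k iy); abstract_atoms; ring.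
rewrite [LHS]exchange_big3; apply: eq_bigr => a _.
rewrite [LHS]exchange_big3; apply: eq_bigr => b _.
rewrite [LHS]exchange_big3; apply: eq_bigr => c _.
by rewrite [LHS]exchange_big; apply: eq_bigr => k _; rewrite mulr_sumr.
Qed.

Lemma row_free_indep (u v : vec) :
  ~~ row_free (col_mx u v) -> (exists c, u = c *: v) \/ (exists c, v = c *: u).
Proof.
rewrite -kermx_eq0 => /rowV0Pn[w /sub_kermxP wK w0].
move: wK; rewrite -[w]hsubmxK mul_row_col.
rewrite [lsubmx w]mx11_scalar [rsubmx w]mx11_scalar !mul_scalar_mx.
set a := lsubmx w 0 0; set b := rsubmx w 0 0 => E.
have [a0|a0] := eqVneq a 0; last first.
  left; exists (- (a^-1 * b)); apply: (scalerI a0).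
  rewrite scalerA mulrN mulrA mulfV // mul1r scaleNr.
  by apply/eqP; rewrite -addr_eq0 E.
have [b0|b0] := eqVneq b 0; last first.
  right; exists 0; apply: (scalerI b0); rewrite scale0r scaler0.
  by move: E; rewrite a0 scale0r add0r.
case/eqP: w0; rewrite -[w]hsubmxK [lsubmx w]mx11_scalar [rsubmx w]mx11_scalar.
by rewrite -/a -/b a0 b0 !raddf0 row_mx0.
Qed.

(** The vector [w], a multiple of the component of [u] orthogonal to [v], has square norm <v, v>
    times the Gram determinant. *)
Lemma gram_neq0 y (u v : vec) : chart_image i y -> row_free (col_mx u v) ->
  gdot i y u u * gdot i y v v - gdot i y u v ^+ 2 != 0.
Proof.
move=> iy fr.
have v0 : v != 0.
  apply: contraTneq fr => ->; rewrite -kermx_eq0; apply/rowV0Pn.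
  exists (row_mx 0 1%:M).
    by apply/sub_kermxP; rewrite mul_row_col mul0mx mul1mx add0r.
  apply/eqP => /(congr1 rsubmx); rewrite row_mxKr linear0 => /matrixP/(_ 0 0).
  by rewrite !mxE eqxx => /eqP; rewrite oner_eq0.
set w := gdot i y v v *: u - gdot i y u v *: v.
have vv := gdot_gt0 iy v0.
have w0 : w != 0.
  apply: contraTneq fr => w0; rewrite -kermx_eq0; apply/rowV0Pn.
  exists (row_mx (gdot i y v v)%:M (- gdot i y u v)%:M).
    by apply/sub_kermxP; rewrite mul_row_col !mul_scalar_mx scaleNr.
  apply/eqP => /(congr1 lsubmx); rewrite row_mxKl linear0 => /matrixP/(_ 0 0).
  by rewrite !mxE eqxx mulr1n => /eqP; rewrite gt_eqF.
have := gdot_gt0 iy w0.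
have -> : gdot i y w w =
    gdot i y v v * (gdot i y u u * gdot i y v v - gdot i y u v ^+ 2).
  rewrite /w -scaleNr !(gdotDl, gdotDr, gdotZl, gdotZr) (gdot_sym v u iy).
  by move: (gdot i y u u) (gdot i y u v) (gdot i y v v) => p q s; ring.
by rewrite pmulr_rgt0 // => /gt_eqF ->.
Qed.

Lemma riem_formDl y u1 u2 v w x :
  riem_form y (u1 + u2) v w x = riem_form y u1 v w x + riem_form y u2 v w x.
Proof.
rewrite /riem_form -big_split; apply: eq_bigr => a _ /=.
rewrite -big_split; apply: eq_bigr => b _ /=; rewrite -big_split.
apply: eq_bigr => c _ /=; rewrite -big_split; apply: eq_bigr => k _ /=.
by rewrite mxE !mulrDl.
Qed.

Lemma riem_formD2 y u v1 v2 w x :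
  riem_form y u (v1 + v2) w x = riem_form y u v1 w x + riem_form y u v2 w x.
Proof.
rewrite /riem_form -big_split; apply: eq_bigr => a _ /=.
rewrite -big_split; apply: eq_bigr => b _ /=; rewrite -big_split.
apply: eq_bigr => c _ /=; rewrite -big_split; apply: eq_bigr => k _ /=.
by rewrite mxE !(mulrDl, mulrDr).
Qed.

Lemma riem_formD3 y u v w1 w2 x :
  riem_form y u v (w1 + w2) x = riem_form y u v w1 x + riem_form y u v w2 x.
Proof.
rewrite /riem_form -big_split; apply: eq_bigr => a _ /=.
rewrite -big_split; apply: eq_bigr => b _ /=; rewrite -big_split.
apply: eq_bigr => c _ /=; rewrite -big_split; apply: eq_bigr => k _ /=.
by rewrite mxE !(mulrDl, mulrDr).
Qed.

Lemma riem_formD4 y u v w x1 x2 :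
  riem_form y u v w (x1 + x2) = riem_form y u v w x1 + riem_form y u v w x2.
Proof.
rewrite /riem_form -big_split; apply: eq_bigr => a _ /=.
rewrite -big_split; apply: eq_bigr => b _ /=; rewrite -big_split.
apply: eq_bigr => c _ /=; rewrite -big_split; apply: eq_bigr => k _ /=.
by rewrite mxE !(mulrDl, mulrDr).
Qed.

Lemma riem_form_asym12 y u v w x : riem_form y u v w x = - riem_form y v u w x.
Proof.
rewrite /riem_form [in RHS]exchange_big -sumrN; apply: eq_bigr => a _.
rewrite -sumrN; apply: eq_bigr => b _; rewrite -sumrN; apply: eq_bigr => c _.
rewrite -sumrN; apply: eq_bigr => k _; rewrite riemann_low_asym12.
by move: (riemann_low _ _ _ _ _) => p; ring.
Qed.

Lemma riem_form_asym34 y u v w x : Q y -> riem_form y u v w x = - riem_form y u v x w.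
Proof.
move=> Qy; rewrite /riem_form -sumrN; apply: eq_bigr => a _.
rewrite -sumrN; apply: eq_bigr => b _; rewrite exchange_big -sumrN.
apply: eq_bigr => c _; rewrite -sumrN; apply: eq_bigr => k _.
by rewrite riemann_low_asym34 //; move: (riemann_low _ _ _ _ _) => p; ring.
Qed.

Lemma riem_form_bianchi y u v w x : Q y ->
  riem_form y u v w x + riem_form y v w u x + riem_form y w u v x = 0.
Proof.
move=> Qy.
have -> : riem_form y v w u x = \sum_a \sum_b \sum_c \sum_k
    u 0 a * v 0 b * w 0 c * x 0 k * riemann_low b c a k y.
  rewrite /riem_form exchange_big3; apply: eq_bigr => a _.
  apply: eq_bigr => b _; apply: eq_bigr => c _; apply: eq_bigr => k _.
  by move: (riemann_low _ _ _ _ _) => p; ring.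
have -> : riem_form y w u v x = \sum_a \sum_b \sum_c \sum_k
    u 0 a * v 0 b * w 0 c * x 0 k * riemann_low c a b k y.
  rewrite /riem_form -exchange_big3; apply: eq_bigr => a _.
  apply: eq_bigr => b _; apply: eq_bigr => c _; apply: eq_bigr => k _.
  by move: (riemann_low _ _ _ _ _) => p; ring.
rewrite -!big_split /=; apply: big1 => a _; rewrite -!big_split /=.
apply: big1 => b _; rewrite -!big_split /=; apply: big1 => c _.
rewrite -!big_split /=; apply: big1 => k _; rewrite -!mulrDr.
rewrite /riemann_low -!big_split /=.
under eq_bigr => l _ do rewrite -!mulrDr riemann_bianchi // mulr0.
by rewrite big1 // mulr0.
Qed.

(** The difference [T] with the tensor of constant curvature has the symmetries asked by
    [curvature_form_eq0]. On (u, v, v, u) it vanishes by the value of the sectional curvature if [u]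
    and [v] are independent, and by antisymmetry if they are not, the only case in dimension 1. *)
Lemma constant_curvature_riem_form kappa y u v w x : Q y ->
  constant_curvature M kappa ->
  riem_form y u v w x =
  kappa * (gdot i y u x * gdot i y v w - gdot i y v x * gdot i y u w).
Proof.
move=> Qy curv; have iy := lb_sub lb Qy.
pose T u v w x := riem_form y u v w x -
  kappa * (gdot i y u x * gdot i y v w - gdot i y v x * gdot i y u w).
suff : T u v w x = 0 by move=> /eqP; rewrite subr_eq0 => /eqP.
apply: curvature_form_eq0 => {u v w x}; rewrite /T.
- by move=> a b c e f; rewrite riem_formDl !gdotDl; abstract_atoms; ring.
- by move=> a b c e f; rewrite riem_formD2 !gdotDl; abstract_atoms; ring.
- by move=> a b c e f; rewrite riem_formD3 !gdotDr; abstract_atoms; ring.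
- by move=> a b c e f; rewrite riem_formD4 !gdotDr; abstract_atoms; ring.
- by move=> a b c e; rewrite (riem_form_asym12 y a b); ring.
- by move=> a b c e; rewrite (riem_form_asym34 a b c e Qy); ring.
- move=> a b c e; have := riem_form_bianchi a b c e Qy.
  rewrite (gdot_sym c a iy) (gdot_sym b a iy) (gdot_sym c b iy) => H.
  rewrite -[RHS]H; move: (riem_form _ _ _ _ _) (riem_form _ _ _ _ _) => p q.
  by ring.
- move=> u v; have [fr|/row_free_indep dep] := boolP (row_free (col_mx u v)).
    have := curv i y u v iy fr; rewrite /sectional curvature_op_riem // => <-.
    rewrite (gdot_sym v u iy) -expr2 divfK ?subrr //.
    exact: gram_neq0.
  have rZl c u' v' : riem_form y (c *: v') v' u' u' = 0.
    suff : riem_form y (c *: v') v' u' u' = - riem_form y (c *: v') v' u' u' by lra.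
    exact: riem_form_asym34.
  have asym v' c : riem_form y (c *: v') v' v' (c *: v') = 0.
    have : riem_form y (c *: v') v' v' (c *: v') =
       c * riem_form y v' v' v' (c *: v').
      rewrite /riem_form mulr_sumr; do 3 (apply: eq_bigr => ? _; rewrite mulr_sumr).
      by apply: eq_bigr => ? _; rewrite mxE; move: (riemann_low _ _ _ _ _) => p; ring.
    by have := riem_form_asym12 y v' v' v' (c *: v'); nra.
  case: dep => -[c ->].
    by rewrite asym // !(gdotZl, gdotZr) ; ring.
  have -> : riem_form y u (c *: u) (c *: u) u = 0.
    rewrite riem_form_asym12 riem_form_asym34 // opprK.
    exact: asym.
  by rewrite !(gdotZl, gdotZr); ring.
Qed.

Lemma constant_curvature_riemann kappa l a b c y : Q y ->
  constant_curvature M kappa ->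
  riemann i l a b c y =
  kappa * ((l == a)%:R * metric i y b c - (l == b)%:R * metric i y a c).
Proof.
move=> Qy curv; have iy := lb_sub lb Qy.
have formE a' b' c' k : riem_form y (delta_mx 0 a') (delta_mx 0 b')
    (delta_mx 0 c') (delta_mx 0 k) = riemann_low a' b' c' k y.
  have pick (f : 'I_d.+1 -> R) (p : 'I_d.+1) :
      \sum_q (delta_mx 0 p : vec) 0 q * f q = f p.
    rewrite (bigD1 p) //= big1 => [|q qp]; rewrite !mxE /= ?eqxx ?mul1r ?addr0 //.
    by rewrite (negPf qp) mul0r.
  rewrite /riem_form -[RHS](pick (fun a => riemann_low a b' c' k y)).
  apply: eq_bigr => p _; rewrite -[in RHS](pick (fun b => riemann_low p b c' k y)).
  rewrite mulr_sumr; apply: eq_bigr => q _.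
  rewrite -[in RHS](pick (fun c => riemann_low p q c k y)) !mulr_sumr.
  apply: eq_bigr => s _; rewrite -[in RHS](pick (fun k => riemann_low p q s k y)).
  rewrite !mulr_sumr; apply: eq_bigr => t _; rewrite !mulrA.
  by [].
have gE a' b' : gdot i y (delta_mx 0 a') (delta_mx 0 b') = metric i y a' b'.
  by rewrite /gdot trmx_delta -rowE -colE !mxE.
have low k : riemann_low a b c k y =
    kappa * (metric i y a k * metric i y b c - metric i y b k * metric i y a c).
  by rewrite -formE (constant_curvature_riem_form _ _ _ _ Qy curv) !gE.
have inv_low : riemann i l a b c y = \sum_k invmx (metric i y) l k * riemann_low a b c k y.
  rewrite /riemann_low; under eq_bigr => k _ do rewrite mulr_sumr.
  rewrite exchange_big /=.
  transitivity (\sum_m (invmx (metric i y) *m metric i y) l m * riemann i m a b c y).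
    rewrite (mulVmx (metric_unit iy)) (bigD1 l) //= big1 => [|m ml]; rewrite mxE.
      by rewrite eqxx mul1r addr0.
    by rewrite eq_sym (negPf ml) mul0r.
  apply: eq_bigr => m _; rewrite mxE mulr_suml; apply: eq_bigr => k _.
  by rewrite mulrA.
have invg p : \sum_k invmx (metric i y) l k * metric i y p k = (l == p)%:R.
  have := mulVmx (metric_unit iy) => /matrixP /(_ l p); rewrite !mxE => <-.
  by apply: eq_bigr => k _; rewrite (metric_symE p k iy).
rewrite inv_low -!invg !mulr_suml -sumrB mulr_sumr; apply: eq_bigr => k _.
by rewrite low; ring.
Qed.

End flatness.

(** * Parallel frames of flat connections *)

Section generalized_limits.
Context {R : realType}.

Definition bdd_seq (u : nat -> R) := exists B : R, forall m, `|u m| <= B.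

(* A limit along an ultrafilter is defined on all bounded sequences, which spares
   a proof that the Euler products converge. *)
Record generalized_limit (L : (nat -> R) -> R) : Prop := {
  glimD : forall u v, bdd_seq u -> bdd_seq v ->
    L (fun m => u m + v m) = L u + L v;
  glimZ : forall c u, bdd_seq u -> L (fun m => c * u m) = c * L u;
  glim_cst : forall c, L (fun=> c) = c;
  glim_le : forall u (C K : R), (forall m, `|u m| <= C + K / m.+1%:R) -> `|L u| <= C
}.

(** Bounded sequences converge along an ultrafilter because segments are compact; as it refines
    [\oo], errors of order 1/m disappear in [glim_le]. *)
Lemma generalized_limit_exists : exists L, generalized_limit L.
Proof.
have [G [GU sG]] := @ultraFilterLemma nat \oo _.
have PG : ProperFilter G by exact: ultra_proper.
pose L (u : nat -> R) : R := lim (u @ G).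
have cv u : bdd_seq u -> u @ G --> L u.
  move=> [B hB].
  have := @segment_compact R (- B) B; rewrite compact_ultra => /(_ (u @ G)).
  have UG : UltraFilter (u @ G).
    split; first exact: fmap_proper_filter.
    move=> H HP sH; rewrite eqEsubset; split => // A HA.
    have [//|GA] := in_ultra_setVsetC (u @^-1` A) GU.
    have : H (~` A) by apply: sH.
    by move=> /(filterI HA); rewrite setICr => /filter_ex[].
  move=> /(_ UG) H; have [|x [_ /= hx]] := H.
    change (G (u @^-1` [set` `[- B, B]])).
    by apply: filterE => m /=; rewrite in_itv /=; have := hB m; rewrite ler_norml.
  by rewrite /L; apply/cvg_ex; exists x.
exists L; split.
- move=> u v bu bv; apply: cvg_lim => //; exact: (cvgD (cv _ bu) (cv _ bv)).
- move=> c u bu; apply: cvg_lim => //; exact: (cvgM (cvg_cst c) (cv _ bu)).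
- by move=> c; apply: cvg_lim => //; exact: cvg_cst.
- move=> u C K hu.
  have bu : bdd_seq u.
    exists (C + `|K|) => m; apply: le_trans (hu m) _; rewrite lerD2l.
    apply: le_trans (ler_norm _) _; rewrite normrM ler_piMr // ger0_norm ?invr_ge0 //.
    by rewrite invf_le1 ?ltr0n // ler1n.
  have h1 : (fun m => `|u m|) @ G --> `|L u| by apply: cvg_norm; exact: cv.
  have h2 : (fun m => C + K * m.+1%:R^-1) @ G --> C + K * 0.
    apply: cvgD; first exact: cvg_cst.
    apply: cvgM; first exact: cvg_cst.
    apply: (@cvg_trans _ (harmonic @ \oo)); last exact: cvg_harmonic.
    by move=> A hA; apply: sG.
  rewrite mulr0 addr0 in h2.
  apply: (ler_cvg_to h1 h2); exact: filterE.
Qed.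

Definition mxlim (L : (nat -> R) -> R) {m k} (U : nat -> 'M[R]_(m, k)) : 'M[R]_(m, k) :=
  \matrix_(i, j) L (fun p => U p i j).

Definition bdd_mx {m k} (U : nat -> 'M[R]_(m, k)) := exists B : R, forall p, nrm (U p) <= B.

Section matrix_limits.
Context (L : (nat -> R) -> R) (hL : generalized_limit L).

Lemma bdd_entry m k (U : nat -> 'M[R]_(m, k)) i j :
  bdd_mx U -> bdd_seq (fun p => U p i j).
Proof. by move=> [B h]; exists B => p; exact: le_trans (entry_le _ i j) (h p). Qed.

Lemma mxlimD m k (U V : nat -> 'M[R]_(m, k)) : bdd_mx U -> bdd_mx V ->
  mxlim L (fun p => U p + V p) = mxlim L U + mxlim L V.
Proof.
move=> bU bV; apply/matrixP => i j; rewrite !mxE -(glimD hL); [|exact: bdd_entry..].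
by congr L; apply: funext => p; rewrite mxE.
Qed.

Lemma mxlimN m k (U : nat -> 'M[R]_(m, k)) : bdd_mx U ->
  mxlim L (fun p => - U p) = - mxlim L U.
Proof.
move=> bU; apply/matrixP => i j; rewrite !mxE -mulN1r -(glimZ hL); last exact: bdd_entry.
by congr L; apply: funext => p; rewrite mxE mulN1r.
Qed.

Lemma mxlim_cst m k (A : 'M[R]_(m, k)) : mxlim L (fun=> A) = A.
Proof. by apply/matrixP => i j; rewrite !mxE (glim_cst hL). Qed.

Lemma mxlimM m k q (U : nat -> 'M[R]_(m, k)) (A : 'M[R]_(k, q)) : bdd_mx U ->
  mxlim L (fun p => U p *m A) = mxlim L U *m A.
Proof.
move=> bU; apply/matrixP => i j; rewrite !mxE.
transitivity (L (fun p => \sum_l U p i l * A l j)).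
  by congr L; apply: funext => p; rewrite mxE.
have bs (s : seq 'I_k) : bdd_seq (fun p => \sum_(l <- s) U p i l * A l j).
  elim: s => [|l s [B hB]]; first by exists 0 => p; rewrite big_nil normr0.
  have [B' hB'] := bdd_entry i l bU.
  exists (B' * `|A l j| + B) => p; rewrite big_cons.
  apply: le_trans (ler_normD _ _) _; apply: lerD => //.
  by rewrite normrM ler_wpM2r.
have H (s : seq 'I_k) : L (fun p => \sum_(l <- s) U p i l * A l j) =
    \sum_(l <- s) mxlim L U i l * A l j; last exact: H.
elim: s => [|l s ih].
  by rewrite big_nil; under eq_fun do rewrite big_nil; exact: glim_cst.
under eq_fun do rewrite big_cons.
rewrite big_cons (glimD hL) //; last first.
  have [B' hB'] := bdd_entry i l bU; exists (B' * `|A l j|) => p.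
  by rewrite normrM ler_wpM2r.
rewrite ih; congr (_ + _); rewrite mxE mulrC -(glimZ hL); last exact: bdd_entry.
by congr L; apply: funext => p; rewrite mulrC.
Qed.

Lemma mxlim_le m k (U : nat -> 'M[R]_(m, k)) (C K : R) :
  (forall p, nrm (U p) <= C + K / p.+1%:R) -> nrm (mxlim L U) <= (m * k)%:R * C.
Proof.
move=> h; apply: nrm_le_entries => i j; rewrite mxE; apply: (glim_le hL (K := K)) => p.
exact: le_trans (entry_le _ i j) (h p).
Qed.

End matrix_limits.
End generalized_limits.

(** * Euler products and their error recursion *)

Section euler_products.
Context {R : realType}.

(** The Euler scheme of step [h] for the equation P' = P B. *)
Fixpoint euler {N : nat} (h : R) (B : nat -> 'M[R]_N) (j : nat) : 'M[R]_N :=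
  if j is j'.+1 then euler h B j' + h *: (euler h B j' *m B j') else 1%:M.

Lemma euler_near1 N h (B : nat -> 'M[R]_N) (eps : R) m : 0 <= h -> h * m%:R <= 1 ->
  0 <= eps -> eps <= 2^-1 -> (forall j, (j < m)%N -> nrm (B j) <= eps) ->
  forall j, (j <= m)%N -> nrm (euler h B j - 1%:M) <= 2 * (j%:R * h * eps).
Proof.
move=> h0 hm e0 e1 hB; elim => [|j ih] jm; first by rewrite subrr nrm0 !mul0r mulr0.
have jh : j%:R * h <= 1.
  by apply: le_trans hm; rewrite mulrC ler_wpM2l // ler_nat ltnW.
have -> : euler h B j.+1 - 1%:M = (euler h B j - 1%:M) +
    h *: ((euler h B j - 1%:M) *m B j) + h *: B j.
  rewrite /= mulmxBl mul1mx scalerBr; set X := euler _ _ _; set Y := h *: (X *m _).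
  by rewrite -[RHS]addrA subrK addrAC.
have {}ih := ih (ltnW jm); have Bj := hB j jm.
set E := _ - 1%:M in ih *.
apply: le_trans (nrmD _ _) _; rewrite nrmZ ger0_norm //.
apply: le_trans (lerD (nrmD _ _) (lexx _)) _; rewrite nrmZ ger0_norm //.
have H1 : h * nrm (E *m B j) <= h * (2 * (j%:R * h * eps) * eps).
  apply: ler_wpM2l => //; apply: le_trans (nrmM _ _) _; exact: ler_pM.
have H2 : h * nrm (B j) <= h * eps by exact: ler_wpM2l.
have jh0 : 0 <= j%:R * h by rewrite mulr_ge0.
have H3 : 2 * (j%:R * h * eps) * eps <= eps.
  have : (j%:R * h) * (eps * eps) <= 1 * (eps * 2^-1).
    by apply: ler_pM; rewrite ?mulr_ge0 // ler_wpM2l.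
  by lra.
have H4 : h * (2 * (j%:R * h * eps) * eps) <= h * eps by exact: ler_wpM2l.
rewrite -[j.+1%:R]natr1; lra.
Qed.

(** Over a total time at most 1 the growth factor [1 + h / 2] costs no more than the constant 2: the
    extra term in the induction is [(j%:R * h) * (h * b)], at most [h * b]. *)
Lemma discrete_gronwall (r : nat -> R) (h b : R) m : 0 <= h -> h * m%:R <= 1 -> 0 <= b ->
  r 0%N <= 0 ->
  (forall j, (j < m)%N -> r j.+1 <= r j * (1 + h / 2) + h * b) ->
  forall j, (j <= m)%N -> r j <= 2 * (j%:R * h * b).
Proof.
move=> h0 hm b0 r0 rS; elim => [|j ih] jm; first by rewrite !mul0r mulr0.
have jh : j%:R * h <= 1.
  by apply: le_trans hm; rewrite mulrC ler_wpM2l // ler_nat ltnW.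
apply: le_trans (rS j jm) _; have {}ih := ih (ltnW jm).
have H1 : r j * (1 + h / 2) <= 2 * (j%:R * h * b) * (1 + h / 2).
  by apply: ler_wpM2r => //; lra.
have H2 : (j%:R * h) * (h * b) <= 1 * (h * b) by apply: ler_wpM2r; rewrite ?mulr_ge0.
rewrite -[j.+1%:R]natr1; lra.
Qed.

(* One step of the error recursion; flatness [db + a b = da + b a] cancels the
   first order terms. *)
Lemma euler_step_identity N (P P' a b a' b' da db e1 ee : 'M[R]_N) (t h : R) :
  db + a *m b = da + b *m a ->
  b' = b + h *: db + e1 -> a' = a + t *: da + b + ee ->
  P' + h *: (P' *m a') - (P + h *: (P *m a)) - (t + h) *: ((P + h *: (P *m a)) *m b') =
  (P' - P - t *: (P *m b)) + h *: ((P' - P - t *: (P *m b)) *m a') +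
  (h *: (P *m ee + t ^+ 2 *: (P *m b *m da) + t *: (P *m b *m b)
         + t *: (P *m b *m ee)
         - h *: (P *m db) - (t * h) *: (P *m a *m db) - h *: (P *m a *m b'))
   - (t + h) *: (P *m e1) - (t * h) *: (P *m a *m e1)).
Proof.
move=> flat -> ->.
have {flat}F : P *m db = P *m da + P *m b *m a - P *m a *m b.
  apply/eqP; rewrite eq_sym subr_eq eq_sym -!mulmxA -!mulmxDr.
  by rewrite flat.
rewrite !(mulmxDl, mulmxDr, mulmxBl, mulmxBr, mulmxN, mulNmx) -?scalemxAl -?scalemxAr.
rewrite ?mulmxA F.
move: (P' *m a) (P' *m da) (P' *m b) (P' *m ee) => p1 p2 p3 p4.
move: (P *m a *m db) (P *m a *m b) (P *m a *m e1) => p5 p6 p7.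
move: (P *m b *m a) (P *m b *m da) (P *m b *m b) (P *m b *m ee) => p8 p9 p10 p11.
move: (P *m a) (P *m b) (P *m da) (P *m ee) (P *m e1) => q1 q2 q3 q4 q5.
by apply/matrixP => i j; rewrite !mxE; ring.
Qed.

End euler_products.

Section norm_bounds.
Context {R : realType}.

Lemma nrmD_le m k (X Y : 'M[R]_(m, k)) x y :
  nrm X <= x -> nrm Y <= y -> nrm (X + Y) <= x + y.
Proof. by move=> hx hy; apply: le_trans (nrmD _ _) _; exact: lerD. Qed.

Lemma nrmB_le m k (X Y : 'M[R]_(m, k)) x y :
  nrm X <= x -> nrm Y <= y -> nrm (X - Y) <= x + y.
Proof. by move=> hx hy; apply: le_trans (nrmB _ _) _; exact: lerD. Qed.

Lemma nrmM_le m k p (X : 'M[R]_(m, k)) (Y : 'M[R]_(k, p)) x y :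
  nrm X <= x -> nrm Y <= y -> nrm (X *m Y) <= x * y.
Proof. by move=> hx hy; apply: le_trans (nrmM _ _) _; exact: ler_pM. Qed.

Lemma nrmZ_le m k (X : 'M[R]_(m, k)) t x :
  0 <= t -> nrm X <= x -> nrm (t *: X) <= t * x.
Proof. by move=> t0 hx; rewrite nrmZ ger0_norm // ler_wpM2l. Qed.

Lemma nrmZ_le1 m k (X : 'M[R]_(m, k)) t x :
  0 <= t -> t <= 1 -> nrm X <= x -> nrm (t *: X) <= x.
Proof.
move=> t0 t1 hx; apply: le_trans (nrmZ_le t0 hx) _.
by rewrite ler_piMl // (le_trans _ hx).
Qed.

Lemma euler_step_bound N (P a b b' da db e1 ee : 'M[R]_N) (t h s B c : R) :
  0 <= t -> t <= 1 -> 0 <= h -> h <= 1 -> 0 <= s -> s <= 1 -> 1 <= c ->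
  nrm P <= B -> nrm a <= c -> nrm b <= c * s -> nrm da <= c * s -> nrm db <= c ->
  nrm b' <= c -> nrm e1 <= c * h ^+ 2 -> nrm ee <= 2 * (c * s ^+ 2) ->
  nrm (h *: (P *m ee + t ^+ 2 *: (P *m b *m da) + t *: (P *m b *m b)
         + t *: (P *m b *m ee)
         - h *: (P *m db) - (t * h) *: (P *m a *m db) - h *: (P *m a *m b'))
   - (t + h) *: (P *m e1) - (t * h) *: (P *m a *m e1))
  <= h * (6 * (B * c ^+ 2) * (s ^+ 2 + h)).
Proof.
move=> t0 t1 h0 h1 s0 s1 c1 nP na nb nda ndb nb' ne1 nee.
have B0 : 0 <= B by apply: le_trans nP.
have c0 : 0 <= c by lra.
have cc : c <= c ^+ 2 by rewrite expr2; nra.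
set M := B * c ^+ 2.
have BcM : B * c <= M by rewrite /M ler_wpM2l.
have M0 : 0 <= M by rewrite mulr_ge0 // sqr_ge0.
have s20 : 0 <= s ^+ 2 by exact: sqr_ge0.
have s2s : s ^+ 2 <= 1 by rewrite expr2; nra.
have t20 : 0 <= t ^+ 2 by exact: sqr_ge0.
have t21 : t ^+ 2 <= 1 by rewrite expr2; nra.
have th0 : 0 <= t * h by rewrite mulr_ge0.
have th1 : t * h <= 1 by nra.
have nPb : nrm (P *m b) <= B * (c * s) by exact: nrmM_le.
have nPa : nrm (P *m a) <= B * c by exact: nrmM_le.
have h20 : 0 <= h ^+ 2 by exact: sqr_ge0.
have Ms : 0 <= M * s ^+ 2 by rewrite mulr_ge0.
have Mh : 0 <= M * h by rewrite mulr_ge0.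
have E1 : nrm (P *m ee) <= 2 * (M * s ^+ 2).
  apply: le_trans (nrmM_le nP nee) _.
  have : (B * c) * s ^+ 2 <= M * s ^+ 2 by rewrite ler_wpM2r.
  by lra.
have E2 : nrm (t ^+ 2 *: (P *m b *m da)) <= M * s ^+ 2.
  apply: nrmZ_le1 => //; apply: le_trans (nrmM_le nPb nda) _.
  by rewrite /M le_eqVlt; apply/orP; left; apply/eqP; ring.
have E3 : nrm (t *: (P *m b *m b)) <= M * s ^+ 2.
  apply: nrmZ_le1 => //; apply: le_trans (nrmM_le nPb nb) _.
  by rewrite /M le_eqVlt; apply/orP; left; apply/eqP; ring.
have E4 : nrm (t *: (P *m b *m ee)) <= 2 * (M * s ^+ 2).
  apply: nrmZ_le1 => //; apply: le_trans (nrmM_le nPb nee) _.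
  have : s * (M * s ^+ 2) <= 1 * (M * s ^+ 2) by rewrite ler_wpM2r.
  by rewrite /M; lra.
have E5 : nrm (h *: (P *m db)) <= M * h.
  apply: le_trans (nrmZ_le h0 (nrmM_le nP ndb)) _.
  by rewrite mulrC ler_wpM2r.
have E6 : nrm ((t * h) *: (P *m a *m db)) <= M * h.
  rewrite -scalerA; apply: nrmZ_le1 => //; apply: le_trans (nrmZ_le h0 (nrmM_le nPa ndb)) _.
  by rewrite /M le_eqVlt; apply/orP; left; apply/eqP; ring.
have E7 : nrm (h *: (P *m a *m b')) <= M * h.
  apply: le_trans (nrmZ_le h0 (nrmM_le nPa nb')) _.
  by rewrite /M le_eqVlt; apply/orP; left; apply/eqP; ring.
have E8 : nrm ((t + h) *: (P *m e1)) <= h * (2 * (M * h)).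
  apply: le_trans (nrmZ_le (addr_ge0 t0 h0) (nrmM_le nP ne1)) _.
  have : B * (c * h ^+ 2) <= M * h ^+ 2 by rewrite mulrA ler_wpM2r.
  have : 0 <= B * (c * h ^+ 2) by rewrite !mulr_ge0.
  have : (t + h) * (B * (c * h ^+ 2)) <= 2 * (B * (c * h ^+ 2)).
    by rewrite ler_wpM2r ?mulr_ge0 //; lra.
  by rewrite !expr2; lra.
have E9 : nrm ((t * h) *: (P *m a *m e1)) <= h * (M * h).
  apply: nrmZ_le1 => //; apply: le_trans (nrmM_le nPa ne1) _.
  by rewrite /M le_eqVlt; apply/orP; left; apply/eqP; ring.
apply: le_trans (nrmB_le (nrmB_le (nrmZ_le h0 (nrmB_le (nrmB_le (nrmB_le (nrmD_le
  (nrmD_le (nrmD_le E1 E2) E3) E4) E5) E6) E7)) E8) E9) _.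
rewrite -!mulrDr; apply: ler_wpM2l => //; lra.
Qed.

End norm_bounds.

Section local_frames.
Context {R : realType} {n N : nat}.
Local Notation V := 'rV[R]_n.
Context (Q : set V) (A : 'I_n -> V -> 'M[R]_N) (DA : 'I_n -> 'I_n -> V -> 'M[R]_N).

Definition contr (B : 'I_n -> 'M[R]_N) (w : V) : 'M[R]_N := \sum_a w 0 a *: B a.

Lemma contr_le (B : 'I_n -> 'M[R]_N) C w : (forall a, nrm (B a) <= C) ->
  nrm (contr B w) <= C * nrm w.
Proof.
move=> h; apply: le_trans (nrm_sum _ _ _) _.
have -> : nrm w = \sum_a `|w 0 a| by rewrite /nrm big_ord1.
by rewrite mulr_sumr; apply: ler_sum => a _; rewrite nrmZ mulrC ler_wpM2r.
Qed.

Lemma contrD (B : 'I_n -> 'M[R]_N) v w : contr B (v + w) = contr B v + contr B w.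
Proof.
by rewrite /contr -big_split; apply: eq_bigr => a _; rewrite mxE scalerDl.
Qed.

Lemma contrB (B B' : 'I_n -> 'M[R]_N) w :
  contr B w - contr B' w = contr (fun a => B a - B' a) w.
Proof. by rewrite /contr -sumrB; apply: eq_bigr => a _; rewrite scalerBr. Qed.

Lemma contrZ (B : 'I_n -> 'M[R]_N) c w : contr B (c *: w) = c *: contr B w.
Proof.
by rewrite /contr scaler_sumr; apply: eq_bigr => a _; rewrite mxE scalerA.
Qed.

Lemma contr0 (B : 'I_n -> 'M[R]_N) : contr B 0 = 0.
Proof. by rewrite /contr big1 // => a _; rewrite mxE scale0r. Qed.

Hypothesis smQ : small vdisp Q.
Hypothesis qdA : forall a, QDm vdisp Q (A a) (fun e => DA e a).
Hypothesis flat : forall y a b, Q y ->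
  DA a b y + A a y *m A b y = DA b a y + A b y *m A a y.

Definition AA y w := contr (fun a => A a y) w.
(** Here [v] is the direction of differentiation and [w] the argument of the connection form. *)
Definition DAA y v w := contr (fun a => contr (fun e => DA e a y) v) w.

Lemma AA_flat y v w : Q y ->
  DAA y v w + AA y v *m AA y w = DAA y w v + AA y w *m AA y v.
Proof.
move=> Qy.
have e u x : DAA y u x + AA y u *m AA y x =
    \sum_a \sum_b (u 0 a * x 0 b) *: (DA a b y + A a y *m A b y).
  rewrite [RHS]exchange_big /DAA /AA /contr mulmx_sumr -big_split.
  apply: eq_bigr => b _ /=; rewrite mulmx_suml scaler_sumr -big_split.
  apply: eq_bigr => a _ /=; rewrite scalerDr scalerA mulrC -scalemxAr -scalemxAl.
  by rewrite scalerA mulrC.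
rewrite !e exchange_big; apply: eq_bigr => a _; apply: eq_bigr => b _.
by rewrite mulrC flat.
Qed.

Lemma AA_bounds : exists2 C : R, 0 <= C &
  [/\ forall y w, Q y -> nrm (AA y w) <= C * nrm w,
      forall y v w, Q y -> nrm (DAA y v w) <= C * (nrm v * nrm w),
      forall y y' w, Q y -> Q y' -> nrm (AA y' w - AA y w) <= C * (nrm (y' - y) * nrm w) &
      forall y y' w, Q y -> Q y' ->
        nrm (AA y' w - AA y w - DAA y (y' - y) w) <= C * (nrm (y' - y) ^+ 2 * nrm w)].
Proof.
have /choice[c hc] a : exists C : R, 0 <= C /\ forall y, Q y ->
   [/\ nrm (A a y) <= C, forall e, nrm (DA e a y) <= C &
   forall y', Q y' -> nrm (A a y' - A a y - \sum_e vdisp y y' 0 e *: DA e a y)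
      <= C * nrm (vdisp y y') ^+ 2].
  by have [C] := qdm_est (qdA a); exists C.
have /choice[l hl] a : exists C : R, 0 <= C /\ forall y y', Q y -> Q y' ->
   nrm (A a y' - A a y) <= C * nrm (vdisp y y').
  by have [C] := qdm_lip smQ (qdA a); exists C.
pose C := \sum_a (c a + l a).
have cl0 a : 0 <= c a + l a by rewrite addr_ge0 //; [case: (hc a)|case: (hl a)].
have C0 : 0 <= C by apply: sumr_ge0.
have leC a : c a + l a <= C by exact: (ler_term (f := fun a => c a + l a)).
have cC a : c a <= C by apply: le_trans (leC a); rewrite lerDl; case: (hl a).
have lC a : l a <= C by apply: le_trans (leC a); rewrite lerDr; case: (hc a).
exists C => //; split.
- move=> y w Qy; apply: contr_le => a; apply: le_trans (cC a).
  by have [_ /(_ _ Qy)[]] := hc a.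
- move=> y v w Qy; rewrite mulrA; apply: contr_le => a; apply: contr_le => e.
  by apply: le_trans (cC a); have [_ /(_ _ Qy)[]] := hc a.
- move=> y y' w Qy Qy'; rewrite contrB mulrA; apply: contr_le => a.
  apply: le_trans (_ : _ <= l a * nrm (y' - y)) _; last by rewrite ler_wpM2r.
  by have [_ h] := hl a; exact: h.
- move=> y y' w Qy Qy'; rewrite /AA /DAA !contrB mulrA; apply: contr_le => a.
  apply: le_trans (_ : _ <= c a * nrm (y' - y) ^+ 2) _.
    by have [_ /(_ _ Qy)[_ _ h]] := hc a; exact: h.
  by rewrite ler_wpM2r // sqr_ge0.
Qed.

(* Psi y is the limit of the Euler products of A along the segment from c to y.
   Comparing the products for y and y' step by step shows that Psi is parallel in
   all directions, not only radially; this is where flatness is used. *)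
Lemma local_frame : exists2 eps : R, 0 < eps &
  forall (Q' : set V) (c : V), Q' `<=` Q -> seg_convex Q' -> Q' c ->
    (forall y, Q' y -> nrm (y - c) <= eps) ->
  exists Psi : V -> 'M[R]_N,
    [/\ QDm vdisp Q' Psi (fun a y => Psi y *m A a y),
        forall y, Q' y -> nrm (Psi y - 1%:M) <= 2^-1 & Psi c = 1%:M].
Proof.
have [C C0 [b1 b2 b3 b4]] := AA_bounds.
have [L hL] := @generalized_limit_exists R.
pose NN : R := (N * N)%:R; have NN0 : 0 <= NN by [].
(* [euler_near1] costs a factor 2 and the entrywise limit a factor [NN], so [4 * NN * e' <= 1]
   yields the bound [2^-1] for [Psi y - 1%:M]. *)
pose e' : R := (4 * (NN + 1))^-1.
have e'0 : 0 < e' by rewrite invr_gt0; lra.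
have e'E : 4 * NN * e' <= 1.
  by rewrite /e' ler_pdivrMr; lra.
have e'h : e' <= 4^-1 by rewrite lef_pV2 ?posrE; lra.
pose eps := Num.min 1 (e' / (C + 1)).
have eps0 : 0 < eps by rewrite lt_min ltr01 divr_gt0 //; lra.
have eps1 : eps <= 1 by rewrite ge_min lexx.
have Ceps : C * eps <= e'.
  apply: le_trans (_ : _ <= (C + 1) * (e' / (C + 1))) _; last first.
    by rewrite mulrC divfK // gt_eqF //; lra.
  apply: ler_pM => //; [exact: ltW|by lra|by rewrite ge_min lexx orbT].
exists eps => // Q' c sQ cQ Qc hQ'.
pose Bs (m : nat) (w : V) (j : nat) := AA (c + (j%:R / m.+1%:R) *: w) w.
pose P m w := euler m.+1%:R^-1 (Bs m w).
pose U (y : V) (m : nat) := P m (y - c) m.+1.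
have h0 m : 0 <= m.+1%:R^-1 :> R by rewrite invr_ge0.
have h1 m : m.+1%:R^-1 <= 1 :> R by rewrite invf_le1 ?ltr0n // ler1n.
have hm m : m.+1%:R^-1 * m.+1%:R <= 1 :> R by rewrite mulVf // pnatr_eq0.
have Qt m j y : Q' y -> (j <= m.+1)%N -> Q' (c + (j%:R / m.+1%:R) *: (y - c)).
  move=> Qy jm; apply: cQ => //; rewrite divr_ge0 //=.
  by rewrite ler_pdivrMr ?ltr0n // mul1r ler_nat.
have nw y : Q' y -> nrm (y - c) <= 1 by move=> /hQ' h; exact: le_trans eps1.
have nB m y j : Q' y -> (j < m.+1)%N -> nrm (Bs m (y - c) j) <= e'.
  move=> Qy jm; apply: le_trans (b1 _ _ (sQ _ (Qt m j y Qy (ltnW jm)))) _.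
  by apply: le_trans Ceps; apply: ler_wpM2l => //; exact: hQ'.
have nE m y j : Q' y -> (j <= m.+1)%N -> nrm (P m (y - c) j - 1%:M) <= 2 * e'.
  move=> Qy jm.
  apply: le_trans (euler_near1 (h0 m) (hm m) (ltW e'0) _ (fun j => nB m y j Qy) jm) _.
    by lra.
  rewrite ler_wpM2l // ler_piMl ?(ltW e'0) //.
  by rewrite ler_pdivrMr ?ltr0n // mul1r ler_nat.
pose B := nrm (1%:M : 'M[R]_N) + 1.
have B0 : 0 <= B by rewrite addr_ge0.
have nP m y j : Q' y -> (j <= m.+1)%N -> nrm (P m (y - c) j) <= B.
  move=> Qy jm; rewrite -[P _ _ _](subrK 1%:M) addrC; apply: nrmD_le => //.
  by apply: le_trans (nE m y j Qy jm) _; lra.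
have bU y : Q' y -> bdd_mx (U y) by move=> Qy; exists B => m; exact: nP.
have Qw y : c + (y - c) = y by rewrite addrC subrK.
pose K := 6 * (B * (C + 1) ^+ 2).
have K0 : 0 <= K by rewrite mulr_ge0 // mulr_ge0 // sqr_ge0.
have est y y' m : Q' y -> Q' y' ->
    nrm (U y' m - U y m - U y m *m AA y (y' - y)) <=
    2 * (K * nrm (y' - y) ^+ 2) + 2 * K / m.+1%:R.
  move=> Qy Qy'; set h := m.+1%:R^-1; set k := y' - y; set s := nrm k.
  have hh0 : 0 <= h := h0 m.
  have hh1 : h <= 1 := h1 m.
  have s1 : s <= 1 by apply: smQ; apply: sQ.
  have s0 : 0 <= s by exact: nrm_ge0.
  (* The error after [j] steps in predicting the product for [y'] from the one for [y]: at time
     [j%:R * h] the two points on the segments differ by [(j%:R * h) *: k]. For j = m + 1 it is the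
     error in the expansion of [Psi] at [y]. *)
  pose r j := nrm (P m (y' - c) j - P m (y - c) j -
     (j%:R * h) *: (P m (y - c) j *m AA (c + (j%:R * h) *: (y - c)) k)).
  have rS j : (j < m.+1)%N -> r j.+1 <= r j * (1 + h / 2) + h * (K * (s ^+ 2 + h)).
    move=> jm.
    set t := j%:R * h; set yj := c + t *: (y - c); set yj' := c + t *: (y' - c).
    have tS : j.+1%:R * h = t + h by rewrite -[j.+1%:R]natr1 mulrDl mul1r.
    have t0 : 0 <= t by rewrite mulr_ge0 // h0.
    have t1 : t <= 1 by rewrite /t /h ler_pdivrMr ?ltr0n // mul1r ler_nat ltnW.
    have Qj : Q yj by apply: sQ; exact: Qt (ltnW jm).
    have Qj' : Q yj' by apply: sQ; exact: Qt (ltnW jm).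
    set w := y - c.
    have Qj1 : Q (c + (t + h) *: w) by rewrite -tS; apply: sQ; exact: Qt.
    pose a := AA yj w; pose b := AA yj k; pose b' := AA (c + (t + h) *: w) k.
    pose a' := AA yj' (y' - c); pose da := DAA yj k w; pose db := DAA yj w k.
    pose e1 := b' - b - h *: db; pose ee := a' - (a + t *: da + b).
    have w'E : y' - c = w + k by apply/rowP => q; rewrite !mxE; ring.
    have dj1 : c + (t + h) *: w - yj = h *: w.
      by rewrite /yj -/w scalerDl; apply/rowP => q; rewrite !mxE; ring.
    have djk : yj' - yj = t *: k.
      by rewrite /yj /yj' -/w w'E; apply/rowP => q; rewrite !mxE; ring.
    have DZ u v (x : R) : DAA yj (x *: u) v = x *: DAA yj u v.
      rewrite /DAA /contr scaler_sumr; apply: eq_bigr => q _.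
      rewrite scalerA mulrC -scalerA; congr (_ *: _); exact: contrZ.
    have wk : nrm w <= 1 by exact: nw.
    have ne1 : nrm e1 <= (C + 1) * h ^+ 2.
      have := b4 yj _ k Qj Qj1; rewrite dj1 DZ nrmZ ger0_norm // => H.
      apply: le_trans H _; rewrite exprMn -!mulrA.
      apply: ler_pM => //; first by rewrite !mulr_ge0 ?sqr_ge0.
        by rewrite lerDl.
      have wwk : nrm w * (nrm w * nrm k) <= 1 by rewrite !mulr_ile1 // mulr_ge0.
      by rewrite mulrA expr2 ler_piMr // mulr_ge0.
    have nee : nrm ee <= 2 * ((C + 1) * s ^+ 2).
      have -> : ee = (AA yj' w - a - t *: da) + (AA yj' k - b).
        rewrite /ee /a' w'E /AA contrD -/(AA yj' w) -/(AA yj' k).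
        move: (AA yj' w) (AA yj' k) => X Y.
        by apply/matrixP => p q; rewrite !mxE; ring.
      have H1 := b4 yj yj' w Qj Qj'; have H2 := b3 yj yj' k Qj Qj'.
      rewrite djk DZ nrmZ ger0_norm // in H1 H2.
      apply: le_trans (nrmD_le H1 H2) _; rewrite -/s.
      have s20 : 0 <= s ^+ 2 by exact: sqr_ge0.
      have X1 : (t * s) ^+ 2 * nrm w <= s ^+ 2.
        rewrite exprMn -mulrA; apply: le_trans (_ : _ <= 1 * (s ^+ 2 * 1)) _; last by lra.
        apply: ler_pM; rewrite ?mulr_ge0 ?sqr_ge0 ?expr_le1 // ler_wpM2l //.
      have X2 : t * s * s <= s ^+ 2 by rewrite expr2 ler_wpM2r // ler_piMl.
      have X3 : C * ((t * s) ^+ 2 * nrm w) <= C * s ^+ 2 by rewrite ler_wpM2l.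
      have X4 : C * (t * s * s) <= C * s ^+ 2 by rewrite ler_wpM2l.
      by lra.
    have sw : nrm k * nrm w <= s by rewrite -/s ler_piMr.
    have aux (X Y Z : 'M[R]_N) : X = Y + Z + (X - Y - Z).
      by apply/matrixP => p q; rewrite !mxE; ring.
    have b'E : b' = b + h *: db + e1 by exact: aux.
    have aux' (X Y : 'M[R]_N) : X = Y + (X - Y).
      by apply/matrixP => p q; rewrite !mxE; ring.
    have a'E : a' = a + t *: da + b + ee by exact: aux'.
    have idn := euler_step_identity (P m w j) (P m (y' - c) j) (AA_flat w k Qj) b'E a'E.
    have -> : r j.+1 = nrm (P m (y' - c) j + h *: (P m (y' - c) j *m a') -
       (P m w j + h *: (P m w j *m a)) -
       (t + h) *: ((P m w j + h *: (P m w j *m a)) *m b')) by rewrite /r tS.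
    rewrite idn.
    have C1 : C * s <= (C + 1) * s by rewrite ler_wpM2r // lerDl.
    have Cs : C * s <= C + 1.
      by apply: le_trans (_ : _ <= C * 1) _; [rewrite ler_wpM2l|lra].
    have Cw : C * nrm w <= C + 1.
      by apply: le_trans (_ : _ <= C * 1) _; [rewrite ler_wpM2l|lra].
    apply: nrmD_le.
      rewrite mulrDr mulr1; apply: nrmD_le => //; rewrite nrmZ ger0_norm // mulrCA.
      apply: ler_wpM2l => //; apply: nrmM_le => //.
      apply: le_trans (nB m y' j Qy' jm) _; lra.
    apply: (@euler_step_bound _ _ _ _ _ _ _ _ _ _ _ _ s B (C + 1)) => //.
    - by lra.
    - exact: nP (ltnW jm).
    - exact: le_trans (b1 _ _ Qj) Cw.
    - exact: le_trans (b1 _ _ Qj) C1.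
    - apply: le_trans (b2 _ _ _ Qj) _; apply: le_trans C1; exact: ler_wpM2l.
    - apply: le_trans (b2 _ _ _ Qj) _; apply: le_trans Cs; rewrite mulrC in sw.
      exact: ler_wpM2l.
    - exact: le_trans (b1 _ _ Qj1) Cs.
  have r0 : r 0%N <= 0 by rewrite /r /= mul0r scale0r subrr subr0 nrm0.
  have := discrete_gronwall (h0 m) (hm m) _ r0 rS (leqnn _).
  rewrite /r mulfV ?pnatr_eq0 // !scale1r Qw mul1r => H.
  apply: le_trans (H _) _; first by rewrite mulr_ge0 // addr_ge0 // sqr_ge0.
  by rewrite -/s -/h; lra.
exists (fun y => mxlim L (U y)); split.
- apply: (@qdm_of_est _ _ _ _ _ _ _ _ _
    (NN * B + NN * B * (\sum_a (C * nrm (delta_mx 0 a : V))) + NN * (2 * K))) => y Qy.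
  have nPsi : nrm (mxlim L (U y)) <= NN * B.
    by apply: (@mxlim_le _ _ hL _ _ _ B 0) => m; rewrite mul0r addr0; exact: nP.
  have nA a : nrm (A a y) <= \sum_a (C * nrm (delta_mx 0 a : V)).
    have AE : A a y = AA y (delta_mx 0 a).
      rewrite /AA /contr (bigD1 a) //= big1 => [|b ba]; rewrite !mxE /=.
        by rewrite eqxx scale1r addr0.
      by rewrite (negPf ba) scale0r.
    rewrite {1}AE; apply: le_trans (b1 _ _ (sQ _ Qy)) _.
    apply: (ler_term (f := fun a => C * nrm (delta_mx 0 a : V))) => a'.
    by rewrite mulr_ge0.
  have S0 : 0 <= \sum_a (C * nrm (delta_mx 0 a : V)).
    by apply: sumr_ge0 => a _; rewrite mulr_ge0.
  have NB : 0 <= NN * B by rewrite mulr_ge0.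
  have N2K : 0 <= NN * (2 * K) by rewrite mulr_ge0 // mulr_ge0.
  split.
  + by apply: le_trans nPsi _; rewrite -addrA lerDl addr_ge0 // mulr_ge0.
  + move=> a; apply: le_trans (nrmM_le nPsi (nA a)) _.
    by rewrite addrAC lerDr addr_ge0.
  + move=> y' Qy'.
    have -> : \sum_a vdisp y y' 0 a *: (mxlim L (U y) *m A a y) =
        mxlim L (fun m => U y m *m AA y (y' - y)).
      rewrite (mxlimM hL (AA y (y' - y)) (bU _ Qy)) /AA /contr mulmx_sumr.
      by apply: eq_bigr => a _; rewrite -scalemxAr.
    have bUA : bdd_mx (fun m => U y m *m AA y (y' - y)).
      have [D hD] := bU _ Qy; exists (D * nrm (AA y (y' - y))) => m; exact: nrmM_le.
    have bN u : bdd_mx u -> bdd_mx (fun m => - u m : 'M[R]_N).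
      by move=> [D hD]; exists D => m; rewrite nrmN.
    have bD u v : bdd_mx u -> bdd_mx v -> bdd_mx (fun m => u m + v m : 'M[R]_N).
      by move=> [D hD] [D' hD']; exists (D + D') => m; exact: nrmD_le.
    have -> : mxlim L (U y') - mxlim L (U y) - mxlim L (fun m => U y m *m AA y (y' - y)) =
        mxlim L (fun m => U y' m - U y m - U y m *m AA y (y' - y)).
      apply/esym; apply: etrans (mxlimD hL (bD _ _ (bU _ Qy') (bN _ (bU _ Qy)))
        (bN _ bUA)) _; congr (_ + _); last exact: (mxlimN hL bUA).
      apply: etrans (mxlimD hL (bU _ Qy') (bN _ (bU _ Qy))) _; congr (_ + _).
      exact: (mxlimN hL (bU _ Qy)).
    apply: le_trans (mxlim_le hL (fun m => est y y' m Qy Qy')) _.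
    rewrite /vdisp; move: (sqr_ge0 (nrm (y' - y))); move: (nrm _ ^+ 2) => q q0.
    rewrite [2 * _]mulrA [_%:R * _]mulrA ler_wpM2r // lerDr addr_ge0 // mulr_ge0 //.
- move=> y Qy.
  have -> : mxlim L (U y) - 1%:M = mxlim L (fun m => U y m - 1%:M).
    have b1M : bdd_mx (fun=> - 1%:M : 'M[R]_N) by exists (nrm (- 1%:M : 'M[R]_N)).
    apply/esym; apply: etrans (mxlimD hL (bU _ Qy) b1M) _.
    by rewrite (mxlim_cst hL).
  apply: le_trans (@mxlim_le _ _ hL _ _ _ (2 * e') 0 _) _.
    by move=> m; rewrite mul0r addr0; exact: nE.
  by rewrite -/NN; lra.
- rewrite -[RHS](mxlim_cst hL); congr (mxlim L _); apply: funext => m.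
  rewrite /U subrr; have : forall j, P m 0 j = 1%:M; last exact.
  by elim => [//|j ih]; rewrite /P /= -/(P m 0 j) ih /Bs /AA contr0 mulmx0 scaler0 addr0.
Qed.

End local_frames.

(** * The connection of Hess f = - kappa f g *)

Lemma block_conn (R : realType) n (ga gb dg : 'rV[R]_n) (ea eb : 'cV[R]_n)
    (Ga Gb dG : 'M[R]_n) :
  block_mx (0 : 'M[R]_1) dg 0 dG + block_mx (0 : 'M[R]_1) ga ea Ga *m block_mx 0 gb eb Gb =
  block_mx (ga *m eb) (dg + ga *m Gb) (Ga *m eb) (dG + (ea *m gb + Ga *m Gb)).
Proof. by rewrite mulmx_block add_block_mx !(mul0mx, mulmx0) !add0r. Qed.

Section connection.
Context {R : realType} {d : nat} (M : riemannian_manifold R d) (kappa : R).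
Local Notation vec := 'rV[R]_d.+1.
Local Notation "'MN'" := 'M[R]_(1 + d.+1).
Implicit Types (i : chart_idx M) (y : vec).

(* A solution of Hess f = - kappa f g, together with its differential omega, is
   a row s = (f, omega) with d_a s = s A_a. *)
Definition conn i (a : 'I_d.+1) y : MN :=
  block_mx (0 : 'M[R]_1) (- kappa *: row a (metric i y))
    (delta_mx a 0 : 'cV[R]_d.+1) (\matrix_(l, b) christoffel i l a b y).

Definition dconn i (e a : 'I_d.+1) y : MN :=
  block_mx (0 : 'M[R]_1) (- kappa *: (\row_b dmetric i e a b y))
    (0 : 'cV[R]_d.+1) (\matrix_(l, b) dchristoffel i e l a b y).

(* The pull-back by a frame of the form H of the model {Y | Y^T H Y = 1}. *)
Definition gram_mx i y : MN := block_mx (1%:M : 'M[R]_1) 0 0 (kappa *: metric i y).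

Definition dgram_mx i a y : MN :=
  block_mx (0 : 'M[R]_1) 0 0 (kappa *: \matrix_(b, c) dmetric i a b c y).

Definition e0 : 'cV[R]_(1 + d.+1) := col_mx (1%:M : 'M[R]_1) 0.

Lemma conn_e0 i a y : conn i a y *m e0 = col_mx (0 : 'M[R]_1) (delta_mx a 0).
Proof.
by rewrite /conn /e0 mul_block_col !mulmx0 mul0mx mulmx1 !addr0.
Qed.

Section local.
Context (i : chart_idx M) (y0 : vec) (r : R) (lb : local_box i y0 r).
Local Notation Q := (box y0 r).

Lemma metric_qdm : QDm vdisp Q (metric i) (fun a y => \matrix_(b, c) dmetric i a b c y).
Proof. by move=> b c; apply: qd_ext (lb_metric lb b c) => // a y _; rewrite mxE. Qed.

Lemma conn_qd a : QDm vdisp Q (conn i a) (fun e => dconn i e a).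
Proof.
apply: qdm_block.
- exact: qdm_cst.
- move=> k b; apply: qd_ext (qd_scale (- kappa) (lb_metric lb a b)) => [y|e y] _;
  by rewrite !mxE.
- exact: qdm_cst.
- by move=> l b; apply: qd_ext (lb_christoffel lb l a b) => [y|e y] _; rewrite !mxE.
Qed.

Lemma gram_qd : QDm vdisp Q (gram_mx i) (dgram_mx i).
Proof.
apply: qdm_block; [exact: qdm_cst..|].
exact: qdm_scale metric_qdm.
Qed.

(** Block by block: the symmetry of the metric; that of d_a g_bc + [bc, a] = [ab, c] + [ac, b] +
    [bc, a] in a and b; the absence of torsion; and, in the last block, the curvature of the
    Levi-Civita connection, which the product of the two off-diagonal blocks compensates because it
    is constant. *)
Lemma conn_flat (curv : constant_curvature M kappa) a b y : Q y ->
  dconn i a b y + conn i a y *m conn i b y = dconn i b a y + conn i b y *m conn i a y.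
Proof.
move=> Qy; have iy := lb_sub lb Qy.
apply: etrans (block_conn _ _ _ _ _ _ _ _) _.
apply/esym; apply: etrans (block_conn _ _ _ _ _ _ _ _) _; apply/esym.
apply: (f_equal4 block_mx).
- rewrite -!scalemxAl; congr (_ *: _); apply/matrixP => p q.
  have h x w : (row x (metric i y) *m (delta_mx w 0 : 'cV[R]_d.+1)) p q = metric i y x w.
    by rewrite -colE !mxE.
  by rewrite !h; exact: metric_symE.
- rewrite -!scalemxAl -!scalerDr; apply: (congr1 (fun X => - kappa *: X)); apply/rowP => c.
  have h x w : (row x (metric i y) *m \matrix_(l, b0) christoffel i l w b0 y) 0 c =
      chr1 i w c x y.
    rewrite !mxE -(metric_christoffel lb w c x Qy); apply: eq_bigr => l _.
    by rewrite !mxE.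
  rewrite mxE h [in RHS]mxE h !mxE.
  have := chr1_add lb a b c Qy; have := chr1_add lb b a c Qy.
  rewrite {1 3}/chr1 (dmetric_sym lb c b a Qy) /chr1.
  rewrite (dmetric_sym lb b c a Qy) (dmetric_sym lb a c b Qy) (dmetric_sym lb c b a Qy).
  by abstract_atoms; lra.
- by apply/matrixP => l q; rewrite -!colE !mxE; exact: (christoffel_sym lb l a b Qy).
- apply/matrixP => l c.
  have := constant_curvature_riemann lb l a b c Qy curv; rewrite riemannE => H.
  have hd x w : ((delta_mx x 0 : 'cV[R]_d.+1) *m (- kappa *: row w (metric i y))) l c =
      - kappa * ((l == x)%:R * metric i y w c).
    by rewrite mxE big_ord1 !mxE eqxx andbT; ring.
  have hG x w : ((\matrix_(l, b) christoffel i l x b y) *m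
       (\matrix_(l, b) christoffel i l w b y)) l c =
       \sum_m christoffel i m w c y * christoffel i l x m y.
    by rewrite mxE; apply: eq_bigr => m _; rewrite !mxE mulrC.
  have hD x w : (\matrix_(l, b) dchristoffel i x l w b y) l c = dchristoffel i x l w c y.
    by rewrite mxE.
  have addE (X Y Z : 'M[R]_d.+1) : (X + (Y + Z)) l c = X l c + (Y l c + Z l c).
    by rewrite !mxE.
  have E x w : (\matrix_(l, b) dchristoffel i x l w b y +
      ((delta_mx x 0 : 'cV[R]_d.+1) *m (- kappa *: row w (metric i y)) +
       (\matrix_(l, b) christoffel i l x b y) *m
       (\matrix_(l, b) christoffel i l w b y))) l c =
      dchristoffel i x l w c y + (- kappa * ((l == x)%:R * metric i y w c) +
       \sum_m christoffel i m w c y * christoffel i l x m y).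
    by apply: etrans (addE _ _ _) _; apply: f_equal2 (hD x w) _;
       apply: f_equal2 (hd x w) (hG x w).
  apply: etrans (E a b) _; apply/esym; apply: etrans (E b a) _; apply/esym.
  move: H; rewrite sumrB => H.
  have cancel (p q S1 S2 k u v : R) : p - q + (S1 - S2) = k * (u - v) ->
      p + (- k * u + S1) = q + (- k * v + S2).
    move=> h; have -> : p = k * (u - v) - (S1 - S2) + q by rewrite -h; ring.
    by ring.
  exact: cancel H.
Qed.

(** The form [gram_mx] is parallel, by compatibility with the metric. This keeps the values of a
    frame on the quadric and, along geodesics, the speed constant. *)
Lemma conn_gram a y : Q y ->
  (conn i a y)^T *m gram_mx i y + gram_mx i y *m conn i a y = dgram_mx i a y.
Proof.
move=> Qy; have iy := lb_sub lb Qy.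
rewrite /conn /gram_mx /dgram_mx tr_block_mx !mulmx_block !add_block_mx.
rewrite ?(mul0mx, mulmx0, trmx0, addr0, add0r, mulmx1, mul1mx).
congr block_mx.
- rewrite trmx_delta -scalemxAr -rowE; apply/rowP => b; rewrite !mxE.
  by ring.
- rewrite -scalemxAl -colE; apply/colP => b; rewrite !mxE.
  by rewrite (metric_symE a b iy); ring.
- rewrite -scalemxAl -scalemxAr -scalerDr; congr (_ *: _); apply/matrixP => b c.
  have h1 : ((\matrix_(l, b0) christoffel i l a b0 y)^T *m metric i y) b c =
      chr1 i a b c y.
    rewrite mxE -(metric_christoffel lb a b c Qy); apply: eq_bigr => l _.
    by rewrite !mxE mulrC (metric_symE c l iy).
  have h2 : (metric i y *m \matrix_(l, b0) christoffel i l a b0 y) b c =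
      chr1 i a c b y.
    rewrite mxE -(metric_christoffel lb a c b Qy); apply: eq_bigr => l _.
    by rewrite !mxE.
  by rewrite mxE h1 h2 mxE; exact: (chr1_add lb a b c Qy).
Qed.

(* The sections of the flat connection are tracked as matrices of m rows. *)
Definition sol {m} (Q : set vec) (S : vec -> 'M[R]_(m, 1 + d.+1)) :=
  QDm vdisp Q S (fun a y => S y *m conn i a y).

Lemma sol_mul m p (L : 'M[R]_(p, m)) Q' (S : vec -> 'M[R]_(m, 1 + d.+1)) :
  small vdisp Q' -> sol Q' S -> sol Q' (fun y => L *m S y).
Proof.
move=> sm h; apply: qdm_ext (qdm_mul sm (qdm_cst vdisp Q' L) h) => // a y _.
by rewrite mul0mx add0r mulmxA.
Qed.

Lemma sol_subset m Q' Q'' (S : vec -> 'M[R]_(m, 1 + d.+1)) :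
  Q'' `<=` Q' -> sol Q' S -> sol Q'' S.
Proof. exact: qdm_subset. Qed.

End local.

(** Writing v = v A - v (A - 1) gives [nrm v <= 2 * nrm (v *m A)]. This shows that [A] is injective
    and, for the rows of its inverse, the bound. *)
Lemma unit_near1 N (A : 'M[R]_N) : nrm (A - 1%:M) <= 2^-1 ->
  A \in unitmx /\ nrm (invmx A) <= 2 * nrm (1%:M : 'M[R]_N).
Proof.
move=> h.
have inj v : nrm (v : 'rV[R]_N) <= 2 * nrm (v *m A).
  have : nrm v <= nrm (v *m A) + nrm (v *m (A - 1%:M)).
    have E : v = v *m A - v *m (A - 1%:M) by rewrite mulmxBr mulmx1 subKr.
    by rewrite {1}E; exact: nrmB.
  have := nrmM_le (lexx (nrm v)) h; lra.
have uA : A \in unitmx.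
  rewrite -row_free_unit -kermx_eq0; apply/eqP/row_matrixP => k; rewrite row0.
  apply: nrm_eq0; apply: le_trans (inj _) _.
  by rewrite -row_mul mulmx_ker row0 nrm0 mulr0.
split => //.
have nrow (B : 'M[R]_N) : nrm B = \sum_k nrm (row k B).
  apply: eq_bigr => k _; rewrite /nrm big_ord1.
  by apply: eq_bigr => l _; rewrite mxE.
rewrite nrow [nrm 1%:M]nrow mulr_sumr; apply: ler_sum => k _.
by apply: le_trans (inj _) _; rewrite -row_mul mulVmx.
Qed.

End connection.

(** * Change of charts: metric, Christoffel symbols, connection *)

Section chart_change.
Context {R : realType} {d : nat} (M : riemannian_manifold R d) (kappa : R).
Local Notation vec := 'rV[R]_d.+1.
Implicit Types (i j : chart_idx M) (y : vec).

Lemma inv_chart i y : chart_image i y -> dom i (inv i y) /\ coord i (inv i y) = y.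
Proof. by move=> [p ip <-]; rewrite coordK. Qed.

Definition overlap_image i j : set vec := coord i @` (dom i `&` dom j).
Definition transition i j y : vec := coord j (inv i y).
Definition jac i j (a b : 'I_d.+1) : vec -> R :=
  partial (overlap_image i j) (fun z => transition i j z 0 b) a.
Definition djac i j (c a b : 'I_d.+1) : vec -> R :=
  partial (overlap_image i j) (jac i j a b) c.
Definition jac_mx i j y : 'M[R]_d.+1 := \matrix_(a, b) jac i j a b y.

Lemma overlapP i j y : overlap_image i j y ->
  [/\ chart_image i y, dom j (inv i y), chart_image j (transition i j y) &
      inv j (transition i j y) = inv i y].
Proof.
move=> [p [ip jp] <-]; rewrite /transition coordK //; split => //.
- by exists p.
- by exists p.
- exact: coordK.
Qed.

Lemma overlap_box i j p : dom i p -> dom j p ->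
  exists2 r : R, 0 < r & box (coord i p) r `<=` overlap_image i j.
Proof.
move=> ip jp.
have iy : chart_image i (coord i p) by exists p.
have [r r0 hr] := chart_box iy.
have /subspace_continuousP /(_ _ iy) := @inv_continuous _ _ M i.
rewrite /from_subspace => cvi.
have : nbhs (inv i (coord i p)) (dom j).
  by rewrite coordK //; apply: open_nbhs_nbhs; split => //; exact: dom_open.
move=> /cvi; rewrite /within /= => /nbhs_ballP[e /= e0 he].
exists (Num.min r e); first by rewrite lt_min r0 e0.
move=> y Qy.
have iy' : chart_image i y by apply: hr; apply: box_le Qy; rewrite ge_min lexx.
have [h1 h2] := inv_chart iy'.
exists (inv i y) => //; split => //; apply: he => //.
split => // k a; rewrite (ord1 k) /ball /= /ball_ /= distrC.
by case: Qy => /(_ a) + _; rewrite lt_min => /andP[].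
Qed.

Record overlap i j (y0 : vec) (r r2 : R) : Prop := Overlap {
  ov_src : local_box i y0 r;
  ov_tgt : local_box j (transition i j y0) r2;
  ov_sub : box y0 r `<=` overlap_image i j;
  ov_map : forall y, box y0 r y -> box (transition i j y0) r2 (transition i j y);
  ov_qd : QDm vdisp (box y0 r) (transition i j) (fun a y => \row_b jac i j a b y);
  ov_jac : forall a b, QD vdisp (box y0 r) (jac i j a b) (fun c => djac i j c a b)
}.

Lemma overlap_exists i j p r2 : dom i p -> dom j p -> local_box j (coord j p) r2 ->
  exists r, overlap i j (coord i p) r r2.
Proof.
move=> ip jp lbj; set y0 := coord i p.
have iy : chart_image i y0 by exists p.
have phi0 : transition i j y0 = coord j p by rewrite /transition coordK.
have [r0 r00 s0] := overlap_box ip jp.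
have hy : half_space y0 by exact: chart_image_half iy.
have [r1 lb1] := local_box_exists iy.
have r10 := lb_gt0 lb1.
have m0 : 0 < Num.min r0 r1 by rewrite lt_min r00 r10.
have [r3 /andP[r3_gt0 r3_le] hr3] := @common_radius R 'I_d.+1
  (fun b r => QD vdisp (box y0 r) (fun y => transition i j y 0 b)
    (fun a => jac i j a b)) _ m0
  (fun _ _ _ _ rr => qd_subset (box_le rr))
  (fun b => smooth_qd (@transition_smooth _ _ M i j b) s0 r00 hy).
have [r4 /andP[r4_gt0 r4_le] hr4] := @common_radius R ('I_d.+1 * 'I_d.+1)%type
  (fun ab r => QD vdisp (box y0 r) (jac i j ab.1 ab.2)
    (fun c => djac i j c ab.1 ab.2)) _ r3_gt0
  (fun _ _ _ _ rr => qd_subset (box_le rr))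
  (fun ab => smooth_qd (smooth_partial ab.1 (@transition_smooth _ _ M i j ab.2)) s0 r00 hy).
move: r3_le; rewrite le_min => /andP[r3r0 r3r1].
have r4r1 : r4 <= r1 by exact: le_trans r3r1.
have lb4 := local_box_le r4_gt0 r4r1 lb1.
have qd4 : QDm vdisp (box y0 r4) (transition i j) (fun a y => \row_b jac i j a b y).
  move=> k b; rewrite (ord1 k); apply: qd_ext (qd_subset (box_le r4_le) (hr3 b)) => //.
  by move=> a y _; rewrite mxE.
have [L L0 lip] := qdm_lip (lb_small lb4) qd4.
have r20 := lb_gt0 lbj.
have den0 : 0 < (L + 1) * d.+1%:R by rewrite mulr_gt0 ?ltr0n //; lra.
pose r := Num.min r4 (r2 / ((L + 1) * d.+1%:R)).
have r_gt0 : 0 < r by rewrite lt_min r4_gt0 divr_gt0.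
have rr4 : r <= r4 by rewrite ge_min lexx.
have s : box y0 r `<=` box y0 r4 by exact: box_le.
have sov : box y0 r `<=` overlap_image i j.
  by apply: subset_trans s0; apply: box_le; apply: le_trans r3r0; exact: le_trans r4_le.
exists r; split.
- exact: local_box_le rr4 lb4.
- by rewrite phi0.
- exact: sov.
- move=> y Qy; split; last first.
    have [_ _ h _] := overlapP (sov _ Qy); exact: chart_image_half h.
  move=> a; have := lip y0 y (local_box_mem lb4) (s _ Qy); rewrite /vdisp => H.
  have := entry_le (transition i j y - transition i j y0) 0 a; rewrite !mxE => H'.
  apply: le_lt_trans (le_trans H' H) _.
  have H2 : nrm (y - y0) <= d.+1%:R * (r2 / ((L + 1) * d.+1%:R)).
    have := @nrm_le_entries _ _ _ (y - y0) (r2 / ((L + 1) * d.+1%:R)).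
    rewrite mul1n; apply => k b; rewrite (ord1 k) !mxE.
    case: Qy => /(_ b) /ltW h _; apply: le_trans h _.
    by rewrite ge_min lexx orbT.
  have H3 : d.+1%:R * (r2 / ((L + 1) * d.+1%:R)) = r2 / (L + 1).
    have q0 : d.+1%:R != 0 :> R by rewrite pnatr_eq0.
    have p0 : L + 1 != 0 by rewrite gt_eqF //; lra.
    by move: (d.+1%:R) q0 (L + 1) p0 => q q0 w w0; field; rewrite w0 q0.
  rewrite H3 in H2; apply: le_lt_trans (_ : _ <= L * (r2 / (L + 1))) _.
    by rewrite ler_wpM2l.
  have L1 : 0 < L + 1 by lra.
  by rewrite mulrA ltr_pdivrMr // mulrC ltr_pM2l //; lra.
- exact: qdm_subset qd4.
- by move=> a b; exact: qd_subset (qd_subset s (hr4 (a, b))).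
Qed.

Section law.
Context i j (y0 : vec) (r r2 : R) (ov : overlap i j y0 r r2).
Local Notation Q := (box y0 r).
Local Notation phi := (transition i j).
Local Notation J := (jac_mx i j).

Lemma metric_jac y : Q y -> metric i y = J y *m metric j (phi y) *m (J y)^T.
Proof. by move=> Qy; exact: (metric_compat (ov_sub ov Qy)). Qed.

Lemma jac_unit y : Q y -> J y \in unitmx.
Proof.
move=> Qy; rewrite -row_free_unit -kermx_eq0; apply/eqP/row_matrixP => k.
rewrite row0; apply/eqP; apply: contraT => hk.
have iy := lb_sub (ov_src ov) Qy.
have := metric_pos iy hk; rewrite metric_jac // !mulmxA.
rewrite (_ : _ *m J y = 0) ?mul0mx ?mxE ?ltxx //.
by apply/eqP; rewrite -sub_kermx row_sub.
Qed.

Lemma djac_sym c a b y : Q y -> djac i j c a b y = djac i j a c b y.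
Proof.
move=> Qy; apply/esym.
apply: (@schwarz R d y0 y r (fun y => phi y 0 b) (fun a => jac i j a b)
  (fun a c => djac i j c a b) c a Qy _ (fun a => ov_jac ov a b)).
by apply: qd_ext (ov_qd ov 0 b) => // a' x _; rewrite mxE.
Qed.

Definition jac3 (f : 'I_d.+1 -> 'I_d.+1 -> 'I_d.+1 -> R) y a b c : R :=
  \sum_l \sum_m \sum_k jac i j a l y * jac i j b m y * jac i j c k y * f l m k.

(** A term of the derivative of J g J^T in which a factor J is differentiated. *)
Definition jac_corr y e a b : R :=
  \sum_m \sum_k djac i j e a m y * metric j (phi y) m k * jac i j b k y.

Lemma dmetric_jac e a b y : Q y -> dmetric i e a b y =
  jac_corr y e a b + jac_corr y e b a +
  jac3 (fun l m k => dmetric j l m k (phi y)) y e a b.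
Proof.
move=> Qy.
have sm := lb_small (ov_src ov).
have hJ : QDm vdisp Q J (fun c y => \matrix_(a, b) djac i j c a b y).
  by move=> a' b'; apply: qd_ext (ov_jac ov a' b') => [x|c x] _; rewrite mxE.
have hg := qdm_comp sm (ov_map ov) (ov_qd ov) (metric_qdm (ov_tgt ov)).
have hP := qdm_mul sm (qdm_mul sm hJ hg) (qdm_tr hJ).
have hP' : QD vdisp Q (fun y => metric i y a b) (fun e y => jac_corr y e a b +
    jac_corr y e b a + jac3 (fun l m k => dmetric j l m k (phi y)) y e a b).
  apply: qd_ext (hP a b) => [x Qx|c x Qx]; first by rewrite metric_jac.
  have Qj := ov_map ov Qx; have jx := lb_sub (ov_tgt ov) Qj.
  set g := metric j (phi x).
  have T1 : ((\matrix_(a, b) djac i j c a b x) *m g *m (J x)^T) a b =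
      jac_corr x c a b.
    rewrite mxE [RHS]exchange_big; apply: eq_bigr => k _; rewrite !mxE mulr_suml.
    by apply: eq_bigr => m _; rewrite !mxE.
  have T2 : (J x *m g *m (\matrix_(a, b) djac i j c a b x)^T) a b =
      jac_corr x c b a.
    rewrite mxE; apply: eq_bigr => m _; rewrite !mxE mulr_suml.
    apply: eq_bigr => k _; rewrite !mxE (metric_symE m k jx) -/g.
    by move: (jac _ _ _ _ _) (g _ _) (djac _ _ _ _ _ _) => u v w; ring.
  have T3 : (J x *m (\sum_l (\row_b jac i j c b x) 0 l *:
        \matrix_(b, c) dmetric j l b c (phi x)) *m (J x)^T) a b =
      jac3 (fun l m k => dmetric j l m k (phi x)) x c a b.
    rewrite mulmx_sumr mulmx_suml summxE; apply: eq_bigr => l _.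
    rewrite -scalemxAr -scalemxAl [LHS]mxE [X in X * _]mxE [X in _ * X]mxE.
    rewrite [RHS]exchange_big mulr_sumr.
    apply: eq_bigr => k _; rewrite !mxE mulr_suml mulr_sumr; apply: eq_bigr => m _.
    rewrite !mxE; move: (jac _ _ _ _ _) (jac _ _ _ _ _) (jac _ _ _ _ _) => u v w.
    by move: (dmetric _ _ _ _ _) => z; ring.
  rewrite mulmxDl mxE [X in X + _]mxE T1 T3 T2.
  by rewrite addrAC.
exact: (qd_unique e (lb_metric (ov_src ov) a b) hP' Qy).
Qed.

Lemma jac3_swap12 f y a b c : jac3 f y b a c = jac3 (fun l m k => f m l k) y a b c.
Proof.
rewrite /jac3 exchange_big; apply: eq_bigr => l _; apply: eq_bigr => m _.
apply: eq_bigr => k _; move: (jac _ _ _ _ _) (jac _ _ _ _ _) (jac _ _ _ _ _) => u v w.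
by rewrite (mulrC w).
Qed.

Lemma jac3_rot f y a b c : jac3 f y c a b = jac3 (fun l m k => f k l m) y a b c.
Proof.
rewrite /jac3 exchange_big; apply: eq_bigr => l _ /=.
rewrite exchange_big; apply: eq_bigr => m _ /=; apply: eq_bigr => k _.
move: (jac _ _ _ _ _) (jac _ _ _ _ _) (jac _ _ _ _ _) (f _ _ _) => u v w z; ring.
Qed.

(** By [djac_sym], [jac_corr] is symmetric in its first two indices. Of the six correction terms in
    the three derivatives of the metric four cancel, and the other two are equal, which absorbs the
    factor 1/2. *)
Lemma chr1_jac a b c y : Q y -> chr1 i a b c y =
  jac_corr y a b c + jac3 (fun l m k => chr1 j l m k (phi y)) y a b c.
Proof.
move=> Qy; rewrite /chr1 !dmetric_jac // (jac3_swap12 _ y a b c) (jac3_rot _ y a b c).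
have sS e x w : jac_corr y e x w = jac_corr y x e w.
  by apply: eq_bigr => m _; apply: eq_bigr => k _; rewrite djac_sym.
have -> : jac3 (fun l m k => 2^-1 * (dmetric j l m k (phi y) + dmetric j m l k (phi y) -
     dmetric j k l m (phi y))) y a b c =
   2^-1 * (jac3 (fun l m k => dmetric j l m k (phi y)) y a b c +
     jac3 (fun l m k => dmetric j m l k (phi y)) y a b c -
     jac3 (fun l m k => dmetric j k l m (phi y)) y a b c).
  rewrite /jac3 -big_split -sumrB mulr_sumr; apply: eq_bigr => l _.
  rewrite -big_split -sumrB mulr_sumr; apply: eq_bigr => m _.
  rewrite -big_split -sumrB mulr_sumr; apply: eq_bigr => k _ /=.
  by abstract_atoms; move: (jac _ _ _ _ _) (jac _ _ _ _ _) (jac _ _ _ _ _) => u v w; ring.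
rewrite (sS b a c) (sS c a b) (sS c b a).
move: (jac3 _ _ _ _ _) (jac3 _ _ _ _ _) (jac3 _ _ _ _ _) => u v w.
move: (jac_corr _ _ _ _) (jac_corr _ _ _ _) (jac_corr _ _ _ _) => p q s.
by field.
Qed.

(** Multiplied by the invertible matrix g J^T, which lowers the index, the transformation law
    becomes [chr1_jac]. *)
Lemma christoffel_jac a b m y : Q y ->
  \sum_l christoffel i l a b y * jac i j l m y = djac i j a b m y +
  \sum_k jac i j a k y * \sum_l christoffel j m k l (phi y) * jac i j b l y.
Proof.
move=> Qy; have Qj := ov_map ov Qy; have jx := lb_sub (ov_tgt ov) Qj.
set g := metric j (phi y).
have uG : g *m (J y)^T \in unitmx.
  by rewrite unitmx_mul (metric_unit jx) unitmx_tr jac_unit.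
pose X : vec := \row_m (\sum_l christoffel i l a b y * jac i j l m y -
  (djac i j a b m y +
  \sum_k jac i j a k y * \sum_l christoffel j m k l (phi y) * jac i j b l y)).
suff X0 : X = 0.
  by move/rowP: X0 => /(_ m); rewrite !mxE => /eqP; rewrite subr_eq0 => /eqP.
apply: (can_inj (mulmxK uG)); rewrite mul0mx; apply/rowP => c; rewrite [RHS]mxE mulmxA.
have gJ m' : (g *m (J y)^T) m' c = \sum_k g m' k * jac i j c k y.
  by rewrite mxE; apply: eq_bigr => k _; rewrite !mxE.
rewrite -mulmxA mxE.
have E1 : \sum_m' (\sum_l christoffel i l a b y * jac i j l m' y) * (g *m (J y)^T) m' c =
    chr1 i a b c y.
  rewrite -(metric_christoffel (ov_src ov) a b c Qy).
  under eq_bigr => m' _ do rewrite mulr_suml.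
  rewrite exchange_big; apply: eq_bigr => l _ /=.
  rewrite (metric_symE c l (lb_sub (ov_src ov) Qy)) metric_jac // -mulmxA mxE mulr_suml.
  apply: eq_bigr => m' _; rewrite -/g [J y l m']mxE.
  by move: (christoffel _ _ _ _ _) (jac _ _ _ _ _) ((g *m _) _ _) => u v w; ring.
have E2 : \sum_m' djac i j a b m' y * (g *m (J y)^T) m' c = jac_corr y a b c.
  apply: eq_bigr => m' _; rewrite gJ mulr_sumr; apply: eq_bigr => k _.
  by rewrite mulrA.
have E3 : \sum_m' (\sum_k jac i j a k y * \sum_l christoffel j m' k l (phi y) * jac i j b l y)
    * (g *m (J y)^T) m' c = jac3 (fun l m k => chr1 j l m k (phi y)) y a b c.
  under eq_bigr => m' _ do rewrite mulr_suml.
  rewrite exchange_big; apply: eq_bigr => k _ /=.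
  under eq_bigr => m' _ do rewrite -mulrA mulr_suml mulr_sumr.
  rewrite exchange_big; apply: eq_bigr => l _ /=.
  under [RHS]eq_bigr => q _ do rewrite -(metric_christoffel (ov_tgt ov) k l q Qj) mulr_sumr.
  rewrite [RHS]exchange_big; apply: eq_bigr => m' _ /=.
  rewrite gJ !mulr_sumr; apply: eq_bigr => q _.
  rewrite (metric_symE q m' jx) -/g.
  by move: (christoffel _ _ _ _ _) (g _ _) (jac _ _ _ _ _) (jac _ _ _ _ _)
    (jac _ _ _ _ _) => u v w x z; ring.
transitivity (chr1 i a b c y - (jac_corr y a b c +
    jac3 (fun l m k => chr1 j l m k (phi y)) y a b c)).
  rewrite -E1 -E2 -E3 -big_split -sumrB; apply: eq_bigr => m' _ /=.
  by rewrite mxE mulrBl mulrDl.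
by rewrite chr1_jac // subrr.
Qed.

(* Acts on the right on the rows (f, df), from the chart j to the chart i. *)
Definition gauge y : 'M[R]_(1 + d.+1) := block_mx (1%:M : 'M[R]_1) 0 0 (J y)^T.

Lemma gauge_e0 y : gauge y *m e0 = e0 :> 'cV[R]_(1 + d.+1).
Proof. by rewrite /gauge /e0 mul_block_col !mulmx0 mul0mx mulmx1 !addr0. Qed.

Lemma gauge_unit y : Q y -> gauge y \in unitmx.
Proof.
by move=> Qy; rewrite unitmxE det_ublock det1 mul1r -unitmxE unitmx_tr jac_unit.
Qed.

Lemma gauge_gram y : Q y ->
  (gauge y)^T *m gram_mx kappa j (phi y) *m gauge y = gram_mx kappa i y.
Proof.
move=> Qy; rewrite /gauge /gram_mx tr_block_mx !mulmx_block.
rewrite !(trmx0, trmx1, mul0mx, mulmx0, addr0, add0r, mulmx1, mul1mx) trmxK.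
by rewrite -scalemxAr -scalemxAl -metric_jac.
Qed.

Lemma gauge_qd : QDm vdisp Q gauge
  (fun a y => block_mx (0 : 'M[R]_1) 0 0 (\matrix_(b, c) djac i j a b c y)^T).
Proof.
apply: qdm_block; [exact: qdm_cst..|].
move=> a b; apply: qd_ext (ov_jac ov b a) => [x|c x] _; by rewrite !mxE.
Qed.

(** The two connection matrices differ by a gauge transformation; the inhomogeneous term is the
    derivative of [gauge], and the lower right block is [christoffel_jac]. *)
Lemma gauge_conn a y : Q y ->
  gauge y *m conn kappa i a y =
  (\sum_b jac i j a b y *: conn kappa j b (phi y)) *m gauge y +
  block_mx (0 : 'M[R]_1) 0 0 (\matrix_(b, c) djac i j a b c y)^T.
Proof.
move=> Qy; have Qj := ov_map ov Qy; have jx := lb_sub (ov_tgt ov) Qj.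
have -> : \sum_b jac i j a b y *: conn kappa j b (phi y) =
   block_mx (0 : 'M[R]_1) (- kappa *: (row a (J y) *m metric j (phi y)))
     (row a (J y))^T (\sum_b jac i j a b y *:
       \matrix_(l, c) christoffel j l b c (phi y)).
  have blk (I : Type) (s : seq I) (c : I -> R) (A : I -> 'M[R]_1) B C D :
      \sum_(b <- s) c b *: block_mx (A b) (B b) (C b) (D b : 'M[R]_d.+1) =
      block_mx (\sum_(b <- s) c b *: A b) (\sum_(b <- s) c b *: B b)
        (\sum_(b <- s) c b *: C b) (\sum_(b <- s) c b *: D b).
    elim: s => [|b s ih]; first by rewrite !big_nil block_mx0.
    by rewrite !big_cons ih scale_block_mx add_block_mx.
  apply: etrans (blk _ _ _ _ _ _ _) _; apply: f_equal4 => //.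
  - by rewrite big1 // => b _; rewrite scaler0.
  - rewrite mulmx_sum_row scaler_sumr; apply: eq_bigr => b _.
    by rewrite scalerA mulrC -scalerA !mxE.
  - apply/colP => l; rewrite summxE !mxE (bigD1 l) //= big1 => [|b bl]; rewrite !mxE.
      by rewrite eqxx mulr1 addr0.
    by rewrite eq_sym (negPf bl) mulr0.
rewrite /gauge /conn !mulmx_block add_block_mx.
rewrite !(mul0mx, mulmx0, addr0, add0r, mulmx1, mul1mx).
apply: f_equal4 => //.
- rewrite -scalemxAl -mulmxA; congr (_ *: _).
  by rewrite (metric_jac Qy) -mulmxA row_mul.
- by rewrite -colE; apply/colP => l; rewrite !mxE.
- apply/matrixP => m c.
  have H := christoffel_jac a c m Qy.
  transitivity (\sum_l christoffel i l a c y * jac i j l m y).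
    by rewrite mxE; apply: eq_bigr => l _; rewrite !mxE mulrC.
  rewrite H addrC mxE; congr (_ + _); last by rewrite !mxE.
  rewrite mulmx_suml summxE; apply: eq_bigr => k _.
  rewrite -scalemxAl mxE; congr (_ * _); rewrite mxE; apply: eq_bigr => l _.
  by rewrite !mxE.
Qed.

Lemma sol_transfer m (S : vec -> 'M[R]_(m, 1 + d.+1)) :
  sol kappa j (box (phi y0) r2) S ->
  sol kappa i Q (fun y => S (phi y) *m gauge y).
Proof.
move=> hS; have sm := lb_small (ov_src ov).
have h1 := qdm_comp sm (ov_map ov) (ov_qd ov) hS.
apply: qdm_ext (qdm_mul sm h1 gauge_qd) => // a y Qy.
rewrite -mulmxA gauge_conn // mulmxDr; congr (_ + _); rewrite mulmxA; congr (_ *m _).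
rewrite mulmx_sumr; apply: eq_bigr => b _; rewrite -scalemxAr.
by rewrite mxE.
Qed.

End law.
End chart_change.

(** * Frames of local solutions *)

Section frames.
Context {R : realType} {d : nat} (M : riemannian_manifold R d) (kappa : R)
  (curv : constant_curvature M kappa).
Local Notation vec := 'rV[R]_d.+1.
Local Notation cvec := 'cV[R]_(1 + d.+1).
Local Notation "'MN'" := 'M[R]_(1 + d.+1).
Local Notation sol := (sol kappa).
Local Notation gram_mx := (gram_mx kappa).
Implicit Types (i j : chart_idx M) (y : vec) (H L : MN) (F : M -> cvec).

Lemma box_nbhd (y0 y1 : vec) (r : R) : box y0 r y1 ->
  exists2 r1 : R, 0 < r1 & box y1 r1 `<=` box y0 r.
Proof.
move=> [h1 h2].
have hp a : exists2 r1 : R, 0 < r1 &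
    forall x : R, `|x - y1 0 a| < r1 -> `|x - y0 0 a| < r.
  exists (r - `|y1 0 a - y0 0 a|) => [|x hx]; first by rewrite subr_gt0.
  rewrite -(subrK (y1 0 a) x) -addrA.
  by apply: le_lt_trans (ler_normD _ _) _; lra.
have [r1 /andP[r1_gt0 _] h] := @common_radius R 'I_d.+1
  (fun a r1 => forall x : R, `|x - y1 0 a| < r1 -> `|x - y0 0 a| < r) 1 ltr01
  (fun _ _ _ _ rr h x hx => h x (lt_le_trans hx rr)) hp.
by exists r1 => // y [b1 b2]; split => // a; apply: h.
Qed.

Lemma local_box_sub i y0 y1 r r1 : 0 < r1 -> box y0 r y1 -> box y1 r1 `<=` box y0 r ->
  local_box i y0 r -> local_box i y1 r1.
Proof.
move=> r10 y1Q s [h1 h2 h3 h4 h5 h6 h7 [C h8]]; split => //.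
- exact: h3.
- exact: subset_trans h3.
- exact: small_subset h4.
- by move=> b c; exact: qd_subset (h5 b c).
- by move=> a b c; exact: qd_subset (h6 a b c).
- by move=> l a b; exact: qd_subset (h7 l a b).
- by exists C => y /s; exact: h8.
Qed.

(** The bound [2^-1] makes [Psi y] invertible with a uniform bound on the inverse, by
    [unit_near1]. *)
Record std_frame i (y0 : vec) (r : R) (Psi : vec -> MN) : Prop := StdFrame {
  sf_box : local_box i y0 r;
  sf_sol : sol i (box y0 r) Psi;
  sf_one : Psi y0 = 1%:M;
  sf_near : forall y, box y0 r y -> nrm (Psi y - 1%:M) <= 2^-1
}.

Lemma std_frame_exists i y0 : chart_image i y0 -> exists r Psi, std_frame i y0 r Psi.
Proof.
move=> iy; have [r lb] := local_box_exists iy.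
have [eps eps0 h] := local_frame (lb_small lb) (conn_qd kappa lb)
  (fun y a b Qy => conn_flat lb curv a b Qy).
have n0 : 0 < d.+1%:R :> R by rewrite ltr0n.
have r0 := lb_gt0 lb.
pose r' := Num.min r (eps / d.+1%:R).
have r'0 : 0 < r' by rewrite lt_min r0 divr_gt0.
have rr : r' <= r by rewrite ge_min lexx.
have lb' := local_box_le r'0 rr lb.
have [||||Psi [p1 p2 p3]] := h (box y0 r') y0.
- exact: box_le.
- exact: box_convex.
- exact: local_box_mem lb'.
- move=> y [hy _]; rewrite -[leRHS](mulfVK (lt0r_neq0 n0)) mulrC.
  have := @nrm_le_entries _ _ _ (y - y0) (eps / d.+1%:R).
  rewrite mul1n; apply => k a; rewrite (ord1 k) !mxE; apply: ltW.
  by apply: lt_le_trans (hy a) _; rewrite ge_min lexx orbT.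
by exists r', Psi.
Qed.

Section std.
Context i y0 r (Psi : vec -> MN) (sf : std_frame i y0 r Psi).
Local Notation Q := (box y0 r).

Lemma sf_unit y : Q y -> Psi y \in unitmx.
Proof. by move=> Qy; have [] := unit_near1 (sf_near sf Qy). Qed.

Lemma sf_inv : QDm vdisp Q (invmx \o Psi) (fun a y => - (conn kappa i a y *m invmx (Psi y))).
Proof.
have sm := lb_small (sf_box sf).
apply: qdm_ext (qdm_inv (X := invmx \o Psi) (C := 2 * nrm (1%:M : MN)) sm (sf_sol sf) _ _).
- by [].
- by move=> a y Qy; rewrite /= mulmxA mulVmx ?sf_unit // mul1mx.
- by move=> y Qy; rewrite /= mulVmx // sf_unit.
- by move=> y Qy; have [] := unit_near1 (sf_near sf Qy).
Qed.

(** By the product rule [S] times the inverse of [Psi] has derivative 0, and the box is convex. *)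
Lemma sol_const m y1 r1 (S : vec -> 'M[R]_(m, 1 + d.+1)) : box y1 r1 `<=` Q ->
  sol i (box y1 r1) S -> exists L : 'M[R]_(m, 1 + d.+1), forall y, box y1 r1 y -> S y = L *m Psi y.
Proof.
move=> s hS; have [ne|ne] := pselect (exists y, box y1 r1 y); last first.
  by exists 0 => y Qy; exfalso; apply: ne; exists y.
have [yy Qyy] := ne; exists (S yy *m invmx (Psi yy)) => y Qy.
have sm := small_subset s (lb_small (sf_box sf)).
have hc : QDm vdisp (box y1 r1) (fun y => S y *m (invmx \o Psi) y) (fun _ _ => 0).
  apply: qdm_ext (qdm_mul sm hS (qdm_subset s sf_inv)) => // a x Qx /=.
  by rewrite mulmxN mulmxA subrr.
rewrite (qdm0_const (@box_convex _ _ _ _) hc Qyy Qy) /= mulmxKV //.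
exact/sf_unit/s.
Qed.

(** The form [T], transported back by [Psi], has derivative 0 by [conn_gram], and
    [Psi y0 = 1%:M]. *)
Lemma sf_gram y : Q y -> (Psi y)^T *m gram_mx i y0 *m Psi y = gram_mx i y.
Proof.
move=> Qy; have sm := lb_small (sf_box sf).
pose T y := (invmx (Psi y))^T *m gram_mx i y *m invmx (Psi y).
have hc : QDm vdisp Q T (fun _ _ => 0).
  apply: qdm_ext (qdm_mul sm (qdm_mul sm (qdm_tr sf_inv) (gram_qd kappa (sf_box sf)))
    sf_inv) => // a x Qx /=.
  rewrite -(conn_gram kappa (sf_box sf) a Qx) linearN /= trmx_mul mulNmx mulmxN.
  rewrite mulmxDr !mulmxA addrA addNr add0r.
  by rewrite subrr.
have E := qdm0_const (@box_convex _ _ _ _) hc (local_box_mem (sf_box sf)) Qy.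
have {}E : gram_mx i y0 = T y.
  by rewrite -E /T (sf_one sf) invmx1 trmx1 mul1mx mulmx1.
rewrite E /T !mulmxA -trmx_mul mulVmx ?sf_unit // trmx1 mul1mx mulmxKV //.
exact: sf_unit.
Qed.

End std.

(** By [conn_e0] the other columns are the partial derivatives of the first one. *)
Lemma sol_first_col m i y0 r (S S' : vec -> 'M[R]_(m, 1 + d.+1)) : local_box i y0 r ->
  sol i (box y0 r) S -> sol i (box y0 r) S' ->
  (forall y, box y0 r y -> S y *m e0 = S' y *m e0) ->
  forall y, box y0 r y -> S y = S' y.
Proof.
move=> lb hS hS' E y Qy; have sm := lb_small lb.
have c0 (A : 'M[R]_(m, 1 + d.+1)) : A *m e0 = col (lshift d.+1 0) A.
  rewrite colE; congr (_ *m _); rewrite /e0; apply/matrixP => p q.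
  have [k ->|k ->] := @split_ordP 1 d.+1 p.
    by rewrite col_mxEu !mxE (ord1 q) (ord1 k) !eqxx.
  by rewrite col_mxEd !mxE eq_rlshift.
have hc (A : vec -> 'M[R]_(m, 1 + d.+1)) : sol i (box y0 r) A ->
    QDm vdisp (box y0 r) (fun y => A y *m e0)
      (fun a y => A y *m col_mx (0 : 'M[R]_1) (delta_mx a 0)).
  move=> hA; apply: qdm_ext (qdm_mul sm hA (qdm_cst vdisp _ e0)) => // a x _.
  by rewrite mulmx0 addr0 -mulmxA conn_e0.
have cs (A : 'M[R]_(m, 1 + d.+1)) a :
    A *m col_mx (0 : 'M[R]_1) (delta_mx a 0) = col (rshift 1 a) A.
  rewrite colE; congr (_ *m _); apply/matrixP => p q.
  have [k ->|k ->] := @split_ordP 1 d.+1 p.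
    by rewrite col_mxEu !mxE eq_lrshift.
  by rewrite col_mxEd !mxE eq_rshift.
apply/matrixP => k l.
have [l' ->|a ->] := @split_ordP 1 d.+1 l.
  rewrite (ord1 l'); have := E y Qy; rewrite !c0 => /matrixP /(_ k 0).
  by rewrite !mxE.
have h2 := qdm_ext (fun x Qx => esym (E x Qx)) (fun _ _ _ => erefl) (hc _ hS').
have := qd_unique a (hc _ hS k 0) (h2 k 0) Qy.
by rewrite !cs !mxE.
Qed.

(* The rows of S are solutions (f, omega) and the entries of F are the f. *)
Definition germ_at H F i (y1 : vec) (r : R) (S : vec -> MN) : Prop :=
  [/\ local_box i y1 r, sol i (box y1 r) S,
      forall y, box y1 r y -> F (inv i y) = S y *m e0,
      S y1 \in unitmx & (S y1)^T *m H *m S y1 = gram_mx i y1].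

Definition frame H F (p : M) : Prop :=
  forall i, dom i p -> exists r S, germ_at H F i (coord i p) r S.

(** One chart is enough: the gauge matrix carries the germ to any other chart and fixes [e0], hence
    [F]. *)
Lemma frame_chart H F p i r S : dom i p -> germ_at H F i (coord i p) r S -> frame H F p.
Proof.
move=> ip [lb hS hF uS gS] j jp.
have [r' ov] := overlap_exists jp ip lb.
have phip : transition j i (coord j p) = coord i p by rewrite /transition coordK.
have mp := local_box_mem (ov_src ov).
exists r', (fun y => S (transition j i y) *m gauge j i y); split.
- exact: ov_src ov.
- by apply: (sol_transfer ov); rewrite phip.
- move=> y Qy; have [_ _ _ <-] := overlapP (ov_sub ov Qy).
  rewrite hF -?mulmxA ?gauge_e0 // -phip; exact: (ov_map ov Qy).
- by rewrite phip unitmx_mul uS (gauge_unit ov mp).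
- rewrite phip trmx_mul -(gauge_gram kappa ov mp) phip -gS.
  by rewrite !mulmxA.
Qed.

Section std_frames.
Context i y0 r (Psi : vec -> MN) (sf : std_frame i y0 r Psi).
Local Notation Q := (box y0 r).

(** Here [L] may depend on the point [y1]; that it does not on the interior points of a box is shown
    in [std_develop], by connectedness. *)
Lemma frame_std H F y1 : Q y1 -> frame H F (inv i y1) ->
  exists L r1, [/\ L \in unitmx, L^T *m H *m L = gram_mx i y0, 0 < r1,
    box y1 r1 `<=` Q & forall y, box y1 r1 y -> F (inv i y) = L *m Psi y *m e0].
Proof.
move=> Qy1 fr; have [iy yE] := inv_chart (lb_sub (sf_box sf) Qy1).
have [r2 [S [lb hS hF uS gS]]] := fr i iy.
rewrite yE in lb hS hF uS gS.
have [r3 r30 s3] := box_nbhd Qy1.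
have r20 := lb_gt0 lb.
pose r1 := Num.min r2 r3; have r10 : 0 < r1 by rewrite lt_min r20.
have s12 : box y1 r1 `<=` box y1 r2 by apply: box_le; rewrite ge_min lexx.
have s1 : box y1 r1 `<=` Q.
  by apply: subset_trans s3; apply: box_le; rewrite ge_min lexx orbT.
have [L hL] := sol_const sf s1 (sol_subset s12 hS).
have y11 : box y1 r1 y1 by apply: box_center => //; exact: box_half Qy1.
exists L, r1; split => //.
- by move: uS; rewrite hL // unitmx_mul => /andP[].
- have uP := sf_unit sf Qy1.
  move: gS; rewrite hL // -(sf_gram sf Qy1) trmx_mul !mulmxA => gS.
  apply: (can_inj (mulmxK uP)).
  have uP' : (Psi y1)^T \in unitmx by rewrite unitmx_tr.
  by apply: (can_inj (mulKmx uP')); rewrite !mulmxA.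
- by move=> y Qy; rewrite hF ?hL //; exact: s12.
Qed.

Lemma std_is_frame H F L y1 r1 : Q y1 -> 0 < r1 -> L \in unitmx ->
  L^T *m H *m L = gram_mx i y0 ->
  (forall y, Q y -> box y1 r1 y -> F (inv i y) = L *m Psi y *m e0) ->
  frame H F (inv i y1).
Proof.
move=> Qy1 r10 uL gL hF; have [iy yE] := inv_chart (lb_sub (sf_box sf) Qy1).
have [r2 r20 s2] := box_nbhd Qy1.
pose r3 := Num.min r1 r2; have r30 : 0 < r3 by rewrite lt_min r10.
have s3 : box y1 r3 `<=` Q.
  by apply: subset_trans s2; apply: box_le; rewrite ge_min lexx orbT.
have s31 : box y1 r3 `<=` box y1 r1 by apply: box_le; rewrite ge_min lexx.
apply: (frame_chart (i := i) (r := r3) (S := fun y => L *m Psi y)) => //; rewrite yE.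
have sm := small_subset s3 (lb_small (sf_box sf)).
split.
- exact: local_box_sub (sf_box sf).
- by apply: sol_mul => //; exact: sol_subset (sf_sol sf).
- by move=> y Qy; apply: hF; [exact: s3|exact: s31].
- by rewrite unitmx_mul uL (sf_unit sf Qy1).
- by rewrite -(sf_gram sf Qy1) -gL trmx_mul !mulmxA.
Qed.

Lemma std_unique (L L' : MN) y1 r1 : 0 < r1 -> Q y1 -> box y1 r1 `<=` Q ->
  (forall y, box y1 r1 y -> L *m Psi y *m e0 = L' *m Psi y *m e0) -> L = L'.
Proof.
move=> r10 Qy1 s h.
have lb := local_box_sub r10 Qy1 s (sf_box sf).
have hs (A : MN) : sol i (box y1 r1) (fun y => A *m Psi y).
  by apply: sol_mul; [exact: lb_small lb|exact: sol_subset (sf_sol sf)].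
have E := sol_first_col lb (hs L) (hs L') h (local_box_mem lb).
exact: (can_inj (mulmxK (sf_unit sf Qy1)) E).
Qed.

End std_frames.
End frames.

(** * Frames along geodesics *)

Section time_calculus.
Context {R : realType}.
Implicit Types (T : set R) (s t c : R).

Definition td T (f f1 : R -> R) : Prop := QD tdisp T f (fun=> f1).
Definition tdm T {m k} (X X1 : R -> 'M[R]_(m, k)) : Prop := QDm tdisp T X (fun=> X1).

Definition unit_int : set R := [set t | 0 <= t <= 1].
Definition tnear T t (e : R) : set R := [set s | T s /\ `|s - t| < e].
Definition order_convex T : Prop := forall r s t, T r -> T t -> r <= s <= t -> T s.

Lemma nrm_tdisp t t' : nrm (tdisp t t') = `|t' - t|.
Proof. by rewrite /nrm !big_ord1 mxE eqxx mulr1n. Qed.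

Lemma tdisp_entry t t' (a : 'I_1) : tdisp t t' 0 a = t' - t.
Proof. by rewrite (ord1 a) mxE eqxx mulr1n. Qed.

Lemma small_unit_int T : T `<=` unit_int -> small tdisp T.
Proof.
move=> s t t' /s /andP[? ?] /s /andP[? ?]; rewrite nrm_tdisp ler_norml.
by apply/andP; split; lra.
Qed.

Lemma tnear_sub T t e : tnear T t e `<=` T.
Proof. by move=> s []. Qed.

Lemma tnear_le T t e e' : e <= e' -> tnear T t e `<=` tnear T t e'.
Proof. by move=> ee s [Ts st]; split => //; exact: lt_le_trans ee. Qed.

Lemma tnear_mono T T' t e : T `<=` T' -> tnear T t e `<=` tnear T' t e.
Proof. by move=> TT s [Ts st]; split => //; exact: TT. Qed.

Lemma td_intro T f f1 C : (forall t, T t -> [/\ `|f t| <= C, `|f1 t| <= C &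
    forall t', T t' -> `|f t' - f t - f1 t * (t' - t)| <= C * (t' - t) ^+ 2]) ->
  td T f f1.
Proof.
move=> h; exists C => t Tt; have [h1 h2 h3] := h t Tt; split => // t' Tt'.
by rewrite big_ord1 tdisp_entry nrm_tdisp real_normK ?num_real // h3.
Qed.

Lemma td_elim T f f1 : td T f f1 -> exists2 C : R, 0 <= C &
  forall t, T t -> [/\ `|f t| <= C, `|f1 t| <= C &
    forall t', T t' -> `|f t' - f t - f1 t * (t' - t)| <= C * (t' - t) ^+ 2].
Proof.
move=> /qd_const[C C0 h]; exists C => // t Tt; have [h1 h2 h3] := h t Tt; split => //.
  exact: (h2 0).
move=> t' Tt'; have := h3 t' Tt'.
by rewrite big_ord1 tdisp_entry nrm_tdisp real_normK ?num_real.
Qed.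

Lemma td_affine T B (f f1 : R -> R) (k b : R) : td B f f1 ->
  (forall t, T t -> B (k * t + b)) ->
  td T (fun t => f (k * t + b)) (fun t => k * f1 (k * t + b)).
Proof.
move=> /td_elim[C C0 h] TB.
have kk : 0 <= `|k| by [].
have q0 : 0 <= `|k| * C by rewrite mulr_ge0.
have q1 : 0 <= k ^+ 2 * C by rewrite mulr_ge0 // sqr_ge0.
apply: (@td_intro _ _ _ (C + `|k| * C + k ^+ 2 * C)) => t Tt.
have [h1 h2 h3] := h _ (TB _ Tt); split.
- by lra.
- by rewrite normrM; have := ler_wpM2l kk h2; lra.
- move=> t' Tt'; have := h3 _ (TB _ Tt').
  have -> : k * t' + b - (k * t + b) = k * (t' - t) by ring.
  rewrite mulrA [f1 _ * k]mulrC => H; apply: le_trans H _.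
  rewrite exprMn mulrA ler_wpM2r ?sqr_ge0 //; rewrite mulrC; lra.
Qed.

Lemma td_subset T T' f f1 : T' `<=` T -> td T f f1 -> td T' f f1.
Proof. exact: qd_subset. Qed.

Lemma tdm_affine T B m k (X X1 : R -> 'M[R]_(m, k)) (a b : R) : tdm B X X1 ->
  (forall t, T t -> B (a * t + b)) ->
  tdm T (fun t => X (a * t + b)) (fun t => a *: X1 (a * t + b)).
Proof.
move=> h TB i j.
apply: qd_ext (td_affine (h i j) TB) => // u t _; by rewrite mxE.
Qed.

Lemma td0_const T f : order_convex T ->
  (forall t, T t -> exists2 e : R, 0 < e & td (tnear T t e) f (fun=> 0)) ->
  forall s t, T s -> T t -> f s = f t.
Proof.
move=> cT h.
suff H s t : T s -> T t -> s <= t -> f s = f t.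
  by move=> s t Ts Tt; have [st|/ltW ts] := leP s t; [exact: H|apply/esym/H].
move=> Ts Tt st.
have Tr r : s <= r <= t -> T r by exact: cT.
pose P r := f s = f r.
apply: (@real_step _ P s t st _ _ t) => //; last by rewrite st lexx.
move=> r rst; have [e e0 /td_elim[C C0 hC]] := h r (Tr r rst).
exists e => // r1 r2 sr1 r12 r2t n1 n2; rewrite /P => ->.
have m x : r1 <= x -> x <= r2 -> tnear T r e x.
  move=> x1 x2; split; first by apply: Tr; rewrite (le_trans sr1) //= (le_trans x2).
  by move: n1 n2; rewrite !ltr_norml => /andP[? ?] /andP[? ?]; apply/andP; split; lra.
have est x y : r1 <= x -> x <= y -> y <= r2 -> `|f y - f x| <= C * (y - x) ^+ 2.
  move=> x1 xy y2; have [_ _ /(_ y)] := hC x (m x x1 (le_trans xy y2)).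
  rewrite mul0r subr0; apply; apply: m => //; exact: le_trans xy.
apply/eqP; rewrite eq_le; apply/andP; split.
  apply: (@mono_quad _ f r1 r2 C) => // x y x1 xy y2.
  by have := est x y x1 xy y2; rewrite ler_norml => /andP[]; lra.
rewrite -lerN2; apply: (@mono_quad _ (fun x => - f x) r1 r2 C) => // x y x1 xy y2.
by have := est x y x1 xy y2; rewrite ler_norml => /andP[]; lra.
Qed.

(** Only [1 + x <= expR x] is used, from both ends: the remainder lies between 0 and
    [(expR t' - expR t) * (t' - t)], which is quadratic on a bounded interval. *)
Lemma td_expR (A : R) : td [set t | `|t| <= A] expR expR.
Proof.
have [A0|A0] := leP 0 A; last first.
  by exists 0 => t /= h; have := le_lt_trans h A0; rewrite normr_lt0.
have E t : `|t| <= A -> `|expR t| <= expR A.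
  by move=> /ler_normlP[_ h]; rewrite ger0_norm ?expR_ge0 // ler_expR.
have low t t' : expR t * (t' - t) <= expR t' - expR t.
  have := expR_ge1Dx (t' - t); rewrite -(ler_pM2l (expR_gt0 t)) -expRD.
  by rewrite [t + _]addrC subrK mulrDr mulr1; lra.
apply: (@td_intro _ _ _ (expR A)) => t /= tA; split; [exact: E..|].
move=> t' /= t'A; have l1 := low t t'; have l2 := low t' t.
rewrite ger0_norm; last by rewrite subr_ge0.
apply: (@le_trans _ _ ((expR t' - expR t) * (t' - t))); first by rewrite mulrBl; lra.
have E1 := E _ tA; have E2 := E _ t'A.
rewrite !ger0_norm ?expR_ge0 // in E1 E2.
have [tt|/ltW tt] := leP t t'.
  rewrite expr2 mulrA ler_wpM2r ?subr_ge0 //.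
  apply: (@le_trans _ _ (expR t' * (t' - t))); first by lra.
  by rewrite ler_wpM2r ?subr_ge0.
rewrite -mulrNN opprB expr2 -[(t' - t) * _]mulrNN opprB mulrA ler_wpM2r ?subr_ge0 //.
apply: (@le_trans _ _ (expR t * (t - t'))); first by lra.
by rewrite ler_wpM2r ?subr_ge0.
Qed.

(* The solutions of x'' = c x with initial data (1, 0) and (0, 1). *)
Definition cs c t : R :=
  if c == 0 then 1 else (expR (Num.sqrt c * t) + expR (- (Num.sqrt c * t))) / 2.
Definition sn c t : R :=
  if c == 0 then t
  else (expR (Num.sqrt c * t) - expR (- (Num.sqrt c * t))) / (2 * Num.sqrt c).

Lemma cs0 c : cs c 0 = 1.
Proof. by rewrite /cs; case: eqP => // _; rewrite mulr0 oppr0 expR0; field. Qed.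

Lemma sn0 c : sn c 0 = 0.
Proof. by rewrite /sn; case: eqP => // _; rewrite mulr0 oppr0 expR0 subrr mul0r. Qed.

Lemma csN c t : cs c (- t) = cs c t.
Proof. by rewrite /cs; case: eqP => // _; rewrite mulrN opprK addrC. Qed.

Lemma snN c t : sn c (- t) = - sn c t.
Proof. by rewrite /sn; case: eqP => // _; rewrite mulrN opprK -[in LHS]opprB mulNr. Qed.

Section nonneg.
Context (c : R) (c0 : 0 <= c).

Lemma sqrt_gt0 : c != 0 -> 0 < Num.sqrt c.
Proof. by move=> cn; rewrite sqrtr_gt0 lt_neqAle eq_sym cn. Qed.

Lemma cs_sn t : cs c t ^+ 2 - c * sn c t ^+ 2 = 1.
Proof.
rewrite /cs /sn; case: eqVneq => [->|cn]; first by ring.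
move: (sqr_sqrtr c0) (sqrt_gt0 cn); move: (Num.sqrt c) => th <- r0; rewrite expRN.
have := expR_gt0 (th * t); move: (expR _) => u u0.
by field; rewrite !gt_eqF.
Qed.

Lemma cs_ge1 t : 1 <= cs c t.
Proof.
rewrite /cs; case: eqP => // _; rewrite ler_pdivlMr // mul1r.
have := expR_ge1Dx (Num.sqrt c * t); have := expR_ge1Dx (- (Num.sqrt c * t)); lra.
Qed.

Lemma sn_lt s t : s < t -> sn c s < sn c t.
Proof.
rewrite /sn; case: eqVneq => // cn st; have r0 := sqrt_gt0 cn.
rewrite ltr_pM2r ?invr_gt0 ?mulr_gt0 //.
have h : Num.sqrt c * s < Num.sqrt c * t by rewrite ltr_pM2l.
have := h; rewrite -ltr_expR; have : - (Num.sqrt c * t) < - (Num.sqrt c * s) by rewrite ltrN2.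
move=> h1; rewrite -ltr_expR in h1; lra.
Qed.

Lemma sn_le s t : s <= t -> sn c s <= sn c t.
Proof. by rewrite le_eqVlt => /orP[/eqP->//|/sn_lt/ltW]. Qed.

Lemma sn_gt0 t : 0 < t -> 0 < sn c t.
Proof. by move=> /sn_lt; rewrite sn0. Qed.

Lemma sn_ge0 t : 0 <= t -> 0 <= sn c t.
Proof. by move=> /sn_le; rewrite sn0. Qed.

Lemma td_id T (A : R) : T `<=` [set t | `|t| <= A] -> td T (fun t => t) (fun=> 1).
Proof.
move=> TA; apply: (@td_intro _ _ _ (`|A| + 1)) => t /TA /= tA; split.
- by apply: le_trans tA _; have := ler_norm A; lra.
- by rewrite normr1 lerDr.
- by move=> t' _; rewrite mul1r subrr normr0 mulr_ge0 ?sqr_ge0 ?addr_ge0.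
Qed.

Lemma td_exp_scale A (k : R) :
  td [set t | `|t| <= A] (fun t => expR (k * t)) (fun t => k * expR (k * t)).
Proof.
have := @td_affine [set t | `|t| <= A] [set t | `|t| <= `|k| * A] expR expR k 0 (td_expR _).
have -> : (fun t => expR (k * t + 0)) = (fun t => expR (k * t)).
  by apply: funext => t; rewrite addr0.
have -> : (fun t => k * expR (k * t + 0)) = (fun t => k * expR (k * t)).
  by apply: funext => t; rewrite addr0.
by apply => t /= tA; rewrite addr0 normrM ler_wpM2l.
Qed.

Lemma cs_sn_td A : td [set t | `|t| <= A] (cs c) (fun t => c * sn c t) /\
  td [set t | `|t| <= A] (sn c) (cs c).
Proof.
have [cz|cn] := eqVneq c 0.
  split; last first.
    have := @td_id [set t | `|t| <= A] A (fun _ h => h).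
    apply: qd_ext => [t|a t] _; first by rewrite /sn cz eqxx.
    by rewrite /cs cz eqxx.
  apply: qd_ext (qd_cst tdisp [set t | `|t| <= A] 1) => [t|a t] _.
    by rewrite /cs cz eqxx.
  by rewrite cz mul0r.
have r0 := sqrt_gt0 cn; have e1 := td_exp_scale A (Num.sqrt c).
have e2 := td_exp_scale A (- Num.sqrt c).
split.
- apply: qd_ext (qd_scale 2^-1 (qd_add e1 e2)) => [t|a t] _ /=.
    by rewrite /cs (negPf cn) mulNr mulrC.
  rewrite /sn (negPf cn) !mulNr.
  move: (sqr_sqrtr c0) r0; move: (Num.sqrt c) => th <- r0.
  by move: (expR _) (expR _) => u v; field; rewrite gt_eqF.
- apply: qd_ext (qd_scale (2 * Num.sqrt c)^-1 (qd_sub e1 e2)) => [t|a t] _ /=.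
    by rewrite /sn (negPf cn) mulNr mulrC.
  rewrite /cs (negPf cn) !mulNr.
  by move: (expR _) (expR _) => u v; field; rewrite gt_eqF.
Qed.

(** The equation X'' = c X, with error bounds that are only local in time. *)
Definition ode T {m k} (X X1 : R -> 'M[R]_(m, k)) : Prop :=
  forall t, T t -> exists2 e : R, 0 < e &
    tdm (tnear T t e) X X1 /\ tdm (tnear T t e) X1 (fun s => c *: X s).

(** The combinations in [K1] and [K2] are constants of the motion, and [cs_sn] inverts the linear
    system that they form. This also gives uniqueness of solutions. *)
Lemma ode_formula T m k (X X1 : R -> 'M[R]_(m, k)) : order_convex T ->
  T `<=` unit_int -> ode T X X1 -> forall s t, T s -> T t ->
  X t = cs c (t - s) *: X s + sn c (t - s) *: X1 s /\
  X1 t = (c * sn c (t - s)) *: X s + cs c (t - s) *: X1 s.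
Proof.
move=> cT T01 hX s t Ts Tt.
suff H i j : X t i j = cs c (t - s) * X s i j + sn c (t - s) * X1 s i j /\
    X1 t i j = (c * sn c (t - s)) * X s i j + cs c (t - s) * X1 s i j.
  by split; apply/matrixP => i j; have [h1 h2] := H i j; rewrite !mxE.
have [tc ts] := cs_sn_td 1.
have shift (f f1 : R -> R) : td [set t | `|t| <= 1] f f1 ->
    td T (fun r => f (r - s)) (fun r => f1 (r - s)).
  move=> hf; have := @td_affine T _ _ _ 1 (- s) hf.
  have TB r : T r -> [set t | `|t| <= 1] (1 * r - s).
    move=> /T01 /andP[? ?]; have /andP[? ?] := T01 _ Ts.
    by rewrite /= ler_norml; apply/andP; split; lra.
  move=> /(_ TB); apply: qd_ext => [r|a r] _; by rewrite !mul1r.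
have {}tc := shift _ _ tc; have {}ts := shift _ _ ts.
have K1 : X t i j * cs c (t - s) - X1 t i j * sn c (t - s) = X s i j.
  have := @td0_const T (fun t => X t i j * cs c (t - s) - X1 t i j * sn c (t - s)) cT.
  move=> /(_ _ s t Ts Tt); rewrite subrr cs0 sn0 mulr1 mulr0 subr0 => -> // r Tr.
  have [e e0 [x1 x2]] := hX r Tr; exists e => //.
  have sm : small tdisp (tnear T r e).
    by apply: small_unit_int; exact: subset_trans (@tnear_sub _ _ _) T01.
  apply: qd_ext (qd_sub (qd_mul sm (x1 i j) (td_subset (@tnear_sub _ _ _) tc))
    (qd_mul sm (x2 i j) (td_subset (@tnear_sub _ _ _) ts))) => // a x _.
  by rewrite mxE; ring.
have K2 : X1 t i j * cs c (t - s) - c * (X t i j * sn c (t - s)) = X1 s i j.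
  have := @td0_const T (fun t => X1 t i j * cs c (t - s) - c * (X t i j * sn c (t - s))) cT.
  move=> /(_ _ s t Ts Tt); rewrite subrr cs0 sn0 !mulr1 !mulr0 subr0 => -> // r Tr.
  have [e e0 [x1 x2]] := hX r Tr; exists e => //.
  have sm : small tdisp (tnear T r e).
    by apply: small_unit_int; exact: subset_trans (@tnear_sub _ _ _) T01.
  apply: qd_ext (qd_sub (qd_mul sm (x2 i j) (td_subset (@tnear_sub _ _ _) tc))
    (qd_scale c (qd_mul sm (x1 i j) (td_subset (@tnear_sub _ _ _) ts)))) => // a x _.
  by rewrite mxE; ring.
have := cs_sn (t - s); rewrite -K1 -K2.
move: (cs _ _) (sn _ _) (X _ _ _) (X1 _ _ _) => C S x x1 H; split.
- transitivity (x * (C ^+ 2 - c * S ^+ 2)); first by rewrite H mulr1.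
  by ring.
- transitivity (x1 * (C ^+ 2 - c * S ^+ 2)); first by rewrite H mulr1.
  by ring.
Qed.

(** An addition formula, obtained by solving the equation of [sn c (1 - t)] from its data at 0. *)
Lemma sn_rev t : 0 <= t <= 1 -> sn c (1 - t) = sn c 1 * cs c t - cs c 1 * sn c t.
Proof.
move=> t01; have [tc ts] := cs_sn_td 1.
have rev (f f1 : R -> R) : td [set t | `|t| <= 1] f f1 ->
    td unit_int (fun r => f (1 - r)) (fun r => - f1 (1 - r)).
  move=> hf; have := @td_affine unit_int _ _ _ (-1) 1 hf.
  have TB r : unit_int r -> [set t | `|t| <= 1] (-1 * r + 1).
    by move=> /andP[? ?]; rewrite /= ler_norml; apply/andP; split; lra.
  by move=> /(_ TB); apply: qd_ext => [r|a r] _; rewrite !mulN1r [_ + 1]addrC.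
have cU : order_convex unit_int.
  by move=> x y z /andP[? ?] /andP[? ?] /andP[? ?]; apply/andP; split; lra.
have h : ode unit_int (fun t => (sn c (1 - t))%:M : 'M[R]_1) (fun t => (- cs c (1 - t))%:M : 'M[R]_1).
  move=> r _; exists 1 => //; split => i j.
    apply: qd_ext (td_subset (@tnear_sub _ _ _) (rev _ _ ts)) => [x|a x] _;
    by rewrite !mxE (ord1 i) (ord1 j) eqxx mulr1n.
  apply: qd_ext (qd_opp (td_subset (@tnear_sub _ _ _) (rev _ _ tc))) => [x|a x] _;
  by rewrite !mxE (ord1 i) (ord1 j) eqxx mulr1n ?opprK.
have u0 : unit_int 0 by rewrite /unit_int /= lexx ler01.
have [+ _] := ode_formula cU (fun _ h => h) h u0 t01.
move=> /matrixP /(_ 0 0); rewrite !mxE eqxx !mulr1n !subr0; lra.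
Qed.

End nonneg.
End time_calculus.

(** * Pointwise derivatives of paths and Lipschitz bounds *)

Section time_derivatives.
Context {R : realType}.
Implicit Types (D T : set R) (s t : R).

Lemma derivable_within_est (W : normedModType R) D (f : R -> W) t :
  derivable_within D f t 1 -> forall eps : R, 0 < eps ->
  exists2 e : R, 0 < e & forall s, D s -> `|s - t| < e ->
    `|f s - f t - (s - t) *: derive_within D f 1 t| <= eps * `|s - t|.
Proof.
move=> /cvgrPdist_le h eps eps0; have := h _ eps0.
rewrite /incr /within /= => -[e /= e0 he]; exists e => // s Ds st.
have [->|sN] := eqVneq s t.
  by rewrite !subrr scale0r subrr !normr0 mulr0.
have hN : s - t != 0 by rewrite subr_eq0.
have hE : (s - t) *: (1 : R) + t = s by rewrite [_ *: _]mulr1 subrK.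
have := he (s - t); rewrite /ball_ /= sub0r normrN hE => /(_ st hN Ds).
rewrite /diff_quot hE => H.
have -> : f s - f t - (s - t) *: derive_within D f 1 t =
    - ((s - t) *: (derive_within D f 1 t - (s - t)^-1 *: (f s - f t))).
  by rewrite scalerBr scalerA divff // scale1r opprB.
by rewrite normrN normrZ mulrC ler_wpM2r.
Qed.

Lemma segment_mvt (f f1 : R -> R) s t : s <= t ->
  (forall r, s <= r <= t -> forall eps : R, 0 < eps -> exists2 e : R, 0 < e &
    forall x, s <= x <= t -> `|x - r| < e -> `|f x - f r - (x - r) * f1 r| <= eps * `|x - r|) ->
  exists2 r, s <= r <= t & f t - f s = f1 r * (t - s).
Proof.
move=> st h.
have cont (r eps : R) : s <= r <= t -> 0 < eps -> exists2 e : R, 0 < e &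
    forall x : R, s <= x <= t -> `|x - r| < e -> `|f x - f r| <= eps.
  move=> rI eps0; have [e e0 he] := h r rI 1 ltr01.
  have B0 : 0 < 1 + `|f1 r| by rewrite ltr_pwDl.
  exists (Num.min e (eps / (1 + `|f1 r|))); first by rewrite lt_min e0 divr_gt0.
  move=> x xI; rewrite lt_min => /andP[x1 x2]; have H := he x xI x1.
  apply: (@le_trans _ _ ((1 + `|f1 r|) * `|x - r|)); last first.
    by rewrite mulrC -ler_pdivlMr // ltW.
  have nM : `|(x - r) * f1 r| = `|x - r| * `|f1 r| by rewrite normrM.
  have E : `|f x - f r| <= `|f x - f r - (x - r) * f1 r| + `|(x - r) * f1 r|.
    by rewrite -{1}(subrK ((x - r) * f1 r) (f x - f r)) ler_normD.
  by lra.
have cf : {within `[s, t], continuous (f : R^o -> R^o)}.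
  apply/subspace_continuousP => r /=; rewrite in_itv /= => rI.
  apply/cvgrPdist_le => eps eps0; rewrite /within /=.
  have [e e0 he] := cont r eps rI eps0; exists e => // x /=.
  by rewrite distrC in_itv /= => x1 xI; rewrite distrC; exact: he.
have df r : r \in `]s, t[%R -> is_derive r (1 : R^o) (f : R^o -> R^o) (f1 r).
  rewrite in_itv /= => /andP[sr rt].
  have rI : s <= r <= t by rewrite !ltW.
  have cv : (fun x : R => x^-1 *: (((f : R^o -> R^o) \o shift r) (x *: (1 : R^o)) - f r) : R^o)
      @ 0^' --> (f1 r : R^o).
    apply/cvgrPdist_le => eps eps0; have [e e0 he] := h r rI eps eps0.
    exists (Num.min e (Num.min (r - s) (t - r))) => /=.
      by rewrite !lt_min e0 !subr_gt0 sr.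
    move=> x /=; rewrite sub0r normrN !lt_min => /and3P[x1 x2 x3] xN.
    rewrite [x *: 1]mulr1.
    have := he (x + r); rewrite addrK => /(_ _ x1) H.
    have {}H := H ltac:(move: x2 x3; rewrite !ltr_norml => /andP[? ?] /andP[? ?]; lra).
    have -> : f1 r - x^-1 *: (f (x + r) - f r) = - (x^-1 * (f (x + r) - f r - x * f1 r)).
      by rewrite [in RHS]mulrBr [x^-1 * (x * _)]mulrA mulVf // mul1r opprB.
    rewrite normrN normrM normfV ler_pdivrMl ?normr_gt0 //.
    by rewrite [leRHS]mulrC.
  by split; [exact: cvgP cv|exact: cvg_lim cv].
have [r rI E] := @MVT_segment R f f1 s t st df cf.
by exists r => //; move: rI; rewrite in_itv.
Qed.

Definition lip T (f : R -> R) : Prop := exists2 C : R, 0 <= C &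
  forall s, T s -> `|f s| <= C /\ forall t, T t -> `|f t - f s| <= C * `|t - s|.

Lemma lip_mul T f g : lip T f -> lip T g -> lip T (fun t => f t * g t).
Proof.
move=> [C C0 hf] [C' C0' hg]; exists (C * C' + C * C') => [|s Ts].
  by rewrite addr_ge0 ?mulr_ge0.
have [f1 f2] := hf s Ts; have [g1 g2] := hg s Ts; split.
  rewrite normrM; apply: le_trans (_ : C * C' <= _); first exact: ler_pM.
  by rewrite lerDl mulr_ge0.
move=> t Tt; have [f3 _] := hf t Tt.
have -> : f t * g t - f s * g s = f t * (g t - g s) + g s * (f t - f s) by ring.
apply: le_trans (ler_normD _ _) _; rewrite !normrM mulrDl -!mulrA; apply: lerD.
  by apply: ler_pM => //; exact: g2.
by rewrite [C * _]mulrCA; apply: ler_pM => //; exact: f2.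
Qed.

Lemma lip_sum T I (r : seq I) (f : I -> R -> R) :
  (forall i, lip T (f i)) -> lip T (fun t => \sum_(i <- r) f i t).
Proof.
move=> h; elim: r => [|i r [C C0 ih]].
  by exists 0 => // s _; split => [|t _]; rewrite !big_nil ?subrr ?mul0r normr0.
have [C' C0' hi] := h i; exists (C' + C) => [|s Ts]; first exact: addr_ge0.
have [i1 i2] := hi s Ts; have [r1 r2] := ih s Ts; split => [|t Tt]; rewrite !big_cons.
  by apply: le_trans (ler_normD _ _) _; exact: lerD.
rewrite opprD addrACA; apply: le_trans (ler_normD _ _) _; rewrite mulrDl.
by apply: lerD; [exact: i2|exact: r2].
Qed.

Lemma lip_opp T f : lip T f -> lip T (fun t => - f t).
Proof.
move=> [C C0 h]; exists C => // s Ts; have [h1 h2] := h s Ts; split.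
  by rewrite normrN.
by move=> t Tt; rewrite -opprD normrN h2.
Qed.

Section within.
Context (D T : set R) (TD : T `<=` D) (cT : order_convex T) (f f1 : R -> R).
Context (hf : forall t, T t -> forall eps : R, 0 < eps -> exists2 e : R, 0 < e &
    forall x, D x -> `|x - t| < e -> `|f x - f t - (x - t) * f1 t| <= eps * `|x - t|).

Lemma within_mvt s t : T s -> T t ->
  exists r, [/\ T r, `|r - s| <= `|t - s| & f t - f s = f1 r * (t - s)].
Proof.
have H x y : T x -> T y -> x <= y ->
    exists2 r, x <= r <= y & f y - f x = f1 r * (y - x).
  move=> Tx Ty xy; apply: segment_mvt => // r rI eps eps0.
  have [e e0 he] := hf (cT Tx Ty rI) eps0; exists e => // z zI; apply: he.
  exact/TD/(cT Tx Ty zI).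
move=> Ts Tt; have [st|/ltW ts] := leP s t.
  have [r rI E] := H s t Ts Tt st; exists r; split=> //; first exact: cT rI.
  by rewrite !ger0_norm; lra.
have [r rI E] := H t s Tt Ts ts; exists r; split=> //; first exact: cT rI.
  by rewrite !ler0_norm; lra.
by rewrite -opprB E; ring.
Qed.

Lemma lip_of_deriv B C : (forall t, T t -> `|f t| <= C) ->
  (forall t, T t -> `|f1 t| <= B) -> lip T f.
Proof.
move=> hC hB; exists (`|C| + `|B|) => [|s Ts]; first exact: addr_ge0.
split=> [|t Tt].
  by apply: le_trans (hC s Ts) _; apply: le_trans (ler_norm _) _; rewrite lerDl.
have [r [Tr _ ->]] := within_mvt Ts Tt; rewrite normrM ler_wpM2r //.
by apply: le_trans (hB r Tr) _; apply: le_trans (ler_norm _) _; rewrite lerDr.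
Qed.

Lemma td_of_lip : lip T f -> lip T f1 -> td T f f1.
Proof.
move=> [C C0 h] [C' C0' h1]; apply: (@td_intro _ _ _ _ (C + C')) => s Ts.
have [a1 _] := h s Ts; have [b1 b2] := h1 s Ts; split; [lra|lra|].
move=> t Tt; have [r [Tr rs ->]] := within_mvt Ts Tt.
rewrite -mulrBl normrM; apply: (@le_trans _ _ (C' * `|t - s| * `|t - s|)).
  by rewrite ler_wpM2r //; apply: le_trans (b2 r Tr) _; rewrite ler_wpM2l.
by rewrite -mulrA -expr2 real_normK ?num_real // ler_wpM2r ?sqr_ge0 // lerDr.
Qed.

End within.

Lemma order_convex_tnear T t (e : R) : order_convex T -> order_convex (tnear T t e).
Proof.
move=> cT x y z [Tx hx] [Tz hz] /andP[xy yz]; split; first by apply: (cT x y z); rewrite ?xy.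
by move: hx hz; rewrite !ltr_norml => /andP[? ?] /andP[? ?]; apply/andP; split; lra.
Qed.

Lemma order_convex_unit : order_convex (@unit_int R).
Proof. by move=> x y z /andP[? ?] /andP[? ?] /andP[? ?]; apply/andP; split; lra. Qed.

End time_derivatives.

Section geodesic_calculus.
Context {R : realType} {d : nat} (M : riemannian_manifold R d).
Local Notation vec := 'rV[R]_d.+1.
Implicit Types (i j : chart_idx M) (g : R -> M).

Definition gacc i (y v : vec) : vec :=
  \row_l - \sum_a \sum_b christoffel i l a b y * v 0 a * v 0 b.

(** The definition of a geodesic gives pointwise derivatives without bounds. Derivability at [t0]
    bounds the coordinates and the velocity nearby; so the coordinates are Lipschitz, the geodesic
    equation bounds the acceleration, the velocity is Lipschitz, and so is the acceleration. Both
    expansions then follow by [td_of_lip]. *)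
Lemma geodesic_td g i t0 r : geodesic g -> unit_int t0 -> dom i (g t0) ->
  local_box i (coord i (g t0)) r ->
  exists2 e : R, 0 < e &
    [/\ forall s, tnear unit_int t0 e s -> time_dom g i s /\
          box (coord i (g t0)) r (coord i (g s)),
        tdm (tnear unit_int t0 e) (coord i \o g) (velocity g i) &
        tdm (tnear unit_int t0 e) (velocity g i)
          (fun s => gacc i (coord i (g s)) (velocity g i s))].
Proof.
move=> [cg hg] t0I i0 lb; set y0 := coord i (g t0).
have D0 : time_dom g i t0 by [].
have [dy0 dv0 _] := hg i t0 D0.
have r0 := lb_gt0 lb.
have [e1 e10 h1] : exists2 e : R, 0 < e &
    forall s, unit_int s -> `|s - t0| < e -> time_dom g i s.
  move/subspace_continuousP : cg => /(_ t0); rewrite /= in_itv /= => /(_ t0I) cg.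
  have /cg : nbhs (g t0) (dom i) by apply: open_nbhs_nbhs; split => //; exact: dom_open.
  rewrite /within /= => -[e /= e0 he]; exists e => // s sI st; split => //.
  by apply: he => /=; [rewrite distrC|rewrite in_itv].
have near (W : normedModType R) (f : R -> W) : derivable_within (time_dom g i) f t0 1 ->
    forall eps : R, 0 < eps -> exists2 e : R, 0 < e & forall s, time_dom g i s -> `|s - t0| < e ->
      `|f s - f t0| <= eps.
  move=> df eps eps0; have [e e0 he] := derivable_within_est df ltr01.
  have B0 : 0 < 1 + `|derive_within (time_dom g i) f 1 t0| by rewrite ltr_pwDl.
  exists (Num.min e (eps / (1 + `|derive_within (time_dom g i) f 1 t0|))).
    by rewrite lt_min e0 divr_gt0.
  move=> s Ds; rewrite lt_min => /andP[s1 s2].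
  rewrite -(subrK ((s - t0) *: derive_within (time_dom g i) f 1 t0) (f s - f t0)).
  apply: le_trans (ler_normD _ _) _.
  apply: (@le_trans _ _ ((1 + `|derive_within (time_dom g i) f 1 t0|) * `|s - t0|)).
    rewrite mulrDl normrZ [`|s - t0| * _]mulrC lerD2r; exact: he.
  by rewrite mulrC -ler_pdivlMr // ltW.
have [e2 e20 h2] := near _ _ dy0 (r / 2) ltac:(lra).
have [e3 e30 h3] := near _ _ dv0 1 ltr01.
pose e := Num.min e1 (Num.min e2 e3).
have e0 : 0 < e by rewrite !lt_min e10 e20 e30.
pose T := tnear (@unit_int R) t0 e.
have TE s : T s -> [/\ unit_int s, `|s - t0| < e1, `|s - t0| < e2 & `|s - t0| < e3].
  by move=> [sI]; rewrite !lt_min => /and3P[].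
have TD : T `<=` time_dom g i by move=> s /TE[? ? _ _]; exact: h1.
have Tb s : T s -> box y0 r (coord i (g s)).
  move=> Ts; have [sI _ s2 _] := TE s Ts; split; last first.
    apply: (@chart_image_half _ _ M i); exists (g s) => //; exact: (TD s Ts).2.
  move=> a; have H := h2 s (TD s Ts) s2.
  apply: (@le_lt_trans _ _ (r / 2)); last lra.
  apply: le_trans H; have := entry_le_mxnorm (coord i (g s) - y0) 0 a.
  by rewrite !mxE.
have cT : order_convex T := order_convex_tnear (@order_convex_unit R).
have est (f : R -> vec) a t : derivable_within (time_dom g i) f t 1 ->
    forall eps : R, 0 < eps -> exists2 e : R, 0 < e &
    forall x, time_dom g i x -> `|x - t| < e ->
      `|f x 0 a - f t 0 a - (x - t) * (derive_within (time_dom g i) f 1 t) 0 a| <= eps * `|x - t|.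
  move=> df eps eps0; have [e' e'0 he] := derivable_within_est df eps0.
  exists e' => // x Dx xt; apply: le_trans (he x Dx xt).
  have := entry_le_mxnorm (f x - f t - (x - t) *: derive_within (time_dom g i) f 1 t) 0 a.
  by rewrite !mxE.
pose y s := coord i (g s); pose V := velocity g i.
have hy a t (Tt : T t) := @est y a t (let: And3 h _ _ := hg i t (TD t Tt) in h).
have hV a t (Tt : T t) := @est V a t (let: And3 _ h _ := hg i t (TD t Tt) in h).
have yB a t : T t -> `|y t 0 a| <= `|y0 0 a| + r.
  move=> /Tb[/(_ a) /ltW H _]; rewrite -(subrK (y0 0 a) (y t 0 a)) addrC.
  by apply: le_trans (ler_normD _ _) _; rewrite lerD2l.
have VB a t : T t -> `|V t 0 a| <= `|V t0 0 a| + 1.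
  move=> Tt; have [sI _ _ s3] := TE t Tt; have := h3 t (TD t Tt) s3.
  move=> /(le_trans (entry_le_mxnorm (V t - V t0) 0 a)); rewrite !mxE => H.
  rewrite -(subrK (V t0 0 a) (V t 0 a)) addrC.
  by apply: le_trans (ler_normD _ _) _; rewrite lerD2l.
have lipy a : lip T (fun t => y t 0 a).
  exact: (@lip_of_deriv _ _ T TD cT (fun t => y t 0 a) (fun t => V t 0 a) (hy a)
    _ _ (yB a) (VB a)).
have accE t : T t -> acceleration g i t = gacc i (y t) (V t).
  move=> Tt; have [_ _ E] := hg i t (TD t Tt).
  by apply/rowP => l; rewrite mxE; apply/eqP; rewrite -addr_eq0 E.
have lipc l a b : lip T (fun t => christoffel i l a b (y t)).
  have [C C0 hC] := qd_const (lb_christoffel lb l a b).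
  have [L L0 hL] := qd_lip (lb_small lb) (lb_christoffel lb l a b).
  have /choice[K hK] c : exists K : R, 0 <= K /\ forall s t, T s -> T t ->
      `|y t 0 c - y s 0 c| <= K * `|t - s|.
    by have [K K0 h] := lipy c; exists K; split => // s t Ts Tt; exact: (h s Ts).2.
  have sK : 0 <= \sum_c K c by apply: sumr_ge0 => c _; case: (hK c).
  exists (C + L * \sum_c K c) => [|s Ts]; first by rewrite addr_ge0 ?mulr_ge0.
  have [c1 _ _] := hC _ (Tb s Ts); split.
    by apply: le_trans c1 _; rewrite lerDl mulr_ge0.
  move=> t Tt; apply: le_trans (hL _ _ (Tb s Ts) (Tb t Tt)) _.
  apply: (@le_trans _ _ (L * (\sum_c K c * `|t - s|))); last first.
    by rewrite -mulr_suml mulrDl -!mulrA lerDr mulr_ge0.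
  rewrite ler_wpM2l // /nrm big_ord1; apply: ler_sum => c _; rewrite !mxE.
  exact: (hK c).2.
have [BG hBG] : exists BG : R, forall l t, T t -> `|gacc i (y t) (V t) 0 l| <= BG.
  have /choice[C hC] (lab : 'I_d.+1 * 'I_d.+1 * 'I_d.+1) : exists C : R, 0 <= C /\
      forall t, T t -> `|christoffel i lab.1.1 lab.1.2 lab.2 (y t)| <= C.
    have [C C0 h] := lipc lab.1.1 lab.1.2 lab.2; exists C; split => // t Tt.
    by have [] := h t Tt.
  pose VV a := `|V t0 0 a| + 1.
  exists (\sum_l \sum_a \sum_b C (l, a, b) * VV a * VV b) => l t Tt.
  have pos l' a' b' : 0 <= C (l', a', b') * VV a' * VV b'.
    by rewrite !mulr_ge0 ?addr_ge0 //; case: (hC (l', a', b')).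
  rewrite mxE normrN; apply: (@le_trans _ _ (\sum_a \sum_b C (l, a, b) * VV a * VV b)).
    apply: le_trans (ler_norm_sum _ _ _) _; apply: ler_sum => a _.
    apply: le_trans (ler_norm_sum _ _ _) _; apply: ler_sum => b _.
    rewrite (normrM (christoffel i l a b (y t) * V t 0 a)).
    rewrite (normrM (christoffel i l a b (y t))).
    apply: ler_pM; rewrite ?mulr_ge0 //; last exact: VB.
    apply: ler_pM => //; last exact: VB.
    by have [_ /(_ t Tt)] := hC (l, a, b).
  apply: (@ler_term _ _ (fun l => \sum_a \sum_b C (l, a, b) * VV a * VV b)) => l'.
  by apply: sumr_ge0 => a _; apply: sumr_ge0 => b _; exact: pos.
have hV' a t (Tt : T t) : forall eps : R, 0 < eps -> exists2 e : R, 0 < e &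
    forall x, time_dom g i x -> `|x - t| < e ->
      `|V x 0 a - V t 0 a - (x - t) * gacc i (y t) (V t) 0 a| <= eps * `|x - t|.
  by rewrite -accE //; exact: hV.
have lipV a : lip T (fun t => V t 0 a).
  exact: (@lip_of_deriv _ _ T TD cT (fun t => V t 0 a)
    (fun t => gacc i (y t) (V t) 0 a) (hV' a) _ _ (VB a) (hBG a)).
have lipG l : lip T (fun t => gacc i (y t) (V t) 0 l).
  have : lip T (fun t => - \sum_a \sum_b christoffel i l a b (y t) * V t 0 a * V t 0 b).
    by apply/lip_opp/lip_sum => a; apply/lip_sum => b; apply/lip_mul => //; apply/lip_mul.
  by congr lip; apply: funext => t; rewrite mxE.
exists e => //; split.
- by move=> s Ts; split; [exact: TD|exact: Tb].
- move=> k a; rewrite (ord1 k); exact: (td_of_lip TD cT (hy a) (lipy a) (lipV a)).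
- move=> k a; rewrite (ord1 k); exact: (td_of_lip TD cT (hV' a) (lipV a) (lipG a)).
Qed.

End geodesic_calculus.

Section frames_along_paths.
Context {R : realType} {d : nat} (M : riemannian_manifold R d) (kappa : R)
  (curv : constant_curvature M kappa).
Local Notation vec := 'rV[R]_d.+1.
Local Notation cvec := 'cV[R]_(1 + d.+1).
Local Notation "'MN'" := 'M[R]_(1 + d.+1).
Local Notation sol := (sol kappa).
Local Notation gram_mx := (gram_mx kappa).
Local Notation frame := (frame kappa).
Implicit Types (i j : chart_idx M) (y v : vec) (H L : MN) (F : M -> cvec) (g : R -> M).

(** The derivative of xi^T K xi vanishes when K is parallel for the connection matrix B and the
    covariant derivative of xi is a multiple of a vector orthogonal to xi. *)
Lemma gram_parallel N (B K : 'M[R]_N) (xi xi' e : 'cV[R]_N) c K' :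
  K' = B^T *m K + K *m B -> xi' = c *: e - B *m xi ->
  e^T *m K *m xi = 0 -> xi^T *m K *m e = 0 ->
  (xi'^T *m K + xi^T *m K') *m xi + xi^T *m K *m xi' = 0.
Proof.
move=> -> -> h1 h2; rewrite linearB linearZ /= trmx_mul mulmxBl mulmxDr mulmxBr.
rewrite mulmxDl mulmxBl mulmxDl -!scalemxAl -!scalemxAr h1 h2 !scaler0 !mulmxA.
by rewrite !sub0r addrA addNr add0r subrr.
Qed.

(** By [conn_e0], [S y *m lower v] is the derivative of [S y *m e0] in the direction [v] for every
    solution [S]. *)
Definition lower (v : vec) : cvec := col_mx (0 : 'M[R]_1) v^T.

Lemma nrm_lower v : nrm (lower v) = nrm v.
Proof. by rewrite /lower nrm_col nrm0 add0r nrm_tr. Qed.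

Lemma lower_sum (v : vec) : lower v = \sum_a v 0 a *: col_mx (0 : 'M[R]_1) (delta_mx a 0).
Proof.
apply/matrixP => p q; rewrite summxE (ord1 q).
have [k ->|k ->] := @split_ordP 1 d.+1 p.
  rewrite col_mxEu mxE big1 // => a _.
  by rewrite mxE col_mxEu mxE mulr0.
rewrite col_mxEd mxE (bigD1 k) //= big1 => [|a ak]; rewrite mxE col_mxEd !mxE.
  by rewrite !eqxx mulr1 addr0.
by rewrite eq_sym (negPf ak) mulr0.
Qed.

(** The computation behind F'' = c F: the left-hand side, multiplied by [S], is the second
    derivative of [S *m e0] along the geodesic of velocity [v]. *)
Lemma conn_contract i y v : \sum_a v 0 a *: (conn kappa i a y *m lower v) +
  lower (gacc i y v) = (- kappa * gdot i y v v) *: e0.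
Proof.
apply/matrixP => p q; rewrite mxE summxE (ord1 q) {q}.
have cE a : conn kappa i a y *m lower v =
    col_mx (- kappa *: (row a (metric i y) *m v^T))
      ((\matrix_(l, b) christoffel i l a b y) *m v^T).
  by rewrite /conn /lower mul_block_col !mulmx0 !add0r -scalemxAl.
have [k ->|l ->] := @split_ordP 1 d.+1 p.
  rewrite [lower _ _ _]col_mxEu [in RHS]mxE [e0 _ _]col_mxEu !mxE (ord1 k) eqxx mulr1 addr0.
  rewrite /gdot -mulmxA mxE mulr_sumr; apply: eq_bigr => a _.
  rewrite mxE cE col_mxEu mxE mulrCA; congr (_ * (_ * _)).
  by rewrite !mxE; apply: eq_bigr => b _; rewrite !mxE.
rewrite [lower _ _ _]col_mxEd [in RHS]mxE [e0 _ _]col_mxEd !mxE mulr0.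
apply/eqP; rewrite subr_eq0; apply/eqP; apply: eq_bigr => a _.
rewrite mxE cE col_mxEd mxE mulr_sumr; apply: eq_bigr => b _; rewrite !mxE.
by move: (christoffel _ _ _ _ _) => u; ring.
Qed.

Lemma lower_td T (V V1 : R -> vec) : tdm T V V1 ->
  tdm T (fun s => lower (V s)) (fun s => lower (V1 s)).
Proof.
move=> h p q; rewrite (ord1 q); have [k ->|a ->] := @split_ordP 1 d.+1 p.
  by apply: qd_ext (qd_cst tdisp T 0) => [s|a s] _; rewrite /lower col_mxEu mxE.
by apply: qd_ext (h 0 a) => [s|u s] _; rewrite /lower col_mxEd mxE.
Qed.

Lemma e0_gram_lower i y v : (e0 : cvec)^T *m gram_mx i y *m lower v = 0.
Proof.
rewrite /e0 /lower tr_col_mx /gram_mx trmx1 trmx0.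
by rewrite mul_row_block mul_row_col !(mul0mx, mulmx0, addr0, add0r).
Qed.

Lemma lower_gram i y v : (lower v)^T *m gram_mx i y *m lower v =
  (kappa * gdot i y v v)%:M.
Proof.
rewrite /lower tr_col_mx /gram_mx trmx0 trmxK mul_row_block mul_row_col.
rewrite !(mul0mx, mulmx0, addr0, add0r) -scalemxAr -scalemxAl.
by rewrite [in LHS](mx11_scalar (v *m metric i y *m v^T)) scale_scalar_mx.
Qed.

Lemma gram_sym i y : chart_image i y -> (gram_mx i y)^T = gram_mx i y.
Proof.
move=> iy; rewrite /gram_mx tr_block_mx !trmx0 trmx1 linearZ /=.
by congr block_mx; congr (_ *: _); exact: metric_sym.
Qed.

Section geodesics.
Context (kappa_le0 : kappa <= 0).

Lemma germ_along_geodesic H F g i t0 r S : geodesic g -> unit_int t0 -> dom i (g t0) ->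
  germ_at kappa H F i (coord i (g t0)) r S ->
  exists2 e : R, 0 < e & exists2 c : R, 0 <= c &
    [/\ forall s, tnear unit_int t0 e s -> dom i (g s),
        tdm (tnear unit_int t0 e) (F \o g)
          (fun s => S (coord i (g s)) *m lower (velocity g i s)) &
        tdm (tnear unit_int t0 e) (fun s => S (coord i (g s)) *m lower (velocity g i s))
          (fun s => c *: F (g s))].
Proof.
move=> gg t0I i0 [lb hS hF _ _].
have [e e0' [hT hy hV]] := geodesic_td gg t0I i0 lb.
set T := tnear unit_int t0 e in hT hy hV.
set y := fun s => coord i (g s); set V := velocity g i.
have sm : small tdisp T by apply: small_unit_int; exact: tnear_sub.
have Qy s : T s -> box (coord i (g t0)) r (y s) by move=> /hT[].
have hSy := qdm_comp sm Qy hy hS.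
have hL := lower_td hV.
pose q s := - kappa * gdot i (y s) (V s) (V s).
have FE s : T s -> F (g s) = S (y s) *m e0.
  by move=> Ts; rewrite -hF ?coordK //; [exact: (hT s Ts).1.2|exact: Qy].
have X'' : tdm T (fun s => S (y s) *m lower (V s)) (fun s => q s *: F (g s)).
  apply: qdm_ext (qdm_mul sm hSy hL) => // a s Ts.
  rewrite FE // scalemxAr /q -conn_contract mulmxDr; congr (_ + _).
  rewrite mulmx_suml mulmx_sumr; apply: eq_bigr => b _.
  by rewrite -scalemxAl -scalemxAr mulmxA.
have cT : order_convex T := order_convex_tnear (@order_convex_unit R).
have T0 : T t0 by split => //; rewrite subrr normr0.
(* Constancy of the speed: [gram_parallel] is applied to the form [gram_mx] along the path and to
   the column [lower (V x)], whose covariant derivative is a multiple of [e0]. *)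
have qc s : T s -> q s = q t0.
  move=> Ts.
  have kq x : (lower (V x))^T *m gram_mx i (y x) *m lower (V x) = (- q x)%:M.
    by rewrite lower_gram /q mulNr opprK.
  have hK := qdm_comp sm Qy hy (gram_qd kappa lb).
  have h0 : tdm T (fun x => (- q x)%:M : 'M[R]_1) (fun=> 0).
    apply: qdm_ext (qdm_mul sm (qdm_mul sm (qdm_tr hL) hK) hL) => [x _|a x Tx].
      exact: kq.
    have xi : lower (gacc i (y x) (V x)) = q x *: e0 -
        \sum_a V x 0 a *: (conn kappa i a (y x) *m lower (V x)).
      by rewrite /q -conn_contract addrAC subrr add0r.
    have G0 := e0_gram_lower i (y x) (V x).
    have G0' : (lower (V x))^T *m gram_mx i (y x) *m (e0 : cvec) = 0.
      apply: (can_inj (@trmxK _ _ _)); rewrite !trmx_mul trmxK trmx0 mulmxA gram_sym //.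
      exact: (lb_sub lb (Qy x Tx)).
    change (lower (gacc i (coord i (g x)) (velocity g i x))) with
      (lower (gacc i (y x) (V x))).
    pose B := \sum_b V x 0 b *: conn kappa i b (y x).
    apply: (@gram_parallel _ B _ _ _ (e0 : cvec) (q x)) => //.
    - rewrite /B linear_sum mulmx_suml mulmx_sumr -big_split; apply: eq_bigr => b _ /=.
      by rewrite -(conn_gram kappa lb b (Qy x Tx)) linearZ /= -scalemxAl -scalemxAr scalerDr.
    - rewrite xi /B mulmx_suml; congr (_ - _); apply: eq_bigr => b _.
      by rewrite -scalemxAl.
  have E := td0_const cT (f := fun x => - q x).
  apply: oppr_inj; apply: E => // x Tx; exists 1 => //.
  apply: td_subset (@tnear_sub _ _ _ _) _.
  by apply: qd_ext (h0 0 0) => [z|u z] _; rewrite mxE // eqxx mulr1n.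
exists e => //; exists (q t0).
  rewrite mulr_ge0 ?oppr_ge0 //.
  have [->|VN] := eqVneq (V t0) 0; first by rewrite /gdot mul0mx mul0mx mxE.
  exact/ltW/(metric_pos (lb_sub lb (Qy t0 T0)) VN).
split.
- by move=> s Ts; exact: (hT s Ts).1.2.
- apply: qdm_ext (qdm_mul sm hSy (qdm_cst tdisp T e0)) => [s Ts|a s Ts] /=.
    by rewrite FE.
  rewrite mulmx0 addr0 lower_sum mulmx_suml mulmx_sumr; apply: eq_bigr => b _.
  by rewrite -scalemxAl -scalemxAr -mulmxA conn_e0.
- have E s (Ts : T s) : q s *: F (g s) = q t0 *: F (g s) :=
    congr1 (fun x => x *: F (g s)) (qc s Ts).
  exact: (qdm_ext (fun _ _ => erefl) (fun _ s Ts => E s Ts) X'').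
Qed.

End geodesics.
End frames_along_paths.

(** * Paths with model developments are geodesics *)

Section paths_to_geodesics.
Context {R : realType} {d : nat} (M : riemannian_manifold R d) (kappa : R)
  (curv : constant_curvature M kappa).
Local Notation vec := 'rV[R]_d.+1.
Local Notation cvec := 'cV[R]_(1 + d.+1).
Local Notation "'MN'" := 'M[R]_(1 + d.+1).
Local Notation sol := (sol kappa).
Local Notation gram_mx := (gram_mx kappa).
Local Notation frame := (frame kappa).
Local Notation std_frame := (std_frame kappa).
Implicit Types (i j : chart_idx M) (y v : vec) (H L : MN) (F : M -> cvec) (g : R -> M).

Lemma box_nrm (y1 y : vec) r : box y1 r y -> nrm (y - y1) <= d.+1%:R * r.
Proof.
move=> [h _]; have := @nrm_le_entries _ _ _ (y - y1) r; rewrite mul1n; apply => k a.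
by rewrite (ord1 k) !mxE ltW.
Qed.

Lemma box_nrm2 (y1 y y' : vec) r : box y1 r y -> box y1 r y' ->
  nrm (y' - y) <= 2 * d.+1%:R * r.
Proof.
move=> /box_nrm h /box_nrm h'.
have -> : y' - y = (y' - y1) - (y - y1) by rewrite opprB addrA subrK.
by apply: le_trans (nrmB _ _) _; rewrite -mulrA; lra.
Qed.

Lemma sol_first_order i y1 r (S : vec -> MN) : small vdisp (box y1 r) -> sol i (box y1 r) S ->
  exists2 C : R, 0 <= C & forall y y', box y1 r y -> box y1 r y' ->
    nrm (S y' *m e0 - S y *m e0 - S y *m lower (y' - y)) <= C * nrm (y' - y) ^+ 2.
Proof.
move=> sm hS; have h := qdm_mul sm hS (qdm_cst vdisp (box y1 r) (e0 : cvec)).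
have [C C0 hC] := qdm_est h; exists C => // y y' Qy Qy'.
have [_ _ /(_ y' Qy')] := hC y Qy; congr (nrm (_ - _) <= _).
rewrite lower_sum mulmx_sumr; apply: eq_bigr => a _.
by rewrite mulmx0 addr0 -mulmxA conn_e0 -scalemxAr.
Qed.

(** An inverse function estimate: near [y1] the increment of [S *m e0] is close to the invertible
    [S y1] applied to [lower (y' - y)]. The constant [q] makes the two error terms at most half of
    [nrm (y' - y)]. *)
Lemma sol_inj i y1 r (S : vec -> MN) : local_box i y1 r -> sol i (box y1 r) S ->
  S y1 \in unitmx -> exists r' K, [/\ 0 < r', r' <= r, 0 <= K &
    forall y y', box y1 r' y -> box y1 r' y' ->
      nrm (y' - y) <= K * nrm (S y' *m e0 - S y *m e0)].
Proof.
move=> lb hS uS; have sm := lb_small lb.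
have [C C0 hC] := sol_first_order sm hS; have [L L0 hL] := qdm_lip sm hS.
pose I := nrm (invmx (S y1)); pose N : R := d.+1%:R.
have I0 : 0 <= I by exact: nrm_ge0.
have N0 : 0 < N by rewrite ltr0n.
pose q := 4 * I * (C + L) * N + 1.
have q0 : 0 < q by rewrite ltr_wpDl // !mulr_ge0 // ?addr_ge0 // ltW.
have r0 := lb_gt0 lb.
pose r' := Num.min r q^-1.
have r'0 : 0 < r' by rewrite lt_min r0 invr_gt0.
have rr : r' <= r by rewrite ge_min lexx.
exists r', (2 * I); split => //; first by rewrite mulr_ge0.
move=> y y' Qy Qy'.
have s := @box_le _ _ y1 _ _ rr.
set w := y' - y; set DF := S y' *m e0 - S y *m e0.
have h1 := hC y y' (s _ Qy) (s _ Qy').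
have h2 := hL y1 y (local_box_mem lb) (s _ Qy).
have b1 := box_nrm Qy; have b2 := box_nrm2 Qy Qy'.
have E : lower w = invmx (S y1) *m (DF - (DF - S y *m lower w) - (S y - S y1) *m lower w).
  by rewrite subKr mulmxBl subKr mulKmx.
have H1 : nrm w <= I * (nrm DF + C * nrm w ^+ 2 + L * nrm (y - y1) * nrm w).
  rewrite -{1}nrm_lower E; apply: le_trans (nrmM _ _) _; rewrite ler_wpM2l //.
  apply: le_trans (nrmB _ _) _; apply: lerD.
    by apply: le_trans (nrmB _ _) _; rewrite lerD2l.
  apply: le_trans (nrmM _ _) _; rewrite nrm_lower ler_wpM2r //.
have W0 : 0 <= nrm w by exact: nrm_ge0.
have Y0 : 0 <= nrm (y - y1) by exact: nrm_ge0.
have H2 : C * nrm w ^+ 2 + L * nrm (y - y1) * nrm w <= (C + L) * (2 * N * r') * nrm w.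
  have w1 : nrm w <= 2 * N * r' := b2.
  have w2 : nrm (y - y1) <= 2 * N * r'.
    by apply: le_trans b1 _; rewrite -mulrA; have := mulr_ge0 (ltW N0) (ltW r'0); rewrite /N; lra.
  rewrite mulrDl mulrDl expr2 mulrA; apply: lerD.
    by rewrite -!mulrA; apply: ler_wpM2l => //; rewrite !mulrA; apply: ler_wpM2r.
  by apply: ler_wpM2r => //; apply: ler_wpM2l.
have H3 : I * ((C + L) * (2 * N * r')) <= 2^-1.
  have qr : r' * q <= 1 by rewrite -ler_pdivlMr // div1r ge_min lexx orbT.
  have : I * ((C + L) * (2 * N * r')) * 2 = r' * (q - 1) by rewrite /q; ring.
  by rewrite mulrBr mulr1; have := ltW r'0; lra.
have H4 : nrm w <= I * nrm DF + 2^-1 * nrm w.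
  apply: le_trans H1 _; rewrite -addrA mulrDr lerD2l.
  apply: le_trans (ler_wpM2l I0 H2) _; rewrite [leLHS]mulrA; exact: ler_wpM2r.
by rewrite -mulrA; lra.
Qed.

Lemma chart_nbhd i p r : dom i p -> 0 < r ->
  nbhs p [set q | dom i q /\ box (coord i p) r (coord i q)].
Proof.
move=> ip r0.
have nd : nbhs p (dom i) by apply: open_nbhs_nbhs; split => //; exact: dom_open.
have /subspace_continuousP /(_ _ ip) := @coord_continuous _ _ M i.
have nb : nbhs (coord i p) [set y | forall a, `|y 0 a - coord i p 0 a| < r].
  apply/nbhs_ballP; exists r => //= y [_ hy] a.
  by have := hy 0 a; rewrite /ball /= /ball_ /= distrC.
move=> /(_ _ nb); rewrite /within /= => nb'.
apply: filterS2 nd nb' => q iq hq; split => //; split; first exact: hq.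
by apply: (@chart_image_half _ _ M i); exists q.
Qed.

Lemma unit_accum (s e : R) : unit_int s -> 0 < e ->
  exists s', [/\ unit_int s', s' != s & `|s' - s| < e].
Proof.
move=> /andP[s0 s1] e0; have [h|h] := leP s (1 / 2).
  exists (s + Num.min (e / 2) (1 / 2)).
  have m0 : 0 < Num.min (e / 2) (1 / 2) by rewrite lt_min; apply/andP; split; lra.
  have m1 : Num.min (e / 2) (1 / 2) <= e / 2 by rewrite ge_min lexx.
  have m2 : Num.min (e / 2) (1 / 2) <= 1 / 2 by rewrite ge_min lexx orbT.
  split; first by apply/andP; split; lra.
    by rewrite gt_eqF //; lra.
  by rewrite addrAC subrr add0r gtr0_norm //; lra.
exists (s - Num.min (e / 2) (1 / 2)).
have m0 : 0 < Num.min (e / 2) (1 / 2) by rewrite lt_min; apply/andP; split; lra.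
have m1 : Num.min (e / 2) (1 / 2) <= e / 2 by rewrite ge_min lexx.
have m2 : Num.min (e / 2) (1 / 2) <= 1 / 2 by rewrite ge_min lexx orbT.
split; first by apply/andP; split; lra.
  by rewrite lt_eqF //; lra.
by rewrite addrAC subrr add0r normrN gtr0_norm //; lra.
Qed.

Lemma tnear_accum (t0 s e e' : R) : tnear unit_int t0 e s -> 0 < e' ->
  exists s', [/\ tnear unit_int t0 e s', s' != s & `|s' - s| < e'].
Proof.
move=> [sI st] e'0.
have [|s' [s'I sN ss]] := @unit_accum s (Num.min e' (e - `|s - t0|)) sI.
  by rewrite lt_min e'0 subr_gt0.
move: ss; rewrite lt_min => /andP[ss1 ss2]; exists s'; split => //; split => //.
rewrite -(subrK s s') -addrA; apply: le_lt_trans (ler_normD _ _) _; lra.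
Qed.

Definition cont_at (T : set R) (g : R -> M) (t : R) : Prop :=
  forall U, nbhs (g t) U -> exists2 e : R, 0 < e & forall s, tnear T t e s -> U (g s).

(** The converse of [germ_along_geodesic], from mere continuity of [g]. Since Psi e0 = L^-1 X along
    the path, [sol_inj] makes the coordinates Lipschitz, the first order expansion of Psi e0
    identifies their velocity as [xi], and differentiating [xi] gives the geodesic equation through
    [conn_contract]. *)
Lemma frame_path_td H F g i t0 e (X X1 : R -> cvec) c : frame H F (g t0) ->
  dom i (g t0) -> unit_int t0 -> cont_at unit_int g t0 -> 0 < e ->
  (forall s, tnear unit_int t0 e s -> F (g s) = X s) ->
  tdm (tnear unit_int t0 e) X X1 -> tdm (tnear unit_int t0 e) X1 (fun s => c *: X s) ->
  exists e' (eta : R -> vec), 0 < e' /\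
    [/\ forall s, tnear unit_int t0 e' s -> dom i (g s),
        tdm (tnear unit_int t0 e') (coord i \o g) eta &
        tdm (tnear unit_int t0 e') eta (fun s => gacc i (coord i (g s)) (eta s))].
Proof.
move=> fr i0 t0I cg eg0 FX hX hX1; set y1 := coord i (g t0).
have iy : chart_image i y1 by exists (g t0).
have [r [Psi sf]] := std_frame_exists curv iy.
have lb := sf_box sf; have m1 := local_box_mem lb.
rewrite -(coordK i0) in fr.
have [L [r1 [uL _ r10 s1 hF]]] := frame_std sf m1 fr.
have uP : Psi y1 \in unitmx := sf_unit sf m1.
have [r' [K [r'0 rr K0 hK]]] := sol_inj lb (sf_sol sf) uP.
pose r2 := Num.min r1 r'; have r20 : 0 < r2 by rewrite lt_min r10.
have [e1 e10 h1] := cg _ (chart_nbhd i0 r20).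
pose e' := Num.min e e1; have e'0 : 0 < e' by rewrite lt_min eg0.
pose T := tnear (@unit_int R) t0 e'.
have Te : T `<=` tnear unit_int t0 e by apply: tnear_le; rewrite ge_min lexx.
have Te1 : T `<=` tnear unit_int t0 e1 by apply: tnear_le; rewrite ge_min lexx orbT.
have sm : small tdisp T by apply: small_unit_int; exact: tnear_sub.
pose y s := coord i (g s).
have Td s : T s -> dom i (g s) by move=> /Te1/h1[].
have Ty2 s : T s -> box y1 r2 (y s) by move=> /Te1/h1[].
have Ty' s : T s -> box y1 r' (y s).
  by move=> /Ty2; apply: box_le; rewrite ge_min lexx orbT.
have Ty s : T s -> box y1 r (y s) by move=> /Ty'; exact: box_le.
have Ty1 s : T s -> box y1 r1 (y s) by move=> /Ty2; apply: box_le; rewrite ge_min lexx.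
pose Z s := invmx L *m X s; pose Z1 s := invmx L *m X1 s.
have hmul (W W1 : R -> cvec) : tdm T W W1 ->
    tdm T (fun s => invmx L *m W s) (fun s => invmx L *m W1 s).
  move=> hW; apply: qdm_ext (qdm_mul sm (qdm_cst tdisp T (invmx L)) hW) => // a s _.
  by rewrite mul0mx add0r.
have hZ : tdm T Z Z1 := hmul _ _ (qdm_subset Te hX).
have hZ1 : tdm T Z1 (fun s => c *: Z s).
  apply: qdm_ext (hmul _ _ (qdm_subset Te hX1)) => // a s _.
  by rewrite /Z scalemxAr.
have ZE s : T s -> Psi (y s) *m e0 = Z s.
  move=> Ts; rewrite /Z -FX; last exact: Te.
  by rewrite -(coordK (Td s Ts)) hF ?mulmxA ?mulVmx ?mul1mx //; exact: Ty1.
have hP := sf_inv sf.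
have [CP CP0 bP] := qdm_est hP; have [LP LP0 lP] := qdm_lip (lb_small lb) hP.
have [CZ CZ0 bZ] := qdm_est hZ; have [LZ LZ0 lZ] := qdm_lip sm hZ.
have [C1 C10 fo] := sol_first_order (lb_small lb) (sf_sol sf).
have ly s s' : T s -> T s' -> nrm (y s' - y s) <= K * LZ * `|s' - s|.
  move=> Ts Ts'; apply: le_trans (hK _ _ (Ty' s Ts) (Ty' s' Ts')) _.
  by rewrite !ZE // -mulrA -nrm_tdisp ler_wpM2l // lZ.
pose xi s := invmx (Psi (y s)) *m Z1 s.
have [CB CB0 est] : exists2 CB : R, 0 <= CB & forall s s', T s -> T s' ->
    nrm (lower (y s' - y s) - (s' - s) *: xi s) <= CB * (s' - s) ^+ 2.
  exists (CP * (C1 * (K * LZ) ^+ 2 + CZ)).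
    by rewrite mulr_ge0 ?addr_ge0 ?mulr_ge0 ?sqr_ge0.
  move=> s s' Ts Ts'; have uy := sf_unit sf (Ty s Ts).
  have -> : lower (y s' - y s) - (s' - s) *: xi s = invmx (Psi (y s)) *m
      ((Z s' - Z s - (s' - s) *: Z1 s) - (Z s' - Z s - Psi (y s) *m lower (y s' - y s))).
    rewrite [X in _ *m X](_ : _ = Psi (y s) *m lower (y s' - y s) - (s' - s) *: Z1 s).
      by rewrite mulmxBr mulKmx // -scalemxAr.
    move: (Z s' - Z s) (_ *: Z1 s) (Psi _ *m _) => u v w.
    by apply/matrixP => a b; rewrite !mxE; ring.
  have [P1 _ _] := bP (y s) (Ty s Ts).
  apply: le_trans (nrmM _ _) _; rewrite -mulrA; apply: ler_pM => //.
  apply: le_trans (nrmB _ _) _; rewrite mulrDl addrC; apply: lerD.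
    rewrite -!ZE //; apply: le_trans (fo _ _ (Ty s Ts) (Ty s' Ts')) _.
    rewrite -mulrA ler_wpM2l // -[(s' - s) ^+ 2]real_normK ?num_real // -exprMn.
    by rewrite ler_pXn2r ?nnegrE ?mulr_ge0 //; exact: ly.
  have [_ _ /(_ s' Ts')] := bZ s Ts.
  by rewrite big_ord1 tdisp_entry nrm_tdisp real_normK ?num_real.
pose eta s := (dsubmx (xi s))^T.
(* [xi s] is a limit of difference quotients of [lower (y s)], whose first entry is 0. *)
have xiE s : T s -> xi s = lower (eta s).
  move=> Ts; rewrite /lower /eta trmxK -[LHS]vsubmxK; congr col_mx.
  apply: nrm_eq0; apply/ler_addgt0Pr => eps eps0; rewrite add0r.
  have [s' [Ts' sN ss]] := tnear_accum Ts (divr_gt0 eps0 (ltr_pwDr ltr01 CB0)).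
  have d0 : 0 < `|s' - s| by rewrite normr_gt0 subr_eq0.
  have := est s s' Ts Ts'; rewrite -[xi s]vsubmxK /lower scale_col_mx opp_col_mx add_col_mx.
  rewrite nrm_col sub0r nrmN nrmZ => h.
  have {}h : `|s' - s| * nrm (usubmx (xi s)) <= CB * (s' - s) ^+ 2.
    by apply: le_trans h; rewrite lerDl.
  rewrite -[(s' - s) ^+ 2]real_normK ?num_real // expr2 mulrCA ler_pM2l // in h.
  rewrite col_mxKu; apply: le_trans h _; move: ss; rewrite ltr_pdivlMr ?ltr_wpDl // => ss.
  by apply: le_trans (ltW ss); rewrite mulrDr mulr1 mulrC lerDl ltW.
have [CZ1 CZ10 bZ1] := qdm_est hZ1.
have hy : tdm T y eta.
  apply: (@qdm_of_est _ _ _ _ _ _ _ _ _ (nrm y1 + d.+1%:R * r2 + CP * CZ1 + CB)) => s Ts.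
  have Cp : 0 <= CP * CZ1 by rewrite mulr_ge0.
  have Np : 0 <= d.+1%:R * r2 by rewrite mulr_ge0 // ltW.
  have Y1 := nrm_ge0 y1; split.
  - have := box_nrm (Ty2 s Ts); have := nrmD (y s - y1) y1; rewrite subrK; lra.
  - move=> _; rewrite -nrm_lower -xiE //; have [P1 _ _] := bP (y s) (Ty s Ts).
    have [z1 _ _] := bZ1 s Ts.
    have : nrm (xi s) <= CP * CZ1 by apply: le_trans (nrmM _ _) _; exact: ler_pM.
    lra.
  - move=> s' Ts'; rewrite big_ord1 tdisp_entry nrm_tdisp real_normK ?num_real //.
    apply: le_trans (_ : CB * (s' - s) ^+ 2 <= _); last by rewrite ler_wpM2r ?sqr_ge0 //; lra.
    apply: le_trans (est s s' Ts Ts'); rewrite xiE // -nrm_lower.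
    rewrite /lower linearB /= linearZ /= scale_col_mx opp_col_mx add_col_mx scaler0 subr0.
    by rewrite linearB.
exists e', eta; split => //; split => //.
have hPy := qdm_comp sm Ty hy hP.
have hxi := qdm_mul sm hPy hZ1.
apply: qdm_ext (qdm_tr (qdm_dsub hxi)) => [s _|a s Ts]; first by [].
have uy := sf_unit sf (Ty s Ts).
have -> : (\sum_b eta s 0 b *: - (conn kappa i b (y s) *m invmx (Psi (y s)))) *m Z1 s +
    (invmx \o Psi \o y) s *m (c *: Z s) =
    - (\sum_b eta s 0 b *: (conn kappa i b (y s) *m lower (eta s))) + c *: e0.
  rewrite /= -scalemxAr -ZE // mulKmx // mulmx_suml -sumrN; congr (_ + _).
  apply: eq_bigr => b _; rewrite -scalemxAl mulNmx -mulmxA scalerN.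
  by rewrite -xiE.
have -> : \sum_b eta s 0 b *: (conn kappa i b (y s) *m lower (eta s)) =
    (- kappa * gdot i (y s) (eta s) (eta s)) *: e0 - lower (gacc i (y s) (eta s)).
  by rewrite -conn_contract addrK.
rewrite opprB -addrA addrC -scaleNr -scalerDl /e0 /lower scale_col_mx add_col_mx.
by rewrite col_mxKd scaler0 add0r trmxK.
Qed.

Lemma td_derivative (D : set R) (f f1 : R -> vec) t0 e s : D `<=` unit_int ->
  tnear unit_int t0 e `<=` D -> tdm (tnear unit_int t0 e) f f1 -> tnear unit_int t0 e s ->
  derivable_within D f s 1 /\ derive_within D f 1 s = f1 s.
Proof.
move=> DU TD /qdm_est[C C0 h] Ts; have [_ _ hs] := h s Ts.
have cv : diff_quot f s 1 @ incr D s 1 --> f1 s.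
  apply/cvgrPdist_le => eps eps0; rewrite /incr /within /=.
  have d0 : 0 < Num.min (e - `|s - t0|) (eps / (C + 1)).
    by rewrite lt_min subr_gt0 Ts.2 divr_gt0 // ltr_wpDl.
  exists (Num.min (e - `|s - t0|) (eps / (C + 1))) => //= x.
  rewrite /ball_ /= sub0r normrN lt_min => /andP[x1 x2] xN; rewrite [x *: 1]mulr1 => Dx.
  have Tx : tnear unit_int t0 e (x + s).
    split; first exact: DU.
    by rewrite -addrA; apply: le_lt_trans (ler_normD _ _) _; lra.
  have := hs _ Tx; rewrite big_ord1 tdisp_entry nrm_tdisp addrK => H.
  rewrite /diff_quot [x *: 1]mulr1.
  have -> : f1 s - x^-1 *: (f (x + s) - f s) = - (x^-1 *: (f (x + s) - f s - x *: f1 s)).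
    by rewrite [in RHS]scalerBr scalerA mulVf // scale1r opprB.
  apply: le_trans (mxnorm_le_nrm _) _; rewrite nrmN nrmZ normfV ler_pdivrMl ?normr_gt0 //.
  apply: le_trans H _; rewrite expr2 mulrCA ler_wpM2l //.
  have : `|x| * (C + 1) < eps by rewrite -ltr_pdivlMr ?ltr_wpDl.
  by have := normr_ge0 x; rewrite mulrDr mulr1 mulrC; lra.
have PF : ProperFilter (incr D s 1).
  apply: Build_ProperFilter_ex => A; rewrite /incr /within /= => -[e' /= e'0 hA].
  have [s' [Ts' sN ss]] := tnear_accum Ts e'0.
  exists (s' - s); apply: hA => /=; rewrite ?sub0r ?normrN ?subr_eq0 //.
  by rewrite [_ *: 1]mulr1 subrK; exact: TD.
have E : derive_within D f 1 s = f1 s by apply: cvg_lim cv; exact: norm_hausdorff.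
by split => //; rewrite /derivable_within -/(derive_within D f 1 s) E.
Qed.

(** The form and the frame may vary with [t]; only the development [X] is global. *)
Lemma framed_path_geodesic g c (X X1 : R -> cvec) :
  (forall t, unit_int t -> cont_at unit_int g t) -> ode c unit_int X X1 ->
  (forall t, unit_int t -> exists H F, frame H F (g t) /\
     exists2 e : R, 0 < e & forall s, tnear unit_int t e s -> F (g s) = X s) ->
  geodesic g.
Proof.
move=> cg oX hF; split.
  apply/subspace_continuousP => t /=; rewrite in_itv /= => tI U /(cg t tI)[e e0 he].
  rewrite /within /=; exists e => // s /= st; rewrite in_itv /= => sI; apply: he.
  by split => //; rewrite distrC.
move=> i t [tI it].
have [H [F [fr [e e0 FX]]]] := hF t tI.
have [e2 e20 [X2 X12]] := oX t tI.
pose e3 := Num.min e e2; have e30 : 0 < e3 by rewrite lt_min e0.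
have s1 : tnear (@unit_int R) t e3 `<=` tnear unit_int t e.
  by apply: tnear_le; rewrite ge_min lexx.
have s2 : tnear (@unit_int R) t e3 `<=` tnear unit_int t e2.
  by apply: tnear_le; rewrite ge_min lexx orbT.
have [e4 [eta [e40 [hd hy he]]]] := frame_path_td fr it tI (cg t tI) e30
  (fun s Ts => FX s (s1 _ Ts)) (qdm_subset s2 X2) (qdm_subset s2 X12).
have DU : time_dom g i `<=` unit_int by move=> s [].
have TD : tnear (@unit_int R) t e4 `<=` time_dom g i.
  by move=> s Ts; split; [exact: Ts.1|exact: hd].
have T0 : tnear (@unit_int R) t e4 t by split => //; rewrite subrr normr0.
have vE s : tnear unit_int t e4 s -> velocity g i s = eta s.
  by move=> Ts; have [] := td_derivative DU TD hy Ts.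
have hv : tdm (tnear unit_int t e4) (velocity g i)
    (fun s => gacc i (coord i (g s)) (velocity g i s)).
  by apply: qdm_ext he => [s Ts|a s Ts]; rewrite vE.
have [d1 _] := td_derivative DU TD hy T0.
have [d2 a2] := td_derivative DU TD hv T0.
split => // l.
rewrite /acceleration a2 [gacc _ _ _ _ _]mxE.
by rewrite addNr.
Qed.

End paths_to_geodesics.

(** * Lifting chords of the model *)

Section contractions.
Context {R : realType}.

Lemma half_expr_le (k : nat) : (2^-1 : R) ^+ k <= k.+1%:R^-1.
Proof.
rewrite exprVn lef_pV2 ?posrE ?ltr0n ?exprn_gt0 // -natrX ler_nat.
exact: ltn_expl.
Qed.

(** Banach's fixed point: the candidate is a generalized limit of the iterates from 0. The geometric
    bound on the tails passes to it and shows that the iterates converge to it. *)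
Lemma contraction_fixed m k (f : 'M[R]_(m, k) -> 'M[R]_(m, k)) (r : R) : 0 <= r ->
  (forall u, nrm u <= r -> nrm (f u) <= r) ->
  (forall u v, nrm u <= r -> nrm v <= r -> nrm (f u - f v) <= 2^-1 * nrm (u - v)) ->
  exists2 u, nrm u <= r & f u = u.
Proof.
move=> r0 fr fc; pose u p := iter p f (0 : 'M[R]_(m, k)).
have ur p : nrm (u p) <= r by elim: p => [|p ih]; rewrite /u /= ?nrm0 //; exact: fr.
have step p : nrm (u p.+1 - u p) <= r * 2^-1 ^+ p.
  elim: p => [|p ih]; first by rewrite expr0 mulr1 subr0; exact: ur 1%N.
  apply: le_trans (fc _ _ (ur p.+1) (ur p)) _.
  by rewrite exprS mulrCA ler_wpM2l.
have tail p q : nrm (u (p + q)%N - u p) <= 2 * r * 2^-1 ^+ p * (1 - 2^-1 ^+ q).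
  elim: q => [|q ih]; first by rewrite addn0 subrr nrm0 expr0 subrr mulr0.
  have -> : u (p + q.+1)%N - u p = (u (p + q).+1 - u (p + q)%N) + (u (p + q)%N - u p).
    by rewrite addnS addrA subrK.
  apply: le_trans (nrmD _ _) _; have := step (p + q)%N; rewrite exprD exprS.
  have : 0 <= r * 2^-1 ^+ p * 2^-1 ^+ q by rewrite !mulr_ge0 ?exprn_ge0.
  by move: ih; move: (2^-1 ^+ p) (2^-1 ^+ q) => a b; lra.
have [L hL] := @generalized_limit_exists R.
pose us := mxlim L u; pose c : R := (m * k)%:R * (2 * r).
have c0 : 0 <= c by rewrite !mulr_ge0.
have bu : bdd_mx u by exists r.
have lim p : nrm (us - u p) <= c * 2^-1 ^+ p.
  have -> : us - u p = mxlim L (fun q => u q + - u p).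
    by rewrite (mxlimD hL) //; [rewrite (mxlim_cst hL)|exists (nrm (- u p))].
  rewrite /c -mulrA; apply: (mxlim_le hL (K := 2 * r * p.+1%:R)) => q.
  have a0 : 0 <= 2^-1 ^+ p :> R by rewrite exprn_ge0.
  have [pq|qp] := leqP p q.
    rewrite -(subnKC pq); apply: le_trans (tail _ _) _.
    have b0 : 0 <= 2^-1 ^+ (q - p) :> R by rewrite exprn_ge0.
    apply: (@le_trans _ _ (2 * r * 2^-1 ^+ p)); last first.
      by rewrite lerDl divr_ge0 // !mulr_ge0.
    rewrite -[leRHS]mulr1; apply: ler_wpM2l; first by rewrite !mulr_ge0.
    by lra.
  apply: (@le_trans _ _ (2 * r)).
    by apply: le_trans (nrmB _ _) _; have := ur q; have := ur p; lra.
  apply: (@le_trans _ _ (2 * r * p.+1%:R / q.+1%:R)); last by rewrite lerDr !mulr_ge0.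
  by rewrite ler_pdivlMr ?ltr0n // ler_wpM2l ?mulr_ge0 // ler_nat ltnS ltnW.
have usr : nrm us <= r.
  apply: (@le_of_quad _ _ _ c) => p.
  have := nrmD (us - u p) (u p); rewrite subrK => h; apply: le_trans h _.
  apply: le_trans (lerD (lim p) (ur p)) _; rewrite addrC lerD2l.
  by apply: ler_wpM2l => //; apply: half_expr_le.
exists us => //; apply/eqP; rewrite -subr_eq0; apply/eqP/nrm_eq0.
apply: (@le_of_quad _ _ _ (2 * c)) => p; rewrite add0r.
have h1 := fc us (u p) usr (ur p); have h2 := lim p; have h3 := lim p.+1.
have := nrmD (f us - f (u p)) (u p.+1 - us); rewrite addrA subrK => h4.
rewrite [nrm (u p.+1 - us)]nrm_distC in h4.
have h5 := ler_wpM2l c0 (half_expr_le p).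
have h6 : c * 2^-1 ^+ p.+1 <= c * 2^-1 ^+ p.
  apply: ler_wpM2l => //; rewrite exprS; have : 0 <= (2^-1 : R) ^+ p by rewrite exprn_ge0.
  by lra.
have h7 := nrm_ge0 (us - u p); rewrite -mulrA; move: h2 h3 h5 h6.
by move: (c * 2^-1 ^+ p) (c * 2^-1 ^+ p.+1) (c / p.+1%:R) => A1 A2 A3; lra.
Qed.

End contractions.

Section cone_coordinates.
Context {R : realType} {d : nat} (M : riemannian_manifold R d) (kappa : R).
Local Notation vec := 'rV[R]_d.+1.
Local Notation cvec := 'cV[R]_(1 + d.+1).
Local Notation "'MN'" := 'M[R]_(1 + d.+1).
Context (i : chart_idx M) (y0 : vec) (r : R) (Psi : vec -> MN)
  (sf : std_frame kappa i y0 r Psi) (y0_gt0 : 0 < y0 0 ord0).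
Local Notation E0 := (e0 : cvec).

Lemma nrm_e0 : nrm E0 = 1.
Proof. by rewrite /e0 nrm_col nrm0 addr0 /nrm !big_ord1 !mxE eqxx mulr1n normr1. Qed.

Lemma nrm_usub_le (u : cvec) : `|u (lshift d.+1 0) 0| <= nrm u.
Proof. exact: entry_le. Qed.

Lemma nrm_dsub_le (u : cvec) : nrm (dsubmx u) <= nrm u.
Proof. by rewrite -{2}(vsubmxK u) nrm_col lerDr nrm_ge0. Qed.

(* The cone map (rho, y) |-> rho Psi(y) e0 is tangent to a translation at
   (1, y0), since the derivative of Psi e0 in direction a is Psi (0, e_a). *)
Lemma cone_inverse r' : 0 < r' -> r' <= r -> exists (eta : R) (rho : cvec -> R)
  (Y : cvec -> vec), 0 < eta /\
  [/\ forall X, nrm (X - E0) <= eta -> [/\ 0 < rho X, box y0 r' (Y X) &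
        rho X *: (Psi (Y X) *m E0) = X],
      forall X X', nrm (X - E0) <= eta -> nrm (X' - E0) <= eta ->
        nrm (Y X' - Y X) <= 2 * nrm (X' - X) &
      Y E0 = y0].
Proof.
move=> r'0 rr; have lb := sf_box sf; have sm := lb_small lb.
have [C C0 hC] := sol_first_order sm (sf_sol sf).
have [L L0 hL] := qdm_lip sm (sf_sol sf).
(* [B / 2] is the sum of the coefficients of the four errors [t1] to [t4], so [q * B <= 1] makes
   [Rm] a contraction of factor 1/2. The bound [q <= y0 0 ord0] keeps [yu u] in the half-space. *)
pose B := 2 * (3 * L + 4 * C + 1); have B0 : 0 < B by rewrite /B; lra.
pose q := Num.min (Num.min (r' / 2) (y0 0 ord0)) (Num.min 2^-1 B^-1).
have q0 : 0 < q by rewrite !lt_min y0_gt0 !invr_gt0 B0 divr_gt0 //= ltr0n.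
have [q1 q2 q3 q4] : [/\ q <= r' / 2, q <= y0 0 ord0, q <= 2^-1 & q <= B^-1].
  by split; rewrite /q !ge_min lexx ?orbT.
have qB : q * B <= 1 by rewrite -ler_pdivlMr // div1r.
pose yu (u : cvec) : vec := y0 + (dsubmx u)^T.
pose au (u : cvec) : R := 1 + u (lshift d.+1 0) 0.
have yb u : nrm u <= q -> box y0 r' (yu u).
  move=> uq; have ent a : `|(dsubmx u)^T 0 a| <= q.
    by apply: le_trans (entry_le _ 0 a) _; rewrite nrm_tr; exact: le_trans (nrm_dsub_le u) uq.
  split=> [a|]; rewrite mxE.
    by rewrite addrAC subrr add0r; have := ent a; lra.
  by have := ent ord0; rewrite ler_norml => /andP[? _]; lra.
pose G u := au u *: (Psi (yu u) *m E0).
pose Rm u := G u - E0 - u.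
have m0 := local_box_mem lb.
have uE (u v : cvec) : v - u = (au v - au u) *: E0 + lower (yu v - yu u).
  rewrite /au /yu opprD addrACA subrr add0r [in RHS]opprD [in RHS]addrACA subrr add0r.
  rewrite /lower /e0 linearB /= !trmxK scale_col_mx add_col_mx scaler0 add0r addr0.
  rewrite -{1}(vsubmxK u) -{1}(vsubmxK v) opp_col_mx add_col_mx; congr col_mx.
  by apply/matrixP => a b; rewrite (ord1 a) (ord1 b) !mxE eqxx mulr1n mulr1.
have Rc u v : nrm u <= q -> nrm v <= q -> nrm (Rm v - Rm u) <= 2^-1 * nrm (v - u).
  move=> uq vq; have Qu := box_le rr (yb _ uq); have Qv := box_le rr (yb _ vq).
  set w := lower (yu v - yu u); set a := au u; set a' := au v.
  set P := Psi (yu u) *m E0; set P' := Psi (yu v) *m E0.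
  have E : Rm v - Rm u = (a' - a) *: (P' - E0) + a *: (P' - P - Psi (yu u) *m w) +
      a *: ((Psi (yu u) - 1%:M) *m w) + (a - 1) *: w.
    have -> : Rm v - Rm u = a' *: P' - a *: P - (v - u).
      rewrite /Rm /G -/a -/a' -/P -/P'; move: (a' *: P') (a *: P) => x z.
      by apply/matrixP => s t; rewrite !mxE; ring.
    rewrite uE -/a -/a' -/w mulmxBl mul1mx; move: (Psi (yu u) *m w) => z.
    by apply/matrixP => s t; rewrite !mxE; ring.
  have dist x : nrm x <= q -> nrm (yu x - y0) <= q.
    move=> xq; rewrite /yu addrAC subrr add0r nrm_tr; exact: le_trans (nrm_dsub_le x) xq.
  have D0 : 0 <= nrm (v - u) by exact: nrm_ge0.
  have dw : nrm w <= nrm (v - u).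
    rewrite /w nrm_lower /yu opprD addrACA subrr add0r -linearB /= nrm_tr -linearB /=.
    exact: nrm_dsub_le.
  have da : `|a' - a| <= nrm (v - u).
    have := nrm_usub_le (v - u); rewrite !mxE /a /a' /au.
    by rewrite opprD addrACA subrr add0r.
  have a2 : `|a| <= 2.
    have := le_trans (nrm_usub_le u) uq; rewrite /a /au => h.
    by apply: le_trans (ler_normD _ _) _; rewrite normr1; lra.
  have a1 : `|a - 1| <= q.
    by rewrite /a /au addrAC subrr add0r; exact: le_trans (nrm_usub_le u) uq.
  have lP : nrm (Psi (yu u) - 1%:M) <= L * q.
    have := hL y0 (yu u) m0 Qu; rewrite (sf_one sf) => h; apply: le_trans h _.
    by rewrite ler_wpM2l //; exact: dist.
  have lP' : nrm (P' - E0) <= L * q.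
    have := hL y0 (yu v) m0 Qv; rewrite (sf_one sf) => h.
    have -> : P' - E0 = (Psi (yu v) - 1%:M) *m E0 by rewrite mulmxBl mul1mx.
    apply: le_trans (nrmM _ _) _; rewrite nrm_e0 mulr1; apply: le_trans h _.
    by rewrite ler_wpM2l //; exact: dist.
  have w0 : 0 <= nrm w by exact: nrm_ge0.
  have w2 : nrm w <= 2 * q.
    by apply: le_trans dw _; apply: le_trans (nrmB _ _) _; lra.
  have fo := hC _ _ Qu Qv; rewrite -nrm_lower -/w -/P -/P' in fo.
  have q0' := ltW q0.
  have t1 : nrm ((a' - a) *: (P' - E0)) <= (L * q) * nrm (v - u).
    by rewrite nrmZ mulrC; apply: ler_pM => //; exact: nrm_ge0.
  have t2 : nrm (a *: (P' - P - Psi (yu u) *m w)) <= (2 * (C * (2 * q))) * nrm (v - u).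
    rewrite nrmZ -[leRHS]mulrA; apply: ler_pM; [exact: normr_ge0|exact: nrm_ge0|exact: a2|].
    apply: le_trans fo _; rewrite -mulrA ler_wpM2l // expr2; exact: ler_pM.
  have t3 : nrm (a *: ((Psi (yu u) - 1%:M) *m w)) <= (2 * (L * q)) * nrm (v - u).
    rewrite nrmZ -[leRHS]mulrA; apply: ler_pM; [exact: normr_ge0|exact: nrm_ge0|exact: a2|].
    apply: le_trans (nrmM _ _) _; apply: ler_pM => //; exact: nrm_ge0.
  have t4 : nrm ((a - 1) *: w) <= q * nrm (v - u) by rewrite nrmZ; exact: ler_pM.
  rewrite E; apply: le_trans (nrmD_le (nrmD_le (nrmD_le t1 t2) t3) t4) _.
  rewrite -!mulrDl; apply: ler_wpM2r => //.
  have -> : L * q + 2 * (C * (2 * q)) + 2 * (L * q) + q = q * B / 2 by rewrite /B; field.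
  by rewrite -[leRHS]mul1r; apply: ler_wpM2r.
have R0 : Rm 0 = 0.
  rewrite /Rm /G /au /yu linear0 trmx0 addr0 (sf_one sf) mul1mx mxE addr0 scale1r.
  by rewrite subrr subr0.
have ex X : nrm (X - E0) <= q / 2 -> exists2 u : cvec, nrm u <= q & G u = X.
  move=> hX; have [||u uq uf] := @contraction_fixed _ _ _ (fun u => X - E0 - Rm u) q (ltW q0).
  - move=> u uq; have := Rc 0 u; rewrite nrm0 R0 !subr0 => /(_ (ltW q0) uq) h.
    by apply: le_trans (nrmB _ _) _; lra.
  - move=> u v uq vq; rewrite nrm_distC [nrm (u - v)]nrm_distC.
    have -> : X - E0 - Rm v - (X - E0 - Rm u) = - (Rm v - Rm u).
      move: (Rm u) (Rm v) (X - E0) => x z w.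
      by apply/matrixP => s t; rewrite !mxE; ring.
    by rewrite nrmN; exact: Rc.
  exists u => //; have : X - E0 - Rm u - u = 0 by rewrite uf subrr.
  move=> h; apply/eqP; rewrite -subr_eq0 -oppr_eq0; apply/eqP; rewrite -h /Rm.
  by move: (G u) => w; apply/matrixP => s t; rewrite !mxE; ring.
have /choice[U hU] X : exists u : cvec, nrm (X - E0) <= q / 2 -> nrm u <= q /\ G u = X.
  have [h|h] := pselect (nrm (X - E0) <= q / 2); last by exists 0.
  by have [u u1 u2] := ex X h; exists u.
have lipU X X' : nrm (X - E0) <= q / 2 -> nrm (X' - E0) <= q / 2 ->
    nrm (U X' - U X) <= 2 * nrm (X' - X).
  move=> /hU[u1 u2] /hU[v1 v2]; have := Rc _ _ u1 v1.
  have E : U X' - U X = (X' - X) - (Rm (U X') - Rm (U X)).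
    rewrite /Rm u2 v2; move: (U X) (U X') => u v.
    by apply/matrixP => s t; rewrite !mxE; ring.
  have := nrmB (X' - X) (Rm (U X') - Rm (U X)); rewrite -E; lra.
exists (q / 2), (fun X => au (U X)), (fun X => yu (U X)); split; first by rewrite divr_gt0.
split.
- move=> X /hU[u1 u2]; split; [|exact: yb|exact: u2].
  have := le_trans (nrm_usub_le (U X)) u1; rewrite /au ler_norml => /andP[? _]; lra.
- move=> X X' hX hX'; apply: le_trans (lipU X X' hX hX').
  rewrite /yu opprD addrACA subrr add0r -linearB /= nrm_tr -linearB /=.
  exact: nrm_dsub_le.
- have z : nrm (E0 - E0) <= q / 2 by rewrite subrr nrm0 divr_ge0 // ltW.
  have [u1 u2] := hU _ z; have h := Rc 0 (U E0); rewrite nrm0 R0 !subr0 in h.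
  have {}h := h (ltW q0) u1; rewrite /Rm u2 subrr sub0r nrmN in h.
  have U0 : U E0 = 0 by apply: nrm_eq0; have := nrm_ge0 (U E0); lra.
  by rewrite U0 /yu linear0 trmx0 addr0.
Qed.

End cone_coordinates.

Section lifts.
Context {R : realType} {d : nat} (M : riemannian_manifold R d) (kappa : R)
  (curv : constant_curvature M kappa).
Local Notation vec := 'rV[R]_d.+1.
Local Notation cvec := 'cV[R]_(1 + d.+1).
Local Notation "'MN'" := 'M[R]_(1 + d.+1).
Local Notation sol := (sol kappa).
Local Notation gram_mx := (gram_mx kappa).
Local Notation frame := (frame kappa).
Local Notation std_frame := (std_frame kappa).
Local Notation E0 := (e0 : cvec).
Implicit Types (i j : chart_idx M) (y v : vec) (H L : MN) (F : M -> cvec) (g : R -> M).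

Lemma inv_nbhd i y (U : set M) : chart_image i y -> nbhs (inv i y) U ->
  exists2 r : R, 0 < r & forall y', chart_image i y' -> nrm (y' - y) < r -> U (inv i y').
Proof.
move=> iy nU; have /subspace_continuousP /(_ _ iy) := @inv_continuous _ _ M i.
move=> /(_ _ nU); rewrite /within /= => /nbhs_ballP[e /= e0 he].
exists e => // y' iy' h; apply: he => //; split => // k a.
rewrite (ord1 k) /ball /= /ball_ /= distrC.
by have := entry_le (y' - y) 0 a; rewrite !mxE => h'; exact: le_lt_trans h' h.
Qed.

Lemma std_norm i y1 r Psi y : std_frame i y1 r Psi -> box y1 r y ->
  (Psi y *m E0)^T *m gram_mx i y1 *m (Psi y *m E0) = 1%:M.
Proof.
move=> sf Qy.
transitivity (E0^T *m ((Psi y)^T *m gram_mx i y1 *m Psi y) *m E0).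
  by rewrite trmx_mul !mulmxA.
rewrite (sf_gram sf Qy).
rewrite /e0 /gram_mx tr_col_mx trmx1 trmx0 mul_row_block mul_row_col.
by rewrite !(mul0mx, mulmx0, addr0, mulmx1, mul1mx).
Qed.

(** Both points lie on the quadric of [std_norm], so the form takes on each side the square of its
    factor. *)
Lemma std_scale i y1 r Psi y y' (rho rho' : R) : std_frame i y1 r Psi ->
  box y1 r y -> box y1 r y' -> 0 < rho -> 0 < rho' ->
  rho *: (Psi y *m E0) = rho' *: (Psi y' *m E0) -> rho = rho'.
Proof.
move=> sf Qy Qy' r0 r0' E; apply/eqP; rewrite -(eqrXn2 (n := 2)) // ?ltW //; apply/eqP.
have h (a : R) x : box y1 r x -> (a *: (Psi x *m E0))^T *m gram_mx i y1 *m
    (a *: (Psi x *m E0)) = (a ^+ 2)%:M.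
  move=> Qx; have -> : (a *: (Psi x *m E0))^T = a *: (Psi x *m E0)^T by rewrite linearZ.
  rewrite -!scalemxAl -scalemxAr (std_norm sf Qx).
  by rewrite !scale_scalar_mx mulr1 -expr2.
have := h rho y Qy; rewrite E (h rho' y' Qy') => /matrixP /(_ 0 0).
by rewrite !mxE eqxx !mulr1n.
Qed.

Lemma frame_norm H F p : frame H F p -> (F p)^T *m H *m F p = 1%:M.
Proof.
move=> fr; have ip := dom_chart_at p; have [r [S [lb _ hF uS gS]]] := fr _ ip.
rewrite -(coordK ip) hF; last exact: local_box_mem lb.
rewrite trmx_mul; transitivity (E0^T *m gram_mx (chart_at p) (coord (chart_at p) p) *m E0).
  by rewrite -gS !mulmxA.
rewrite /e0 /gram_mx tr_col_mx trmx1 trmx0 mul_row_block mul_row_col.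
by rewrite !(mul0mx, mulmx0, addr0, mulmx1, mul1mx).
Qed.

Lemma td_unique (T : set R) m k (X X1 X1' : R -> 'M[R]_(m, k)) s : T s ->
  (forall e : R, 0 < e -> exists s', [/\ T s', s' != s & `|s' - s| < e]) ->
  tdm T X X1 -> tdm T X X1' -> X1 s = X1' s.
Proof.
move=> Ts acc h h'; apply/matrixP => i j.
have [C C0 /(_ s Ts) [_ _ hC]] := td_elim (h i j).
have [C' C'0 /(_ s Ts) [_ _ hC']] := td_elim (h' i j).
apply/eqP; rewrite -subr_eq0 -normr_le0; apply/ler_addgt0Pr => eps eps0; rewrite add0r.
have q0 : 0 < C + C' + 1 by rewrite ltr_wpDl // addr_ge0.
have [s' [Ts' sN ss]] := acc _ (divr_gt0 eps0 q0).
have d0 : 0 < `|s' - s| by rewrite normr_gt0 subr_eq0.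
rewrite -(ler_pM2r d0) -normrM.
have := hC s' Ts'; have := hC' s' Ts'; move: (X s' i j) (X s i j) => a b h1 h2.
have -> : (X1 s i j - X1' s i j) * (s' - s) =
  (a - b - X1' s i j * (s' - s)) - (a - b - X1 s i j * (s' - s)) by ring.
apply: le_trans (ler_normB _ _) _; apply: le_trans (lerD h1 h2) _.
rewrite -mulrDl -[(s' - s) ^+ 2]real_normK ?num_real // expr2 mulrA ler_wpM2r //.
move: ss; rewrite ltr_pdivlMr // => ss; apply: le_trans (ltW ss).
by rewrite mulrC ler_wpM2l //; lra.
Qed.

(** Agreement near [s] forces equal first and second derivatives at [s]. As [X s] is not 0 the
    constants agree, and [ode_formula] does the rest. *)
Lemma ode_unique (t e : R) m k (X X1 X' X1' : R -> 'M[R]_(m, k)) c c' s e' :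
  0 <= c -> 0 <= c' -> tnear unit_int t e s -> 0 < e' ->
  ode c (tnear unit_int t e) X X1 -> ode c' (tnear unit_int t e) X' X1' ->
  (forall x, tnear unit_int t e x -> `|x - s| < e' -> X x = X' x) -> X s != 0 ->
  c = c' /\ forall x, tnear unit_int t e x -> X x = X' x.
Proof.
move=> c0 c0' Ts e'0 o o' E XN; set T := tnear unit_int t e in Ts o o' E *.
have [e1 e10 [x1 x2]] := o s Ts; have [e2 e20 [x1' x2']] := o' s Ts.
pose e3 := Num.min e' (Num.min e1 e2); have e30 : 0 < e3 by rewrite !lt_min e'0 e10 e20.
have sub (x a : R) : tnear T s (Num.min a e3) x ->
    [/\ T x, `|x - s| < e', tnear T s e1 x & tnear T s e2 x].
  by move=> [Tx]; rewrite !lt_min => /and4P[_ h1 h2 h3]; split => //; split.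
have acc (x a : R) : tnear T s e3 x -> 0 < a ->
    exists s', [/\ tnear T s e3 s', s' != x & `|s' - x| < a].
  move=> [Tx xs] a0; have [|s' [Ts' sN ss]] := @tnear_accum R t x e (Num.min a (e3 - `|x - s|)) Tx.
    by rewrite lt_min a0 subr_gt0.
  move: ss; rewrite lt_min => /andP[ss1 ss2]; exists s'; split => //; split => //.
  rewrite -(subrK x s') -addrA; apply: le_lt_trans (ler_normD _ _) _; lra.
have sub3 x : tnear T s e3 x -> [/\ T x, `|x - s| < e', tnear T s e1 x & tnear T s e2 x].
  by move=> [Tx hx]; apply: (sub x (e3 + 1)); split => //; rewrite lt_min hx; lra.
have X1E x : tnear T s e3 x -> X1 x = X1' x.
  move=> Tx; apply: (@td_unique (tnear T s e3) _ _ X) => //; first by move=> a; exact: acc.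
    by apply: qdm_subset x1 => w /sub3[].
  apply: qdm_ext (qdm_subset _ x1') => [w /sub3[Tw ws _ _]| //|w /sub3[] //].
  exact/esym/E.
have Ts3 : tnear T s e3 s by split => //; rewrite subrr normr0.
have cE : c *: X s = c' *: X s.
  rewrite {2}(E s) ?subrr ?normr0 //.
  apply: (@td_unique (tnear T s e3) _ _ X1 (fun x => c *: X x) (fun x => c' *: X' x)) => //.
  - by move=> a; exact: acc.
  - by apply: qdm_subset x2 => w /sub3[].
  - apply: qdm_ext (qdm_subset _ x2') => [w Tw| //|w /sub3[] //].
    exact/esym/X1E.
have {}cE : c = c'.
  apply/eqP; rewrite -subr_eq0; have : (c - c') *: X s = 0 by rewrite scalerBl cE subrr.
  by move=> /eqP; rewrite scaler_eq0 (negPf XN) orbF.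
split => // x Tx; have cT : order_convex T := order_convex_tnear (@order_convex_unit R).
have TU : T `<=` unit_int := @tnear_sub _ _ _ _.
have [-> _] := ode_formula c0 cT TU o Ts Tx; have [-> _] := ode_formula c0' cT TU o' Ts Tx.
by rewrite cE (E s) ?subrr ?normr0 // (X1E s Ts3).
Qed.

(* The chords are affine segments, the central projections of which to the model
   are the geodesics from E0. *)
Definition chord (Y : cvec) (s : R) : cvec := E0 + s *: (Y - E0).
Definition seg (b : R) : set R := [set s | 0 <= s <= b].
(** A chord may leave the quadric, so a lift follows it only up to a positive factor, that is, by
    central projection. *)
Definition aims F (q : M) (X : cvec) : Prop := exists2 rho : R, 0 < rho & rho *: F q = X.
Definition develops F g (T : set R) (Y : cvec) (s : R) : Prop :=
  exists2 e : R, 0 < e & forall s', tnear T s e s' -> aims F (g s') (chord Y s').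

(** The frame may change with [s]; only at the start is it prescribed to be [F0]. *)
Record lift H F0 (z : M) (Y : cvec) (b : R) g : Prop := Lift {
  lift_start : g 0 = z;
  lift_cont : forall s, seg b s -> cont_at (seg b) g s;
  lift_frame : forall s, seg b s -> exists2 F, frame H F (g s) & develops F g (seg b) Y s;
  lift_init : develops F0 g (seg b) Y 0
}.

(** If [b] is 0 the old lift is a single point and the development at 0 is entirely that of the new
    piece; the last hypothesis, that [F] is then [F0], preserves [lift_init]. *)
Lemma lift_extend H F0 z Y b b' g g2 F F' : 0 <= b -> b < b' ->
  lift H F0 z Y b g -> develops F g (seg b) Y b -> g2 b = g b ->
  (forall s, b <= s <= b' -> cont_at [set s | b <= s <= b'] g2 s) ->
  (forall s, b <= s <= b' -> frame H F' (g2 s) /\ aims F' (g2 s) (chord Y s)) ->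
  (\forall q \near g b, F' q = F q) -> (b = 0 -> F = F0) ->
  let h s := if s <= b then g s else g2 s in
  lift H F0 z Y b' h /\ develops F' h (seg b') Y b'.
Proof.
move=> b0 bb' [ls lc lf li] dF gb c2 f2 FF Fz h.
have hl s : s <= b -> h s = g s by rewrite /h => ->.
have hr s : b <= s -> h s = g2 s.
  move=> bs; rewrite /h; case: ifP => // sb.
  by have -> : s = b by lra.
have sb : seg b b by rewrite /seg /= b0 lexx.
have bI : b <= b <= b' by rewrite lexx ltW.
have left_of s e : s < b -> 0 < e -> exists2 e' : R, 0 < e' &
    forall s', tnear (seg b') s e' s' -> s' <= b /\ tnear (seg b) s e s'.
  move=> sb' e0; exists (Num.min e (b - s)) => [|s' [/andP[? ?]]].
    by rewrite lt_min e0 subr_gt0.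
  rewrite lt_min => /andP[h1 h2].
  have s'b : s' <= b by move: h2; rewrite ltr_norml => /andP[? ?]; lra.
  by split => //; split => //; apply/andP; split.
have right_of s e : b < s -> 0 < e -> exists2 e' : R, 0 < e' &
    forall s', tnear (seg b') s e' s' -> b <= s' /\ tnear [set s | b <= s <= b'] s e s'.
  move=> bs e0; exists (Num.min e (s - b)) => [|s' [/andP[? ?]]].
    by rewrite lt_min e0 subr_gt0.
  rewrite lt_min => /andP[h1 h2].
  have s'b : b <= s' by move: h2; rewrite ltr_norml => /andP[? ?]; lra.
  by split => //; split => //; apply/andP; split.
have split_at s' e e' : tnear (seg b') b (Num.min e e') s' ->
    (s' <= b /\ tnear (seg b) b e s') \/
    (b <= s' /\ tnear [set s | b <= s <= b'] b e' s').
  move=> [/andP[? ?]]; rewrite lt_min => /andP[h1 h2].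
  have [s'b|/ltW bs'] := leP s' b; [left|right]; split => //; split => //;
  by apply/andP; split.
have hc s : seg b' s -> cont_at (seg b') h s.
  move=> /andP[s0 sb'] U; have [sltb|slgtb|->] := ltgtP s b.
  - rewrite hl ?ltW // => nU.
    have [e e0 he] := lc s ltac:(by rewrite /seg /= s0 ltW) U nU.
    have [e' e'0 he'] := left_of s e sltb e0; exists e' => // s' /he'[s'b Ts'].
    by rewrite hl //; exact: he.
  - rewrite hr ?ltW // => nU.
    have [e e0 he] := c2 s ltac:(by rewrite sb' ltW) U nU.
    have [e' e'0 he'] := right_of s e slgtb e0; exists e' => // s' /he'[s'b Ts'].
    by rewrite hr //; exact: he.
  - rewrite hl // => nU; have [e e0 he] := lc b sb U nU.
    have nU2 : nbhs (g2 b) U by rewrite gb.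
    have [e' e'0 he'] := c2 b bI U nU2.
    exists (Num.min e e') => [|s' /split_at[[s'b Ts']|[bs' Ts']]].
    + by rewrite lt_min e0.
    + by rewrite hl //; exact: he.
    + by rewrite hr //; exact: he'.
have hd s : b < s <= b' -> develops F' h (seg b') Y s.
  move=> /andP[bs sb']; have [e e0 he] := right_of s 1 bs ltr01.
  exists e => // s' /he[bs' [s'I _]]; rewrite hr //.
  by have [] := f2 s' s'I.
have hb : develops F' h (seg b') Y b.
  have [e e0 he] := dF; have [e' e'0 he'] := lc b sb _ FF.
  exists (Num.min (Num.min e e') 1) => [|s' /split_at[[s'b [Ts']]|[bs' [s'I _]]]].
  - by rewrite !lt_min e0 e'0 ltr01.
  - rewrite lt_min => /andP[h1 h2]; rewrite hl //.
    have [rho r0 E] := he s' (conj Ts' h1); exists rho => //.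
    by rewrite (he' s' (conj Ts' h2)).
  - by rewrite hr //; have [] := f2 s' s'I.
split; last by apply: hd; rewrite bb' lexx.
split.
- by rewrite hl.
- exact: hc.
- move=> s /andP[s0 sb']; have [sltb|slgtb|->] := ltgtP s b.
  + have [F1 fr [e e0 he]] := lf s ltac:(by rewrite /seg /= s0 ltW).
    exists F1; first by rewrite hl ?ltW.
    have [e' e'0 he'] := left_of s e sltb e0; exists e' => // s' /he'[s'b Ts'].
    by rewrite hl //; exact: he.
  + exists F'; last by apply: hd; rewrite slgtb.
    by rewrite hr ?ltW //; have [] := f2 s ltac:(by rewrite sb' ltW).
  + by exists F' => //; rewrite hl // -gb; have [] := f2 b bI.
- have [bz|bp] := eqVneq b 0.
    have [e e0 he] := hb; rewrite bz in he.
    have hc0 := hc 0 ltac:(by rewrite /seg /= lexx -bz ltW).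
    have n0 : nbhs (h 0) (fun q => F' q = F q) by rewrite (hl 0 b0) -[X in g X]bz.
    have [e' e'0 he'] := hc0 _ n0.
    exists (Num.min e e') => [|s' [Ts']]; first by rewrite lt_min e0.
    rewrite lt_min => /andP[h1 h2]; have [rho r0 E] := he s' (conj Ts' h1).
    by exists rho => //; rewrite -(Fz bz) -(he' s').
  have [e e0 he] := li; have b0' : 0 < b by rewrite lt_neqAle eq_sym bp.
  have [e' e'0 he'] := left_of 0 e b0' e0; exists e' => // s' /he'[s'b Ts'].
  by rewrite hl //; exact: he.
Qed.

End lifts.

(** * The continuity method for lifts *)

Section lifting.
Context {R : realType} {d : nat} (M : riemannian_manifold R d) (kappa : R)
  (curv : constant_curvature M kappa) (kappa_le0 : kappa <= 0).
Local Notation vec := 'rV[R]_d.+1.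
Local Notation cvec := 'cV[R]_(1 + d.+1).
Local Notation "'MN'" := 'M[R]_(1 + d.+1).
Local Notation gram_mx := (gram_mx kappa).
Local Notation frame := (frame kappa).
Local Notation std_frame := (std_frame kappa).
Local Notation lift := (lift kappa).
Local Notation E0 := (e0 : cvec).
Implicit Types (i j : chart_idx M) (y v : vec) (H L : MN) (F : M -> cvec) (g : R -> M).

Definition interior_pt (p : M) : Prop := exists2 i, dom i p & 0 < coord i p 0 ord0.

Lemma geodesic_cont g t : geodesic g -> unit_int t -> cont_at unit_int g t.
Proof.
move=> [/subspace_continuousP cg _] tI U nU.
have tI' : [set` `[0, 1]%R] t by rewrite /= in_itv.
have := cg t tI' U nU; rewrite /within /= => -[e /= e0 he]; exists e => // s [sI st].
by apply: he => /=; [rewrite distrC|rewrite in_itv].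
Qed.

(** Adds to [cone_inverse] that [Yf] recovers the points of the box: the factor is determined by
    [std_scale], and then the point by [sol_inj]. *)
Lemma std_cone i y1 r Psi : std_frame i y1 r Psi -> 0 < y1 0 ord0 ->
  exists r' (eta : R) (rho : cvec -> R) (Yf : cvec -> vec), [/\ 0 < r', r' <= r, 0 < eta &
  [/\ forall X, nrm (X - E0) <= eta -> [/\ 0 < rho X, box y1 r' (Yf X) &
        rho X *: (Psi (Yf X) *m E0) = X],
      forall X X', nrm (X - E0) <= eta -> nrm (X' - E0) <= eta ->
        nrm (Yf X' - Yf X) <= 2 * nrm (X' - X) &
      forall (a : R) y, 0 < a -> box y1 r' y ->
        nrm (a *: (Psi y *m E0) - E0) <= eta -> Yf (a *: (Psi y *m E0)) = y]].
Proof.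
move=> sf pos; have lb := sf_box sf.
have [r' [K [r'0 rr K0 hK]]] := sol_inj lb (sf_sol sf) (sf_unit sf (local_box_mem lb)).
have [eta [rho [Yf [eta0 [h1 h2 _]]]]] := cone_inverse sf pos r'0 rr.
exists r', eta, rho, Yf; split => //; split => // a y a0 Qy hX.
have [p0 Qf E] := h1 _ hX; have s := @box_le _ _ y1 _ _ rr.
have sc := std_scale sf (s _ Qf) (s _ Qy) p0 a0 E; rewrite sc in E.
apply/eqP; rewrite -subr_eq0; apply/eqP/nrm_eq0; apply: le_trans (hK _ _ Qy Qf) _.
have -> : Psi (Yf (a *: (Psi y *m E0))) *m E0 = Psi y *m E0.
  have aN : a != 0 by rewrite gt_eqF.
  by apply: (can_inj (scalerK aN)).
by rewrite subrr nrm0 mulr0.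
Qed.

Section along.
Context (H : MN) (F0 : M -> cvec) (z : M) (g : R -> M) (X X1 : R -> cvec) (c : R)
  (Y0 : cvec) (lam sig : R -> R) (Kl : R).
Context (gg : geodesic g) (g0 : g 0 = z) (fr0 : frame H F0 z)
  (int_g : forall t, unit_int t -> interior_pt (g t))
  (c0 : 0 <= c) (oX : ode c unit_int X X1)
  (start : exists2 e : R, 0 < e & forall s, tnear unit_int 0 e s -> F0 (g s) = X s)
  (XE : forall t, unit_int t -> 0 < lam t /\ X t = lam t *: chord Y0 (sig t))
  (Kl0 : 0 <= Kl)
  (lam_lip : forall s t, unit_int s -> unit_int t -> `|lam t - lam s| <= Kl * `|t - s|)
  (sig0 : sig 0 = 0) (sig1 : sig 1 = 1)
  (sig_lt : forall s t, 0 <= s -> s < t -> t <= 1 -> sig s < sig t).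

(* For the continuity method along a geodesic g that develops to the chord of Y0:
   up to time t, the chords of all Y near Y0 lift. *)
Definition liftable t := exists F, [/\ frame H F (g t), sig t = 0 -> F = F0,
  exists2 e : R, 0 < e & forall s, tnear unit_int t e s -> F (g s) = X s &
  forall U, nbhs (g t) U -> exists2 del : R, 0 < del & forall Y, nrm (Y - Y0) < del ->
    exists b, [/\ lift H F0 z Y (sig t) b, U (b (sig t)) &
      develops F b (seg (sig t)) Y (sig t)]].

Lemma sig_ge0 t : unit_int t -> 0 <= sig t <= 1.
Proof.
move=> /andP[t0 t1]; apply/andP; split.
  by have [->|tN] := eqVneq t 0; rewrite ?sig0 // ltW // -sig0 sig_lt // lt_neqAle eq_sym tN.
by have [->|tN] := eqVneq t 1; rewrite ?sig1 // ltW // -sig1 sig_lt // lt_neqAle tN.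
Qed.

Lemma liftable0 : liftable 0.
Proof.
have u0 : @unit_int R 0 by rewrite /unit_int /= lexx ler01.
have aim0 : aims F0 z (chord Y0 0) by have [e e0 /(_ 0)] := start;
  have [l0 XE0] := XE u0; rewrite g0 XE0 sig0 => FE; exists (lam 0)^-1;
  rewrite ?invr_gt0 // FE ?scalerA ?mulVf ?scale1r ?gt_eqF //;
  split; rewrite ?subrr ?normr0.
have chord0 Y : chord Y 0 = chord Y0 0 by rewrite /chord !scale0r.
exists F0; split => //; first by rewrite g0.
move=> U nU; exists 1 => // Y _; exists (fun=> z); rewrite sig0.
have seg0 s : seg 0 s -> s = 0 by move=> /andP[? ?]; lra.
have dev s : seg 0 s -> develops F0 (fun=> z) (seg (0 : R)) Y s.
  by move=> _; exists 1 => // s' [/seg0 -> _]; rewrite chord0.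
have s0 : seg 0 (0 : R) by rewrite /seg /= lexx.
split; [split => //|by rewrite -g0; exact: nbhs_singleton|exact: dev].
- by move=> s _ V nV; exists 1 => // s' _; exact: nbhs_singleton nV.
- by move=> s ss; exists F0 => //; exact: dev.
- exact: dev.
Qed.

(** Everything takes place in cone coordinates at [g t]. There the frame at [g s] is [L *m Fp q] and
    continues to [g s']. Multiplied by [lam t] and the inverse of [L], the part of the chord between
    [sig s] and [sig s'] lies near [e0]; [Yf] lifts it, and this piece is glued to the lift given at
    [s]. *)
Lemma liftable_step t : unit_int t -> exists2 e : R, 0 < e &
  forall s s', 0 <= s -> s <= s' -> s' <= 1 -> `|s - t| < e -> `|s' - t| < e ->
    liftable s -> liftable s'.
Proof.
move=> tI; have [i it pos] := int_g tI; set y1 := coord i (g t).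
have iy : chart_image i y1 by exists (g t).
have [r [Psi sf]] := std_frame_exists curv iy.
have lb := sf_box sf; have m1 := local_box_mem lb.
have [r' [eta [rho [Yf [r'0 rr eta0 [hcone hlip huniq]]]]]] := std_cone sf pos.
pose Fp q := Psi (coord i q) *m E0.
have FpE y : box y1 r y -> Fp (inv i y) = Psi y *m E0.
  by move=> Qy; rewrite /Fp; have [_ ->] := inv_chart (lb_sub lb Qy).
have germ : germ_at kappa (gram_mx i y1) Fp i y1 r Psi.
  split => //; [exact: (sf_sol sf)| |].
  - by rewrite (sf_one sf) unitmx1.
  - by rewrite (sf_one sf) trmx1 mul1mx mulmx1.
have [e1 e10 [cc cc0 [d1 P1 P2]]] := germ_along_geodesic kappa_le0 gg tI it germ.
have [e2 e20 h2] := geodesic_cont gg tI (chart_nbhd it r'0).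
set X1p := (fun s => _) in P1 P2.
have sm1 : small tdisp (tnear unit_int t e1) by apply: small_unit_int; exact: tnear_sub.
have [LP LP0 lP] := qdm_lip sm1 P1.
have tt (e : R) : 0 < e -> tnear unit_int t e t by move=> ?; split => //; rewrite subrr normr0.
have PtE : Fp (g t) = E0 by rewrite /Fp (sf_one sf) mul1mx.
have [lt0 _] := XE tI.
(* [B] bounds the rate at which the normalized point [(lam t / lam s) *: Fp (g s)] moves away from
   [e0], whence [near1]; the entry of [e3] with [Kl + 1] keeps [lam s] above [lam t / 2]. *)
pose B := 2 * Kl / lam t * (1 + LP) + LP + 1.
have B0 : 0 < B.
  by rewrite ltr_wpDl // addr_ge0 // mulr_ge0 ?addr_ge0 // divr_ge0 ?mulr_ge0 // ltW.
pose e3 := Num.min (Num.min 1 (lam t / (2 * (Kl + 1)))) (eta / 2 / B).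
have Kl1 : 0 < Kl + 1 by rewrite ltr_wpDl.
have e30 : 0 < e3 by rewrite !lt_min ltr01 !divr_gt0 // ?mulr_gt0.
pose e := Num.min (Num.min e1 e2) e3.
have e0 : 0 < e by rewrite lt_min e30 lt_min e10 e20.
pose T := tnear (@unit_int R) t e.
have TE s : T s -> [/\ unit_int s, tnear unit_int t e1 s, tnear unit_int t e2 s & `|s - t| < e3].
  by move=> [sI]; rewrite lt_min => /andP[]; rewrite lt_min => /andP[].
have Td s : T s -> dom i (g s) by move=> /TE[_ _ /h2[]].
have Tb s : T s -> box y1 r' (coord i (g s)) by move=> /TE[_ _ /h2[]].
have Tbr s : T s -> box y1 r (coord i (g s)) by move=> /Tb; exact: box_le.
have near1 s : T s -> nrm ((lam t / lam s) *: Fp (g s) - E0) <= eta / 2.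
  move=> /TE[sI Ts1 _]; rewrite !lt_min -andbA => /and3P[s1 s2 s3].
  have [ls0 _] := XE sI; have D0 : 0 <= `|s - t| by [].
  have lPs := lP t s (tt _ e10) Ts1; rewrite nrm_tdisp /= PtE in lPs.
  have ll := lam_lip tI sI.
  have ls2 : lam t / 2 <= lam s.
    have : `|s - t| * (2 * (Kl + 1)) < lam t by rewrite -ltr_pdivlMr ?mulr_gt0.
    have : Kl * `|s - t| <= (Kl + 1) * `|s - t| by rewrite ler_wpM2r // lerDl.
    by move: ll; rewrite ler_norml => /andP[? ?]; lra.
  have -> : (lam t / lam s) *: Fp (g s) - E0 =
      (lam t / lam s - 1) *: Fp (g s) + (Fp (g s) - E0).
    by rewrite scalerBl scale1r addrA subrK.
  have nP : nrm (Fp (g s)) <= 1 + LP.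
    have := nrmD (Fp (g s) - E0) E0; rewrite subrK nrm_e0.
    have : LP * `|s - t| <= LP by rewrite -[leRHS]mulr1 ler_wpM2l // ltW.
    by lra.
  have a1 : `|lam t / lam s - 1| <= 2 * Kl / lam t * `|s - t|.
    have -> : lam t / lam s - 1 = (lam t - lam s) / lam s by field; rewrite gt_eqF.
    rewrite normrM normfV (gtr0_norm ls0) ler_pdivrMr // distrC; apply: le_trans ll _.
    have -> : 2 * Kl / lam t * `|s - t| * lam s = Kl * `|s - t| * (lam s / (lam t / 2)).
      by field; rewrite gt_eqF.
    rewrite -[leLHS]mulr1 ler_wpM2l ?mulr_ge0 // ler_pdivlMr ?divr_gt0 // mul1r //.
  apply: (@le_trans _ _ (2 * Kl / lam t * `|s - t| * (1 + LP) + LP * `|s - t|)).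
    apply: nrmD_le => //; rewrite nrmZ; apply: ler_pM => //; exact: nrm_ge0.
  have : `|s - t| * B < eta / 2 by rewrite -ltr_pdivlMr.
  rewrite /B; move: (2 * Kl / lam t) => q; lra.
exists e => // s s' s0 ss' s'1 st s't [F [fr FF0 [eF eF0 FX] hU]].
have [<-|sN] := eqVneq s s'; first by exists F; split => //; exists eF.
have {sN} slt : s < s' by rewrite lt_neqAle sN.
have sI : unit_int s by rewrite /unit_int /= s0 (le_trans ss').
have s'I : unit_int s' by rewrite /unit_int /= s'1 (le_trans s0).
have Ts : T s by []. have Ts' : T s' by [].
set ys := coord i (g s); have Qs := Tbr s Ts.
have gsE : inv i ys = g s by rewrite coordK //; exact: Td.
rewrite -gsE in fr.
have [L [r1 [uL gL r10 s1 hF]]] := frame_std sf Qs fr.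
rewrite gsE in fr.
pose F' q := L *m Fp q.
have frF' q : dom i q -> box y1 r (coord i q) -> frame H F' q.
  move=> iq Qq; rewrite -(coordK iq); apply: (std_is_frame sf Qq ltr01 uL gL) => y Qy _.
  by rewrite /F' FpE // mulmxA.
have F'F q : dom i q -> box ys r1 (coord i q) -> F' q = F q.
  by move=> iq Qq; rewrite /F' -{2}(coordK iq) hF // -mulmxA.
have [e4 e40 h4] := geodesic_cont gg sI (chart_nbhd (Td s Ts) r10).
have oF' : ode cc T (F' \o g) (fun x => L *m X1p x).
  move=> x Tx; exists 1 => //.
  have sub : tnear T x 1 `<=` tnear unit_int t e1 by move=> w [/TE[]].
  have sm := small_subset sub sm1.
  have hmul (W W1 : R -> cvec) : tdm (tnear unit_int t e1) W W1 ->
      tdm (tnear T x 1) (fun s => L *m W s) (fun s => L *m W1 s).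
    move=> hW; apply: qdm_ext (qdm_mul sm (qdm_cst tdisp _ L) (qdm_subset sub hW)) => // u w _.
    by rewrite mul0mx add0r.
  split; first exact: hmul P1.
  by apply: qdm_ext (hmul _ _ P2) => // u w _; rewrite -scalemxAr.
have oXT : ode c T X X1.
  move=> x [xI _]; have [a a0 [x1 x2]] := oX xI; exists a => //.
  have sub : tnear T x a `<=` tnear unit_int x a by apply: tnear_mono; exact: tnear_sub.
  by split; apply: qdm_subset sub _.
have F'N : (F' \o g) s != 0.
  apply/eqP => /= E; have := frame_norm (frF' _ (Td s Ts) Qs); rewrite E trmx0 !mul0mx.
  by move/matrixP => /(_ 0 0); rewrite !mxE eqxx => /eqP; rewrite eq_sym oner_eq0.
have near_s x : T x -> `|x - s| < Num.min eF e4 -> (F' \o g) x = X x.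
  move=> [xI _]; rewrite lt_min => /andP[x1 x2] /=.
  by have [iq Qq] := h4 x (conj xI x2); rewrite F'F // FX.
have m0 : 0 < Num.min eF e4 by rewrite lt_min eF0.
(* [F' \o g] and [X] solve such equations and agree near [s], hence on all of [T]: the continued
   frame develops [g] to the same curve up to [s']. *)
have [_ F'X] := ode_unique cc0 c0 Ts m0 oF' oXT near_s F'N.
have sg := sig_lt s0 slt s'1.
have /andP[sgs0 sgs1] := sig_ge0 sI; have /andP[sgs'0 sgs'1] := sig_ge0 s'I.
exists F'; split.
- exact: frF' (Td s' Ts') (Tbr s' Ts').
- by move=> sz; move: sg; rewrite sz ltNge sgs0.
- exists (e - `|s' - t|) => [|x [xI xs']]; first by rewrite subr_gt0.
  apply: F'X; split => //; rewrite -(subrK s' x) -addrA.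
  by apply: le_lt_trans (ler_normD _ _) _; rewrite -ltrBrDr.
move=> U nU; set ys' := coord i (g s').
have gs'E : inv i ys' = g s' by rewrite coordK //; exact: Td.
have iys' : chart_image i ys' by exists (g s') => //; exact: Td.
have nU' : nbhs (inv i ys') U by rewrite gs'E.
have [r3 r30 hr3] := inv_nbhd iys' nU'.
have [r2 r20 hr2] := box_nbhd (Tb s Ts).
pose r4 := Num.min r1 r2; have r40 : 0 < r4 by rewrite lt_min r10.
have [del1 del10 hdel1] := hU _ (chart_nbhd (Td s Ts) r40).
pose a := lam t; pose I := nrm (invmx L); have I0 : 0 <= I by exact: nrm_ge0.
have aI0 : 0 <= a * I by rewrite mulr_ge0 // ltW.
have q0 : 0 < 2 * (a * I) + 1 by rewrite ltr_wpDl // mulr_ge0.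
pose del := Num.min del1 (Num.min eta r3 / (2 * (a * I) + 1)).
have mr : 0 < Num.min eta r3 by rewrite lt_min eta0.
exists del => [|Y hY]; first by rewrite lt_min del10 divr_gt0.
have [hY1 hY2] : nrm (Y - Y0) < del1 /\ 2 * (a * I) * nrm (Y - Y0) < Num.min eta r3.
  move: hY; rewrite lt_min => /andP[h1 h3]; split => //.
  move: h3; rewrite ltr_pdivlMr // mulrDr mulr1 mulrC.
  by apply: le_lt_trans; rewrite lerDl.
have [hY3 hY4] : 2 * (a * I) * nrm (Y - Y0) < eta /\ 2 * (a * I) * nrm (Y - Y0) < r3.
  by move: hY2; rewrite lt_min => /andP[].
have [b [lb_ Vb db]] := hdel1 Y hY1.
pose XY (Y : cvec) tau : cvec := a *: (invmx L *m chord Y tau).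
have XY0 x : T x -> XY Y0 (sig x) = (a / lam x) *: Fp (g x).
  move=> Tx; have [xI _] := Tx; have [lx0 Xx] := XE xI.
  have lN : lam x != 0 by rewrite gt_eqF.
  have := F'X x Tx; rewrite /= /F' Xx => E.
  rewrite /XY; have -> : chord Y0 (sig x) = (lam x)^-1 *: (L *m Fp (g x)) by rewrite E scalerA mulVf // scale1r.
  by rewrite -scalemxAr mulKmx // scalerA.
have XYd tau : 0 <= tau -> tau <= 1 -> nrm (XY Y tau - XY Y0 tau) <= a * I * nrm (Y - Y0).
  move=> t0 t1; rewrite /XY -scalerBr -mulmxBr nrmZ (gtr0_norm lt0) -mulrA.
  apply: ler_wpM2l; first exact: ltW.
  apply: le_trans (nrmM _ _) _; apply: ler_wpM2l => //.
  have -> : chord Y tau - chord Y0 tau = tau *: (Y - Y0).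
    by apply/matrixP => u w; rewrite !mxE; ring.
  by rewrite nrmZ ger0_norm // ler_piMl // nrm_ge0.
(* [XY Y0] is affine in [tau] and within [eta / 2] of [e0] at both ends, hence in between; the other
   half of [eta] pays for replacing [Y0] by [Y]. *)
have XYn tau : sig s <= tau <= sig s' -> nrm (XY Y tau - E0) <= eta.
  move=> /andP[ts ts']; pose u := (tau - sig s) / (sig s' - sig s).
  have ds : 0 < sig s' - sig s by rewrite subr_gt0.
  have u0 : 0 <= u by rewrite divr_ge0 ?subr_ge0 // ltW.
  have u1 : u <= 1 by rewrite ler_pdivrMr // mul1r lerD2r.
  have tauE : tau = (1 - u) * sig s + u * sig s'.
    by rewrite /u; field; rewrite gt_eqF.
  have -> : XY Y tau - E0 = (XY Y tau - XY Y0 tau) +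
      ((1 - u) *: (XY Y0 (sig s) - E0) + u *: (XY Y0 (sig s') - E0)).
    have -> : XY Y0 tau = (1 - u) *: XY Y0 (sig s) + u *: XY Y0 (sig s').
      have cE : chord Y0 tau = (1 - u) *: chord Y0 (sig s) + u *: chord Y0 (sig s').
        by rewrite /chord {1}tauE; apply/matrixP => p w; rewrite !mxE; ring.
      rewrite /XY cE mulmxDr scalerDr -!scalemxAr !scalerA.
      by rewrite [a * (1 - u)]mulrC [a * u]mulrC.
    move: (XY Y tau) (XY Y0 (sig s)) (XY Y0 (sig s')) => p w x.
    by apply/matrixP => k l; rewrite !mxE; ring.
  have n1 := near1 s Ts; have n2 := near1 s' Ts'; rewrite -/a in n1 n2.
  rewrite !XY0 //; apply: le_trans (nrmD _ _) _.
  have t0 := le_trans sgs0 ts; have t1 := le_trans ts' sgs'1.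
  have := XYd tau t0 t1; set p := nrm _ => hp.
  apply: (@le_trans _ _ (eta / 2 + ((1 - u) * (eta / 2) + u * (eta / 2)))); last first.
    by rewrite -mulrDl subrK mul1r -splitr.
  apply: lerD; first by rewrite ler_pdivlMr // mulrC (le_trans _ (ltW hY3)) // -mulrA ler_pM2l.
  apply: nrmD_le; rewrite nrmZ ger0_norm ?subr_ge0 //; apply: ler_wpM2l => //.
  by rewrite subr_ge0.
pose g2 tau := inv i (Yf (XY Y tau)).
have g2b tau : sig s <= tau <= sig s' -> box y1 r (Yf (XY Y tau)).
  by move=> /XYn/hcone[_ h _]; exact: box_le h.
have bI : sig s <= sig s <= sig s' by rewrite lexx ltW.
have b'I : sig s <= sig s' <= sig s' by rewrite lexx ltW.
have [ib Qb] := Vb; set yb := coord i (b (sig s)) in Qb.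
have Qb1 : box ys r1 yb by apply: box_le Qb; rewrite ge_min lexx.
have Qb2 : box y1 r' yb by apply: hr2; apply: box_le Qb; rewrite ge_min lexx orbT.
(* The given lift ends in the small box and over the same ray, so [huniq] identifies the two
   points. *)
have g2E : g2 (sig s) = b (sig s).
  have [e5 e50 /(_ (sig s)) he5] := db.
  have [|rr0 rr00 E] := he5; first by split; rewrite ?subrr ?normr0 // /seg /= sgs0 lexx.
  have XE' : XY Y (sig s) = (a * rr0) *: (Psi yb *m E0).
    rewrite /XY -E -(F'F _ ib Qb1) /F' -scalemxAr mulKmx // scalerA //.
  have := XYn _ bI; rewrite /g2 XE' => hn; rewrite huniq ?mulr_gt0 //.
  by rewrite coordK.
have cg2 tau : sig s <= tau <= sig s' -> cont_at [set x | sig s <= x <= sig s'] g2 tau.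
  move=> tauI V nV; have iyt : chart_image i (Yf (XY Y tau)).
    by apply: (lb_sub lb); exact: g2b.
  have [r5 r50 h5] := inv_nbhd iyt nV.
  pose q := 2 * (a * I * nrm (Y - E0)) + 1.
  have q0' : 0 < q by rewrite ltr_wpDl // !mulr_ge0 // ?nrm_ge0 // ltW.
  exists (r5 / q) => [|x [xI xt]]; first by rewrite divr_gt0.
  apply: h5; first by apply: (lb_sub lb); exact: g2b.
  apply: le_lt_trans (hlip _ _ (XYn _ tauI) (XYn _ xI)) _.
  have -> : XY Y x - XY Y tau = (a * (x - tau)) *: (invmx L *m (Y - E0)).
    rewrite /XY -scalerBr -mulmxBr -scalerA; congr (_ *: _); rewrite scalemxAr; congr (_ *m _).
    by apply/matrixP => k l; rewrite !mxE; ring.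
  rewrite nrmZ normrM (gtr0_norm lt0).
  have nm := nrmM (invmx L) (Y - E0); rewrite -/I in nm.
  move: xt; rewrite ltr_pdivlMr // => xt; apply: le_lt_trans xt.
  have x0 : 0 <= `|x - tau| by [].
  have := ler_wpM2l (mulr_ge0 (ltW lt0) x0) nm; rewrite -/a /q.
  by move: (nrm _) (nrm _) => p w; lra.
have fg2 tau : sig s <= tau <= sig s' ->
    frame H F' (g2 tau) /\ aims F' (g2 tau) (chord Y tau).
  move=> tauI; have Q := g2b tau tauI; have [it2 cE] := inv_chart (lb_sub lb Q).
  split; first by apply: frF'; rewrite // cE.
  have [p0 _ E] := hcone _ (XYn _ tauI).
  exists (rho (XY Y tau) / a); first by rewrite divr_gt0.
  rewrite /F' FpE // scalemxAr mulrC -scalerA E /XY scalerA mulVf ?gt_eqF // scale1r.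
  by rewrite mulKVmx.
have nF : \forall q \near b (sig s), F' q = F q.
  have [r5 r50 h5] := box_nbhd Qb1.
  by apply: filterS (chart_nbhd ib r50) => q [iq Qq]; apply: F'F => //; exact: h5.
have [lh dh] := lift_extend sgs0 sg lb_ db g2E cg2 fg2 nF FF0.
exists (fun x => if x <= sig s then b x else g2 x); split => //.
rewrite leNgt sg /=; apply: hr3; first by apply: (lb_sub lb); exact: g2b.
have s'n : nrm (XY Y0 (sig s') - E0) <= eta.
  rewrite XY0 //; apply: le_trans (near1 s' Ts') _.
  by rewrite ler_piMr ?(ltW eta0) // invf_le1 // ler1n.
have yE : Yf (XY Y0 (sig s')) = ys'.
  have [ls'0 _] := XE s'I; rewrite XY0 // huniq //; first by rewrite divr_gt0.
    exact: Tb.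
  by move: s'n; rewrite XY0.
rewrite -yE; apply: le_lt_trans (hlip _ _ s'n (XYn _ b'I)) _.
by apply: le_lt_trans hY4; rewrite -[leRHS]mulrA ler_pM2l //; exact: XYd.
Qed.

Lemma lifts_near_end : exists F, [/\ frame H F (g 1), F (g 1) = X 1 &
  forall U, nbhs (g 1) U -> exists2 del : R, 0 < del & forall Y, nrm (Y - Y0) < del ->
    exists b, [/\ lift H F0 z Y 1 b, U (b 1) & aims F (b 1) Y]].
Proof.
have u1 : @unit_int R 1 by rewrite /unit_int /= lexx ler01.
have st t (tI : 0 <= t <= 1) := liftable_step tI.
have [F [fr _ [e e0 FX] hU]] := real_step ler01 liftable0 st (t := 1) u1.
exists F; split => //.
  by apply: FX; split; rewrite ?subrr ?normr0.
move=> U /hU[del del0 hdel]; exists del => // Y /hdel[b [lb_ Ub db]].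
rewrite sig1 in lb_ Ub db; exists b; split => //.
have [e' e'0 /(_ 1)] := db.
have -> : chord Y 1 = Y by rewrite /chord scale1r addrC subrK.
by apply; split; rewrite ?subrr ?normr0 // /seg /= lexx ler01.
Qed.

End along.
End lifting.

(** * Geodesics of the model in closed form *)

Section model_curves.
Context {R : realType} {N : nat} (c : R) (c0 : 0 <= c).
Implicit Types (s t : R) (E Y : 'cV[R]_N).

(* The model geodesic from E to Y is mlam t times the point of the chord at time
   msig t. *)
Definition mden t : R := sn c (1 - t) + sn c t.
Definition mlam t : R := mden t / sn c 1.
Definition msig t : R := sn c t / mden t.
Definition model E Y t := (sn c (1 - t) / sn c 1) *: E + (sn c t / sn c 1) *: Y.
Definition model1 E Y t := (- cs c (1 - t) / sn c 1) *: E + (cs c t / sn c 1) *: Y.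

Lemma sn1_gt0 : 0 < sn c 1. Proof. exact: sn_gt0. Qed.

Lemma mden_ge t : unit_int t -> sn c 2^-1 <= mden t.
Proof.
move=> /andP[t0 t1]; rewrite /mden; have [h|h] := leP t 2^-1.
  have := @sn_le _ _ c0 2^-1 (1 - t) ltac:(lra); have := sn_ge0 c0 t0; lra.
have := @sn_le _ _ c0 2^-1 t (ltW h).
have := @sn_ge0 _ _ c0 (1 - t) ltac:(lra); lra.
Qed.

Lemma mden_gt0 t : unit_int t -> 0 < mden t.
Proof. by move=> /mden_ge; apply: lt_le_trans; apply: sn_gt0 => //; lra. Qed.

Lemma mlam_gt0 t : unit_int t -> 0 < mlam t.
Proof. by move=> tI; rewrite divr_gt0 ?mden_gt0 ?sn1_gt0. Qed.

Lemma msig0 : msig 0 = 0. Proof. by rewrite /msig sn0 mul0r. Qed.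

Lemma msig1 : msig 1 = 1.
Proof. by rewrite /msig /mden subrr sn0 add0r divff // gt_eqF // sn1_gt0. Qed.

Lemma msig_lt s t : 0 <= s -> s < t -> t <= 1 -> msig s < msig t.
Proof.
move=> s0 st t1.
have sI : unit_int s by apply/andP; split; lra.
have tI : unit_int t by apply/andP; split; lra.
rewrite /msig ltr_pdivrMr ?mden_gt0 // mulrAC ltr_pdivlMr ?mden_gt0 //.
rewrite /mden !mulrDr [sn c t * sn c s]mulrC ltrD2r.
have h1 := sn_lt c0 st; have h2 := @sn_le _ _ c0 (1 - t) (1 - s) ltac:(lra).
have h3 := sn_ge0 c0 s0; have h4 := @sn_gt0 _ _ c0 (1 - s) ltac:(lra).
apply: le_lt_trans (ler_wpM2l h3 h2) _; by rewrite ltr_pM2r.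
Qed.

Lemma msig_unit t : unit_int t -> 0 <= msig t <= 1.
Proof.
move=> tI; have /andP[t0 t1] := tI; have h := sn_ge0 c0 t0.
have h' := @sn_ge0 _ _ c0 (1 - t) ltac:(lra).
have d0 := mden_gt0 tI; apply/andP; split; first by rewrite /msig divr_ge0 // ltW.
by rewrite /msig ler_pdivrMr // mul1r /mden; lra.
Qed.

Lemma sn_lip : exists2 K : R, 0 <= K & forall s t, unit_int s -> unit_int t ->
  `|sn c t - sn c s| <= K * `|t - s|.
Proof.
have [_ ts] := cs_sn_td c0 1.
have sub : @unit_int R `<=` [set t | `|t| <= 1].
  by move=> t /andP[? ?]; rewrite /= ler_norml; apply/andP; split; lra.
have [K K0 h] := qd_lip (@small_unit_int R unit_int (fun _ h => h)) (td_subset sub ts).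
by exists K => // s t sI tI; have := h s t sI tI; rewrite nrm_tdisp.
Qed.

Lemma mden_lip : exists2 K : R, 0 <= K & forall s t, unit_int s -> unit_int t ->
  `|mden t - mden s| <= K * `|t - s|.
Proof.
have [K K0 h] := sn_lip; exists (K + K) => [|s t sI tI]; first exact: addr_ge0.
have rev (r : R) : unit_int r -> unit_int (1 - r).
  by move=> /andP[? ?]; apply/andP; split; lra.
have -> : mden t - mden s = (sn c (1 - t) - sn c (1 - s)) + (sn c t - sn c s).
  by rewrite /mden; lra.
apply: le_trans (ler_normD _ _) _; rewrite mulrDl; apply: lerD; last exact: h.
apply: le_trans (h _ _ (rev s sI) (rev t tI)) _.
by rewrite (_ : 1 - t - (1 - s) = - (t - s)) ?normrN //; lra.
Qed.

Lemma mlam_lip : exists2 K : R, 0 <= K & forall s t, unit_int s -> unit_int t ->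
  `|mlam t - mlam s| <= K * `|t - s|.
Proof.
have [K K0 h] := mden_lip; exists (K / sn c 1) => [|s t sI tI].
  by rewrite divr_ge0 // ltW // sn1_gt0.
rewrite /mlam -mulrBl normrM normfV (gtr0_norm sn1_gt0) mulrAC ler_pM2r ?invr_gt0 ?sn1_gt0 //.
exact: h.
Qed.

Lemma msig_lip : exists2 K : R, 0 <= K & forall s t, unit_int s -> unit_int t ->
  `|msig t - msig s| <= K * `|t - s|.
Proof.
have [K K0 h] := sn_lip; have [K' K'0 h'] := mden_lip.
have m0 : 0 < sn c 2^-1 by apply: sn_gt0 => //; lra.
exists ((K + K') / sn c 2^-1) => [|s t sI tI]; first by rewrite divr_ge0 ?addr_ge0 // ltW.
have ds := mden_gt0 sI; have dt := mden_gt0 tI.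
have /andP[sg0 sg1] := msig_unit sI.
have -> : msig t - msig s = ((sn c t - sn c s) - msig s * (mden t - mden s)) / mden t.
  by rewrite /msig; field; rewrite !gt_eqF.
rewrite normrM normfV (gtr0_norm dt) ler_pdivrMr //.
have -> : (K + K') / sn c 2^-1 * `|t - s| * mden t =
    (K + K') * `|t - s| * (mden t / sn c 2^-1) by field; rewrite gt_eqF.
apply: (@le_trans _ _ ((K + K') * `|t - s|)); last first.
  rewrite -[leLHS]mulr1 ler_wpM2l ?mulr_ge0 ?addr_ge0 // ler_pdivlMr // mul1r.
  exact: mden_ge.
apply: le_trans (ler_normB _ _) _; rewrite mulrDl; apply: lerD; first exact: h.
rewrite normrM (ger0_norm sg0); apply: le_trans (h' s t sI tI).
by rewrite ler_piMl.
Qed.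

Lemma model_ode E Y : ode c unit_int (model E Y) (model1 E Y).
Proof.
have [tc ts] := cs_sn_td c0 1.
have sub : @unit_int R `<=` [set t | `|t| <= 1].
  by move=> t /andP[? ?]; rewrite /= ler_norml; apply/andP; split; lra.
have rev (f f1 : R -> R) : td [set t | `|t| <= 1] f f1 ->
    td unit_int (fun r => f (1 - r)) (fun r => - f1 (1 - r)).
  move=> hf; have := @td_affine _ unit_int _ _ _ (-1) 1 hf.
  have TB (r : R) : unit_int r -> [set t | `|t| <= 1] (-1 * r + 1).
    by move=> /andP[? ?]; rewrite /= ler_norml; apply/andP; split; lra.
  by move=> /(_ TB); apply: qd_ext => [r|a r] _; rewrite !mulN1r [_ + 1]addrC.
have lin (f1 g1 f2 g2 : R -> R) (F : R -> 'cV[R]_N) G :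
    td unit_int f1 g1 -> td unit_int f2 g2 ->
    (forall t, F t = (f1 t / sn c 1) *: E + (f2 t / sn c 1) *: Y) ->
    (forall t, G t = (g1 t / sn c 1) *: E + (g2 t / sn c 1) *: Y) ->
    tdm unit_int F G.
  move=> h1 h2 FE GE i j.
  apply: qd_ext (qd_add (qd_scale (E i j / sn c 1) h1) (qd_scale (Y i j / sn c 1) h2)) =>
    [t|a t] _ /=; rewrite ?FE ?GE !mxE; ring.
move=> t _; exists 1 => //; split; apply: qdm_subset (@tnear_sub _ _ _ _) _.
- exact: (lin _ _ _ _ _ _ (rev _ _ ts) (td_subset sub ts)).
- apply: (lin _ _ _ _ _ _ (qd_opp (rev _ _ tc)) (td_subset sub tc)) => s.
    by rewrite /model1.
  by rewrite /model scalerDr !scalerA opprK !mulrA.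
Qed.

Lemma modelE E Y t : unit_int t -> model E Y t = mlam t *: (E + msig t *: (Y - E)).
Proof.
move=> tI; have h := mden_gt0 tI; have h1 := sn1_gt0.
have e1 : sn c t / sn c 1 = mlam t * msig t.
  by rewrite /mlam /msig; field; rewrite !gt_eqF.
have e2 : sn c (1 - t) / sn c 1 = mlam t * (1 - msig t).
  rewrite /mlam /msig; have -> : sn c (1 - t) = mden t - sn c t by rewrite /mden addrK.
  by field; rewrite !gt_eqF.
rewrite /model e1 e2; move: (mlam t) (msig t) => l m.
by apply/matrixP => i j; rewrite !mxE; ring.
Qed.

Lemma model_init E W t : unit_int t ->
  cs c t *: E + sn c t *: W = model E (cs c 1 *: E + sn c 1 *: W) t.
Proof.
move=> tI; have h1 := sn1_gt0; rewrite /model (sn_rev c0 tI).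
by apply/matrixP => i j; rewrite !mxE; field; rewrite gt_eqF.
Qed.

(** The left-hand side is the form at [model c E Y t] when [E] and [Y] lie on the quadric and have
    product [cs c 1]. This ties the constant [c] to the end point. *)
Lemma model_coef_norm t : unit_int t ->
  (sn c (1 - t) / sn c 1) ^+ 2 + (sn c t / sn c 1) ^+ 2 +
  2 * (sn c (1 - t) / sn c 1) * (sn c t / sn c 1) * cs c 1 = 1.
Proof.
move=> tI; have h1 := sn1_gt0; rewrite (sn_rev c0 tI).
have := cs_sn c0 1; have := cs_sn c0 t; move: h1.
move: (sn c 1) (sn c t) (cs c 1) (cs c t) => a b u v a0 E1 E2.
have aN : a != 0 by rewrite gt_eqF.
transitivity ((a ^+ 2 * v ^+ 2 - b ^+ 2 * (u ^+ 2 - 1)) / a ^+ 2); first by field.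
have -> : u ^+ 2 - 1 = c * a ^+ 2 by rewrite -E2; ring.
transitivity (v ^+ 2 - c * b ^+ 2); first by field.
exact: E1.
Qed.

End model_curves.

(** For [h] above 1, [c] is the square of ln (h + s) with s^2 = h^2 - 1, for which the two
    exponentials are h + s and h - s. *)
Lemma cs_onto (R : realType) (h : R) : 1 <= h -> exists2 c : R, 0 <= c & cs c 1 = h.
Proof.
move=> h1; have [->|hN] := eqVneq h 1; first by exists 0; rewrite // /cs eqxx.
have {hN}h1 : 1 < h by rewrite lt_neqAle eq_sym hN.
have q0 : 0 < h ^+ 2 - 1.
  by have : 0 < (h - 1) * (h + 1); [rewrite mulr_gt0; lra|rewrite expr2; lra].
pose s := Num.sqrt (h ^+ 2 - 1); have s0 : 0 < s by rewrite sqrtr_gt0.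
have s2 : s ^+ 2 = h ^+ 2 - 1 by rewrite sqr_sqrtr // ltW.
pose th := ln (h + s); have th0 : 0 < th by apply: ln_gt0; lra.
have eth : expR th = h + s by rewrite lnK // posrE; lra.
exists (th ^+ 2); first exact: sqr_ge0.
rewrite /cs sqrf_eq0 gt_eqF // sqrtr_sqr gtr0_norm // mulr1 expRN eth.
have -> : (h + s)^-1 = h - s.
  have p0 : h + s != 0 by rewrite gt_eqF //; lra.
  apply: (mulfI p0); rewrite mulfV // mulrC -subr_sqr s2; ring.
by field.
Qed.

(** * Developed geodesics do not meet themselves *)

Section loops.
Context {R : realType} {d : nat} (M : riemannian_manifold R d) (kappa : R)
  (curv : constant_curvature M kappa) (convM : convexM M).
Local Notation cvec := 'cV[R]_(1 + d.+1).
Local Notation "'MN'" := 'M[R]_(1 + d.+1).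
Local Notation frame := (frame kappa).
Implicit Types (g : R -> M) (H : MN).

Definition framed_path H g (X : R -> cvec) := forall t, unit_int t ->
  cont_at unit_int g t /\ exists2 F, frame H F (g t) &
    exists2 e : R, 0 < e & forall s, tnear unit_int t e s -> F (g s) = X s.

Lemma framed_affine_geodesic H g c (X X1 : R -> cvec) a k : framed_path H g X ->
  ode c unit_int X X1 -> (forall t, unit_int t -> unit_int (k * t + a)) ->
  geodesic (fun t => g (k * t + a)).
Proof.
move=> fp oX aff.
have nr t e : 0 < e -> exists2 e' : R, 0 < e' & forall s, tnear unit_int t e' s ->
    tnear unit_int (k * t + a) e (k * s + a).
  have k0 : 0 < `|k| + 1 by rewrite ltr_wpDl.
  move=> e0; exists (e / (`|k| + 1)) => [|s [sI]]; first by rewrite divr_gt0.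
  rewrite ltr_pdivlMr // => h; split; first exact: aff.
  have -> : k * s + a - (k * t + a) = k * (s - t) by ring.
  by rewrite normrM; have := normr_ge0 (s - t); rewrite mulrDr mulr1 mulrC in h; lra.
apply: (@framed_path_geodesic _ _ _ _ curv _ (c * k ^+ 2) (fun t => X (k * t + a))
  (fun t => k *: X1 (k * t + a))).
- move=> t tI U nU; have [cg _] := fp _ (aff t tI); have [e e0 he] := cg U nU.
  have [e' e'0 he'] := nr t e e0; exists e' => // s /he'; exact: he.
- move=> t tI; have [e e0 [x1 x2]] := oX _ (aff t tI); have [e' e'0 he'] := nr t e e0.
  exists e' => //; split; first exact: (tdm_affine x1 he').
  apply: qdm_ext (qdm_scale k (tdm_affine x2 he')) => // u s _.
  by rewrite !scalerA; congr (_ *: _); ring.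
- move=> t tI; have [_ [F fr [e e0 he]]] := fp _ (aff t tI).
  have [e' e'0 he'] := nr t e e0; exists H, F; split => //.
  by exists e' => // s /he'; exact: he.
Qed.

(* At a first self-intersection g u = g v of a geodesic, the two halves of the
   loop would be two distinct arcs with the same end points. *)
Lemma framed_path_inj H g c (X X1 : R -> cvec) : framed_path H g X ->
  ode c unit_int X X1 ->
  (forall s t, unit_int s -> unit_int t -> X s = X t -> s = t) ->
  forall s t, unit_int s -> unit_int t -> g s = g t -> s = t.
Proof.
move=> fp oX Xinj.
pose P (t : R) := forall u v : R, 0 <= u -> u < v -> v <= t -> g u <> g v.
suff P1 : P 1.
  move=> s t /andP[s0 s1] /andP[t0 t1] E; have [st|ts|//] := ltgtP s t.
    by case: (P1 s t s0 st t1).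
  by case: (P1 t s t0 ts s1).
have loc t : unit_int t -> exists2 e : R, 0 < e & forall u v,
    tnear unit_int t e u -> tnear unit_int t e v -> g u = g v -> u = v.
  move=> tI; have [_ [F _ [e e0 he]]] := fp t tI; exists e => // u v Tu Tv E.
  apply: Xinj; [exact: tnear_sub Tu|exact: tnear_sub Tv|].
  by rewrite -(he u Tu) -(he v Tv) E.
have u1 : 0 <= (1 : R) <= 1 by rewrite ler01 lexx.
apply: (@real_step _ P 0 1 ler01 _ _ 1 u1) => [u v u0 uv v0|t tI]; first by exfalso; lra.
have [e e0 he] := loc t tI; exists e => // s s' s0 ss' s'1 st s't Ps u v u0 uv vs' E.
have [vs|sv] := leP v s; first exact: (Ps u v).
have nearv : `|v - t| < e.
  by move: st s't; rewrite !ltr_norml => /andP[? ?] /andP[? ?]; apply/andP; split; lra.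
have vI : unit_int v by apply/andP; split; lra.
have sI : unit_int s by apply/andP; split; lra.
have uI : unit_int u by apply/andP; split; lra.
have Tv : tnear unit_int t e v by [].
have Ts : tnear unit_int t e s by [].
have [nu|nu] := ltP `|u - t| e.
  by have := he u v (conj uI nu) Tv E; lra.
have us : u < s.
  rewrite ltNge; apply/negP => su; move: nu; rewrite leNgt => /negP; apply.
  by move: st nearv; rewrite !ltr_norml => /andP[? ?] /andP[? ?]; apply/andP; split; lra.
have affI (x y t' : R) : unit_int x -> unit_int y -> unit_int t' -> unit_int ((x - y) * t' + y).
  move=> /andP[x0 x1] /andP[y0 y1] /andP[t0 t1].
  have -> : (x - y) * t' + y = x * t' + y * (1 - t') by ring.
  have p1 := mulr_ge0 x0 t0; have p2 : 0 <= y * (1 - t') by rewrite mulr_ge0 // subr_ge0.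
  have p3 : x * t' <= t' by rewrite ler_piMl.
  have p4 : y * (1 - t') <= 1 - t' by rewrite ler_piMl // subr_ge0.
  by apply/andP; split; lra.
have inj_aff (x y t1 t2 : R) : x - y != 0 -> (x - y) * t1 + y = (x - y) * t2 + y -> t1 = t2.
  by move=> xy /addIr /(mulfI xy).
have su0 : s - u != 0 by rewrite gt_eqF //; lra.
have sv0 : s - v != 0 by rewrite lt_eqF //; lra.
have sn : g u <> g s by apply: (Ps u s) => //; lra.
(* The path is injective up to [s] by [Ps], and near [t] by [he]. So the piece from [u] forward to
   [s] and the piece from [v] backward to [s] are both arcs, with the same ends because g u = g
   v. *)
have arc1 : geodesic_arc (g u) (g s) (fun t => g ((s - u) * t + u)).
  split.
  - by apply: (framed_affine_geodesic fp oX) => t'; exact: affI.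
  - move=> t1 t2; rewrite !in_itv /= => t1I t2I E'; apply: (inj_aff s u) => //.
    have b t' : 0 <= t' <= 1 -> 0 <= (s - u) * t' + u <= s.
      move=> /andP[a1 a2]; have h : 0 <= (s - u) * t' by rewrite mulr_ge0 //; lra.
      have h' : (s - u) * t' <= s - u by rewrite ler_piMr //; lra.
      by apply/andP; split; lra.
    have /andP[p1 p2] := b _ t1I; have /andP[p3 p4] := b _ t2I.
    have [lt|lt|//] := ltgtP ((s - u) * t1 + u) ((s - u) * t2 + u).
      by case: (Ps _ _ p1 lt p4).
    by case: (Ps _ _ p3 lt p2).
  - by rewrite mulr0 add0r.
  - by rewrite mulr1 subrK.
have arc2 : geodesic_arc (g u) (g s) (fun t => g ((s - v) * t + v)).
  split.
  - by apply: (framed_affine_geodesic fp oX) => t'; exact: affI.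
  - move=> t1 t2; rewrite !in_itv /= => t1I t2I E'; apply: (inj_aff s v) => //.
    have b t' : 0 <= t' <= 1 -> tnear unit_int t e ((s - v) * t' + v).
      move=> t'I; split; first exact: affI.
      have /andP[a1 a2] := t'I.
      have -> : (s - v) * t' + v - t = (1 - t') * (v - t) + t' * (s - t) by ring.
      have h1 : (1 - t') * `|v - t| <= (1 - t') * Num.max `|v - t| `|s - t|.
        by rewrite ler_wpM2l ?subr_ge0 // le_max lexx.
      have h2 : t' * `|s - t| <= t' * Num.max `|v - t| `|s - t|.
        by rewrite ler_wpM2l // le_max lexx orbT.
      apply: le_lt_trans (ler_normD _ _) _; rewrite !normrM (ger0_norm a1).
      rewrite ger0_norm ?subr_ge0 //; apply: le_lt_trans (lerD h1 h2) _.
      by rewrite -mulrDl subrK mul1r gt_max nearv.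
    exact: he (b _ t1I) (b _ t2I) E'.
  - by rewrite mulr0 add0r E.
  - by rewrite mulr1 subrK.
have [g' _ uniq] := convM sn.
(* At time [1 - q] both arcs have parameters in the neighbourhood of [t] where [g] is injective;
   equality of the arcs there would give u = v. *)
pose q := Num.min 2^-1 ((e - `|s - t|) / 2).
have q0 : 0 < q by rewrite lt_min; apply/andP; split; [lra|rewrite divr_gt0 // subr_gt0].
have [q1 q2] : q <= 2^-1 /\ q <= (e - `|s - t|) / 2 by rewrite !ge_min !lexx orbT.
have tauI : 1 - q \in `[0, 1]%R by rewrite in_itv /=; apply/andP; split; lra.
have E2 : g ((s - u) * (1 - q) + u) = g ((s - v) * (1 - q) + v).
  by rewrite (uniq _ arc1 _ tauI) (uniq _ arc2 _ tauI).
have tI' : unit_int (1 - q) by move: tauI; rewrite in_itv.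
have nq (x : R) : unit_int x -> tnear unit_int t e ((s - x) * (1 - q) + x).
  move=> xI; split; first exact: affI.
  have -> : (s - x) * (1 - q) + x - t = (s - t) - q * (s - x) by ring.
  apply: le_lt_trans (ler_normB _ _) _; rewrite normrM (gtr0_norm q0).
  have : `|s - x| <= 1.
    by move: sI xI => /andP[? ?] /andP[? ?]; rewrite ler_norml; apply/andP; split; lra.
  move=> /(ler_wpM2l (ltW q0)); lra.
have := he _ _ (nq u uI) (nq v vI) E2.
have : 0 < q * (v - u) by rewrite mulr_gt0 // subr_gt0.
by rewrite !mulrBr !mulrBl; lra.
Qed.

End loops.

(** * The developing map *)

Section frame_germs.
Context {R : realType} {d : nat} (M : riemannian_manifold R d) (kappa : R)
  (curv : constant_curvature M kappa).
Local Notation vec := 'rV[R]_d.+1.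
Local Notation cvec := 'cV[R]_(1 + d.+1).
Local Notation "'MN'" := 'M[R]_(1 + d.+1).
Local Notation gram_mx := (gram_mx kappa).
Local Notation frame := (frame kappa).
Local Notation std_frame := (std_frame kappa).
Local Notation E0 := (e0 : cvec).
Implicit Types (i j : chart_idx M) (y v : vec) (H L : MN) (F : M -> cvec).

Lemma frame_near H F F' p : frame H F p -> (\forall q \near p, F' q = F q) -> frame H F' p.
Proof.
move=> fr nF i ip; have [r [S [lb hS hF uS gS]]] := fr i ip.
have iy : chart_image i (coord i p) by exists p.
have nF' : nbhs (inv i (coord i p)) (fun q => F' q = F q) by rewrite coordK.
have [r1 r10 h1] := inv_nbhd iy nF'; have r0 := lb_gt0 lb.
have n0 : 0 < d.+1%:R :> R by rewrite ltr0n.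
pose r2 := Num.min r (r1 / 2 / d.+1%:R).
have r20 : 0 < r2 by rewrite lt_min r0 !divr_gt0.
have rr : r2 <= r by rewrite ge_min lexx.
have s := @box_le _ _ (coord i p) _ _ rr.
exists r2, S; split => //; [exact: local_box_le lb|exact: sol_subset hS|].
move=> y Qy; rewrite -hF; last exact: s.
apply: h1; first exact/(lb_sub lb)/s.
apply: le_lt_trans (box_nrm Qy) _.
have : d.+1%:R * r2 <= d.+1%:R * (r1 / 2 / d.+1%:R).
  by rewrite ler_pM2l // ge_min lexx orbT.
rewrite [_ * (r1 / 2 / _)]mulrC divfK ?gt_eqF //; lra.
Qed.

Lemma frame_form H F p : frame H F p -> exists i r Psi L r1,
  [/\ dom i p, std_frame i (coord i p) r Psi, L \in unitmx, 0 < r1 &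
  [/\ L^T *m H *m L = gram_mx i (coord i p), box (coord i p) r1 `<=` box (coord i p) r &
  forall q, dom i q -> box (coord i p) r1 (coord i q) ->
    F q = L *m Psi (coord i q) *m E0]].
Proof.
move=> fr; have ip := dom_chart_at p; set i := chart_at p in ip.
have iy : chart_image i (coord i p) by exists p.
have [r [Psi sf]] := std_frame_exists curv iy.
have m1 := local_box_mem (sf_box sf).
have fr' : frame H F (inv i (coord i p)) by rewrite coordK.
have [L [r1 [uL gL r10 s1 hF]]] := frame_std sf m1 fr'.
exists i, r, Psi, L, r1; split => //; split => // q iq Qq.
by rewrite -hF // coordK.
Qed.

Lemma frame_open H F p : frame H F p -> \forall q \near p, frame H F q.
Proof.
move=> /frame_form[i [r [Psi [L [r1 [ip sf uL r10 [gL s1 hF]]]]]]].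
apply: filterS (chart_nbhd ip r10) => q [iq Qq].
have [r2 r20 s2] := box_nbhd Qq.
rewrite -(coordK iq); apply: (std_is_frame sf (s1 _ Qq) r20 uL gL) => y Qy Qy2.
have [iy yE] := inv_chart (lb_sub (sf_box sf) Qy).
by rewrite hF ?yE //; exact: s2.
Qed.

Lemma frame_locally_inj H F p : frame H F p ->
  exists2 V, nbhs p V & forall q q', V q -> V q' -> F q = F q' -> q = q'.
Proof.
move=> /frame_form[i [r [Psi [L [r1 [ip sf uL r10 [gL s1 hF]]]]]]].
have lb := sf_box sf.
have [r' [K [r'0 rr K0 hK]]] := sol_inj lb (sf_sol sf) (sf_unit sf (local_box_mem lb)).
pose r2 := Num.min r1 r'; have r20 : 0 < r2 by rewrite lt_min r10.
exists [set q | dom i q /\ box (coord i p) r2 (coord i q)]; first exact: chart_nbhd.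
move=> q q' [iq Qq] [iq' Qq']; have s x : box (coord i p) r2 x -> box (coord i p) r1 x.
  by apply: box_le; rewrite ge_min lexx.
have s' x : box (coord i p) r2 x -> box (coord i p) r' x.
  by apply: box_le; rewrite ge_min lexx orbT.
rewrite !hF; [|by []|exact: s|by []|exact: s] => E.
rewrite -(coordK iq) -(coordK iq'); congr (inv i _).
apply/eqP; rewrite -subr_eq0; apply/eqP/nrm_eq0.
apply: le_trans (hK _ _ (s' _ Qq') (s' _ Qq)) _.
by move: E; rewrite -!mulmxA => /(can_inj (mulKmx uL)) ->; rewrite subrr nrm0 mulr0.
Qed.

Lemma frame_cont H F p eps : frame H F p -> 0 < eps ->
  \forall q \near p, nrm (F q - F p) < eps.
Proof.
move=> /frame_form[i [r [Psi [L [r1 [ip sf uL r10 [gL s1 hF]]]]]]] eps0.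
have lb := sf_box sf; have [K K0 lK] := qdm_lip (lb_small lb) (sf_sol sf).
have n0 : 0 < d.+1%:R :> R by rewrite ltr0n.
pose q0 := nrm L * K * d.+1%:R + 1.
have q00 : 0 < q0 by rewrite ltr_wpDl // !mulr_ge0 ?nrm_ge0.
pose r2 := Num.min r1 (eps / q0); have r20 : 0 < r2 by rewrite lt_min r10 divr_gt0.
apply: filterS (chart_nbhd ip r20) => q [iq Qq].
have Q1 : box (coord i p) r1 (coord i q) by apply: box_le Qq; rewrite ge_min lexx.
have m1 : box (coord i p) r1 (coord i p).
  by apply: box_center => //; exact: (chart_image_half (lb_center lb)).
rewrite !hF // -!mulmxA -mulmxBr -mulmxBl; apply: le_lt_trans (nrmM _ _) _.
have h1 : nrm ((Psi (coord i q) - Psi (coord i p)) *m E0) <= K * (d.+1%:R * r2).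
  apply: le_trans (nrmM _ _) _; rewrite nrm_e0 mulr1.
  apply: le_trans (lK _ _ (s1 _ m1) (s1 _ Q1)) _; rewrite ler_wpM2l //.
  exact: box_nrm Qq.
apply: le_lt_trans (ler_wpM2l (nrm_ge0 _) h1) _.
have : r2 * q0 <= eps by rewrite -ler_pdivlMr // ge_min lexx orbT.
by rewrite /q0 mulrDr mulr1; move: (nrm L) => l; lra.
Qed.

End frame_germs.

(** * The developing map on the interior *)

Section developing.
Context {R : realType} {d : nat} (M : riemannian_manifold R d) (kappa : R)
  (curv : constant_curvature M kappa) (convM : convexM M) (kappa_le0 : kappa <= 0).
Local Notation vec := 'rV[R]_d.+1.
Local Notation cvec := 'cV[R]_(1 + d.+1).
Local Notation "'MN'" := 'M[R]_(1 + d.+1).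
Local Notation gram_mx := (gram_mx kappa).
Local Notation frame := (frame kappa).
Local Notation lift := (lift kappa).
Local Notation framed_path := (framed_path kappa).
Local Notation std_frame := (std_frame kappa).
Local Notation E0 := (e0 : cvec).
Implicit Types (i j : chart_idx M) (y v : vec) (F : M -> cvec) (g : R -> M).
Context (z : M) (iz : chart_idx M) (dz : dom iz z) (int_z : 0 < coord iz z 0 ord0)
  (rz : R) (Psi : vec -> MN) (sf : std_frame iz (coord iz z) rz Psi).
Local Notation yz := (coord iz z).
Local Notation H := (gram_mx iz yz).

Definition F0 (q : M) : cvec := Psi (coord iz q) *m E0.
(** The product with [e0] for the form [H], see [gram_e0_hd]. *)
Definition hd (Y : cvec) : R := Y (lshift d.+1 0) 0.
(** The points other than [e0] of the model: positivity of [hd] selects the sheet of the quadric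
    through [e0]. *)
Definition normal_pt (Y : cvec) : Prop := [/\ Y^T *m H *m Y = 1%:M, 0 < hd Y & Y <> E0].

Lemma F0z : F0 z = E0. Proof. by rewrite /F0 (sf_one sf) mul1mx. Qed.

Lemma F0E y : box yz rz y -> F0 (inv iz y) = Psi y *m E0.
Proof. by move=> Qy; rewrite /F0; have [_ ->] := inv_chart (lb_sub (sf_box sf) Qy). Qed.

Lemma F0_germ : germ_at kappa H F0 iz yz rz Psi.
Proof.
split; [exact: sf_box sf|exact: sf_sol sf|exact: F0E|..].
- by rewrite (sf_one sf) unitmx1.
- by rewrite (sf_one sf) trmx1 mul1mx mulmx1.
Qed.

Lemma F0_frame y : box yz rz y -> frame H F0 (inv iz y).
Proof.
move=> Qy; apply: (std_is_frame sf Qy ltr01 (unitmx1 _ _)).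
  by rewrite trmx1 mul1mx mulmx1.
by move=> y' Qy' _; rewrite mul1mx F0E.
Qed.

Lemma F0_frame_z : frame H F0 z.
Proof. by have := F0_frame (local_box_mem (sf_box sf)); rewrite coordK. Qed.

Lemma hd_split (Y : cvec) : Y = hd Y *: E0 + lower (dsubmx Y)^T.
Proof.
rewrite /lower /e0 trmxK scale_col_mx add_col_mx scaler0 add0r addr0 -{1}(vsubmxK Y).
by congr col_mx; apply/matrixP => a b; rewrite (ord1 a) (ord1 b) !mxE eqxx mulr1.
Qed.

Lemma gram_e0 : E0^T *m H *m E0 = 1%:M.
Proof.
rewrite /e0 /gram_mx tr_col_mx trmx1 trmx0 mul_row_block mul_row_col.
by rewrite !(mul0mx, mulmx0, addr0, mulmx1, mul1mx).
Qed.

Lemma gram_e0_hd (Y : cvec) : E0^T *m H *m Y = (hd Y)%:M.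
Proof.
by rewrite {1}(hd_split Y) mulmxDr e0_gram_lower addr0 -scalemxAr gram_e0 scale_scalar_mx mulr1.
Qed.

Lemma gram_hd_e0 (Y : cvec) : Y^T *m H *m E0 = (hd Y)%:M.
Proof.
apply: (can_inj (@trmxK _ _ _)); rewrite tr_scalar_mx -gram_e0_hd !trmx_mul trmxK mulmxA.
by rewrite gram_sym //; exists z.
Qed.

Lemma gram_form (Y : cvec) : Y^T *m H *m Y =
  (hd Y ^+ 2 + kappa * gdot iz yz (dsubmx Y)^T (dsubmx Y)^T)%:M.
Proof.
set w := (dsubmx Y)^T.
have h1 : Y^T *m H *m Y = hd Y *: (Y^T *m H *m E0) + Y^T *m H *m lower w.
  by rewrite scalemxAr -mulmxDr -hd_split.
have tY : Y^T = hd Y *: E0^T + (lower w)^T by rewrite -linearZ -linearD -hd_split.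
have h2 : Y^T *m H *m lower w = (kappa * gdot iz yz w w)%:M.
  by rewrite tY 2!mulmxDl -!scalemxAl e0_gram_lower scaler0 add0r lower_gram.
by rewrite h1 gram_hd_e0 h2 scale_scalar_mx -expr2 -raddfD.
Qed.

(** As kappa <= 0, the form is at most [hd Y ^+ 2]. The bound makes [hd Y] a value of [cs], which
    fixes the constant of the model geodesic from [e0] to [Y]. *)
Lemma normal_hd_ge1 Y : normal_pt Y -> 1 <= hd Y.
Proof.
move=> [n p _]; move: n; rewrite gram_form => /matrixP /(_ 0 0); rewrite !mxE eqxx !mulr1n => n.
have g0 : 0 <= gdot iz yz (dsubmx Y)^T (dsubmx Y)^T.
  have [->|wN] := eqVneq (dsubmx Y)^T 0; first by rewrite /gdot mul0mx mul0mx mxE.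
  exact/ltW/(metric_pos (lb_center (sf_box sf)) wN).
have : 1 <= hd Y ^+ 2.
  have : kappa * gdot iz yz (dsubmx Y)^T (dsubmx Y)^T <= 0 by rewrite mulr_le0_ge0.
  by lra.
by rewrite -{1}(expr1n R 2) ler_pXn2r ?nnegrE // ltW.
Qed.

Lemma hdZ (m : R) Y : hd (m *: Y) = m * hd Y. Proof. by rewrite /hd mxE. Qed.

Lemma hdD Y Y' : hd (Y + Y') = hd Y + hd Y'. Proof. by rewrite /hd mxE. Qed.

Lemma hd_e0 : hd E0 = 1. Proof. by rewrite /hd /e0 col_mxEu mxE eqxx. Qed.

Lemma hd_lower v : hd (lower v) = 0. Proof. by rewrite /hd /lower col_mxEu mxE. Qed.

Lemma hd_le Y : `|hd Y| <= nrm Y. Proof. exact: entry_le. Qed.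

Lemma normal_indep Y (a b : R) : normal_pt Y -> a *: E0 + b *: Y = 0 -> b = 0.
Proof.
move=> [n p NE] E; apply/eqP; apply: contrapT => /negP bN; apply: NE.
have YE : Y = (- (a / b)) *: E0.
  have : b *: Y = - a *: E0 by rewrite scaleNr; apply/eqP; rewrite -addr_eq0 addrC E.
  move=> h; have -> : Y = b^-1 *: (b *: Y) by rewrite scalerA mulVf // scale1r.
  by rewrite h scalerA; congr (_ *: _); ring.
move: n p; set m := - (a / b) in YE; rewrite YE hdZ hd_e0 mulr1 => n p.
suff -> : m = 1 by rewrite scale1r.
apply/eqP; rewrite -(eqrXn2 (n := 2)) ?ler01 ?ltW // expr1n.
move: n; have -> : (m *: E0)^T = m *: E0^T by rewrite linearZ.
rewrite -!scalemxAl -scalemxAr gram_e0 !scale_scalar_mx mulr1 -expr2.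
by move=> /matrixP /(_ 0 0); rewrite !mxE eqxx !mulr1n => ->.
Qed.

Lemma model_norm c Y t : 0 <= c -> cs c 1 = hd Y -> Y^T *m H *m Y = 1%:M -> unit_int t ->
  (model c E0 Y t)^T *m H *m model c E0 Y t = 1%:M.
Proof.
move=> c0 cE n tI; have := model_coef_norm c0 tI; rewrite /model.
move: (_ / _) (_ / _) => b a E.
have -> : (a *: E0 + b *: Y)^T = a *: E0^T + b *: Y^T by rewrite linearD !linearZ.
rewrite !mulmxDl !mulmxDr -!scalemxAl -!scalemxAr gram_e0 gram_e0_hd gram_hd_e0 n.
rewrite !scale_scalar_mx -!raddfD /=; congr (_%:M).
by rewrite -[RHS]E -cE; ring.
Qed.

Lemma model_inj c Y s t : 0 <= c -> normal_pt Y -> model c E0 Y s = model c E0 Y t -> s = t.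
Proof.
move=> c0 nY E; have h1 := sn1_gt0 c0.
have : sn c s / sn c 1 - sn c t / sn c 1 = 0.
  apply: (normal_indep (a := sn c (1 - s) / sn c 1 - sn c (1 - t) / sn c 1) nY).
  by rewrite !scalerBl addrACA -opprD -/(model c E0 Y s) -/(model c E0 Y t) E subrr.
rewrite -mulrBl => /eqP; rewrite mulf_eq0 invr_eq0 (gt_eqF h1) orbF subr_eq0 => /eqP e.
have [st|ts|//] := ltgtP s t.
  by have := sn_lt c0 st; rewrite e ltxx.
by have := sn_lt c0 ts; rewrite e ltxx.
Qed.

Lemma cont_near g t (P : set M) : cont_at unit_int g t -> (\forall q \near g t, P q) ->
  exists2 e : R, 0 < e & forall s, tnear unit_int t e s -> P (g s).
Proof. exact. Qed.

(** If cs c 1 = hd Y, the model curve stays on the quadric. The lift at time [msig c s] follows it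
    up to a positive factor, which is 1 because both sides have norm 1. So [framed_path_inj] applies
    to the reparametrized lift. *)
Lemma lift_framed Y b : lift H F0 z Y 1 b -> normal_pt Y -> exists2 c : R, 0 <= c &
  [/\ framed_path H (b \o msig c) (model c E0 Y),
      forall s t, unit_int s -> unit_int t -> b (msig c s) = b (msig c t) -> s = t &
      exists2 e : R, 0 < e & forall s, tnear unit_int 0 e s ->
        F0 (b (msig c s)) = model c E0 Y s].
Proof.
move=> [b0 bc bf bi] nY; have h1 := normal_hd_ge1 nY; have [n _ _] := nY.
have [c c0 cE] := cs_onto h1.
have [K K0 lK] := msig_lip c0.
have sI t : unit_int t -> seg 1 (msig c t) by move=> /(msig_unit c0).
have snear t e : unit_int t -> 0 < e -> exists2 e' : R, 0 < e' & forall s,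
    tnear unit_int t e' s -> tnear (seg 1) (msig c t) e (msig c s).
  have k0 : 0 < K + 1 by rewrite ltr_wpDl.
  move=> tI e0; exists (e / (K + 1)) => [|s [sI' st]]; first by rewrite divr_gt0.
  split; first exact: sI.
  apply: le_lt_trans (lK _ _ tI sI') _; move: st; rewrite ltr_pdivlMr // mulrDr mulr1 mulrC.
  by have := normr_ge0 (s - t); lra.
have cb t : unit_int t -> cont_at unit_int (b \o msig c) t.
  move=> tI U nU; have [e e0 he] := bc _ (sI t tI) U nU.
  by have [e' e'0 he'] := snear t e tI e0; exists e' => // s /he'; exact: he.
have key F t : unit_int t -> frame H F (b (msig c t)) -> develops F b (seg 1) Y (msig c t) ->
    exists2 e : R, 0 < e & forall s, tnear unit_int t e s -> F (b (msig c s)) = model c E0 Y s.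
  move=> tI fr [e e0 he]; have [e1 e10 h1'] := snear t e tI e0.
  have [e2 e20 h2] := cont_near (cb t tI) (frame_open curv fr).
  exists (Num.min e1 e2) => [|s [sI']]; first by rewrite lt_min e10.
  rewrite lt_min => /andP[s1 s2].
  have [rho r0 E] := he _ (h1' s (conj sI' s1)).
  have frs := frame_norm (h2 s (conj sI' s2)).
  have l0 := mlam_gt0 c0 sI'.
  have E2 : model c E0 Y s = (mlam c s * rho) *: F (b (msig c s)).
    by rewrite (modelE c0 E0 Y sI') -/(chord Y (msig c s)) -E scalerA.
  have := model_norm c0 cE n sI'; rewrite E2.
  set m := mlam c s * rho; have m0 : 0 < m by rewrite mulr_gt0.
  have -> : (m *: F (b (msig c s)))^T = m *: (F (b (msig c s)))^T by rewrite linearZ.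
  rewrite -!scalemxAl -scalemxAr frs !scale_scalar_mx mulr1 -expr2.
  move=> /matrixP /(_ 0 0); rewrite !mxE eqxx !mulr1n => m2.
  suff -> : m = 1 by rewrite scale1r.
  by apply/eqP; rewrite -(eqrXn2 (n := 2)) ?ler01 ?ltW // expr1n m2.
have fp : framed_path H (b \o msig c) (model c E0 Y).
  move=> t tI; split; first exact: cb.
  by have [F fr dv] := bf _ (sI t tI); exists F => //; exact: key.
have u0 : @unit_int R 0 by rewrite /unit_int /= lexx ler01.
exists c => //; split => //.
- apply: (framed_path_inj curv convM fp (model_ode c0 E0 Y)) => s t _ _.
  exact: model_inj.
- by apply: key => //; rewrite msig0 ?b0 //; exact: F0_frame_z.
Qed.

Lemma lift_arc Y b : lift H F0 z Y 1 b -> normal_pt Y -> exists2 c : R, 0 <= c &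
  exists2 g, geodesic_arc z (b 1) g &
    exists2 e : R, 0 < e & forall s, tnear unit_int 0 e s -> F0 (g s) = model c E0 Y s.
Proof.
move=> lb nY; have [c c0 [fp inj st]] := lift_framed lb nY.
exists c => //; exists (b \o msig c) => //; split.
- have := framed_affine_geodesic curv (a := 0) (k := 1) fp (model_ode c0 E0 Y).
  have E : (fun t => (b \o msig c) (1 * t + 0)) = b \o msig c.
    by apply: funext => t; rewrite mul1r addr0.
  by rewrite E; apply => t tI; rewrite mul1r addr0.
- by move=> s t; rewrite !in_itv /= => sI tI; exact: inj.
- by rewrite /= msig0; exact: lift_start lb.
- by rewrite /= msig1.
Qed.

(* The lifts are arcs from z, which are equal by convexity, and the development of
   an arc is determined by its beginning. *)
Lemma lift_unique Y Y' b b' : lift H F0 z Y 1 b -> lift H F0 z Y' 1 b' ->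
  normal_pt Y -> normal_pt Y' -> b 1 = b' 1 -> Y = Y'.
Proof.
move=> l l' nY nY' E.
have [c c0 [g ag [e e0 hg]]] := lift_arc l nY.
have [c' c'0 [g' ag' [e' e'0 hg']]] := lift_arc l' nY'.
rewrite -E in ag'.
have zN : z <> b 1.
  case: (ag) => _ inj <- <- /inj; rewrite !in_itv /= lexx ler01 lexx => /(_ isT isT) /eqP.
  by rewrite eq_sym oner_eq0.
have [g1 _ uniq] := convM zN.
have gg' s : unit_int s -> g s = g' s.
  by move=> sI; rewrite (uniq _ ag) ?(uniq _ ag') // in_itv.
have Tall (s : R) : unit_int s -> tnear unit_int 0 2 s.
  by move=> sI; split => //; move: sI => /andP[? ?]; rewrite subr0 ger0_norm //; lra.
have u0 : @unit_int R 0 by rewrite /unit_int /= lexx ler01.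
have u1 : @unit_int R 1 by rewrite /unit_int /= lexx ler01.
have oT c1 W : 0 <= c1 -> ode c1 (tnear unit_int 0 2) (model c1 E0 W) (model1 c1 E0 W).
  move=> c10 t [tI _]; have [a a0 [x1 x2]] := model_ode c10 E0 W tI; exists a => //.
  have sub : tnear (tnear unit_int 0 2) t a `<=` tnear unit_int t a.
    by apply: tnear_mono; exact: tnear_sub.
  by split; apply: qdm_subset sub _.
have m0 : 0 < Num.min e e' by rewrite lt_min e0.
have nr x : tnear unit_int 0 2 x -> `|x - 0| < Num.min e e' -> model c E0 Y x = model c' E0 Y' x.
  move=> [xI _]; rewrite lt_min => /andP[x1 x2].
  by rewrite -hg // -hg' // gg'.
have XN : model c E0 Y 0 != 0.
  apply/eqP => X0; have := hg 0 (conj u0 _); rewrite subrr normr0 X0 => /(_ e0) F00.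
  have := frame_norm F0_frame_z; case: ag => _ _ g0 _; rewrite g0 in F00.
  rewrite F00 trmx0 !mul0mx => /matrixP /(_ 0 0).
  by rewrite !mxE eqxx => /eqP; rewrite eq_sym oner_eq0.
have [_ XE] := ode_unique c0 c'0 (Tall 0 u0) m0 (oT c Y c0) (oT c' Y' c'0) nr XN.
have := XE 1 (Tall 1 u1); rewrite /model subrr !sn0 !mul0r !scale0r !add0r.
by rewrite !divff ?scale1r // gt_eqF // sn1_gt0.
Qed.

(** The chord from [e0] to [F0 q] stays in the ball where the cone coordinates at [z] lift it in one
    step. *)
Lemma hd_F0_near : \forall q \near z, q <> z ->
  normal_pt (F0 q) /\ exists2 b, lift H F0 z (F0 q) 1 b & b 1 = q.
Proof.
have [r' [eta [rho [Yf [r'0 rr eta0 [hcone hlip huniq]]]]]] := std_cone sf int_z.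
have lb := sf_box sf.
have near1 := frame_cont curv F0_frame_z eta0.
have near2 := frame_cont curv F0_frame_z (ltr01 : 0 < (1 : R)).
rewrite F0z in near1 near2.
near=> q => qz.
have [iq Qq] : dom iz q /\ box yz r' (coord iz q) by near: q; exact: chart_nbhd.
have nq : nrm (F0 q - E0) < eta by near: q.
have nq1 : nrm (F0 q - E0) < 1 by near: q.
have fq : frame H F0 q by near: q; exact: frame_open F0_frame_z.
have m1 : box yz r' yz by apply: box_center => //; exact: chart_image_half (lb_center lb).
have Yq : Yf (F0 q) = coord iz q.
  have := huniq 1 _ ltr01 Qq; rewrite scale1r -/(F0 q); apply; exact: ltW.
have Yz : Yf E0 = yz.
  have := huniq 1 _ ltr01 m1; rewrite (sf_one sf) mul1mx scale1r subrr nrm0; apply.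
  exact: ltW.
set Y := F0 q in nq nq1 Yq *.
have nY : normal_pt Y.
  split; first exact: frame_norm fq.
    have := le_lt_trans (hd_le (Y - E0)) nq1.
    by rewrite -scaleN1r hdD hdZ hd_e0 ltr_norml => /andP[h _]; lra.
  by move=> YE; apply: qz; rewrite -(coordK iq) -Yq YE Yz coordK.
split => //.
have chn s : 0 <= s <= 1 -> nrm (chord Y s - E0) <= eta.
  move=> /andP[s0 s1]; rewrite /chord addrAC subrr add0r nrmZ ger0_norm //.
  apply: le_trans (ltW nq); rewrite ler_piMl // nrm_ge0.
pose g2 s := inv iz (Yf (chord Y s)).
have Q2 s : 0 <= s <= 1 -> box yz rz (Yf (chord Y s)).
  by move=> /chn/hcone[_ h _]; exact: box_le h.
have chord0 : chord Y 0 = E0 by rewrite /chord scale0r addr0.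
have seg0 (s : R) : seg 0 s -> s = 0 by move=> /andP[? ?]; lra.
have dev0 : develops F0 (fun=> z) (seg (0 : R)) Y 0.
  exists 1 => // s' [/seg0 -> _]; exists 1 => //; rewrite scale1r /= chord0; exact: F0z.
have l0 : lift H F0 z Y 0 (fun=> z).
  split => //.
  - by move=> s _ V nV; exists 1 => // s' _; exact: nbhs_singleton nV.
  - by move=> s /seg0 ->; exists F0 => //; exact: F0_frame_z.
have g20 : g2 0 = z by rewrite /g2 chord0 Yz coordK.
have cg s : 0 <= s <= 1 -> cont_at [set x : R | 0 <= x <= 1] g2 s.
  move=> sI V nV; have iys : chart_image iz (Yf (chord Y s)) := lb_sub lb (Q2 s sI).
  have [r5 r50 h5] := inv_nbhd iys nV.
  have q0 : 0 < 2 * nrm (Y - E0) + 1 by rewrite ltr_wpDl // mulr_ge0 // nrm_ge0.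
  exists (r5 / (2 * nrm (Y - E0) + 1)) => [|x [xI xs]]; first by rewrite divr_gt0.
  apply: h5; first exact: (lb_sub lb (Q2 x xI)).
  apply: le_lt_trans (hlip _ _ (chn s sI) (chn x xI)) _.
  have -> : chord Y x - chord Y s = (x - s) *: (Y - E0).
    by apply/matrixP => k l; rewrite !mxE; ring.
  rewrite nrmZ; move: xs; rewrite ltr_pdivlMr //.
  by have := normr_ge0 (x - s); move: (nrm _) => w; lra.
have fg s : 0 <= s <= 1 -> frame H F0 (g2 s) /\ aims F0 (g2 s) (chord Y s).
  move=> sI; split; first exact: F0_frame (Q2 s sI).
  have [p0 _ E] := hcone _ (chn s sI); exists (rho (chord Y s)) => //.
  by rewrite F0E //; exact: Q2.
have nF : \forall q' \near (fun _ : R => z) 0, F0 q' = F0 q' by near=> q'.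
have [l1 _] := lift_extend (lexx 0) ltr01 l0 dev0 g20 cg fg nF (fun _ => erefl).
eexists; first exact: l1.
rewrite /= leNgt ltr01 /= /g2.
by rewrite /chord scale1r addrC subrK Yq coordK.
Unshelve. all: by end_near. Qed.

(** [Y] is the value at [q] of the developing map from [z], read off from the end of a lifted
    chord. *)
Definition devpt (q : M) (Y : cvec) : Prop :=
  normal_pt Y /\ exists2 b, lift H F0 z Y 1 b & b 1 = q.

Lemma devpt_unique q Y Y' : devpt q Y -> devpt q Y' -> Y = Y'.
Proof.
move=> [n [b l bq]] [n' [b' l' bq']]; apply: lift_unique l l' n n' _.
by rewrite bq bq'.
Qed.

(** The arc from [z] to [q0] stays in the interior and develops to a model geodesic with end [Y0],
    so [lifts_near_end] gives a frame [F] at [q0] and lifts of all chords to points near [Y0]. For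
    [q] near [q0], the lift of the chord to [F q] ends at a point where [F] takes the value [F q],
    up to a factor that is 1 by the norms; by local injectivity this point is [q]. *)
Lemma devpt_near q0 : q0 <> z -> interior_pt q0 ->
  exists2 F, frame H F q0 & \forall q \near q0, devpt q (F q).
Proof.
move=> q0z q0i; have [g [ag gb] _] := convM (fun E => q0z (esym E)).
have [gg ginj g0 g1] := ag.
have u0 : @unit_int R 0 by rewrite /unit_int /= lexx ler01.
have u1 : @unit_int R 1 by rewrite /unit_int /= lexx ler01.
have gi t : unit_int t -> interior_pt (g t).
  move=> /andP[t0 t1]; have [->|tN0] := eqVneq t 0; first by rewrite g0; exists iz.
  have [->|tN1] := eqVneq t 1; first by rewrite g1.
  have nb := gb t ltac:(by rewrite !lt_neqAle eq_sym tN0 tN1 t0).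
  exists (chart_at (g t)); first exact: dom_chart_at.
  rewrite lt_neqAle; apply/andP; split; last first.
    by apply: (@chart_image_half _ _ M (chart_at (g t))); exists (g t) => //; exact: dom_chart_at.
  apply/eqP => E; apply: nb; exists (chart_at (g t)); first exact: dom_chart_at.
  by rewrite -E.
have dg0 : dom iz (g 0) by rewrite g0.
have ger0 : germ_at kappa H F0 iz (coord iz (g 0)) rz Psi by rewrite g0; exact: F0_germ.
have [e e0 [c c0 [dg x1 x2]]] := germ_along_geodesic kappa_le0 gg u0 dg0 ger0.
set W1 := (fun s => _) in x1 x2.
pose W : cvec := W1 0.
have WE : W = lower (velocity g iz 0) by rewrite /W /W1 g0 (sf_one sf) mul1mx.
have T0 (a : R) : 0 < a -> tnear unit_int 0 a 0 by move=> ?; split => //; rewrite subrr normr0.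
have cT : order_convex (tnear (@unit_int R) 0 e) := order_convex_tnear (@order_convex_unit R).
have TU : tnear (@unit_int R) 0 e `<=` unit_int := @tnear_sub _ _ _ _.
have oF : ode c (tnear unit_int 0 e) (F0 \o g) W1.
  move=> t Tt; exists 1 => //; have s := @tnear_sub R (tnear unit_int 0 e) t 1.
  by split; apply: qdm_subset s _.
have F0g s : tnear unit_int 0 e s -> F0 (g s) = cs c s *: E0 + sn c s *: W.
  move=> Ts; have [+ _] := ode_formula c0 cT TU oF (T0 e e0) Ts.
  by rewrite /= subr0 g0 F0z.
pose Y0 := cs c 1 *: E0 + sn c 1 *: W.
have s1 := sn1_gt0 c0.
(* If [Y0] were [e0], then W = 0 and c = 0, and [F0] would be constant on the beginning of [g],
   against the injectivity of [F0] near [z] and of [g]. *)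
have Y0N : Y0 <> E0.
  move=> YE; have hY : cs c 1 = 1.
    by have := congr1 hd YE; rewrite /Y0 hdD !hdZ hd_e0 WE hd_lower mulr0 addr0 mulr1.
  have W0 : W = 0.
    move: YE; rewrite /Y0 hY scale1r -{2}[E0]addr0 => /addrI /eqP.
    by rewrite scaler_eq0 gt_eqF //= => /eqP.
  have [V nV Vinj] := frame_locally_inj curv F0_frame_z.
  have nV' : nbhs (g 0) V by rewrite g0.
  have [e' e'0 he'] := geodesic_cont gg u0 nV'.
  have [|s [Ts sN _]] := @tnear_accum R 0 0 (Num.min e e') 1 (T0 _ _) ltr01.
    by rewrite lt_min e0.
  move: Ts => [sI]; rewrite lt_min => /andP[h1 h2].
  have F0s := F0g s (conj sI h1); rewrite W0 scaler0 addr0 in F0s.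
  have fV : frame H F0 z := F0_frame_z.
  have n0 : (F0 (g s))^T *m H *m F0 (g s) = (cs c s ^+ 2)%:M.
    rewrite F0s; have -> : (cs c s *: E0)^T = cs c s *: E0^T by rewrite linearZ.
    by rewrite -!scalemxAl -scalemxAr gram_e0 !scale_scalar_mx mulr1 -expr2.
  have cc : cs c s = 1.
    have c1 : c * sn c 1 ^+ 2 = 0 by have := cs_sn c0 1; rewrite hY; lra.
    have cz : c = 0 by move/eqP: c1; rewrite mulf_eq0 sqrf_eq0 (gt_eqF s1) orbF => /eqP.
    by rewrite /cs cz eqxx.
  have : g s = g 0.
    apply: Vinj; [exact: he' (conj sI h2)|exact: he' (T0 _ e'0)|].
    by rewrite F0s cc scale1r g0 F0z.
  move=> /ginj; rewrite !in_itv /= lexx ler01 => /(_ sI isT) E.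
  by rewrite E eqxx in sN.
pose X := model c E0 Y0; pose X1 := model1 c E0 Y0.
have start : exists2 a : R, 0 < a & forall s, tnear unit_int 0 a s -> F0 (g s) = X s.
  by exists e => // s Ts; rewrite F0g // (model_init c0 E0 W (TU _ Ts)).
have XE t : unit_int t -> 0 < mlam c t /\ X t = mlam c t *: chord Y0 (msig c t).
  by move=> tI; split; [exact: mlam_gt0|exact: modelE].
have [Kl Kl0 lamL] := mlam_lip c0.
have [F [fr F1 hU]] := lifts_near_end curv kappa_le0 gg g0 F0_frame_z gi c0
  (model_ode c0 E0 Y0) start XE Kl0 lamL (msig0 c) (msig1 c0) (msig_lt c0).
rewrite g1 in fr F1 hU.
have X1E : X 1 = Y0.
  by rewrite /X /model subrr sn0 mul0r scale0r add0r divff ?scale1r // gt_eqF.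
rewrite -/X X1E in F1.
have [V nV Vinj] := frame_locally_inj curv fr.
have [del del0 hdel] := hU _ (filterI nV (frame_open curv fr)).
have hdY0 : 1 <= hd Y0.
  by rewrite /Y0 hdD !hdZ hd_e0 WE hd_lower mulr0 addr0 mulr1; exact: cs_ge1.
have dN : 0 < nrm (Y0 - E0).
  rewrite lt_neqAle nrm_ge0 andbT; apply/eqP => h; apply: Y0N; apply/eqP.
  by rewrite -subr_eq0; apply/eqP/nrm_eq0; rewrite -h.
have m0 : 0 < Num.min del (Num.min 1 (nrm (Y0 - E0))) by rewrite !lt_min del0 ltr01.
exists F => //; have nc := frame_cont curv fr m0; rewrite F1 in nc.
near=> q.
have Vq : V q by near: q.
have fq : frame H F q by near: q; exact: frame_open.
have : nrm (F q - Y0) < Num.min del (Num.min 1 (nrm (Y0 - E0))) by near: q.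
rewrite !lt_min => /and3P[q1 q2 q3].
have [b [lb [Vb fb] [rho r0 E]]] := hdel _ q1.
have nF := frame_norm fq.
split; first split => //.
- have := le_lt_trans (hd_le (F q - Y0)) q2.
  by rewrite -scaleN1r hdD hdZ ltr_norml => /andP[h _]; lra.
- by move=> FE; move: q3; rewrite FE nrm_distC ltxx.
exists b => //; apply: Vinj => //.
have := frame_norm fb; rewrite -E in nF.
move: nF; have -> : (rho *: F (b 1))^T = rho *: (F (b 1))^T by rewrite linearZ.
rewrite -!scalemxAl -scalemxAr => nF nb; move: nF; rewrite nb !scale_scalar_mx mulr1 -expr2.
move=> /matrixP /(_ 0 0); rewrite !mxE eqxx !mulr1n => m2.
have rE : rho = 1 by apply/eqP; rewrite -(eqrXn2 (n := 2)) ?ler01 ?ltW // expr1n m2.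
by rewrite -E rE scale1r.
Unshelve. all: by end_near. Qed.

(** [G] takes the unique developed value where there is one, and [e0] at [z]. Near every interior
    point it agrees with a frame, by [hd_F0_near] or [devpt_near]. *)
Lemma interior_frame : exists G : M -> cvec, (\forall q \near z, G q = F0 q) /\
  forall p, interior_pt p -> frame H G p.
Proof.
have /choice[G hG] q : exists Y, (q = z -> Y = E0) /\
    (q <> z -> forall Y', devpt q Y' -> Y = Y').
  have [qz|qz] := pselect (q = z); first by exists E0.
  have [[Y hY]|hN] := pselect (exists Y, devpt q Y).
    by exists Y; split => // _ Y' hY'; exact: devpt_unique hY hY'.
  by exists E0; split => // _ Y' hY'; case: hN; exists Y'.
have Gz : \forall q \near z, G q = F0 q.
  near=> q; have [qz|qz] := pselect (q = z).
    by have [-> //] := hG q; rewrite qz F0z.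
  have h : q <> z -> devpt q (F0 q) by near: q; exact: hd_F0_near.
  by have [_] := hG q; apply => //; exact: h.
exists G; split => // p pI; have [->|pz] := pselect (p = z).
  exact: frame_near F0_frame_z Gz.
have [F fr nF] := devpt_near pz pI.
apply: (frame_near fr); near=> q.
have [qz|qz] := pselect (q = z); last first.
  by have [_] := hG q; apply => //; near: q.
exfalso; move: qz; near: q.
have [U [/= oU Up] Uz] : exists2 U : set M, open_nbhs p U & ~ U z.
  have := @hausdorff_accessible M (@hausdorffM _ _ M) p z.
  move=> /(_ _)[|U [oU /set_mem Up Uz]]; first exact/eqP.
  by exists U => // h; move/set_mem: Uz; apply.
apply: filterS (open_nbhs_nbhs (conj oU Up)) => q Uq qz; apply: Uz.
by rewrite -qz.
Unshelve. all: by end_near. Qed.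

End developing.

(** * Extension of a frame to the boundary *)

Section extension.
Context {R : realType} {d : nat} (M : riemannian_manifold R d) (kappa : R)
  (curv : constant_curvature M kappa).
Local Notation vec := 'rV[R]_d.+1.
Local Notation cvec := 'cV[R]_(1 + d.+1).
Local Notation "'MN'" := 'M[R]_(1 + d.+1).
Local Notation gram_mx := (gram_mx kappa).
Local Notation frame := (frame kappa).
Local Notation std_frame := (std_frame kappa).
Local Notation E0 := (e0 : cvec).
Implicit Types (i j : chart_idx M) (y v : vec) (L : MN).
Context (H : MN) (G : M -> cvec) (frG : forall p, interior_pt p -> frame H G p).

Definition push (y : vec) (h : R) : vec := y + h *: delta_mx 0 ord0.

Lemma push_box y0 r y : box y0 r y -> exists2 e : R, 0 < e & forall h, 0 < h < e ->
  [/\ box y0 r (push y h), 0 < push y h 0 ord0 & nrm (push y h - y) <= h].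
Proof.
move=> Qy; have [e e0 he] := box_forward Qy; exists e => // h /andP[h0 hlt]; split.
- apply: he => a; rewrite !mxE /=; case: (a == ord0); rewrite ?mulr1 ?mulr0 ?e0 ?lexx //.
  by rewrite ltW.
- by rewrite !mxE !eqxx mulr1; have := Qy.2; lra.
- by rewrite /push addrAC subrr add0r nrm_delta ger0_norm // ltW.
Qed.

Lemma chart_interior i y : chart_image i y -> 0 < y 0 ord0 -> interior_pt (inv i y).
Proof. by move=> /inv_chart[iy yE] y0; exists i => //; rewrite yE. Qed.

(* The interior points of a box form a convex set, so the constant L with
   G = L Psi e0 near one of them is good for all. *)
Lemma std_develop i y0 r Psi : std_frame i y0 r Psi -> exists L,
  [/\ L \in unitmx, L^T *m H *m L = gram_mx i y0 & forall y, box y0 r y ->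
  interior_pt (inv i y) -> G (inv i y) = L *m Psi y *m E0].
Proof.
move=> sf; have lb := sf_box sf; have m1 := local_box_mem lb.
have [e e0 he] := push_box m1.
have [Qs s0 _] := he (e / 2) ltac:(by apply/andP; split; lra).
set ys := push y0 (e / 2) in Qs s0.
have is_ : interior_pt (inv i ys) by apply: chart_interior => //; exact: (lb_sub lb).
have [L [r1 [uL gL r10 s1 hL]]] := frame_std sf Qs (frG is_).
exists L; split => // y Qy iy.
pose yt (t : R) := ys + t *: (y - ys).
have Qt t : 0 <= t <= 1 -> box y0 r (yt t) by exact: box_convex.
have it t : 0 <= t <= 1 -> interior_pt (inv i (yt t)).
  move=> tI; have /andP[t0 t1] := tI.
  have [->|tN] := eqVneq t 1; first by rewrite /yt scale1r addrC subrK.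
  apply: chart_interior; first exact/(lb_sub lb)/Qt.
  have t1' : 0 < 1 - t by rewrite subr_gt0 lt_neqAle tN.
  have -> : yt t 0 ord0 = (1 - t) * ys 0 ord0 + t * y 0 ord0.
    by rewrite /yt; clearbody ys; rewrite !mxE; ring.
  by rewrite ltr_wpDr ?mulr_gt0 // mulr_ge0 //; exact: Qy.2.
pose P (t : R) := exists2 r1 : R, 0 < r1 & forall x, box y0 r x -> box (yt t) r1 x ->
  G (inv i x) = L *m Psi x *m E0.
have yt0 : yt 0 = ys by rewrite /yt scale0r addr0.
have u1 : 0 <= (1 : R) <= 1 by rewrite ler01 lexx.
have P0 : P 0 by exists r1 => // x _; rewrite yt0; exact: hL.
have st t : 0 <= t <= 1 -> exists2 e : R, 0 < e & forall s s', 0 <= s -> s <= s' ->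
    s' <= 1 -> `|s - t| < e -> `|s' - t| < e -> P s -> P s'.
  move=> tI; have [L' [r' [uL' _ r'0 s' hL']]] := frame_std sf (Qt t tI) (frG (it t tI)).
  have n0 : 0 < nrm (y - ys) + 1 by rewrite ltr_wpDl // nrm_ge0.
  have near s : 0 <= s <= 1 -> `|s - t| < r' / (nrm (y - ys) + 1) -> box (yt t) r' (yt s).
    move=> sI; rewrite ltr_pdivlMr // => h; split; last exact: (Qt s sI).2.
    move=> a; have -> : yt s 0 a - yt t 0 a = ((s - t) *: (y - ys)) 0 a.
      by rewrite !mxE; ring.
    apply: le_lt_trans (entry_le _ _ _) _; rewrite nrmZ.
    by have := normr_ge0 (s - t); move: h; rewrite mulrDr mulr1; lra.
  exists (r' / (nrm (y - ys) + 1)) => [|s s2 s00 ss2 s21 st s2t [r2 r20 h2]].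
    by rewrite divr_gt0.
  have sI : 0 <= s <= 1 by apply/andP; split; lra.
  have s2I : 0 <= s2 <= 1 by apply/andP; split; lra.
  have Qst := near s sI st; have Qs2t := near s2 s2I s2t.
  have [r3 r30 s3] := box_nbhd Qst; have [r4 r40 s4] := box_nbhd Qs2t.
  pose r5 := Num.min r2 r3; have r50 : 0 < r5 by rewrite lt_min r20.
  have LL : L = L'.
    apply: (std_unique sf r50 (Qt s sI)) => [x hx|x hx].
      by apply/s'/s3; apply: box_le hx; rewrite ge_min lexx orbT.
    have hx3 : box (yt t) r' x by apply: s3; apply: box_le hx; rewrite ge_min lexx orbT.
    rewrite -hL' // -h2 //; first exact: s'.
    by apply: box_le hx; rewrite ge_min lexx.
  by exists r4 => // x _ /s4 hx; rewrite LL; exact: hL'.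
have [r2 r20 h2] := real_step ler01 P0 st u1.
have yt1 : yt 1 = y by rewrite /yt scale1r addrC subrK.
by apply: h2; rewrite // yt1; apply: box_center => //; exact: box_half Qy.
Qed.

Definition limit_at (p : M) (Y : cvec) : Prop := forall eps : R, 0 < eps ->
  \forall q \near p, interior_pt q -> nrm (G q - Y) < eps.

Lemma interior_accum (p : M) (U : set M) : nbhs p U -> exists2 q, U q & interior_pt q.
Proof.
move=> nU; have ip := dom_chart_at p; set i := chart_at p in ip.
have iy : chart_image i (coord i p) by exists p.
have [r lb] := local_box_exists iy.
have nU' : nbhs (inv i (coord i p)) U by rewrite coordK.
have [r1 r10 h1] := inv_nbhd iy nU'.
have [e e0 he] := push_box (local_box_mem lb).
have m0 : 0 < Num.min e r1 by rewrite lt_min e0.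
have [|Qh ph nh] := he (Num.min e r1 / 2).
  by apply/andP; split; [lra|apply: (@lt_le_trans _ _ (Num.min e r1)); [lra|rewrite ge_min lexx]].
exists (inv i (push (coord i p) (Num.min e r1 / 2))).
  apply: h1; first exact: (lb_sub lb).
  have : Num.min e r1 <= r1 by rewrite ge_min lexx orbT.
  by lra.
by apply: chart_interior => //; exact: (lb_sub lb).
Qed.

Lemma limit_at_unique p Y Y' : limit_at p Y -> limit_at p Y' -> Y = Y'.
Proof.
move=> h h'; apply/eqP; rewrite -subr_eq0; apply/eqP/nrm_eq0.
apply/ler_addgt0Pr => eps eps0; rewrite add0r.
have e2 : 0 < eps / 2 by rewrite divr_gt0.
have [q [q1 q2] qi] := interior_accum (filterI (h _ e2) (h' _ e2)).
have -> : Y - Y' = (G q - Y') - (G q - Y) by rewrite opprB [RHS]addrC addrA subrK.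
apply: le_trans (nrmB _ _) _; have := q1 qi; have := q2 qi; lra.
Qed.

(** [F p] is the limit of [G] through interior points, and 0 if there is none. In a box,
    [std_develop] writes [G] at the interior points as L Psi e0, which is continuous up to the
    boundary; so the limit does exist and is given by the same formula. *)
Lemma frame_extension : exists F : M -> cvec, (forall p, frame H F p) /\
  forall p, interior_pt p -> F p = G p.
Proof.
have /choice[F hF] p : exists Y, forall Y', limit_at p Y' -> Y = Y'.
  have [[Y hY]|hN] := pselect (exists Y, limit_at p Y).
    by exists Y => Y' hY'; exact: limit_at_unique hY hY'.
  by exists 0 => Y' hY'; case: hN; exists Y'.
exists F; split => p; last first.
  move=> pI; apply: hF => eps eps0.
  by apply: filterS (frame_cont curv (frG pI) eps0) => q hq _.
have ip := dom_chart_at p; set i := chart_at p in ip.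
have iy : chart_image i (coord i p) by exists p.
have [r [Psi sf]] := std_frame_exists curv iy.
have lb := sf_box sf; have m1 := local_box_mem lb.
have [L [uL gL hL]] := std_develop sf.
rewrite -(coordK ip); apply: (std_is_frame sf m1 ltr01 uL gL) => y Qy _.
have [iyy yE] := inv_chart (lb_sub lb Qy).
apply: hF => eps eps0.
have [K K0 lK] := qdm_lip (lb_small lb) (sf_sol sf).
pose q0 := nrm L * K * d.+1%:R + 1.
have q00 : 0 < q0 by rewrite ltr_wpDl // !mulr_ge0 ?nrm_ge0.
have [r1 r10 s1] := box_nbhd Qy.
pose r2 := Num.min r1 (eps / q0); have r20 : 0 < r2 by rewrite lt_min r10 divr_gt0.
apply: filterS (chart_nbhd iyy r20) => q; rewrite yE => -[iq Qq] qI.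
have Qq1 : box (coord i p) r (coord i q).
  by apply: s1; apply: box_le Qq; rewrite ge_min lexx.
rewrite -(coordK iq) hL ?coordK // -!mulmxA -mulmxBr -mulmxBl.
apply: le_lt_trans (nrmM _ _) _.
have h1 : nrm ((Psi (coord i q) - Psi y) *m E0) <= K * (d.+1%:R * r2).
  apply: le_trans (nrmM _ _) _; rewrite nrm_e0 mulr1.
  apply: le_trans (lK _ _ Qy Qq1) _; rewrite ler_wpM2l //.
  exact: box_nrm Qq.
apply: le_lt_trans (ler_wpM2l (nrm_ge0 _) h1) _.
have : r2 * q0 <= eps by rewrite -ler_pdivlMr // ge_min lexx orbT.
by rewrite /q0 mulrDr mulr1; move: (nrm L) => l; lra.
Qed.

End extension.

(** * Half-spaces *)

Section volume.
Context {R : realType} {d : nat} (M : riemannian_manifold R d).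

Lemma lebesgue_int_ge0 n (f : 'rV[R]_n -> \bar R) :
  (forall y, 0 <= f y)%E -> (0 <= lebesgue_int f)%E.
Proof.
elim: n f => [|n ih] f f0 /=; first exact: f0.
by apply: integral_ge0 => x _; apply: ih => y; exact: f0.
Qed.

Lemma vol_ge0 (A : set M) : (0 <= vol A)%E.
Proof.
apply: le_ereal_inf_tmp => _ [i [E [_ _ _ ->]]]; apply: nneseries_ge0 => k _ _.
apply: lebesgue_int_ge0 => y; rewrite lee_fin mulr_ge0 ?sqrtr_ge0 //.
Qed.

Lemma vol_le (A B : set M) : A `<=` B -> (vol A <= vol B)%E.
Proof.
move=> AB; apply: ereal_inf_le_tmp => _ [i [E [mE sE BE ->]]].
by exists i, E; split => //; exact: subset_trans BE.
Qed.

End volume.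

Section conclusion.
Context {R : realType} {d : nat} (M : riemannian_manifold R d) (kappa : R)
  (convM : convexM M) (curv : constant_curvature M kappa) (kappa_le0 : kappa <= 0).
Local Notation vec := 'rV[R]_d.+1.
Local Notation cvec := 'cV[R]_(1 + d.+1).
Local Notation "'MN'" := 'M[R]_(1 + d.+1).
Local Notation gram_mx := (gram_mx kappa).
Local Notation frame := (frame kappa).
Local Notation E0 := (e0 : cvec).
Implicit Types (i j : chart_idx M) (y v : vec) (L : MN) (g : R -> M).

Lemma tnear_center (T : set R) t (e : R) : T t -> 0 < e -> tnear T t e t.
Proof. by move=> Tt e0; split => //; rewrite subrr normr0. Qed.

Lemma tdm_deriv_unique m k (X X1 X1' : R -> 'M[R]_(m, k)) t e e' :
  unit_int t -> 0 < e -> 0 < e' -> tdm (tnear unit_int t e) X X1 ->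
  tdm (tnear unit_int t e') X X1' -> X1 t = X1' t.
Proof.
move=> tI e0 e'0 h h'; pose a := Num.min e e'.
have a0 : 0 < a by rewrite lt_min e0.
apply: (@td_unique _ (tnear unit_int t a) _ _ X); first exact: tnear_center.
- by move=> b b0; apply: tnear_accum => //; exact: tnear_center.
- by apply: qdm_subset h; apply: tnear_le; rewrite ge_min lexx.
- by apply: qdm_subset h'; apply: tnear_le; rewrite ge_min lexx orbT.
Qed.

Lemma tnear_in t s (e : R) : tnear unit_int t e s ->
  exists2 e' : R, 0 < e' & tnear unit_int s e' `<=` tnear unit_int t e.
Proof.
move=> [sI st]; exists (e - `|s - t|) => [|x [xI xs]]; first by rewrite subr_gt0.
split => //; rewrite -(subrK s x) -addrA; apply: le_lt_trans (ler_normD _ _) _; lra.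
Qed.

(** Near each time [germ_along_geodesic] gives a constant and a derivative. As [F] has norm 1 and so
    does not vanish, the constant at a time is unique; hence it is the same along the whole
    geodesic, and the derivatives glue. *)
Lemma frame_along_geodesic H F g : (forall p, frame H F p) -> geodesic g ->
  exists c (X1 : R -> cvec), [/\ 0 <= c, ode c unit_int (F \o g) X1 &
  forall t i r S, unit_int t -> dom i (g t) -> germ_at kappa H F i (coord i (g t)) r S ->
    X1 t = S (coord i (g t)) *m lower (velocity g i t)].
Proof.
move=> fr gg.
pose C t c := exists2 e : R, 0 < e & exists X1 : R -> cvec,
  tdm (tnear unit_int t e) (F \o g) X1 /\ tdm (tnear unit_int t e) X1 (fun s => c *: F (g s)).
have Cex t : unit_int t -> exists c, [/\ 0 <= c, C t c &
    exists2 e : R, 0 < e & forall s, tnear unit_int t e s -> C s c].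
  move=> tI; have it := dom_chart_at (g t); have [r [S gS]] := fr (g t) _ it.
  have [e e0 [c c0 [_ x1 x2]]] := germ_along_geodesic kappa_le0 gg tI it gS.
  exists c; split => //; first by exists e => //; eexists; split; [exact: x1|exact: x2].
  exists e => // s Ts; have [e' e'0 sub] := tnear_in Ts; exists e' => //.
  by eexists; split; apply: qdm_subset sub _; [exact: x1|exact: x2].
have Cuniq t c c' : unit_int t -> C t c -> C t c' -> c = c'.
  move=> tI [e e0 [X1 [x1 x2]]] [e' e'0 [X1' [x1' x2']]].
  have N0 : F (g t) != 0.
    apply/eqP => E; have := frame_norm (fr (g t)); rewrite E trmx0 !mul0mx.
    by move/matrixP => /(_ 0 0); rewrite !mxE eqxx => /eqP; rewrite eq_sym oner_eq0.
  pose a := Num.min e e'; have a0 : 0 < a by rewrite lt_min e0.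
  have sa : tnear (@unit_int R) t a `<=` tnear unit_int t e.
    by apply: tnear_le; rewrite ge_min lexx.
  have sa' : tnear (@unit_int R) t a `<=` tnear unit_int t e'.
    by apply: tnear_le; rewrite ge_min lexx orbT.
  have XX s : tnear unit_int t a s -> X1 s = X1' s.
    move=> Ts; have [b b0 sb] := tnear_in Ts.
    apply: (tdm_deriv_unique (X := F \o g) (e := b) (e' := b) _ b0 b0); first exact: Ts.1.
      by apply: qdm_subset x1 => w /sb; exact: sa.
    by apply: qdm_subset x1' => w /sb; exact: sa'.
  have E : c *: F (g t) = c' *: F (g t).
    apply: (tdm_deriv_unique (X := X1) (X1 := fun s => c *: F (g s))
      (X1' := fun s => c' *: F (g s)) tI a0 a0); first exact: qdm_subset x2.
    by apply: qdm_ext (qdm_subset sa' x2') => [s Ts|//]; exact/esym/XX.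
  apply/eqP; rewrite -subr_eq0; have : (c - c') *: F (g t) = 0 by rewrite scalerBl E subrr.
  by move=> /eqP; rewrite scaler_eq0 (negPf N0) orbF.
have u0 : @unit_int R 0 by rewrite /unit_int /= lexx ler01.
have [c [c0 Cc _]] := Cex 0 u0.
have Call t : unit_int t -> C t c.
  move=> tI; apply: (@real_step _ (fun t => C t c) 0 1 ler01 Cc _ t tI) => s sI.
  have [c' [_ _ [e e0 hc']]] := Cex s sI; exists e => // s1 s2 s10 s12 s21 n1 n2 C1.
  have s1I : unit_int s1 by apply/andP; split; lra.
  have s2I : unit_int s2 by apply/andP; split; lra.
  have -> : c = c' by apply: Cuniq C1 _ => //; exact: hc'.
  exact: hc'.
have /choice[X1 hX1] t : exists Y, forall e X1', unit_int t -> 0 < e ->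
    tdm (tnear unit_int t e) (F \o g) X1' -> Y = X1' t.
  have [tI|tN] := pselect (unit_int t); last by exists 0 => e X1' tI; case: (tN tI).
  have [e e0 [X1 [x1 _]]] := Call t tI; exists (X1 t) => e' X1' _ e'0 h.
  exact: tdm_deriv_unique x1 h.
have X1E t e (X1' : R -> cvec) : tdm (tnear unit_int t e) (F \o g) X1' ->
    forall s, tnear unit_int t e s -> X1 s = X1' s.
  move=> h s Ts; have [b b0 sb] := tnear_in Ts.
  by apply: (hX1 s b X1' Ts.1 b0); exact: qdm_subset h.
exists c, X1; split => //.
- move=> t tI; have [e e0 [X1' [x1 x2]]] := Call t tI; exists e => //; split.
    by apply: qdm_ext (x1) => [//|a s Ts]; exact: (esym (X1E _ _ _ x1 s Ts)).
  by apply: qdm_ext (x2) => [s Ts|//]; exact: (esym (X1E _ _ _ x1 s Ts)).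
- move=> t i r S tI it gS.
  have [e e0 [c' _ [_ x1 _]]] := germ_along_geodesic kappa_le0 gg tI it gS.
  exact: hX1 tI e0 x1.
Qed.

Lemma unit_vector (x : M) (w : vec) : w != 0 ->
  exists2 a : R, 0 < a & unit_tangent x (a *: w).
Proof.
move=> wN; have ix : chart_image (chart_at x) (coord (chart_at x) x).
  by exists x => //; exact: dom_chart_at.
have := metric_pos ix wN; set q := (X in 0 < X) => p.
exists (Num.sqrt q)^-1; first by rewrite invr_gt0 sqrtr_gt0.
rewrite /unit_tangent /= /tdot /gdot linearZ /= -scalemxAr -!scalemxAl.
rewrite mxE [X in _ * X]mxE -/q mulrA -expr2 exprVn sqr_sqrtr ?ltW // mulVf // gt_eqF //.
Qed.

Lemma nonzero_vec : exists w : vec, w != 0.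
Proof.
exists (delta_mx 0 ord0); apply/eqP => /matrixP /(_ 0 ord0) /eqP.
by rewrite !mxE !eqxx oner_eq0.
Qed.

(* For the function f = l F, of Hessian - kappa f g: any half-space at x bounded
   by the kernel of df lies in {f >= 0} as soon as f x >= 0. *)
Lemma halfspace_sub H F (l : 'rV[R]_(1 + d.+1)) (x : M) : (forall p, frame H F p) ->
  0 <= (l *m F x) 0 0 -> exists2 v, unit_tangent x v &
  halfM x v `<=` [set q | 0 <= (l *m F q) 0 0].
Proof.
move=> fr fx; set i := chart_at x; have ix : dom i x := dom_chart_at x.
have iy : chart_image i (coord i x) by exists x.
have [r [S gS]] := fr x i ix; set y := coord i x in gS iy.
pose om : vec := rsubmx (l *m S y).
have omE (V : vec) : (l *m (S y *m lower V)) 0 0 = (om *m V^T) 0 0.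
  by rewrite mulmxA -{1}(hsubmxK (l *m S y)) /lower mul_row_col mulmx0 add0r.
(* [om] is df at [x]. If it is not 0, [v] is the normalized gradient; otherwise any unit vector
   serves. *)
have [v uv hv] : exists2 v, unit_tangent x v & forall V : vec,
    gdot i y V v <= 0 -> (om *m V^T) 0 0 <= 0.
  have [om0|omN] := eqVneq om 0.
    have [w wN] := nonzero_vec; have [a a0 ua] := unit_vector x wN.
    by exists (a *: w) => // V _; rewrite om0 mul0mx mxE.
  have uG := metric_unit iy.
  have wN : om *m invmx (metric i y) != 0.
    by apply: contra omN => /eqP E; rewrite -(mulmxKV uG om) E mul0mx.
  have [a a0 ua] := unit_vector x wN; exists (a *: (om *m invmx (metric i y))) => // V.
  rewrite /gdot linearZ /= -scalemxAr mxE pmulr_rle0 //.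
  rewrite trmx_mul trmx_inv (metric_sym iy) mulmxA mulmxK //.
  by have -> : (om *m V^T) 0 0 = (V *m om^T) 0 0 by rewrite -[in LHS](trmxK om) -trmx_mul mxE.
exists v => // q [->//|[g [gg ginj g0 g1] hg]] /=.
have [c [X1 [c0 oX X1E]]] := frame_along_geodesic fr gg.
have u0 : @unit_int R 0 by rewrite /unit_int /= lexx ler01.
have u1 : @unit_int R 1 by rewrite /unit_int /= lexx ler01.
have [+ _] := ode_formula c0 (@order_convex_unit R) (fun _ h => h) oX u1 u0.
rewrite /= sub0r csN snN g0 g1 => ->.
have i1 : dom i (g 1) by rewrite g1.
have := X1E 1 i r S u1 i1; rewrite g1 => /(_ gS) ->.
have hV := hv _ hg; have := omE (velocity g i 1) => E.
rewrite mulmxDr -!scalemxAr mxE mxE [X in _ + X]mxE E.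
have s1 := @sn_ge0 _ _ c0 1 ler01; have c1 := cs_ge1 c 1.
have h1 : 0 <= cs c 1 * (l *m F x) 0 0 by rewrite mulr_ge0 //; lra.
have h2 : sn c 1 * (om *m (velocity g i 1)^T) 0 0 <= 0 by rewrite mulr_ge0_le0.
by rewrite mulNr; lra.
Qed.

Lemma arc_interior (x1 x2 : M) g t : geodesic_arc x1 x2 g -> 0 < t < 1 -> ~ boundary (g t).
Proof.
move=> ag tI; have xN : x1 <> x2.
  case: ag => _ inj <- <- /inj; rewrite !in_itv /= lexx ler01 lexx => /(_ isT isT) /eqP.
  by rewrite eq_sym oner_eq0.
have [g' [ag' nb] uniq] := convM xN.
by rewrite (uniq _ ag) ?in_itv /=; [exact: nb|case/andP: tI => *; rewrite !ltW].
Qed.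

Lemma halfspace_domination (x1 x2 : M) g t v : geodesic_arc x1 x2 g -> 0 < t < 1 ->
  unit_tangent (g t) v ->
  exists x v', [/\ x = x1 \/ x = x2, unit_tangent x v' & halfM x v' `<=` halfM (g t) v].
Proof.
move=> ag tI uv; set z := g t; have nb := arc_interior ag tI; rewrite -/z in nb uv.
have [gg _ g0 g1] := ag.
set iz := chart_at z; have dz : dom iz z := dom_chart_at z.
have iy : chart_image iz (coord iz z) by exists z.
have pz : 0 < coord iz z 0 ord0.
  rewrite lt_neqAle; apply/andP; split; last exact: (chart_image_half iy).
  by apply/eqP => E; apply: nb; exists iz.
have [r [Psi sf]] := std_frame_exists curv iy; set yz := coord iz z in iy pz sf.
have [G [Gz frG]] := interior_frame curv convM kappa_le0 dz pz sf.
have [F [fr FG]] := frame_extension curv frG.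
(* Near the interior point [z], [F] is [G] and hence [F0]. So [Psi], which is 1 at [yz], is a germ
   of [F], and the value and the differential of [l *m F q] at [z] are the two blocks of [l]. *)
have [r1 gF] : exists r1, germ_at kappa (gram_mx iz yz) F iz yz r1 Psi.
  have lb := sf_box sf.
  have nF : \forall q \near inv iz yz, F q = F0 iz Psi q.
    rewrite coordK //; near=> q.
    have -> : F q = G q.
      apply: FG; exists iz.
        near: q; apply: open_nbhs_nbhs; split => //; exact: dom_open.
      near: q; apply: filterS (chart_nbhd dz pz) => q [_ [/(_ ord0)]].
      by rewrite ltr_norml => /andP[h _] _; move: h; rewrite -/yz; lra.
    by near: q.
  have [r2 r20 h2] := inv_nbhd iy nF; have r0 := lb_gt0 lb.
  have n0 : 0 < d.+1%:R :> R by rewrite ltr0n.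
  pose r3 := Num.min r (r2 / 2 / d.+1%:R).
  have r30 : 0 < r3 by rewrite lt_min r0 !divr_gt0.
  have rr : r3 <= r by rewrite ge_min lexx.
  have [lb1 hS hF uS gS] := F0_germ sf; have s := @box_le _ _ yz _ _ rr.
  exists r3; split => //; [exact: local_box_le lb|exact: sol_subset hS|].
  move=> y Qy; rewrite -hF; last exact: s.
  apply: h2; first exact/(lb_sub lb)/s.
  apply: le_lt_trans (box_nrm Qy) _.
  have : d.+1%:R * r3 <= d.+1%:R * (r2 / 2 / d.+1%:R).
    by rewrite ler_pM2l // ge_min lexx orbT.
  rewrite [_ * (r2 / 2 / _)]mulrC divfK ?gt_eqF //; lra.
pose l : 'rV[R]_(1 + d.+1) := row_mx 0 (v *m metric iz yz).
have lV (V : vec) : (l *m lower V) 0 0 = gdot iz yz v V.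
  by rewrite /l /lower mul_row_col mul0mx add0r.
have Fz : F z = E0.
  have [lb _ hF _ _] := gF.
  by rewrite -(coordK dz) hF ?(sf_one sf) ?mul1mx //; exact: local_box_mem lb.
have lz : (l *m F z) 0 0 = 0.
  by rewrite Fz /l /e0 mul_row_col mul0mx mulmx0 addr0 mxE.
have u0 : @unit_int R 0 by rewrite /unit_int /= lexx ler01.
have u1 : @unit_int R 1 by rewrite /unit_int /= lexx ler01.
have sub : [set q | 0 <= (l *m F q) 0 0] `<=` halfM z v.
  move=> q /= lq; have [->|qz] := pselect (q = z); first by left.
  right; have [g' [ag' _] _] := convM qz; exists g' => //.
  have [gg' _ g'0 g'1] := ag'.
  have [c [X1 [c0 oX X1E]]] := frame_along_geodesic fr gg'.
  have [+ _] := ode_formula c0 (@order_convex_unit R) (fun _ h => h) oX u1 u0.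
  rewrite /= sub0r csN snN g'0 g'1 => Fq.
  have i1 : dom iz (g' 1) by rewrite g'1.
  have := X1E 1 iz r1 Psi u1 i1; rewrite g'1 => /(_ gF) E.
  rewrite (sf_one sf) mul1mx in E; rewrite Fq E in lq.
  rewrite mulmxDr -!scalemxAr mxE mxE [X in _ + X]mxE lz mulr0 add0r lV mulNr oppr_ge0 in lq.
  have s1 := @sn_gt0 _ _ c0 1 ltr01.
  rewrite pmulr_rle0 // in lq.
  by rewrite /tdot -/iz -/yz; move: lq; rewrite (gdot_sym _ _ iy).
have [x [xE lx]] : exists x, (x = x1 \/ x = x2) /\ 0 <= (l *m F x) 0 0.
  have [c [X1 [c0 oX _]]] := frame_along_geodesic fr gg.
  have tI' : unit_int t by case/andP: tI => *; apply/andP; split; apply: ltW.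
  have [E0' _] := ode_formula c0 (@order_convex_unit R) (fun _ h => h) oX tI' u0.
  have [E1' _] := ode_formula c0 (@order_convex_unit R) (fun _ h => h) oX tI' u1.
  rewrite /= g0 -/z sub0r snN in E0'; rewrite /= g1 -/z in E1'.
  have /andP[t0 t1] := tI.
  have s1 := @sn_gt0 _ _ c0 t t0; have s2 := @sn_gt0 _ _ c0 (1 - t) ltac:(by rewrite subr_gt0).
  have e1 : (l *m F x1) 0 0 = - (sn c t * (l *m X1 t) 0 0).
    by rewrite E0' mulmxDr -!scalemxAr mxE mxE [X in _ + X]mxE lz mulr0 add0r mulNr.
  have e2 : (l *m F x2) 0 0 = sn c (1 - t) * (l *m X1 t) 0 0.
    by rewrite E1' mulmxDr -!scalemxAr mxE mxE [X in _ + X]mxE lz mulr0 add0r.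
  have [h|/ltW h] := leP 0 ((l *m X1 t) 0 0).
    by exists x2; split; [right|rewrite e2 mulr_ge0 // ltW].
  by exists x1; split; [left|rewrite e1 oppr_ge0 mulr_ge0_le0 // ltW].
have [v' uv' hv'] := halfspace_sub fr lx.
by exists x, v'; split => //; exact: subset_trans hv' sub.
Unshelve. all: by end_near. Qed.

End conclusion.

Theorem proposition21 (R : realType) (d : nat) (M : riemannian_manifold R d)
    (kappa : R) (compM : compact [set: M]) (convM : convexM M)
    (curvM : constant_curvature M kappa) (kappa_le0 : kappa <= 0)
    (x1 x2 : M) (c1 : fair_cut_center x1) (c2 : fair_cut_center x2) :
  forall z, segment x1 x2 z -> fair_cut_center z.
Proof.
move=> z [[_ -> //]|[g [t [ag tI ->]]]]; have [_ _ g0 g1] := ag.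
have [->|t0] := eqVneq t 0; first by rewrite g0.
have [->|t1] := eqVneq t 1; first by rewrite g1.
have {t0 t1} tI' : 0 < t < 1 by move: tI => /andP[*]; rewrite !lt_neqAle eq_sym t0 t1; exact/andP.
apply: le_anti; apply/andP; split; first by apply: ereal_sup_ubound; exists (g t).
apply: le_ereal_inf_tmp => _ [v uv <-].
have [x [v' [xE uv' sub]]] := halfspace_domination convM curvM kappa_le0 ag tI' uv.
have -> : fair_cut_max M = fair_cut x by case: xE => ->; [rewrite -c1|rewrite -c2].
apply: (@le_trans _ _ (vol (halfM x v') / vol [set: M])%E).
  by apply: ereal_inf_lbound; exists v'.
(* The inverse of the nonnegative [vol [set: M]] is nonnegative, so multiplying by it preserves the
   inequality in the extended reals. *)
by apply: lee_wpmul2r; [rewrite inve_ge0 vol_ge0|exact: vol_le].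
Qed.
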